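(* Let $K\in\mathbb R$, $N\in(-\infty,0]\cup[2,\infty]$ and $D\in(0,\infty]$, subject to the proviso that $D<l_\delta$ if $\delta>0$ and $K<0$. Let $f\mapsto(u_f,v_f,h_f)$ be one of the following assignments on functions $f\in C^\infty(\mathbb R)$: (a) ($p$-Poincaré, $p\in(1,\infty)$) $u_f=|f'|^p$, $v_f=|f|^p$, $h_f=f|f|^{p-2}$; (b) (log-Sobolev) $u_f=2(f')^2$, $v_f=f^2\log f^2$, $h_f=f^2-1$. For a finite non-negative Radon measure $\xi$ on $\mathbb R$ put $\mathcal F_*(\xi)=\{0\not\equiv f\in C^\infty(\mathbb R):\ h_f\in C_c(\mathbb R),\ \int h_f\,d\xi=0\}$ and, for $f\in\mathcal F_*(\xi)$, $\Phi_f(\xi)=\frac{\int u_f\,d\xi}{\int v_f\,d\xi}$ if $\int v_f\,d\xi\ne0$ and $\Phi_f(\xi)=+\infty$ otherwise. Let $$\alpha_{K,N,D}=\inf_{0\not\equiv\xi\in\mathcal M_{[K,N,D]}(\mathbb R)}\ \inf_{f\in\mathcal F_*(\xi)}\Phi_f(\xi).$$ Then $$\alpha_{K,N,D}=\inf_{\xi\in\mathcal M^M_{[K,N,D]}(\mathbb R)}\ \inf_{f\in\mathcal F_*(\xi)}\Phi_f(\xi).$$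
   Context: $\delta=\frac K{N-1}$ ($0$ if $N=\infty$); $l_\delta=\pi/\sqrt\delta$ if $\delta>0$ and $l_\delta=+\infty$ otherwise. $\mathfrak s_\delta(x)=\sin(\sqrt\delta x)/\sqrt\delta$, $x$, $\sinh(\sqrt{-\delta}x)/\sqrt{-\delta}$ and $\mathfrak c_\delta(x)=\cos(\sqrt\delta x)$, $1$, $\cosh(\sqrt{-\delta}x)$ for $\delta>0,=0,<0$. $0\log0=0$. Distortion coefficients, for $\theta\ge0$, $t\in[0,1]$ and finite $\mathcal N\ne0$: $\sigma^{(t)}_{K,\mathcal N}(\theta)=+\infty$ if $\frac K{\mathcal N}\theta^2\ge\pi^2$; $=\frac{\sin(t\theta\sqrt{K/\mathcal N})}{\sin(\theta\sqrt{K/\mathcal N})}$ if $0<\frac K{\mathcal N}\theta^2<\pi^2$; $=t$ if $\frac K{\mathcal N}\theta^2=0$; $=\frac{\sinh(t\theta\sqrt{-K/\mathcal N})}{\sinh(\theta\sqrt{-K/\mathcal N})}$ if $\frac K{\mathcal N}\theta^2<0$. $\tau^{(t)}_{K,N}(\theta)=t^{1/N}\sigma^{(t)}_{K,N-1}(\theta)^{1-1/N}$. Distorted mean $\tilde M^{(t)}_{K,N}[d](a,b)$ ($d,a,b\ge0$): it is $0$ if $ab=0$. If $ab>0$: for $N=\infty$ it is $a^{1-t}b^te^{Kt(1-t)d^2/2}$; for $N\ne0,\infty$ and $\frac K{N-1}d^2<\pi^2$ it is $\big(\tau^{(1-t)}_{K,N}(d)a^{1/N}+\tau^{(t)}_{K,N}(d)b^{1/N}\big)^N$;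 for $N\ne0,\infty$ and $\frac K{N-1}d^2\ge\pi^2$ it is $+\infty$ if $K>0,N>1$ and $0$ if $K<0,N<0$; for $N=0$ it is $\min\big((1-t)\sigma^{(1-t)}_{K,-1}(d)^{-1}a,\ t\,\sigma^{(t)}_{K,-1}(d)^{-1}b\big)$ (with $1/\infty=0$). Undefined expressions at $t\in\{0,1\}$ are read as limits in $t$. $\mathcal M_{[K,N,D]}(\mathbb R)$ is the set of finite non-negative Radon measures $\xi$ on $\mathbb R$ with $\mathrm{diam}(\mathrm{supp}(\xi))\le D$ and, for all compact $A_0,A_1\subset\mathbb R$ and $t\in[0,1]$, $\xi((1-t)A_0+tA_1)\ge\tilde M^{(t)}_{K,N}[\theta_K(A_0,A_1)](\xi(A_0),\xi(A_1))$, where $\theta_K(A_0,A_1)$ is $\inf_{x\in A_0,y\in A_1}|x-y|$ if $K\ge0$ and $\sup_{x\in A_0,y\in A_1}|x-y|$ if $K<0$. Model densities: for $\mathfrak h\in\mathbb R$, let $U_{\mathfrak h}$ be the maximal open interval containing $0$ on which $\mathfrak c_\delta+\frac{\mathfrak h}{N-1}\mathfrak s_\delta>0$ ($U_{\mathfrak h}=\mathbb R$ if $N=\infty$); on $U_{\mathfrak h}$ put $J_{K,N,\mathfrak h}(x)=(\mathfrak c_\delta(x)+\frac{\mathfrak h}{N-1}\mathfrak s_\delta(x))^{N-1}$ if $N<\infty$ and $J_{K,\infty,\mathfrak h}(x)=e^{\mathfrak hx-Kx^2/2}$. $\mathcal M^M_{[K,N,D]}(\mathbb R)$ is the set of finite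 absolutely continuous measures with density $J$ such that $J(x+r)=c\,J_{K,N,\mathfrak h}(x)1_{I'}(x)$ for some $c>0$, $r,\mathfrak h\in\mathbb R$ and some interval $I'\subset\overline{U_{\mathfrak h}}$ with $0<\mathrm{diam}(I')\le D$. *)

(* Defs.v *)
From mathcomp Require Import all_boot all_order all_algebra.
From mathcomp Require Import all_classical all_reals all_analysis.

Set Implicit Arguments.
Unset Strict Implicit.
Unset Printing Implicit Defensive.

Import Order.TTheory GRing.Theory Num.Theory.
Import numFieldNormedType.Exports.

Local Open Scope classical_set_scope.
Local Open Scope ring_scope.

(* The dimension N is an extended real. Only N = +oo and finite N different
   from 1 are meaningful; the value at -oo is junk. *)

Definition sinh {R : realType} (x : R) : R := (expR x - expR (- x)) / 2.
Definition cosh {R : realType} (x : R) : R := (expR x + expR (- x)) / 2.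

Definition delta {R : realType} (K : R) (N : \bar R) : R :=
  if N is n%:E then K / (n - 1) else 0.

Definition l_delta {R : realType} (dl : R) : \bar R :=
  if 0 < dl then (pi / Num.sqrt dl)%:E else +oo%E.

Definition s_delta {R : realType} (dl x : R) : R :=
  if 0 < dl then sin (Num.sqrt dl * x) / Num.sqrt dl
  else if dl == 0 then x
  else sinh (Num.sqrt (- dl) * x) / Num.sqrt (- dl).

Definition c_delta {R : realType} (dl x : R) : R :=
  if 0 < dl then cos (Num.sqrt dl * x)
  else if dl == 0 then 1
  else cosh (Num.sqrt (- dl) * x).

Definition sigma {R : realType} (K n t theta : R) : \bar R :=
  let k := K / n * theta ^+ 2 in
  if pi ^+ 2 <= k then +oo%E
  else if 0 < k then
    (sin (t * theta * Num.sqrt (K / n)) / sin (theta * Num.sqrt (K / n)))%:E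
  else if k == 0 then t%:E
  else (sinh (t * theta * Num.sqrt (- (K / n)))
        / sinh (theta * Num.sqrt (- (K / n))))%:E.

Definition tau {R : realType} (K n t theta : R) : \bar R :=
  ((t `^ n^-1)%:E * poweR (sigma K (n - 1) t theta) (1 - n^-1))%E.

(* The closed formula for the distorted mean when a, b > 0 and 0 < t < 1. For
   these parameters poweR is only applied to positive reals in the branch
   where the outer exponent n may be negative, and inve +oo = 0. *)
Definition distorted_mean_inner {R : realType}
    (K : R) (N : \bar R) (d a b t : R) : \bar R :=
  match N with
  | n%:E =>
      if n == 0 then
        mine ((1 - t)%:E * inve (sigma K (- 1) (1 - t) d) * a%:E)%E
             (t%:E * inve (sigma K (- 1) t d) * b%:E)%E
      else if K / (n - 1) * d ^+ 2 < pi ^+ 2 then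
        poweR (tau K n (1 - t) d * (a `^ n^-1)%:E
               + tau K n t d * (b `^ n^-1)%:E)%E n
      else if (0 < K) && (1 < n) then +oo%E
      else 0%E
  | _ => (a `^ (1 - t) * b `^ t * expR (K * t * (1 - t) * d ^+ 2 / 2))%:E
  end.

(* At t = 0 and t = 1 the formula may be undefined (0 to a negative power,
   or 0 / 0), so there the value is the one-sided limit in t; wherever the
   formula is defined at an endpoint it is continuous there. *)
Definition distorted_mean {R : realType}
    (K : R) (N : \bar R) (t d a b : R) : \bar R :=
  if a * b == 0 then 0%E
  else if t == 0 then lim (distorted_mean_inner K N d a b s @[s --> 0^'+])
  else if t == 1 then lim (distorted_mean_inner K N d a b s @[s --> 1^'-])
  else distorted_mean_inner K N d a b t.

Definition theta_K {R : realType} (K : R) (A0 A1 : set R) : R :=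
  let dists := [set `|x - y| | x in A0 & y in A1] in
  if 0 <= K then inf dists else sup dists.

Definition minkowski_mean {R : realType} (t : R) (A0 A1 : set R) : set R :=
  [set (1 - t) * x + t * y | x in A0 & y in A1].

(* The value is 0 on the empty set. *)
Definition diam {R : realType} (A : set R) : \bar R :=
  maxe 0%E (ereal_sup [set `|x - y|%:E | x in A & y in A]).

(* Every finite Borel measure on the real line is a Radon measure. *)
Definition finite_borel (R : realType) :=
  {finite_measure set (measurableTypeR R) -> \bar R}.

Definition msupport {R : realType} (xi : finite_borel R) : set R :=
  [set x | forall U : set R, open U -> U x -> (0 < xi U)%E].

(* The measure of a set is finite here, so fine loses nothing. *)
Definition MKND {R : realType} (K : R) (N D : \bar R) :
    set (finite_borel R) :=
  [set xi | (diam (msupport xi) <= D)%E /\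
    forall (A0 A1 : set R) (t : R),
      compact A0 -> compact A1 -> 0 <= t <= 1 ->
      (distorted_mean K N t (theta_K K A0 A1) (fine (xi A0)) (fine (xi A1))
        <= xi (minkowski_mean t A0 A1))%E].

Definition model_base {R : realType} (K : R) (n h x : R) : R :=
  let dl := delta K n%:E in c_delta dl x + h / (n - 1) * s_delta dl x.

(* The maximal interval is the union of all the open intervals that contain 0
   and on which the base is positive. *)
Definition model_domain {R : realType} (K : R) (N : \bar R) (h : R) : set R :=
  if N is n%:E then
    \bigcup_(I in [set I : set R | [/\ is_interval I, open I, I 0 &
                     forall x, I x -> 0 < model_base K n h x]]) I
  else setT.

(* Meaningful on model_domain only. *)
Definition model_density {R : realType} (K : R) (N : \bar R) (h x : R) : R :=
  if N is n%:E then model_base K n h x `^ (n - 1)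
  else expR (h * x - K * x ^+ 2 / 2).

(* The interval I' may contain endpoints of model_domain, where J is left
   unconstrained: these are at most two points, hence Lebesgue negligible. *)
Definition MMKND {R : realType} (K : R) (N D : \bar R) :
    set (finite_borel R) :=
  [set xi | exists (J : measurableTypeR R -> R) (c r h : R) (I' : set R),
    [/\ measurable_fun setT J /\ (forall x, 0 <= J x),
        forall A, measurable A ->
          xi A = (\int[lebesgue_measure]_(x in A) (J x)%:E)%E,
        0 < c,
        [/\ is_interval I', I' `<=` closure (model_domain K N h) &
            (0 < diam I' <= D)%E] &
        forall x, ~ (closure (model_domain K N h) `\` model_domain K N h) x ->
          J (x + r) = c * model_density K N h x * \1_I' x]].

Definition smooth {R : realType} (f : R -> R) : Prop :=
  forall n x, derivable (derive1n n f) x 1.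

Definition compactly_supported_continuous {R : realType} (g : R -> R) : Prop :=
  continuous g /\ compact (closure [set x | g x != 0]).

Inductive assignment (R : realType) : Type :=
| Poincare (p : R) of 1 < p
| LogSobolev.

Definition u_of {R : realType} (T : assignment R) (f : R -> R) (x : R) : R :=
  match T with
  | Poincare p _ => `|derive1 f x| `^ p
  | LogSobolev => 2 * derive1 f x ^+ 2
  end.

(* Since ln 0 = 0, the convention 0 log 0 = 0 holds. *)
Definition v_of {R : realType} (T : assignment R) (f : R -> R) (x : R) : R :=
  match T with
  | Poincare p _ => `|f x| `^ p
  | LogSobolev => f x ^+ 2 * ln (f x ^+ 2)
  end.

(* For p < 2 the product f |f|^(p-2) is 0 where f vanishes, its limit value. *)
Definition h_of {R : realType} (T : assignment R) (f : R -> R) (x : R) : R :=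
  match T with
  | Poincare p _ => f x * `|f x| `^ (p - 2)
  | LogSobolev => f x ^+ 2 - 1
  end.

Definition F_star {R : realType} (T : assignment R) (xi : finite_borel R) :
    set (R -> R) :=
  [set f | [/\ smooth f, exists x, f x != 0,
      compactly_supported_continuous (h_of T f) &
      (\int[xi]_x (h_of T f x)%:E = 0)%E]].

Definition Phi {R : realType} (T : assignment R) (f : R -> R)
    (xi : finite_borel R) : \bar R :=
  (let iv := \int[xi]_x (v_of T f x)%:E in
   if iv == 0 then +oo else \int[xi]_x (u_of T f x)%:E / iv)%E.

Definition inf_Phi {R : realType} (T : assignment R) (xi : finite_borel R) :
    \bar R :=
  ereal_inf [set Phi T f xi | f in F_star T xi].

Definition alpha {R : realType} (T : assignment R) (K : R) (N D : \bar R) :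
    \bar R :=
  ereal_inf [set inf_Phi T xi | xi in
    [set xi | MKND K N D xi /\ exists2 A, measurable A & xi A <> 0%E]].

(* Main.v *)
(* Localization in dimension one. A member of M_[K,N,D] is, inside a window
   containing the supports of the integrands, either concentrated at a point,
   where the constraint on h forces v = 0, or of the form J dx with J satisfying
   the pointwise inequality gmean(J x, J y) <= J((1-t)x + ty): J is the lower
   left density of the measure, and this inequality is the mean inequality
   applied to short intervals, whose lengths realize the equality case of the
   Hoelder inequality relating dmean and gmean.
   If Phi_f < lambda, then phi = u - lambda v has negative integral while the
   integral of h vanishes, and phi >= 0 where h = 0. Take
   a density of minimal mass among those below J whose phi-integral is negative
   in proportion to the length of the support: whenever it splits as P + Q with
   P and Q satisfying the pointwise inequality and with the integral of h P
   equal to 0, the phi-integral of P is negative. Apply this to P = min(J, m)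
   with m a model chosen by the intermediate value theorem so that the integral
   of h P vanishes; letting m degenerate, P rescales to a model density.
   Conversely, models satisfy the mean inequality: a violation is bisected, along
   pieces of proportional masses, down to a pair of points, where it contradicts
   the Brunn-Minkowski inequality for Lebesgue measure and the concavity of the
   model density. *)
From HB Require Import structures.
Require Import Defs.
From mathcomp Require Import all_boot all_order all_algebra.
From mathcomp Require Import all_classical all_reals all_analysis.
From mathcomp Require Import measurable_realfun ring lra.
Import Order.TTheory GRing.Theory Num.Theory.
Import numFieldNormedType.Exports.
Local Open Scope classical_set_scope.
Local Open Scope ring_scope.
Set Implicit Arguments.
Unset Strict Implicit.
Unset Printing Implicit Defensive.

(** Models are the equality case of the pointwise inequality, and this makes the splitting work:
    [gmean] is monotone, so min(J, m) inherits the inequality, and superadditive, so J - min(J, m)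
    inherits it too. Minimality also forbids a cut point with both halves balanced for h; hence the
    integral of h over initial intervals keeps one sign, which determines the signs at the two ends
    of a one-parameter family of models and feeds the intermediate value argument. The models are
    multiplied by factors tending to 0 (for N = +oo they are made steep instead), so that a rescaled
    piece tends to a pure model. The danger is that the rescaled pieces pile up at an end of the
    interval; but there one of h, - h, phi is positive, which contradicts the constraints. The same
    trichotomy keeps the supports from shrinking during the minimization. Strict negativity is lost
    in the limits, so the argument runs with phi plus a small positive constant. Conversely, the
    passage from a measure to a density avoids covering theorems: it compares additive functions of
    intervals by induction along the line. *)

Lemma is_deriveZN {R : realType} (f : R -> R) (e u d : R) :
  is_derive u 1 f d -> is_derive u 1 (fun s => - (e * f s)) (- (e * d)).
Proof. by move=> fd; apply: is_deriveN; exact: is_deriveZ. Qed.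

Lemma is_derive_ge0_le {R : realType} (f df : R -> R) (a b : R) :
  (forall x, a <= x <= b -> is_derive x 1 f (df x)) ->
  (forall x, a < x < b -> 0 <= df x) -> a <= b -> f a <= f b.
Proof.
move=> fdf df0 ab.
have D x : x \in `]a, b[ -> is_derive x 1 f (df x).
  by rewrite in_itv/= => /andP[/ltW ? /ltW ?]; apply: fdf; apply/andP.
apply: (@ger0_derive1_le_cc _ f a b) => //; rewrite ?in_itv/= ?lexx ?ab//.
- by move=> x /D [].
- by move=> x xab; rewrite derive1E; have [_ ->] := D _ xab; apply: df0;
    rewrite in_itv in xab.
- apply: derivable_within_continuous => x; rewrite in_itv/= => xab.
  by have [] := fdf _ xab.
Qed.

(** * Generalized sine and cosine *)

Section trig_family.
Context {R : realType} (dl : R).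
Local Notation S := (s_delta dl).
Local Notation C := (c_delta dl).

Lemma sinhD (x y : R) : sinh (x + y) = sinh x * cosh y + cosh x * sinh y.
Proof. by rewrite /sinh /cosh opprD !expRD; field. Qed.

Lemma s_deltaD x y : S (x + y) = S x * C y + C x * S y.
Proof.
rewrite /s_delta /c_delta; case: ltrgtP => [d0|d0|_].
- by rewrite mulrDr sinD; field; rewrite sqrtr_eq0 -ltNge.
- by rewrite mulrDr sinhD; field; rewrite sqrtr_eq0 -ltNge oppr_gt0.
- by rewrite mulr1 mul1r.
Qed.

Lemma s_delta0 : S 0 = 0.
Proof.
rewrite /s_delta /sinh !mulr0 sin0; case: ifP => _; first by rewrite mul0r.
by case: ifP => // _; rewrite oppr0 subrr !mul0r.
Qed.

Lemma s_deltaN x : S (- x) = - S x.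
Proof.
rewrite /s_delta; case: ltrgtP => // _; rewrite mulrN ?sinN ?mulNr//.
by rewrite /sinh opprK -opprB !mulNr.
Qed.

Lemma c_deltaN x : C (- x) = C x.
Proof.
rewrite /c_delta; case: ltrgtP => // _; rewrite mulrN ?cosN//.
by rewrite /cosh opprK addrC.
Qed.

Lemma s_deltaB x y : S (x - y) = S x * C y - C x * S y.
Proof. by rewrite s_deltaD c_deltaN s_deltaN mulrN. Qed.

Lemma is_derive_s_delta (x : R) : is_derive x 1 S (C x).
Proof.
rewrite /s_delta /c_delta; case: ltrgtP => [d0|d0|_]; last exact: is_derive_id.
- have s0 : Num.sqrt dl != 0 by rewrite sqrtr_eq0 -ltNge.
  apply: is_derive_eq.
  rewrite /GRing.scale/=. by field.
- have s0 : Num.sqrt (- dl) != 0 by rewrite sqrtr_eq0 -ltNge oppr_gt0.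
  rewrite /sinh /cosh; apply: is_derive_eq.
  rewrite /GRing.scale/=. by field.
Qed.

Lemma is_derive_c_delta (x : R) : is_derive x 1 C (- dl * S x).
Proof.
rewrite /s_delta /c_delta; case: ltrgtP => [d0|d0|<-].
- have s0 : Num.sqrt dl != 0 by rewrite sqrtr_eq0 -ltNge.
  apply: is_derive_eq.
  transitivity (- Num.sqrt dl ^+ 2 * (sin (Num.sqrt dl * x) / Num.sqrt dl)).
    by rewrite /GRing.scale/=; field.
  by rewrite (sqr_sqrtr (ltW d0)).
- have s0 : Num.sqrt (- dl) != 0 by rewrite sqrtr_eq0 -ltNge oppr_gt0.
  have d1 : 0 <= - dl by rewrite oppr_ge0 ltW.
  rewrite /sinh /cosh; apply: is_derive_eq.
  transitivity (Num.sqrt (- dl) ^+ 2 * (sinh (Num.sqrt (- dl) * x) / Num.sqrt (- dl))).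
    by rewrite /sinh /GRing.scale/=; field.
  by rewrite sqr_sqrtr.
- by rewrite oppr0 mul0r; exact: is_derive_cst.
Qed.

Lemma continuous_s_delta : continuous S.
Proof.
by move=> x; apply/differentiable_continuous/derivable1_diffP;
  have [] := is_derive_s_delta x.
Qed.

Lemma continuous_c_delta : continuous C.
Proof.
by move=> x; apply/differentiable_continuous/derivable1_diffP;
  have [] := is_derive_c_delta x.
Qed.

Lemma s_delta_gt0 x : 0 < x -> (x%:E < l_delta dl)%E -> 0 < S x.
Proof.
rewrite /s_delta /l_delta => x0; case: ltrgtP => // d0.
- have s0 : 0 < Num.sqrt dl by rewrite sqrtr_gt0.
  rewrite lte_fin ltr_pdivlMr// mulrC => xpi.
  by rewrite divr_gt0// sin_gt0_pi// xpi mulr_gt0.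
- have s0 : 0 < Num.sqrt (- dl) by rewrite sqrtr_gt0 oppr_gt0.
  move=> _; rewrite !divr_gt0// subr_gt0 ltr_expR gtrN//.
  by rewrite mulr_gt0.
Qed.

(* The three-term relation behind interpolation by solutions of
   [e'' + dl e = 0]. *)
Lemma s_delta_three x z y b :
  S (b - z) * S (y - x) = S (b - x) * S (y - z) + S (b - y) * S (z - x).
Proof.
by rewrite !s_deltaB; ring.
Qed.
End trig_family.

Section sigma_ratio.
Context {R : realType} (dl : R).
Local Notation S := (s_delta dl).
Local Notation C := (c_delta dl).

(** For fixed x <= y the quotient S(s y) / S(s x) is monotone in s: the numerator [q] of its
    derivative vanishes at 0, and the derivative of [q] has the sign of - dl because x ^ 2 - y ^ 2
    <= 0. Compared at s = t and s = 1, this is the monotonicity of the distortion coefficients in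
    the distance. *)
Lemma s_delta_ratio_le (t x y : R) : 0 < t <= 1 -> 0 < x -> x <= y ->
  (y%:E < l_delta dl)%E ->
  (0 <= dl -> S (t * x) * S y <= S (t * y) * S x) /\
  (dl <= 0 -> S (t * y) * S x <= S (t * x) * S y).
Proof.
move=> /andP[t0 t1] x0 xy yl.
have y0 : 0 < y by exact: lt_le_trans xy.
have S0 (u s : R) : 0 < s <= 1 -> 0 < u <= y -> 0 < S (s * u).
  move=> /andP[s0 s1] /andP[u0 uy]; apply: s_delta_gt0; first by rewrite mulr_gt0.
  by rewrite (le_lt_trans _ yl)// lee_fin (le_trans _ uy)// ger_pMl.
have Sx (s : R) : 0 < s <= 1 -> 0 < S (s * x) by move=> ?; apply: S0 => //; rewrite x0.
have Sy (s : R) : 0 < s <= 1 -> 0 < S (s * y) by move=> ?; apply: S0 => //; rewrite y0/=.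
have dS (u s : R) : is_derive s 1 (fun s : R => S (s * u)) (C (s * u) * u).
  have d : is_derive s 1 (fun s : R => s * u) u.
    by apply: is_derive_eq; rewrite /GRing.scale/= mulr0 add0r mulr1.
  exact: (@is_derive1_comp _ S (fun s : R => s * u) _ _ _ (is_derive_s_delta dl (s * u)) d).
have dC (u s : R) : is_derive s 1 (fun s : R => C (s * u)) (- dl * S (s * u) * u).
  have d : is_derive s 1 (fun s : R => s * u) u.
    by apply: is_derive_eq; rewrite /GRing.scale/= mulr0 add0r mulr1.
  exact: (@is_derive1_comp _ C (fun s : R => s * u) _ _ _ (is_derive_c_delta dl (s * u)) d).
pose q (s : R) := y * C (s * y) * S (s * x) - x * S (s * y) * C (s * x).
have dq (s : R) : is_derive s 1 q (dl * (x ^+ 2 - y ^+ 2) * S (s * y) * S (s * x)).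
  rewrite /q; apply: is_derive_eq; rewrite /GRing.scale/=; ring.
have q0 : q 0 = 0 by rewrite /q !mul0r s_delta0; ring.
pose g (s : R) := S (s * y) / S (s * x).
have dg (s : R) : 0 < s <= 1 -> is_derive s 1 g (q s / S (s * x) ^+ 2).
  move=> s01; rewrite /g; have Sn : S (s * x) != 0 by rewrite gt_eqF// Sx.
  have dV := @is_deriveV _ (fun s : R => S (s * x)) _ _ _ Sn (dS x s).
  by apply: is_derive_eq; rewrite /GRing.scale/= /q; field.
have xy2 : x ^+ 2 - y ^+ 2 <= 0.
  by rewrite subr_le0 ler_pXn2r// nnegrE ltW.
have gt : g t = S (t * y) / S (t * x) by [].
have g1 : g 1 = S (1 * y) / S (1 * x) by [].
clearbody g; clearbody q.
have [Sx1 Sxt] := (Sx 1 ltac:(by rewrite ltr01 lexx), Sx t ltac:(by rewrite t0 t1)).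
rewrite mul1r in Sx1.
(* [e] will be 1 or -1, so that both signs of [dl] are treated at once. *)
have H (e : R) : 0 <= e * dl -> e * g 1 <= e * g t.
  move=> ed.
  have qs (s : R) : 0 <= s <= 1 -> e * q s <= 0.
    move=> /andP[s0 s1]; rewrite -lerN2 oppr0 -[X in X <= _](_ : - (e * q 0) = 0); last first.
      by rewrite q0 mulr0 oppr0.
    apply: (@is_derive_ge0_le _ (fun s => - (e * q s))
      (fun s => - (e * (dl * (x ^+ 2 - y ^+ 2) * S (s * y) * S (s * x))))) => //.
    move=> u /andP[u0 us]; have u01 : 0 < u <= 1 by rewrite u0 (le_trans (ltW us)).
    have -> : - (e * (dl * (x ^+ 2 - y ^+ 2) * S (u * y) * S (u * x))) =
        (e * dl) * (- (x ^+ 2 - y ^+ 2)) * (S (u * y) * S (u * x)) by ring.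
    apply: mulr_ge0; last by apply: mulr_ge0; apply: ltW; [exact: Sy|exact: Sx].
    by apply: mulr_ge0; [exact: ed|rewrite oppr_ge0].
  rewrite -lerN2; apply: (@is_derive_ge0_le _ (fun s => - (e * g s))
      (fun s => - (e * (q s / S (s * x) ^+ 2)))) => //.
    move=> s /andP[ts s1]; have s01 : 0 < s <= 1 by rewrite (lt_le_trans t0 ts).
    by apply: (@is_deriveZN _ g); exact: dg.
  move=> s /andP[ts s1]; rewrite mulrA oppr_ge0 mulr_le0_ge0//.
    by rewrite qs// (ltW s1) (le_trans (ltW t0))// ltW.
  by rewrite invr_ge0 exprn_ge0// ltW// Sx// (lt_trans t0 ts) ltW.
rewrite gt g1 !mul1r in H; split => d0.
- have := H 1; rewrite !mul1r => /(_ d0).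
  by rewrite ler_pdivlMr// mulrAC ler_pdivrMr// mulrC [leRHS]mulrC.
- have := H (-1); rewrite !mulN1r oppr_ge0 => /(_ d0).
  by rewrite lerN2 ler_pdivrMr// mulrAC ler_pdivlMr// mulrC [leRHS]mulrC.
Qed.

End sigma_ratio.

(** * Young and Hoelder inequalities, power means *)

Section powR_facts.
Context {R : realType}.
Implicit Types (x y r s u v w A B : R).

Lemma powR_lepos x y r : 0 < x -> x <= y -> 0 <= r -> x `^ r <= y `^ r.
Proof.
by move=> x0 xy r0; rewrite ge0_ler_powR// nnegrE ?ltW// (lt_le_trans x0).
Qed.

Lemma powR_leneg x y r : 0 < x -> x <= y -> r <= 0 -> y `^ r <= x `^ r.
Proof.
move=> x0 xy r0; rewrite -(opprK r) !(powRN _ (- r)).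
by rewrite lef_pV2 ?posrE ?powR_gt0 ?(lt_le_trans x0)// powR_lepos// oppr_ge0.
Qed.

Lemma powRKV x r : 0 < x -> r != 0 -> (x `^ r^-1) `^ r = x.
Proof. by move=> x0 r0; rewrite -powRrM mulVf// powRr1// ltW. Qed.

Lemma powRVK x r : 0 < x -> r != 0 -> (x `^ r) `^ r^-1 = x.
Proof. by move=> x0 r0; rewrite -powRrM mulfV// powRr1// ltW. Qed.

Lemma powR_comp1 x r s t : 0 < x -> r + s = t -> x `^ r * x `^ s = x `^ t.
Proof. by move=> x0 <-; rewrite powRD// (gt_eqF x0) implybT. Qed.

Lemma continuous_powR x r : 0 < x -> {for x, continuous (fun a => a `^ r)}.
Proof.
move=> x0; apply/differentiable_continuous/derivable1_diffP.
by have [] := is_derive1_powR r x0.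
Qed.

(* Dividing by the left-hand side [m], this is [1 <= th e^a + (1-th) e^b] with
   [th a + (1-th) b = 0]. *)
Lemma young_powR th u v : 0 <= th <= 1 -> 0 < u -> 0 < v ->
  u `^ th * v `^ (1 - th) <= th * u + (1 - th) * v.
Proof.
move=> /andP[t0 t1] u0 v0; set m := _ * _.
have m0 : 0 < m by rewrite mulr_gt0 ?powR_gt0.
have lm : ln m = th * ln u + (1 - th) * ln v.
  by rewrite lnM ?posrE ?powR_gt0// !ln_powR.
have E w : 0 < w -> m * (1 + (ln w - ln m)) <= w.
  move=> w0; rewrite -ler_pdivlMl// -ln_div ?posrE// [leRHS]mulrC.
  by rewrite (le_trans (expR_ge1Dx _))// lnK// posrE divr_gt0.
have := lerD (ler_wpM2l t0 (E _ u0)) (ler_wpM2l (_ : 0 <= 1 - th) (E _ v0)).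
rewrite subr_ge0 => /(_ t1); apply: le_trans; rewrite lm le_eqVlt; apply/orP; left.
by apply/eqP; ring.
Qed.

(** This is [young_powR] with exponent 1 / (1 - th) for the pair (X, u), where X is the right-hand
    side, because v = X ^ (1 / (1 - th)) u ^ (1 - 1 / (1 - th)). *)
Lemma young_powR_neg th u v : th <= 0 -> 0 < u -> 0 < v ->
  th * u + (1 - th) * v <= u `^ th * v `^ (1 - th).
Proof.
move=> t0 u0 v0; set X := _ `^ _ * _.
have t1 : 0 < 1 - th by rewrite subr_gt0 (le_lt_trans t0).
have X0 : 0 < X by rewrite mulr_gt0 ?powR_gt0.
have th1 : 0 <= (1 - th)^-1 <= 1.
  by rewrite invr_ge0 ltW//= invf_le1// lerBrDl gerDr t0.
have := young_powR th1 X0 u0.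
have -> : X `^ (1 - th)^-1 * u `^ (1 - (1 - th)^-1) = v.
  rewrite /X powRM ?powR_ge0// powRVK ?gt_eqF// mulrAC -powRrM.
  rewrite (@powR_comp1 _ _ _ 0)// ?powRr0 ?mul1r//.
  by field; rewrite gt_eqF.
rewrite -(ler_pM2l t1) mulrDr mulrA mulfV ?gt_eqF// mul1r mulrA.
have -> : (1 - th) * (1 - (1 - th)^-1) = - th by field; rewrite gt_eqF.
lra.
Qed.

Lemma powR_split r u x : 0 < u -> 0 < x -> u `^ r = x `^ r * (u / x) `^ r.
Proof.
by move=> u0 x0; rewrite -powRM ?divr_ge0 ?ltW// mulrC divfK ?gt_eqF.
Qed.

(** After division by the sums U and V, two Young inequalities add up, the right-hand sides to th +
    (1 - th) = 1. *)
Lemma hoelder_powR th u1 u2 v1 v2 : 0 <= th <= 1 ->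
  0 < u1 -> 0 < u2 -> 0 < v1 -> 0 < v2 ->
  u1 `^ th * v1 `^ (1 - th) + u2 `^ th * v2 `^ (1 - th) <=
  (u1 + u2) `^ th * (v1 + v2) `^ (1 - th).
Proof.
move=> t01 u10 u20 v10 v20; set U := u1 + u2; set V := v1 + v2.
have U0 : 0 < U by rewrite addr_gt0.
have V0 : 0 < V by rewrite addr_gt0.
have E u v : 0 < u -> 0 < v -> u `^ th * v `^ (1 - th) <=
    (U `^ th * V `^ (1 - th)) * (th * (u / U) + (1 - th) * (v / V)).
  move=> u0 v0; rewrite (powR_split th u0 U0) (powR_split (1 - th) v0 V0) mulrACA.
  by rewrite ler_wpM2l ?mulr_ge0 ?powR_ge0// young_powR ?divr_gt0.
rewrite (le_trans (lerD (E _ _ u10 v10) (E _ _ u20 v20)))// -mulrDr.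
rewrite le_eqVlt; apply/orP; left; apply/eqP.
by rewrite !mulrDr addrACA -!mulrDr -!mulrDl !mulfV ?gt_eqF// !mulr1 [th + _]addrC
  subrK mulr1.
Qed.

Lemma hoelder_powR_neg th u1 u2 v1 v2 : th <= 0 ->
  0 < u1 -> 0 < u2 -> 0 < v1 -> 0 < v2 ->
  (u1 + u2) `^ th * (v1 + v2) `^ (1 - th) <=
  u1 `^ th * v1 `^ (1 - th) + u2 `^ th * v2 `^ (1 - th).
Proof.
move=> t0 u10 u20 v10 v20; set U := u1 + u2; set V := v1 + v2.
have U0 : 0 < U by rewrite addr_gt0.
have V0 : 0 < V by rewrite addr_gt0.
have E u v : 0 < u -> 0 < v ->
    (U `^ th * V `^ (1 - th)) * (th * (u / U) + (1 - th) * (v / V)) <=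
    u `^ th * v `^ (1 - th).
  move=> u0 v0; rewrite (powR_split th u0 U0) (powR_split (1 - th) v0 V0) mulrACA.
  by rewrite ler_wpM2l ?mulr_ge0 ?powR_ge0// young_powR_neg ?divr_gt0.
rewrite (le_trans _ (lerD (E _ _ u10 v10) (E _ _ u20 v20)))// -mulrDr.
rewrite le_eqVlt; apply/orP; left; apply/eqP.
by rewrite !mulrDr addrACA -!mulrDr -!mulrDl !mulfV ?gt_eqF// !mulr1 [th + _]addrC
  subrK mulr1.
Qed.

(** The weights need not add up to 1: they will be distortion coefficients. For p < 0 or 1 <= p, the
    values that n - 1 takes, this is a concave function of (A, B). *)
Definition pmean p w1 w2 A B := (w1 * A `^ p^-1 + w2 * B `^ p^-1) `^ p.

(* Tangent plane of the concave function [pmean p w1 w2] at [(A, B)]. *)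
Lemma pmean_tangent p w1 w2 A B : p < 0 \/ 1 <= p ->
  0 < w1 -> 0 < w2 -> 0 < A -> 0 < B ->
  exists l m, [/\ 0 <= l, 0 <= m, pmean p w1 w2 A B = l * A + m * B &
   forall A' B', 0 < A' -> 0 < B' -> pmean p w1 w2 A' B' <= l * A' + m * B'].
Proof.
move=> p01 w10 w20 A0 B0.
have p0 : p != 0 by case: p01 => [/lt_eqF->//|p1]; rewrite gt_eqF// (lt_le_trans _ p1).
set s := p^-1; pose W := w1 * A `^ s + w2 * B `^ s.
have W0 : 0 < W by rewrite addr_gt0// mulr_gt0// powR_gt0.
(* T is W ^ (p - 1), the factor common to both partial derivatives of [pmean] at (A, B). *)
pose T := W `^ (p * (1 - s)).
have T0 : 0 < T by rewrite powR_gt0.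
exists (T * (w1 * A `^ (s - 1))), (T * (w2 * B `^ (s - 1))); split.
- by rewrite mulr_ge0 ?mulr_ge0 ?powR_ge0 ?ltW.
- by rewrite mulr_ge0 ?mulr_ge0 ?powR_ge0 ?ltW.
- have E x : 0 < x -> x `^ (s - 1) * x = x `^ s.
    by move=> x0; rewrite -[X in _ * X]powRr1 ?ltW// (@powR_comp1 _ _ _ s)// subrK.
  rewrite -!mulrA !E// -mulrDr -/W /T -[X in _ * X]powRr1 ?(ltW W0)//.
  by rewrite (@powR_comp1 _ _ _ p)// /s mulrBr mulr1 mulfV// subrK.
- move=> A' B' A'0 B'0.
  pose u1 := w1 * A `^ (s - 1) * A'; pose u2 := w2 * B `^ (s - 1) * B'.
  have u10 : 0 < u1 by rewrite !mulr_gt0 ?powR_gt0.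
  have u20 : 0 < u2 by rewrite !mulr_gt0 ?powR_gt0.
  have v10 : 0 < w1 * A `^ s by rewrite mulr_gt0 ?powR_gt0.
  have v20 : 0 < w2 * B `^ s by rewrite mulr_gt0 ?powR_gt0.
  (* Each term of the mean at (A', B') is split with exponents s and 1 - s, so that Hoelder compares
     their sum with the linear form and with W. *)
  have E w x x' : 0 < w -> 0 < x -> 0 < x' ->
      (w * x `^ (s - 1) * x') `^ s * (w * x `^ s) `^ (1 - s) = w * x' `^ s.
    move=> w0 x0 x'0; rewrite !powRM ?mulr_ge0 ?powR_ge0 ?(ltW w0) ?(ltW x'0)//.
    rewrite mulrAC mulrACA (@powR_comp1 _ _ _ 1)// 1?addrC ?subrK//.
    rewrite powRr1 ?ltW// -!powRrM (@powR_comp1 _ _ _ 0)//; last by ring.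
    by rewrite powRr0 mulr1.
  have W'0 : 0 < w1 * A' `^ s + w2 * B' `^ s by rewrite addr_gt0// mulr_gt0// powR_gt0.
  have U0 : 0 < u1 + u2 by rewrite addr_gt0.
  have -> : T * (w1 * A `^ (s - 1)) * A' + T * (w2 * B `^ (s - 1)) * B' =
      ((u1 + u2) `^ s * W `^ (1 - s)) `^ p.
    rewrite powRM ?powR_ge0// powRKV// -powRrM [(1 - s) * p]mulrC -/T /u1 /u2.
    by ring.
  rewrite /pmean -/s -(E w1 A A') // -(E w2 B B')//; case: p01 => [p_lt0|p1].
    apply: powR_leneg; last exact: ltW.
      by rewrite mulr_gt0// powR_gt0.
    by apply: hoelder_powR_neg => //; rewrite invr_le0 ltW.
  have p_gt0 : 0 < p by rewrite (lt_le_trans _ p1).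
  apply: powR_lepos; last exact: ltW.
    by rewrite !E.
  by apply: hoelder_powR => //; rewrite invr_ge0 ltW//= invf_le1.
Qed.

Lemma pmean_gt0 p w1 w2 A B : 0 < w1 -> 0 < w2 -> 0 < A -> 0 < B ->
  0 < pmean p w1 w2 A B.
Proof. by move=> *; rewrite powR_gt0// addr_gt0// mulr_gt0// powR_gt0. Qed.

(** The tangent plane at (A + A', B + B') is a linear form that dominates the mean at both
    summands. *)
Lemma pmean_superadd p w1 w2 A B A' B' : p < 0 \/ 1 <= p ->
  0 < w1 -> 0 < w2 -> 0 < A -> 0 < B -> 0 < A' -> 0 < B' ->
  pmean p w1 w2 A B + pmean p w1 w2 A' B' <= pmean p w1 w2 (A + A') (B + B').
Proof.
move=> p01 w10 w20 A0 B0 A'0 B'0.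
have [l [m [_ _ -> H]]] := pmean_tangent p01 w10 w20 (addr_gt0 A0 A'0) (addr_gt0 B0 B'0).
by rewrite (le_trans (lerD (H _ _ A0 B0) (H _ _ A'0 B'0)))// !mulrDr addrACA.
Qed.

Lemma pmean_le p w1 w2 A B A' B' : 0 < w1 -> 0 < w2 -> 0 < A -> 0 < B ->
  A <= A' -> B <= B' -> pmean p w1 w2 A B <= pmean p w1 w2 A' B'.
Proof.
move=> w10 w20 A0 B0 AA' BB'; rewrite /pmean.
have S0 a b : 0 < a -> 0 < b -> 0 < w1 * a `^ p^-1 + w2 * b `^ p^-1.
  by move=> *; rewrite addr_gt0// mulr_gt0// powR_gt0.
have [p0|p0] := leP 0 p.
- apply: powR_lepos => //; first exact: S0.
  by rewrite lerD// ler_pM2l// powR_lepos// invr_ge0.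
- apply: powR_leneg; last exact: ltW.
    by apply: S0; [exact: lt_le_trans AA'|exact: lt_le_trans BB'].
  by rewrite lerD// ler_pM2l// powR_leneg// invr_le0 ltW.
Qed.

Lemma pmeanZ p w1 w2 c A B : p != 0 -> 0 < w1 -> 0 < w2 ->
  0 < c -> 0 < A -> 0 < B ->
  pmean p w1 w2 (c * A) (c * B) = c * pmean p w1 w2 A B.
Proof.
move=> p0 w10 w20 c0 A0 B0; rewrite /pmean !powRM ?ltW// ![w1 * _]mulrCA ![w2 * _]mulrCA.
by rewrite -mulrDr powRM ?powR_ge0 ?powRKV// ltW// addr_gt0// mulr_gt0// powR_gt0.
Qed.

End powR_facts.

(** * The mean of densities and the mean of masses *)

Definition sg {R : realType} (dl t d : R) : R :=
  if d == 0 then t else s_delta dl (t * d) / s_delta dl d.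

(** The mean for densities: exponents 1 / (N - 1) and the plain coefficients [sg]. Model densities
    satisfy its inequality with equality. The value at N = -oo is junk. *)
Definition gmean {R : realType} (K : R) (N : \bar R) (t d A B : R) : R :=
  if N is n%:E then
    pmean (n - 1) (sg (delta K N) (1 - t) d) (sg (delta K N) t d) A B
  else A `^ (1 - t) * B `^ t * expR (K * t * (1 - t) * d ^+ 2 / 2).

(** The mean for masses: the real value that [distorted_mean] takes at distances below [l_delta] and
    at 0 < t < 1, with [tau] expanded. *)
Definition dmean {R : realType} (K : R) (N : \bar R) (t d a b : R) : R :=
  if N is n%:E then
    let w1 := sg (delta K N) (1 - t) d in let w2 := sg (delta K N) t d in
    if n == 0 then Num.min ((1 - t) / w1 * a) (t / w2 * b)
    else ((1 - t) `^ n^-1 * w1 `^ (1 - n^-1) * a `^ n^-1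
          + t `^ n^-1 * w2 `^ (1 - n^-1) * b `^ n^-1) `^ n
  else a `^ (1 - t) * b `^ t * expR (K * t * (1 - t) * d ^+ 2 / 2).

Definition dimension_range {R : realType} (N : \bar R) :=
  (-oo < N <= 0)%E \/ (2%:E <= N)%E.

Definition distance_range {R : realType} (K : R) (N : \bar R) (d : R) :=
  0 <= d /\ (d%:E < l_delta (delta K N))%E.

Section means.
Context {R : realType} (K : R) (N : \bar R).
Hypothesis hN : dimension_range N.
Implicit Types (t d a b A B : R).

Lemma dimension_finP n : N = n%:E -> n <= 0 \/ 2 <= n.
Proof.
by move=> En; move: hN; rewrite /dimension_range En !lee_fin => -[/andP[_ ?]|?]; [left|right].
Qed.

Lemma dimension_exponent n : N = n%:E -> n - 1 < 0 \/ 1 <= n - 1.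
Proof. by move=> /dimension_finP[?|?]; [left|right]; lra. Qed.

Lemma sg_gt0 dl t d : 0 < t <= 1 -> 0 <= d -> (d%:E < l_delta dl)%E -> 0 < sg dl t d.
Proof.
move=> /andP[t0 t1] d0 dl1; rewrite /sg; case: eqP => // /eqP dn0.
have dp : 0 < d by rewrite lt_neqAle eq_sym dn0.
by rewrite divr_gt0// s_delta_gt0 ?mulr_gt0// (le_lt_trans _ dl1)// lee_fin ger_pMl.
Qed.

Lemma sg_ge_t dl t d : 0 < t <= 1 -> 0 < d -> (d%:E < l_delta dl)%E ->
  (0 <= dl -> t <= sg dl t d) /\ (dl <= 0 -> sg dl t d <= t).
Proof.
move=> t01 d0 dl1; rewrite /sg gt_eqF//.
have Sd : 0 < s_delta dl d by exact: s_delta_gt0.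
have H (e : R) : 0 <= e * dl -> e * (t * s_delta dl d) <= e * s_delta dl (t * d).
  move=> edl; have /andP[t0 t1] := t01.
  pose f (x : R) := e * (s_delta dl (t * x) - t * s_delta dl x).
  have : f 0 <= f d.
    apply: (@is_derive_ge0_le _ f
        (fun x => e * (t * (c_delta dl (t * x) - c_delta dl x)))) => [x _|x|]; last exact: ltW.
      have d1 : is_derive x 1 (fun x : R => t * x) t.
        by apply: is_derive_eq; rewrite /GRing.scale/= mulr1.
      have d2 := @is_derive1_comp _ (s_delta dl) (fun x : R => t * x) _ _ _
        (is_derive_s_delta dl (t * x)) d1.
      have d3 := is_derive_s_delta dl x.
      have d4 : is_derive x 1 (fun x : R => s_delta dl (t * x) - t * s_delta dl x)
          (c_delta dl (t * x) * t - t * c_delta dl x).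
        by apply: is_deriveB; exact: is_deriveZ.
      rewrite [X in is_derive _ _ _ X](_ : _ = e * (c_delta dl (t * x) * t - t * c_delta dl x)).
        exact: is_deriveZ.
      by ring.
    move=> /andP[x0 xd]; rewrite mulrCA mulr_ge0 ?(ltW t0)//.
    pose g (s : R) := e * (c_delta dl 0 - c_delta dl s).
    rewrite mulrBr subr_ge0.
    have : - (e * c_delta dl (t * x)) <= - (e * c_delta dl x); last by rewrite lerN2.
    apply: (@is_derive_ge0_le _ (fun s => - (e * c_delta dl s))
        (fun s => - (e * (- dl * s_delta dl s)))) => [s _|s /andP[ts sx]|].
    - by apply: (@is_deriveZN _ (c_delta dl)); exact: is_derive_c_delta.
    - rewrite mulrA mulrN mulNr opprK mulr_ge0// ltW// s_delta_gt0//.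
        by rewrite (lt_trans _ ts)// mulr_gt0.
      by rewrite (lt_trans _ dl1)// lte_fin (lt_trans sx).
    - by rewrite ger_pMl.
  by rewrite /f !mulr0 !s_delta0 !mulr0 subrr mulr0 mulrBr subr_ge0.
split=> dls; [have := H 1|have := H (-1)]; rewrite ?mul1r ?mulN1r ?oppr_ge0 => /(_ dls).
- by rewrite ler_pdivlMr.
- by rewrite lerN2 ler_pdivrMr.
Qed.

Lemma sg_le dl t d d' : 0 < t <= 1 -> 0 <= d -> d <= d' -> (d'%:E < l_delta dl)%E ->
  (0 <= dl -> sg dl t d <= sg dl t d') /\ (dl <= 0 -> sg dl t d' <= sg dl t d).
Proof.
move=> t01 d0 dd' dl1; have [->|dn0] := eqVneq d 0.
  have [->//|d'n0] := eqVneq d' 0.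
  rewrite {1 4}/sg eqxx; apply: sg_ge_t => //.
  by rewrite lt_neqAle eq_sym d'n0 (le_trans d0).
have dp : 0 < d by rewrite lt_neqAle eq_sym dn0.
have d'p : 0 < d' by exact: lt_le_trans dd'.
have Sd' : 0 < s_delta dl d' by exact: s_delta_gt0.
have Sd : 0 < s_delta dl d by rewrite s_delta_gt0// (le_lt_trans _ dl1).
have [H1 H2] := s_delta_ratio_le t01 dp dd' dl1.
by rewrite /sg !gt_eqF//; split=> dls;
  rewrite ler_pdivrMr// mulrAC ler_pdivlMr//; [exact: H1|exact: H2].
Qed.

Lemma sg_sigma n t d : n != 0 -> 0 <= d -> (d%:E < l_delta (K / n))%E ->
  sigma K n t d = (sg (K / n) t d)%:E.
Proof.
move=> n0 d0 dl1; rewrite /sigma /sg; set k := K / n in dl1 *.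
have [->|dn0] := eqVneq d 0.
  rewrite expr0n/= mulr0 ltxx eqxx ifF//.
  by apply/negbTE; rewrite -ltNge exprn_gt0// pi_gt0.
have dp : 0 < d by rewrite lt_neqAle eq_sym dn0.
have d2 : 0 < d ^+ 2 by rewrite exprn_gt0.
move: dl1; rewrite /l_delta /s_delta; case: ltrgtP => [k0|k0|k0].
- have s0 : 0 < Num.sqrt k by rewrite sqrtr_gt0.
  rewrite lte_fin ltr_pdivlMr// => dpi; rewrite ifF; last first.
    apply/negbTE; rewrite -ltNge -{1}(sqr_sqrtr (ltW k0)) mulrC -exprMn.
    by rewrite ltr_pXn2r// nnegrE ?mulr_ge0 ?ltW ?pi_gt0.
  rewrite pmulr_rgt0// d2 [Num.sqrt k * d]mulrC [Num.sqrt k * _]mulrC; congr (_%:E).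
  rewrite -mulrA mulrCA; field; rewrite gt_eqF ?s0//= gt_eqF// sin_gt0_pi// dpi andbT.
  by rewrite mulr_gt0.
- move=> _; have kd : k * d ^+ 2 < 0 by rewrite nmulr_rlt0.
  rewrite ifF; last by apply/negbTE; rewrite -ltNge (lt_trans kd)// exprn_gt0// pi_gt0.
  rewrite ltNge ltW//= lt_eqF//.
  have s0 : 0 < Num.sqrt (- k) by rewrite sqrtr_gt0 oppr_gt0.
  rewrite [Num.sqrt _ * d]mulrC [Num.sqrt _ * _]mulrC; congr (_%:E).
  rewrite -mulrA; have sh : 0 < sinh (d * Num.sqrt (- k)).
    by rewrite divr_gt0// subr_gt0 ltr_expR gtrN// mulr_gt0.
  by field; rewrite !gt_eqF.
- move=> _; rewrite -k0 mul0r ltxx eqxx ifF; last first.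
    by apply/negbTE; rewrite -ltNge exprn_gt0// pi_gt0.
  by rewrite mulfK.
Qed.


Section fixed_parameter.
Context (t : R).
Hypothesis t01 : 0 < t < 1.

Let t0 : 0 < t. Proof. by case/andP: t01. Qed.
Let t1 : 0 < 1 - t. Proof. by rewrite subr_gt0; case/andP: t01. Qed.
Let t01' : 0 < t <= 1. Proof. by case/andP: t01 => -> /ltW. Qed.
Let t11' : 0 < 1 - t <= 1. Proof. by rewrite t1/= gerBl ltW. Qed.

Lemma gmean_gt0 d A B : distance_range K N d -> 0 < A -> 0 < B ->
  0 < gmean K N t d A B.
Proof.
move=> [d0 dl1] A0 B0; rewrite /gmean; case: N dl1 => [n||] dl1.
- by apply: pmean_gt0 => //; apply: sg_gt0.
- by rewrite !mulr_gt0 ?powR_gt0 ?expR_gt0.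
- by rewrite !mulr_gt0 ?powR_gt0 ?expR_gt0.
Qed.

Lemma gmean_le d A B A' B' : distance_range K N d -> 0 < A -> 0 < B ->
  A <= A' -> B <= B' -> gmean K N t d A B <= gmean K N t d A' B'.
Proof.
move=> [d0 dl1] A0 B0 AA BB; rewrite /gmean; case: N dl1 => [n||] dl1.
- by apply: pmean_le => //; apply: sg_gt0.
- by rewrite ler_pM2r ?expR_gt0// ler_pM ?powR_ge0// powR_lepos// ltW.
- by rewrite ler_pM2r ?expR_gt0// ler_pM ?powR_ge0// powR_lepos// ltW.
Qed.

Let geom_homog c A B (e : R) : 0 < c -> 0 < A -> 0 < B ->
  (c * A) `^ (1 - t) * (c * B) `^ t * e = c * (A `^ (1 - t) * B `^ t * e).
Proof.
move=> c0 A0 B0; rewrite !powRM ?ltW// mulrACA (@powR_comp1 _ c _ _ 1)//.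
  by rewrite powRr1 ?ltW// !mulrA.
by rewrite subrK.
Qed.

Lemma gmeanZ d c A B : distance_range K N d -> 0 < c -> 0 < A -> 0 < B ->
  gmean K N t d (c * A) (c * B) = c * gmean K N t d A B.
Proof.
move=> [d0 dl1] c0 A0 B0; rewrite /gmean; move EN : N dl1 => [n||] dl1.
- apply: pmeanZ => //; try exact: sg_gt0.
  by case: (dimension_exponent EN) => ?; apply/eqP; lra.
- exact: geom_homog.
- exact: geom_homog.
Qed.

(** Concavity and homogeneity together. It is what lets J minus a piece of J keep the pointwise
    inequality. *)
Lemma gmean_superadd d A B A' B' : distance_range K N d ->
  0 < A -> 0 < B -> 0 < A' -> 0 < B' ->
  gmean K N t d A B + gmean K N t d A' B' <= gmean K N t d (A + A') (B + B').
Proof.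
move=> [d0 dl1] A0 B0 A'0 B'0; rewrite /gmean; move EN : N dl1 => [n||] dl1.
- by apply: pmean_superadd => //; try apply: sg_gt0 => //; exact: dimension_exponent.
- rewrite -mulrDl ler_pM2r ?expR_gt0//.
  have := @hoelder_powR _ t B B' A A'.
  by rewrite ![B `^ _ * _]mulrC ![B' `^ _ * _]mulrC ![(B + B') `^ _ * _]mulrC; apply;
    rewrite ?(ltW t0)//= ltW//; case/andP: t01.
- rewrite -mulrDl ler_pM2r ?expR_gt0//.
  have := @hoelder_powR _ t B B' A A'.
  by rewrite ![B `^ _ * _]mulrC ![B' `^ _ * _]mulrC ![(B + B') `^ _ * _]mulrC; apply;
    rewrite ?(ltW t0)//= ltW//; case/andP: t01.
Qed.

Lemma dmean_gt0 d a b : distance_range K N d -> 0 < a -> 0 < b ->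
  0 < dmean K N t d a b.
Proof.
move=> [d0 dl1] a0 b0; rewrite /dmean; case: N dl1 => [n||] dl1.
- case: eqP => _.
    by rewrite lt_min !mulr_gt0// invr_gt0 sg_gt0.
  by rewrite powR_gt0// addr_gt0// !mulr_gt0// powR_gt0// sg_gt0.
- by rewrite !mulr_gt0 ?powR_gt0 ?expR_gt0.
- by rewrite !mulr_gt0 ?powR_gt0 ?expR_gt0.
Qed.

Lemma dmean_le d a b a' b' : distance_range K N d -> 0 < a -> 0 < b ->
  a <= a' -> b <= b' -> dmean K N t d a b <= dmean K N t d a' b'.
Proof.
move=> [d0 dl1] a0 b0 aa bb.
have a'0 := lt_le_trans a0 aa; have b'0 := lt_le_trans b0 bb.
rewrite /dmean; move EN : N dl1 => [n||] dl1.
- have w1 := sg_gt0 t11' d0 dl1; have w2 := sg_gt0 t01' d0 dl1.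
  case: eqP => [_|/eqP n0].
    by rewrite le_min !ge_min; apply/andP; split; apply/orP; [left|right];
      rewrite ler_pM2l// divr_gt0.
  have P x y : 0 < x -> 0 < y -> 0 < (1 - t) `^ n^-1 * sg (delta K n%:E) (1 - t) d `^ (1 - n^-1) * x `^ n^-1 +
      t `^ n^-1 * sg (delta K n%:E) t d `^ (1 - n^-1) * y `^ n^-1.
    by move=> *; rewrite addr_gt0// !mulr_gt0// powR_gt0.
  case: (dimension_finP EN) => n1.
    apply: powR_leneg => //; first exact: P.
    by rewrite lerD// ler_pM2l ?mulr_gt0 ?powR_gt0// powR_leneg// invr_le0.
  have n2 : 0 <= n by lra.
  apply: powR_lepos => //; first exact: P.
  by rewrite lerD// ler_pM2l ?mulr_gt0 ?powR_gt0// powR_lepos// invr_ge0.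
- by rewrite ler_pM2r ?expR_gt0// ler_pM ?powR_ge0// powR_lepos// ltW.
- by rewrite ler_pM2r ?expR_gt0// ler_pM ?powR_ge0// powR_lepos// ltW.
Qed.

Lemma dmeanZ d c a b : distance_range K N d -> 0 < c -> 0 < a -> 0 < b ->
  dmean K N t d (c * a) (c * b) = c * dmean K N t d a b.
Proof.
move=> [d0 dl1] c0 a0 b0; rewrite /dmean; case: N dl1 => [n||] dl1.
- have w1 := sg_gt0 t11' d0 dl1; have w2 := sg_gt0 t01' d0 dl1.
  case: eqP => [_|/eqP n0].
    by rewrite minr_pMr ?ltW// !(mulrCA c).
  rewrite (powRM _ (ltW c0) (ltW a0)) (powRM _ (ltW c0) (ltW b0)).
  have alg (p q C x y : R) : p * (C * x) + q * (C * y) = C * (p * x + q * y) by ring.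
  rewrite alg powRM ?powR_ge0 ?powRKV//.
  by rewrite ltW// addr_gt0// !mulr_gt0// powR_gt0.
- exact: geom_homog.
- exact: geom_homog.
Qed.

(* For [N = n] this is Hoelder's inequality with exponent [1 / n], applied to
   the pairs [((1 - t) a / A, w1 A^(1/(n-1)))] and [(t b / B, w2 B^(1/(n-1)))]. *)
Lemma dmean_le_gmean d a b A B : distance_range K N d ->
  0 < a -> 0 < b -> 0 < A -> 0 < B ->
  dmean K N t d a b <= gmean K N t d A B * ((1 - t) * (a / A) + t * (b / B)).
Proof.
move=> [d0 dl1] a0 b0 A0 B0.
have G e : 0 <= e -> a `^ (1 - t) * b `^ t * e <=
    A `^ (1 - t) * B `^ t * e * ((1 - t) * (a / A) + t * (b / B)).
  move=> e0; rewrite [leRHS]mulrAC ler_wpM2r//.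
  rewrite (powR_split (1 - t) a0 A0) (powR_split t b0 B0) mulrACA.
  rewrite ler_wpM2l ?mulr_ge0 ?powR_ge0// mulrC [leRHS]addrC.
  by apply: young_powR; rewrite ?divr_gt0// (ltW t0) ltW//; case/andP: t01.
rewrite /dmean /gmean; move EN : N dl1 => [n||] dl1; last 2 first.
- exact/G/expR_ge0.
- exact/G/expR_ge0.
have w1 := sg_gt0 t11' d0 dl1; have w2 := sg_gt0 t01' d0 dl1.
set x1 := sg _ (1 - t) d in w1 *; set x2 := sg _ t d in w2 *; clearbody x1 x2.
have u1 : 0 < (1 - t) * (a / A) by rewrite mulr_gt0// divr_gt0.
have u2 : 0 < t * (b / B) by rewrite mulr_gt0// divr_gt0.
rewrite /pmean; case: eqP => [->|/eqP n0].
  have I x : 0 < x -> x `^ (-1) = x^-1 by move=> x0; rewrite powR_inv1// ltW.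
  rewrite sub0r invrN1 !I ?addr_gt0 ?mulr_gt0 ?powR_gt0 ?invr_gt0//.
  set m := Num.min _ _; set V := _ + _ => //.
  have V0 : 0 < V by rewrite addr_gt0// mulr_gt0 ?invr_gt0.
  have F (s x c C : R) : 0 < x -> 0 < C -> m <= s / x * c -> m * (x / C) <= s * (c / C).
    move=> x0 C0; rewrite mulrAC ler_pdivlMr// => h.
    by rewrite !mulrA ler_wpM2r// invr_ge0 ltW.
  rewrite [leRHS]mulrC ler_pdivlMr// /V mulrDr lerD//; apply: F => //.
    by rewrite ge_min lexx.
  by rewrite ge_min lexx orbT.
have p0 : n - 1 != 0 by case: (dimension_exponent EN) => ?; apply/eqP; lra.
have [v1 Ev1] : {v1 | v1 = x1 * A `^ (n - 1)^-1} by exists (x1 * A `^ (n - 1)^-1).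
have [v2 Ev2] : {v2 | v2 = x2 * B `^ (n - 1)^-1} by exists (x2 * B `^ (n - 1)^-1).
have v10 : 0 < v1 by rewrite Ev1 mulr_gt0// powR_gt0.
have v20 : 0 < v2 by rewrite Ev2 mulr_gt0// powR_gt0.
have E s x c C : 0 < s -> 0 < x -> 0 < c -> 0 < C ->
    (s * (c / C)) `^ n^-1 * (x * C `^ (n - 1)^-1) `^ (1 - n^-1) =
    s `^ n^-1 * x `^ (1 - n^-1) * c `^ n^-1.
  move=> s0 x0 c0 C0; rewrite !powRM ?powR_ge0 ?invr_ge0 ?mulr_ge0 ?ltW ?invr_gt0//.
  rewrite -[C^-1]powR_inv1 ?ltW// -!powRrM.
  have alg (p q u v w : R) : p * (q * u) * (v * w) = p * v * q * (u * w) by ring.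
  rewrite alg (@powR_comp1 _ C _ _ 0)// ?powRr0 ?mulr1//.
  by field; rewrite n0 p0.
rewrite -(E _ x1 a A)// -(E _ x2 b B)// -Ev1 -Ev2.
have UV : ((1 - t) * (a / A) + t * (b / B)) `^ 1 * (v1 + v2) `^ (n - 1) =
   (((1 - t) * (a / A) + t * (b / B)) `^ n^-1 * (v1 + v2) `^ (1 - n^-1)) `^ n.
  rewrite powRM ?powR_ge0// -!powRrM mulVf//; congr (_ * (_ `^ _)).
  by field.
rewrite -[X in _ <= _ * X]powRr1 ?(ltW (addr_gt0 u1 u2))// [leRHS]mulrC UV.
case: (dimension_finP EN) => n1.
- have n1' : n^-1 <= 0 by rewrite invr_le0.
  apply: powR_leneg => //; last exact: hoelder_powR_neg.
  by rewrite mulr_gt0// powR_gt0// addr_gt0.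
- have n2 : 0 < n by lra.
  apply: powR_lepos; [by rewrite addr_gt0// mulr_gt0// powR_gt0| |exact: ltW].
  apply: hoelder_powR => //; rewrite invr_ge0 ltW//= invf_le1//; lra.
Qed.

(** Equality in Hoelder requires (1 - t) al and t be to be proportional to w1 A ^ (1 / (n - 1)) and
    w2 B ^ (1 / (n - 1)); for N = +oo the choice al = be = 1 works. Later [al] and [be] are the
    relative lengths of two short intervals with densities A and B. *)
Lemma gmean_attained d A B : distance_range K N d -> 0 < A -> 0 < B ->
  exists al be, [/\ 0 < al, 0 < be &
    dmean K N t d (al * A) (be * B) = gmean K N t d A B * ((1 - t) * al + t * be)].
Proof.
move=> [d0 dl1] A0 B0; rewrite /dmean /gmean; move EN : N dl1 => [n||] dl1; last 2 first.
- by exists 1, 1; rewrite !mul1r !mulr1 subrK mulr1.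
- by exists 1, 1; rewrite !mul1r !mulr1 subrK mulr1.
have w1 := sg_gt0 t11' d0 dl1; have w2 := sg_gt0 t01' d0 dl1.
set x1 := sg _ (1 - t) d in w1 *; set x2 := sg _ t d in w2 *; clearbody x1 x2.
pose v1 := x1 * A `^ (n - 1)^-1; pose v2 := x2 * B `^ (n - 1)^-1.
have v10 : 0 < v1 by rewrite mulr_gt0// powR_gt0.
have v20 : 0 < v2 by rewrite mulr_gt0// powR_gt0.
exists (v1 / (1 - t)), (v2 / t); split; try by rewrite divr_gt0.
have -> : (1 - t) * (v1 / (1 - t)) + t * (v2 / t) = v1 + v2.
  by rewrite mulrCA mulfV ?gt_eqF// mulrCA mulfV ?gt_eqF// !mulr1.
have p0 : n - 1 != 0 by case: (dimension_exponent EN) => ?; apply/eqP; lra.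
have V0 : 0 < v1 + v2 by rewrite addr_gt0.
rewrite /pmean -/v1 -/v2 -[X in _ = _ * X]powRr1 ?ltW// (@powR_comp1 _ _ _ _ n) ?subrK//.
case: eqP => [En|/eqP n0].
  rewrite En powRr0; have E (s x C : R) : 0 < s -> 0 < x -> 0 < C ->
      s / x * (x * C `^ (n - 1)^-1 / s * C) = 1.
    move=> s0 x0 C0; rewrite En sub0r invrN1 powR_inv1 ?ltW//.
    by field; rewrite !gt_eqF.
  by rewrite /v1 /v2 !E// minxx.
congr (_ `^ _).
have E (s x C : R) : 0 < s -> 0 < x -> 0 < C -> s `^ n^-1 * x `^ (1 - n^-1) *
    (x * C `^ (n - 1)^-1 / s * C) `^ n^-1 = x * C `^ (n - 1)^-1.
  move=> s0 x0 C0; rewrite !powRM ?mulr_ge0 ?powR_ge0 ?invr_ge0 ?ltW//.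
  rewrite -[s^-1]powR_inv1 ?ltW// -!powRrM mulN1r.
  have -> : s `^ n^-1 * x `^ (1 - n^-1) * (x `^ n^-1 * C `^ ((n - 1)^-1 * n^-1) * s `^ (- n^-1) * C `^ n^-1)
    = (s `^ n^-1 * s `^ (- n^-1)) * (x `^ (1 - n^-1) * x `^ n^-1) *
      (C `^ ((n - 1)^-1 * n^-1) * C `^ n^-1) by ring.
  rewrite (@powR_comp1 _ s _ _ 0) ?subrr// powRr0 mul1r.
  rewrite (@powR_comp1 _ x _ _ 1) ?subrK// powRr1 ?ltW//.
  by rewrite (@powR_comp1 _ C _ _ (n - 1)^-1)//; field; rewrite n0 p0.
by rewrite !E.
Qed.

Lemma delta_ge0 n : N = n%:E -> (2 <= n -> (0 <= delta K N) = (0 <= K)) /\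
  (n <= 0 -> (0 <= delta K N) = (K <= 0)).
Proof.
by move=> ->; split=> n1; rewrite /delta; [rewrite pmulr_lge0|rewrite nmulr_lge0];
  rewrite ?invr_gt0 ?invr_lt0//; lra.
Qed.

(** The coefficients carry the positive exponent 1 - 1 / n, while the outer power n is positive in
    the first case and negative in the second; at n = 0 the coefficients stand in denominators. *)
Let dmean_weight n d d' a b : N = n%:E -> distance_range K N d -> distance_range K N d' ->
  0 < a -> 0 < b ->
  (2 <= n -> sg (delta K N) (1 - t) d <= sg (delta K N) (1 - t) d' ->
     sg (delta K N) t d <= sg (delta K N) t d' ->
     dmean K N t d a b <= dmean K N t d' a b) /\
  (n <= 0 -> sg (delta K N) (1 - t) d' <= sg (delta K N) (1 - t) d ->
     sg (delta K N) t d' <= sg (delta K N) t d ->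
     dmean K N t d a b <= dmean K N t d' a b).
Proof.
move=> EN [d0 dl1] [d'0 dl1'] a0 b0; rewrite /dmean; move: dl1 dl1'; rewrite EN => dl1 dl1'.
have w1 := sg_gt0 t11' d0 dl1; have w2 := sg_gt0 t01' d0 dl1.
have w1' := sg_gt0 t11' d'0 dl1'; have w2' := sg_gt0 t01' d'0 dl1'.
move: w1 w2 w1' w2'; move: (sg _ (1 - t) d) (sg _ t d) (sg _ (1 - t) d') (sg _ t d').
move=> x1 x2 y1 y2 w1 w2 w1' w2' {dl1 dl1'}.
split=> n1 s1 s2.
  have n2 : 0 < n by rewrite (lt_le_trans _ n1).
  have n3 : 0 <= 1 - n^-1.
    by rewrite subr_ge0 invf_le1// (le_trans _ n1)// ler1n.
  rewrite (gt_eqF n2).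
  apply: powR_lepos; [by rewrite addr_gt0// !mulr_gt0// powR_gt0| |exact: ltW].
  by rewrite lerD// ler_wpM2r ?powR_ge0// ler_wpM2l ?powR_ge0// powR_lepos.
case: eqP => [_|/eqP n0].
  rewrite le_min !ge_min; apply/andP; split; apply/orP; [left|right].
    by rewrite ler_pM2r// ler_pM2l// lef_pV2.
  by rewrite ler_pM2r// ler_pM2l// lef_pV2.
have n3 : 0 <= 1 - n^-1 by rewrite subr_ge0 (@le_trans _ _ 0)// invr_le0.
apply: powR_leneg => //; first by rewrite addr_gt0// !mulr_gt0// powR_gt0.
by rewrite lerD// ler_wpM2r ?powR_ge0// ler_wpM2l ?powR_ge0// powR_lepos.
Qed.

(** For n >= 2 [delta] has the sign of K and the mean increases with the coefficients; for n <= 0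
    both facts are reversed, so the answer depends on the sign of K only. Hence [theta_K] is an
    infimum for K >= 0 and a supremum for K < 0. *)
Lemma dmean_le_dist d d' a b : 0 <= d -> d <= d' -> distance_range K N d' ->
  0 < a -> 0 < b ->
  (0 <= K -> dmean K N t d a b <= dmean K N t d' a b) /\
  (K <= 0 -> dmean K N t d' a b <= dmean K N t d a b).
Proof.
move=> d0 dd' [d'0 dl1'] a0 b0.
have dr : distance_range K N d by split => //; rewrite (le_lt_trans _ dl1').
have dr' : distance_range K N d' by [].
have d2 : d ^+ 2 <= d' ^+ 2 by rewrite ler_pXn2r// nnegrE.
have G (K' : R) : 0 <= K' -> K' * t * (1 - t) * d ^+ 2 / 2 <= K' * t * (1 - t) * d' ^+ 2 / 2.
  by move=> K0; rewrite ler_pM2r ?invr_gt0// ler_wpM2l ?mulr_ge0// ltW.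
move EN : N => [n||]; last 2 first.
- split=> K0; rewrite /dmean; rewrite ler_wpM2l ?mulr_ge0 ?powR_ge0// ler_expR ?G//.
  by have := G (- K); rewrite !mulNr lerN2 oppr_ge0; exact.
- split=> K0; rewrite /dmean; rewrite ler_wpM2l ?mulr_ge0 ?powR_ge0// ler_expR ?G//.
  by have := G (- K); rewrite !mulNr lerN2 oppr_ge0; exact.
rewrite -EN; have [P1 P2] := sg_le t11' d0 dd' dl1'; have [Q1 Q2] := sg_le t01' d0 dd' dl1'.
have [W1 W2] := dmean_weight EN dr dr' a0 b0; have [W1' W2'] := dmean_weight EN dr' dr a0 b0.
have [D1 D2] := delta_ge0 EN.
have D3 : 2 <= n -> K <= 0 -> delta K N <= 0.
  move=> n2 K0; rewrite EN /delta mulr_le0_ge0// invr_ge0 subr_ge0.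
  by rewrite (le_trans _ n2)// ler1n.
have D4 : n <= 0 -> 0 <= K -> delta K N <= 0.
  move=> n2 K0; rewrite EN /delta mulr_ge0_le0// invr_le0 subr_le0.
  by rewrite (le_trans n2).
split=> K0; case: (dimension_finP EN) => n1.
- by apply: W2 => //; [apply: P2|apply: Q2]; apply: D4.
- by apply: W1 => //; [apply: P1|apply: Q1]; rewrite D1.
- by apply: W2' => //; [apply: P1|apply: Q1]; rewrite D2.
- by apply: W1' => //; [apply: P2|apply: Q2]; apply: D3.
Qed.

End fixed_parameter.
End means.

(** * Continuity of the means and their identification with the distorted mean *)

Section limits_of_means.
Context {R : realType}.

Lemma cvg_for (g : R -> R) (T : Type) (F : set_system T) {FF : Filter F} (f : T -> R) (x : R) :
  {for x, continuous g} -> f z @[z --> F] --> x -> g (f z) @[z --> F] --> g x.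
Proof. by move=> gx fx; exact: (@cvg_comp _ _ _ f g _ _ _ fx). Qed.

Lemma cvg_powR (T : Type) (F : set_system T) {FF : Filter F} (f : T -> R) (x r : R) :
  0 < x -> f z @[z --> F] --> x -> f z `^ r @[z --> F] --> x `^ r.
Proof. by move=> x0; apply: (@cvg_for (fun a => a `^ r)); exact: continuous_powR. Qed.

Lemma cvg_s_delta (dl : R) (T : Type) (F : set_system T) {FF : Filter F} (f : T -> R) (x : R) :
  f z @[z --> F] --> x -> s_delta dl (f z) @[z --> F] --> s_delta dl x.
Proof. by apply: (@cvg_for (s_delta dl)); exact: continuous_s_delta. Qed.

Lemma cvg_minr (T : Type) (F : set_system T) {FF : Filter F} (f g : T -> R) (x y : R) :
  f z @[z --> F] --> x -> g z @[z --> F] --> y ->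
  Num.min (f z) (g z) @[z --> F] --> Num.min x y.
Proof.
move=> fx gy.
have E (u v : R) : Num.min u v = (u + v - `|u - v|) / 2.
  by case: (leP u v) => uv; [rewrite ler0_norm ?subr_le0//|rewrite gtr0_norm ?subr_gt0//]; field.
rewrite E; under eq_fun do rewrite E.
by apply: cvgMl; apply: cvgB; [exact: cvgD|apply: cvg_norm; exact: cvgB].
Qed.

Lemma sg_cvg (dl t : R) (T : Type) (F : set_system T) {FF : Filter F} (f : T -> R) (d : R) :
  0 < d -> (d%:E < l_delta dl)%E -> f z @[z --> F] --> d ->
  sg dl t (f z) @[z --> F] --> sg dl t d.
Proof.
move=> d0 dl1 fd; have Sd : s_delta dl d != 0 by rewrite gt_eqF// s_delta_gt0.
rewrite {2}/sg gt_eqF//.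
have : s_delta dl (t * f z) / s_delta dl (f z) @[z --> F] --> s_delta dl (t * d) / s_delta dl d.
  by apply: cvgM; [apply: cvg_s_delta; exact: cvgZr|apply: cvgV => //; exact: cvg_s_delta].
apply: cvg_trans; apply: near_eq_cvg.
have : \forall z \near F, 0 < f z by exact: (cvgr_gt d).
by apply: filterS => z z0; rewrite /sg gt_eqF.
Qed.

Lemma distance_range_near (K : R) (N : \bar R) (T : Type) (F : set_system T) {FF : Filter F}
    (f : T -> R) (d : R) : 0 < d -> distance_range K N d -> f z @[z --> F] --> d ->
  \forall z \near F, distance_range K N (f z).
Proof.
move=> d0 [_ dl1] fd.
have h1 : \forall z \near F, 0 < f z by exact: (cvgr_gt d).
have h2 : \forall z \near F, ((f z)%:E < l_delta (delta K N))%E.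
  move: dl1; rewrite /l_delta; case: ifP => [_|_ _]; last by apply: nearW => z; exact: ltry.
  rewrite lte_fin; set X := _ / _ => dl1.
  have h : \forall z \near F, f z < X by exact: (cvgr_lt d).
  by apply: filterS h => z; rewrite lte_fin.
by apply: filterS2 h1 h2 => z z0 zl; split => //; exact: ltW.
Qed.

Section with_dimension.
Context (K : R) (N : \bar R).
Hypothesis hN : dimension_range N.

Lemma cvg_dmean (t : R) (T : Type) (F : set_system T) {FF : Filter F} (f : T -> R) (d a b : R) :
  0 < t < 1 -> 0 < a -> 0 < b -> 0 < d -> distance_range K N d ->
  f z @[z --> F] --> d -> dmean K N t (f z) a b @[z --> F] --> dmean K N t d a b.
Proof.
move=> /andP[t0 t1] a0 b0 d0 dr fd.
have G : a `^ (1 - t) * b `^ t * expR (K * t * (1 - t) * f z ^+ 2 / 2) @[z --> F] -->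
   a `^ (1 - t) * b `^ t * expR (K * t * (1 - t) * d ^+ 2 / 2).
  apply: cvgMr; apply: (@cvg_for expR); first exact: continuous_expR.
  by apply: cvgMl; apply: cvgZr; exact: (cvgM fd fd).
rewrite /dmean; move EN : N dr => [n||] dr; [|exact: G|exact: G].
have t01 : 0 < t <= 1 by rewrite t0 ltW.
have t11 : 0 < 1 - t <= 1 by rewrite subr_gt0 t1 gerBl ltW.
have [_ dl1] := dr; have d0' := ltW d0.
have w1 := sg_gt0 t11 d0' dl1; have w2 := sg_gt0 t01 d0' dl1.
have c1 := sg_cvg (t := 1 - t) d0 dl1 fd; have c2 := sg_cvg (t := t) d0 dl1 fd.
move: w1 w2 c1 c2; cbv zeta.
move: (sg _ (1 - t)) (sg _ t) => x1 x2 w1 w2 c1 c2.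
case: (n == 0).
  apply: cvg_minr; apply: cvgMl; apply: cvgMr; apply: cvgV.
  - by rewrite gt_eqF.
  - exact: c1.
  - by rewrite gt_eqF.
  - exact: c2.
apply: cvg_powR.
  by rewrite addr_gt0// !mulr_gt0// powR_gt0// subr_gt0.
apply: cvgD; apply: cvgMl; apply: cvgMr.
  by apply: cvg_powR; [exact: w1|exact: c1].
by apply: cvg_powR; [exact: w2|exact: c2].
Qed.

Lemma distorted_mean_innerE (t d a b : R) : 0 < t < 1 -> distance_range K N d ->
  distorted_mean_inner K N d a b t = (dmean K N t d a b)%:E.
Proof.
move=> /andP[t0 t1] [d0 dl1]; rewrite /distorted_mean_inner /dmean.
move EN : N dl1 => [n||]// dl1.
have t01 : 0 < t <= 1 by rewrite t0 ltW.
have t11 : 0 < 1 - t <= 1 by rewrite subr_gt0 t1 gerBl ltW.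
have w1 := sg_gt0 t11 d0 dl1; have w2 := sg_gt0 t01 d0 dl1.
have p0 : n - 1 != 0.
  by case: (dimension_exponent hN EN) => ?; [rewrite lt_eqF|rewrite gt_eqF// (lt_le_trans ltr01)].
have S1 := sg_sigma (1 - t) p0 d0 dl1; have S2 := sg_sigma t p0 d0 dl1.
case: eqP => [n0|_].
  rewrite n0 sub0r in S1 S2; rewrite S1 S2 /delta n0 sub0r.
  rewrite /delta n0 sub0r in w1 w2.
  by rewrite !inver !gt_eqF// -!EFinM -EFin_min.
have cond : K / (n - 1) * d ^+ 2 < pi ^+ 2; last first.
  by rewrite cond /tau S1 S2 !poweR_EFin.
move: dl1; rewrite /l_delta; case: ifP => [k0|/negbT].
  have s0 : 0 < Num.sqrt (delta K n%:E) by rewrite sqrtr_gt0.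
  rewrite lte_fin ltr_pdivlMr// => dpi.
  rewrite -[X in X * _](sqr_sqrtr (ltW k0)) -exprMn mulrC.
  by rewrite ltr_pXn2r// nnegrE ?mulr_ge0 ?pi_ge0// ltW.
rewrite -leNgt => k0 _; rewrite (@le_lt_trans _ _ 0)// ?exprn_gt0 ?pi_gt0//.
by rewrite mulr_le0_ge0// sqr_ge0.
Qed.

Lemma distorted_meanE (t d a b : R) : 0 < t < 1 -> distance_range K N d ->
  0 < a -> 0 < b -> distorted_mean K N t d a b = (dmean K N t d a b)%:E.
Proof.
move=> t01 dr a0 b0; have /andP[t0 t1] := t01.
rewrite /distorted_mean (gt_eqF (mulr_gt0 a0 b0)) (gt_eqF t0) (lt_eqF t1).
exact: distorted_mean_innerE.
Qed.

Lemma distorted_mean_inner_far (t d a b : R) : 0 < d -> (l_delta (delta K N) <= d%:E)%E ->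
  (0 < K -> distorted_mean_inner K N d a b t = +oo%E) /\
  (K < 0 -> 0 < t < 1 -> distorted_mean_inner K N d a b t = 0%E).
Proof.
move=> d0; rewrite /distorted_mean_inner /l_delta; case: ifP => // k0.
rewrite lee_fin; move EN : N k0 => [n||]; rewrite ?ltxx// => k0.
have s0 : 0 < Num.sqrt (delta K n%:E) by rewrite sqrtr_gt0.
rewrite ler_pdivrMr// => pid.
have pid2 : pi ^+ 2 <= K / (n - 1) * d ^+ 2.
  rewrite -[X in X * _](sqr_sqrtr (ltW k0)) [leRHS]mulrC -exprMn.
  by rewrite ler_pXn2r// nnegrE ?mulr_ge0 ?pi_ge0// ltW.
have HN := dimension_finP hN EN; split=> K0.
- have n2 : 2 <= n.
    case: HN => // n0; move: k0; rewrite /delta ltNge mulr_ge0_le0 ?(ltW K0)// invr_le0 subr_le0.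
    by rewrite (le_trans n0).
  rewrite (gt_eqF (lt_le_trans _ n2))// ltNge pid2/= K0 (lt_le_trans _ n2)//.
  by rewrite ltr1n.
- move=> _; have n0 : n <= 0.
    case: HN => // n2; move: k0; rewrite /delta ltNge mulr_le0_ge0 ?(ltW K0)// invr_ge0 subr_ge0.
    by rewrite (le_trans _ n2)// ler1n.
  (* At n = 0 the value 0 comes from the infinite [sigma] in both denominators. *)
  case: eqP => [n0'|_].
    rewrite n0' sub0r in pid2; rewrite /sigma pid2 invey !mule0 !mul0e.
    by rewrite /mine ltxx.
  by rewrite ltNge pid2/= ltNge (ltW K0).
Qed.

Lemma distorted_mean_far (t d a b : R) : 0 < t < 1 -> 0 < d ->
  (l_delta (delta K N) <= d%:E)%E -> 0 < a -> 0 < b ->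
  (0 < K -> distorted_mean K N t d a b = +oo%E) /\
  (K < 0 -> distorted_mean K N t d a b = 0%E).
Proof.
move=> t01 d0 dl1 a0 b0; have [H1 H2] := distorted_mean_inner_far t a b d0 dl1.
have /andP[t0 t1] := t01.
rewrite /distorted_mean (gt_eqF (mulr_gt0 a0 b0)) (gt_eqF t0) (lt_eqF t1).
by split=> // K0; exact: H2.
Qed.

End with_dimension.
End limits_of_means.

(** * Integration on the line and convergent subsequences *)

Section integral_tools.
Context {R : realType}.
Local Notation mu := (@lebesgue_measure R).
Local Notation intg f := (mu.-integrable setT (EFin \o f)).
Implicit Types f g G J : R -> R.

Lemma intg_dom f G : measurable_fun setT f -> (forall x, `|f x| <= G x) -> intg G -> intg f.
Proof.
move=> mf fG; apply: le_integrable => //; first exact/measurable_EFinP.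
by move=> x _; rewrite !abse_EFin lee_fin (le_trans (fG x))// ler_norm.
Qed.

Lemma intg_mul g J (M : R) : measurable_fun setT g -> (forall x, `|g x| <= M) ->
  intg J -> intg (fun x => g x * J x).
Proof.
move=> mg gM iJ; apply: (@integrableMr _ _ _ mu setT measurableT g (EFin \o J) mg _ iJ).
by exists M; split; rewrite ?num_real// => y My x _ /=; exact: le_trans (gM x) (ltW My).
Qed.

Lemma Rint_dct (f_ : nat -> R -> R) f G :
  (forall n, measurable_fun setT (f_ n)) -> measurable_fun setT f -> intg G ->
  (forall n x, `|f_ n x| <= G x) -> {ae mu, forall x, f_ n x @[n --> \oo] --> f x} ->
  (\int[mu]_x f_ n x)%R @[n --> \oo] --> (\int[mu]_x f x)%R.
Proof.
move=> mf_ mf iG fG fcv.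
have [|||||iF _ H] := @dominated_convergence _ _ _ mu setT measurableT
  (fun n => EFin \o f_ n) (EFin \o f) (EFin \o G).
- by move=> n; apply/measurable_EFinP; exact: mf_.
- by apply/measurable_EFinP.
- apply: negligibleS fcv => x /= + fx; apply => _; apply/cvg_EFin; [exact: nearW|exact: fx].
- by [].
- by apply: aeW => x n _ /=; rewrite lee_fin.
by apply: fine_cvg; rewrite /Rintegral fineK; [exact: H|exact: integrable_fin_num].
Qed.

Lemma bolzano_weierstrass (u : nat -> R) (a b : R) : (forall n, a <= u n <= b) ->
  exists x (s : nat -> nat), [/\ a <= x <= b, {homo s : m n / (m < n)%N} &
    u (s n) @[n --> \oo] --> x].
Proof.
move=> uab.
have [x [/= xab clx]] : (`[a, b] `&` cluster (u @ \oo))%classic !=set0.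
  apply: (@segment_compact _ a b (u @ \oo)) => //.
  by exists 0%N => // n _ /=; rewrite in_itv/=.
have [s incs us] := (cluster_eventually_cvg u x).1 clx.
exists x, s; split => //.
by move=> m n mn; rewrite ltnNge -leEnat incs -ltnNge.
Qed.

Lemma subseq_ge (s : nat -> nat) : {homo s : m n / (m < n)%N} -> forall n, (n <= s n)%N.
Proof. by move=> hs; elim=> // n IH; rewrite (leq_ltn_trans IH)// hs. Qed.

Lemma cvg_subseq (T : topologicalType) (u : nat -> T) (s : nat -> nat) (x : T) :
  {homo s : m n / (m < n)%N} -> u n @[n --> \oo] --> x -> u (s n) @[n --> \oo] --> x.
Proof.
move=> hs ux; apply: (@cvg_comp _ _ _ s u _ \oo) => //.
move=> A [N _ NA]; exists N => // n /= Nn; apply: NA => /=.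
by rewrite (leq_trans Nn)// subseq_ge.
Qed.

Lemma measurable_gt_set (c : R) f : measurable_fun setT f -> measurable [set x | c < f x].
Proof.
move=> mf; have := mf measurableT _ (measurable_itv `]c, +oo[); rewrite setTI.
by congr measurable; apply/seteqP; split=> x /=; rewrite in_itv/= andbT.
Qed.

Lemma Rint_gt0 f : measurable_fun setT f -> intg f -> (forall x, 0 <= f x) ->
  (0 < mu [set x | (0 < f x)%R])%E -> (0 < \int[mu]_x f x)%R.
Proof.
move=> mf iF f0 mf0; rewrite lt_neqAle Rintegral_ge0// andbT eq_sym.
apply/eqP => If0; suff : mu [set x | 0 < f x] = 0%E by move=> m0; rewrite m0 ltxx in mf0.
have : (\int[mu]_x `|(EFin \o f) x|)%E = 0%E.
  rewrite -[RHS]/(0%R%:E) -If0 /Rintegral fineK ?integrable_fin_num//.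
  by apply: eq_integral => x _ /=; rewrite ger0_norm.
move/(ae_eq_integral_abs mu measurableT ((measurable_EFinP _ _).2 mf)).1.
case=> N [mN N0 fN]; apply/eqP; rewrite -measure_le0 -N0.
have mS := measurable_gt_set 0 mf.
apply: le_measure; rewrite ?inE//; move=> x /= fx; apply: fN => /= /(_ Logic.I) [] E.
by move: fx; rewrite E ltxx.
Qed.

Lemma indic_pred (P : R -> bool) x : \1_([set x | P x]) x = (P x)%:R :> R.
Proof.
rewrite indicE; case: (boolP (P x)) => p; first by rewrite mem_set.
by rewrite memNset//; apply/negP.
Qed.

Lemma intg_indic (I : set R) : measurable I -> (mu I < +oo)%E -> intg (\1_I : R -> R).
Proof.
move=> mI fI; apply/integrableP; split.
  by apply/measurable_EFinP; exact: measurable_indic.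
rewrite (_ : (fun x => _) = (fun x => (\1_I x)%:E)); last first.
  by apply/funext => x /=; rewrite ger0_norm// indicE.
by rewrite integral_indic// setIT.
Qed.

Lemma ae_except3 (P : R -> Prop) (u v w : R) :
  (forall x, x != u -> x != v -> x != w -> P x) -> {ae mu, forall x, P x}.
Proof.
move=> H; exists [set u; v; w]; split.
- by apply: measurableU; [apply: measurableU|]; exact: measurable_set1.
- apply: countable_lebesgue_measure0; apply: finite_set_countable.
  by rewrite !finite_setU; split; [split|]; exact: finite_set1.
- move=> x /= nP; apply: contrapT => nE; apply: nP.
  by apply: H; apply/eqP => E; apply: nE; [left; left|left; right|right].
Qed.

Lemma Rint_ae_eq f g (u v w : R) : measurable_fun setT f -> measurable_fun setT g ->
  (forall x, x != u -> x != v -> x != w -> f x = g x) ->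
  \int[mu]_x f x = \int[mu]_x g x.
Proof.
move=> mf mg H; rewrite /Rintegral; congr fine.
apply: ae_eq_integral => //; [exact/measurable_EFinP|exact/measurable_EFinP|].
have := ae_except3 (P := fun x => f x = g x) H.
by apply: negligibleS => x /= + fg; apply => _; rewrite fg.
Qed.

End integral_tools.

(** The one-dimensional curvature-dimension inequality for a density. It is asked only where J is
    positive, since for N <= 0 the mean involves negative powers. *)
Definition CD {R : realType} (K : R) (N : \bar R) (J : R -> R) :=
  forall x y t, x < y -> 0 < J x -> 0 < J y -> 0 < t < 1 ->
    gmean K N t (y - x) (J x) (J y) <= J ((1 - t) * x + t * y).

Lemma conv_between {R : realType} (x z y : R) : x < z < y ->
  exists t, 0 < t < 1 /\ z = (1 - t) * x + t * y.
Proof.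
move=> /andP[xz zy]; have yx : 0 < y - x by rewrite subr_gt0 (lt_trans xz).
exists ((z - x) / (y - x)); split.
  apply/andP; split; first by rewrite divr_gt0// subr_gt0.
  by rewrite ltr_pdivrMr// mul1r ltrD2r.
by field; rewrite gt_eqF.
Qed.

Lemma conv_in {R : realType} (x y t : R) : x < y -> 0 < t < 1 ->
  x < (1 - t) * x + t * y < y.
Proof.
move=> xy /andP[t0 t1]; apply/andP; split; rewrite -subr_gt0.
  have -> : (1 - t) * x + t * y - x = t * (y - x) by ring.
  by rewrite mulr_gt0// subr_gt0.
have -> : y - ((1 - t) * x + t * y) = (1 - t) * (y - x) by ring.
by rewrite mulr_gt0// subr_gt0.
Qed.

(** * Densities of minimal mass *)

Section minimal_density.
Context {R : realType} (K : R) (N : \bar R).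
Hypothesis hN : dimension_range N.
Local Notation mu := (@lebesgue_measure R).
Local Notation intg f := (mu.-integrable setT (EFin \o f)).
Variables (a0 b0 : R).
Hypothesis hl : ((b0 - a0)%:E <= l_delta (delta K N))%E.
Implicit Types J P : R -> R.

(** The interval is open, so two points of it are strictly closer than b0 - a0, hence within range
    even when b0 - a0 equals [l_delta]. *)
Definition inside J := forall x, 0 < J x -> a0 < x < b0.

Lemma inside_range x y : a0 < x < b0 -> a0 < y < b0 -> x < y ->
  distance_range K N (y - x).
Proof.
move=> /andP[ax xb] /andP[ay yb] xy; split; first by rewrite subr_ge0 ltW.
by apply: lt_le_trans hl; rewrite lte_fin ltrB.
Qed.

Lemma CD_pos_between J x z y : inside J -> CD K N J -> 0 < J x -> 0 < J y ->
  x <= z <= y -> 0 < J z.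
Proof.
move=> iJ cJ Jx Jy /andP[]; rewrite le_eqVlt => /predU1P[<-//|xz].
rewrite le_eqVlt => /predU1P[->//|zy].
have [t [t01 ->]] : exists t, 0 < t < 1 /\ z = (1 - t) * x + t * y.
  by apply: conv_between; rewrite xz.
apply: lt_le_trans (cJ x y t (lt_trans xz zy) Jx Jy t01).
apply: gmean_gt0 => //; apply: inside_range; [exact: iJ|exact: iJ|exact: lt_trans zy].
Qed.

Lemma CD_restrict J (I : set R) : is_interval I -> (forall x, 0 <= J x) ->
  CD K N J -> CD K N (fun x => J x * \1_I x).
Proof.
move=> iI J0 cJ x y t xy; rewrite !indicE.
have [xI|_] := boolP (x \in I); last by rewrite mulr0 ltxx.
have [yI|_] := boolP (y \in I); last by rewrite mulr0 ltxx.
rewrite !mulr1 => Jx Jy t01.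
have /andP[xz zy] := conv_in xy t01.
have -> : (1 - t) * x + t * y \in I.
  by rewrite inE; rewrite !inE in xI yI; apply: (iI x y) => //; rewrite !ltW.
by rewrite mulr1; exact: cJ.
Qed.

Definition len J : R := fine (mu [set x | 0 < J x]).

Lemma len_inside J : measurable_fun setT J -> inside J -> a0 < b0 ->
  (len J)%:E = mu [set x | 0 < J x] /\ len J <= b0 - a0.
Proof.
move=> mJ iJ ab.
have mS := measurable_gt_set 0 mJ.
have H : (mu [set x | (0 < J x)%R] <= (b0 - a0)%:E)%E.
  have -> : (b0 - a0)%:E = mu `]a0, b0[%classic by rewrite lebesgue_measure_itv/= lte_fin ab.
  by apply: le_measure; rewrite ?inE// => x /iJ; rewrite /= in_itv.
have F : mu [set x | (0 < J x)%R] \is a fin_num.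
  by rewrite ge0_fin_numE// (le_lt_trans H)// ltry.
by split; [rewrite /len fineK|rewrite -lee_fin /len fineK].
Qed.

Lemma support_interval J : inside J -> CD K N J -> 0 < len J ->
  exists A B, [/\ a0 <= A, A < B, B <= b0, forall x, A < x < B -> 0 < J x &
    forall x, 0 < J x -> A <= x <= B].
Proof.
move=> iJ cJ lJ; pose E := [set x | 0 < J x].
have E0 : E !=set0.
  apply: contrapT => /set0P/negP; rewrite negbK => /eqP E0.
  by move: lJ; rewrite /len -/E E0 measure0 ltxx.
have lE : has_lbound E by exists a0 => x /iJ /andP[/ltW].
have uE : has_ubound E by exists b0 => x /iJ /andP[_ /ltW].
have hi : has_inf E by split. have hs : has_sup E by split.
have AxB x : E x -> inf E <= x <= sup E.
  by move=> Ex; rewrite ge_inf//= ub_le_sup.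
exists (inf E), (sup E); split => //.
- by apply: lb_le_inf => // x /iJ /andP[/ltW].
- have [x Ex] := E0; have /andP[h1 h2] := AxB _ Ex.
  rewrite lt_neqAle (le_trans h1 h2) andbT; apply/eqP => Ie.
  have Ex1 : E = [set x].
    apply/seteqP; split => [y Ey|y ->//]; have /andP[h3 h4] := AxB _ Ey.
    by apply/eqP; rewrite eq_le (le_trans h4) -?Ie//= (le_trans h2) -?Ie.
  by move: lJ; rewrite /len -/E Ex1 lebesgue_measure_set1 ltxx.
- by apply: ge_sup => // x /iJ /andP[_ /ltW].
- move=> x /andP[Ax xB].
  have [x1 Ex1 x1x] := inf_lt E0 Ax; have [x2 Ex2 xx2] := sup_gt E0 xB.
  have P := @CD_pos_between J x1 x x2 iJ cJ Ex1 Ex2.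
  by apply: P; rewrite (ltW x1x) (ltW xx2).
Qed.

Variables (h phi : R -> R) (M : R).
Hypothesis (mh : measurable_fun setT h) (mphi : measurable_fun setT phi).
Hypothesis (hM : forall x, `|h x| <= M) (phiM : forall x, `|phi x| <= M).
Hypothesis short : exists e : R, 0 < e /\ forall x, a0 <= x <= b0 ->
  (forall y, `|y - x| < e -> 0 < h y) \/ (forall y, `|y - x| < e -> h y < 0) \/
  (forall y, `|y - x| < e -> 0 < phi y).
Variable (J0 : R -> R).
Hypothesis (mJ0 : measurable_fun setT J0) (iJ0 : intg J0) (J00 : forall x, 0 <= J0 x).
Hypothesis (insJ0 : inside J0) (cJ0 : CD K N J0).

Definition below J := measurable_fun setT J /\ forall x, 0 <= J x <= J0 x.

Lemma below_intg J : below J -> intg J.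
Proof.
move=> [mJ bJ]; apply: intg_dom iJ0 => // x.
by have /andP[J1 J2] := bJ x; rewrite ger0_norm.
Qed.

Lemma below_inside J : below J -> inside J.
Proof. by move=> [_ bJ] x Jx; apply: insJ0; have /andP[_] := bJ x; exact: lt_le_trans. Qed.

Lemma below_inth J : below J -> intg (fun x => h x * J x).
Proof. by move=> bJ; apply: (intg_mul mh hM); exact: below_intg. Qed.

Lemma below_intphi J : below J -> intg (fun x => phi x * J x).
Proof. by move=> bJ; apply: (intg_mul mphi phiM); exact: below_intg. Qed.

Hypothesis ab : a0 < b0.

Lemma lenE J : below J -> (len J)%:E = mu [set x | 0 < J x].
Proof. by move=> bJ; have [] := len_inside bJ.1 (below_inside bJ) ab. Qed.

Lemma len_le J P : below J -> below P -> (forall x, P x <= J x) -> len P <= len J.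
Proof.
move=> bJ bP PJ; rewrite -lee_fin !lenE//.
apply: le_measure; rewrite ?inE; [exact: measurable_gt_set bP.1|exact: measurable_gt_set bJ.1|].
by move=> x /= Px; exact: lt_le_trans (PJ x).
Qed.

Lemma len_ge0 J : 0 <= len J. Proof. exact: fine_ge0. Qed.

Lemma below_cmp J P : below J -> measurable_fun setT P -> (forall x, 0 <= P x <= J x) -> below P.
Proof.
move=> [mJ bJ] mP PJ; split => // x; have /andP[-> /le_trans] := PJ x; apply.
by have /andP[] := bJ x.
Qed.

Lemma mass_gt0 J : below J -> 0 < len J -> 0 < \int[mu]_x J x.
Proof.
move=> bJ l0; apply: Rint_gt0; [exact: bJ.1|exact: below_intg| |].
  by move=> x; have [_ /(_ x)/andP[]] := bJ.
by rewrite -lenE// lte_fin.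
Qed.

Lemma null_density_int J (g : R -> R) : below J -> intg (fun x => g x * J x) ->
  len J = 0 -> \int[mu]_x (g x * J x) = 0.
Proof.
move=> bJ ig l0; have m0 : mu [set x | 0 < J x] = 0%E by rewrite -lenE// l0.
rewrite /Rintegral (@negligible_integral _ _ _ mu setT [set x | 0 < J x] (fun x => (g x * J x)%:E))//.
  rewrite integral0_eq// => x [_ /= Jx]; rewrite (_ : J x = 0) ?mulr0//.
  by have [_ /(_ x)/andP[J1 _]] := bJ; apply/eqP; rewrite eq_le J1 andbT leNgt; apply/negP.
exact: measurable_gt_set bJ.1.
Qed.

Lemma phi_lt0_len J : below J -> \int[mu]_x (phi x * J x) < 0 -> 0 < len J.
Proof.
move=> bJ PJ; rewrite lt_neqAle len_ge0 andbT eq_sym; apply/eqP => l0.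
by move: PJ; rewrite (null_density_int bJ (below_intphi bJ) l0) ltxx.
Qed.

(** A support of length below the scale of [short] lies in a ball where h has a strict sign or phi
    is positive; then the integral of h cannot vanish or that of phi cannot be negative. This bounds
    the lengths of all competitors from below. *)
Lemma short_len : exists e : R, 0 < e /\ forall J, below J -> CD K N J ->
  \int[mu]_x (h x * J x) = 0 -> \int[mu]_x (phi x * J x) < 0 -> e <= len J.
Proof.
have [e [e0 He]] := short; exists e; split => // J bJ cJ HJ PJ.
have l0 := phi_lt0_len bJ PJ; rewrite leNgt; apply/negP => le.
have Jge x : 0 <= J x by have [_ /(_ x)/andP[]] := bJ.
have [x Jx] : exists x, 0 < J x.
  apply: contrapT => nx; have : len J = 0; last by move=> l1; rewrite l1 ltxx in l0.
  rewrite /len (_ : [set x | _] = set0) ?measure0//.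
  by rewrite -subset0 => x /= Jx; apply: nx; exists x.
have ins := below_inside bJ.
have near y : 0 < J y -> `|y - x| < e.
  move=> Jy; apply: le_lt_trans le; rewrite -lee_fin lenE//.
  wlog xy : x y Jx Jy / x <= y.
    by move=> W; case: (leP x y) => [|/ltW] xy; [exact: W|rewrite distrC; exact: W].
  rewrite ger0_norm ?subr_ge0//.
  have [->|xny] := eqVneq x y; first by rewrite subrr.
  have xlty : x < y by rewrite lt_neqAle xny.
  have -> : (y - x)%:E = mu `]x, y[%classic by rewrite lebesgue_measure_itv/= lte_fin xlty.
  apply: le_measure; rewrite ?inE//; first exact: measurable_gt_set bJ.1.
  move=> z; rewrite /= in_itv/= => /andP[xz zy].
  by apply: (CD_pos_between ins cJ Jx Jy); rewrite !ltW.
have pos (g : R -> R) : intg (fun x => g x * J x) -> measurable_fun setT (fun x => g x * J x) ->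
    (forall y, `|y - x| < e -> 0 < g y) -> 0 < \int[mu]_x (g x * J x).
  move=> ig mg gp; apply: Rint_gt0 => //.
    move=> y; have := Jge y; rewrite le_eqVlt => /predU1P[<-|Jy]; first by rewrite mulr0.
    by rewrite mulr_ge0// ltW// gp// near.
  have -> : [set x | 0 < g x * J x] = [set x | 0 < J x].
    apply/seteqP; split=> y /=; last by move=> Jy; rewrite mulr_gt0// gp// near.
    have := Jge y; rewrite le_eqVlt => /predU1P[<-|//]; by rewrite mulr0.
  by rewrite -lenE// lte_fin.
have /He[Hp|[Hn|Hp]] : a0 <= x <= b0 by have /andP[? ?] := ins _ Jx; rewrite !ltW.
- have := pos h (below_inth bJ) (measurable_funM mh bJ.1) Hp.
  by rewrite HJ ltxx.
- have mN : measurable_fun setT (fun x => - h x) by exact: measurableT_comp.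
  have iN : intg (fun x => - h x * J x).
    by apply: (intg_mul mN) (below_intg bJ) => y; rewrite normrN.
  have := pos (fun x => - h x) iN (measurable_funM mN bJ.1).
  have -> : \int[mu]_x (- h x * J x) = 0.
    have -> : (fun x => - h x * J x) = (fun x => (-1) * (h x * J x)).
      by apply/funext => y; rewrite mulrA mulN1r.
    by rewrite (RintegralZl _ measurableT (below_inth bJ)) HJ mulr0.
  rewrite ltxx => H; suff : false by []; apply: H => y /Hn.
  by rewrite oppr_gt0.
- have := pos phi (below_intphi bJ) (measurable_funM mphi bJ.1) Hp.
  by rewrite ltNge (ltW PJ).
Qed.

(** The bound r * len J, with r < 0, adapts to subdensities: it is weaker for a smaller support, so
    a piece with nonnegative phi-integral can be discarded, and it is superadditive over the two
    halves of a cut, so it cannot fail for both halves. *)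
Definition adm r J := [/\ below J, CD K N J, \int[mu]_x (h x * J x) = 0,
  \int[mu]_x (phi x * J x) < 0 & \int[mu]_x (phi x * J x) <= r * len J].

Lemma adm_limit r (u : nat -> R -> R) : r < 0 -> (forall n, adm r (u n)) ->
  (forall n x, u n.+1 x <= u n x) ->
  exists2 J, adm r J & (forall n x, J x <= u n x) /\
    (\int[mu]_x u n x)%R @[n --> \oo] --> (\int[mu]_x J x)%R.
Proof.
move=> r0 au uS.
have bu n : below (u n) by have [] := au n.
have u0 n x : 0 <= u n x by have [_ /(_ x)/andP[]] := bu n.
have uJ0 n x : u n x <= J0 x by have [_ /(_ x)/andP[]] := bu n.
have ud x : nonincreasing_seq (u^~ x) by apply/nonincreasing_seqP => n; exact: uS.
have cu x : cvgn (u^~ x).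
  by apply: nonincreasing_is_cvgn => //; exists 0 => _ [n _ <-].
pose J x := limn (u^~ x).
have uJ x : u n x @[n --> \oo] --> J x by exact: cu.
have Ju n x : J x <= u n x by apply: nonincreasing_cvgn_ge; [exact: ud|exact: cu].
have Jge x : 0 <= J x by apply: limr_ge; [exact: cu|exact: nearW].
have mJ : measurable_fun setT J.
  by apply: (@measurable_fun_cvg _ _ _ setT u) => [n|x _]; [exact: (bu n).1|exact: uJ].
have bJ : below J by split => // x; rewrite Jge (le_trans (Ju 0%N x)).
have C (g : R -> R) : measurable_fun setT g -> (forall x, `|g x| <= M) ->
    (\int[mu]_x (g x * u n x))%R @[n --> \oo] --> (\int[mu]_x (g x * J x))%R.
  move=> mg gM; apply: (@Rint_dct _ _ _ (fun x => M * J0 x)).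
  - by move=> n; apply: measurable_funM => //; exact: (bu n).1.
  - exact: measurable_funM.
  - by apply: (@intg_mul _ (cst M) _ `|M|) => // x.
  - move=> n x; rewrite normrM ler_pM// ger0_norm//.
  - by apply: aeW => x; exact: cvgMr.
have [e [e0 He]] := short_len.
have ue n : e <= len (u n) by have [? ? ? ? ?] := au n; exact: He.
have HJ : \int[mu]_x (h x * J x) = 0.
  have := C h mh hM; have -> : (fun n => \int[mu]_x (h x * u n x)) = cst 0.
    by apply/funext => n; have [] := au n.
  by move=> c0; apply: (cvg_unique _ c0) => //; exact: cvg_cst.
have PJ' r' : (forall n, \int[mu]_x (phi x * u n x) <= r') -> \int[mu]_x (phi x * J x) <= r'.
  move=> le; rewrite -(cvg_lim _ (C phi mphi phiM))//; apply: limr_le.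
    by apply/cvg_ex; eexists; exact: (C phi mphi phiM).
  by apply: nearW.
(* The strict inequality survives the limit because all lengths are at least [e]. *)
have PJ : \int[mu]_x (phi x * J x) < 0.
  apply: le_lt_trans (_ : r * e < 0); last by rewrite nmulr_rlt0.
  apply: PJ' => n; have [_ _ _ _ H] := au n; apply: (le_trans H).
  by rewrite ler_wnM2l// ltW.
exists J; last first.
  split => //; apply: (@Rint_dct _ _ _ J0) => //.
  - by move=> n; exact: (bu n).1.
  - by move=> n x; rewrite ger0_norm.
  - by apply: aeW.
split => //.
  move=> x y t xy Jx Jy t01; apply: limr_ge; first exact: cu.
  apply: nearW => n; have [_ cn _ _ _] := au n.
  have ux := lt_le_trans Jx (Ju n x); have uy := lt_le_trans Jy (Ju n y).
  apply: le_trans (cn x y t xy ux uy t01); apply: gmean_le => //.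
  by apply: inside_range => //; exact: below_inside bJ _ _.
apply: PJ' => n; have [_ _ _ _ H] := au n; apply: (le_trans H).
by rewrite ler_wnM2l ?(ltW r0)//; exact: len_le.
Qed.

(** A greedy sequence replaces Zorn's lemma: each term has a mass within 1 / (n + 1) of the infimum
    over the admissible densities below the previous one, so no admissible density below the limit
    has smaller mass. *)
Lemma adm_minimal r : r < 0 -> adm r J0 -> exists2 J, adm r J &
  forall J', adm r J' -> (forall x, J' x <= J x) -> \int[mu]_x J x <= \int[mu]_x J' x.
Proof.
move=> r0 aJ0.
pose below_adm J J' := adm r J' /\ forall x, J' x <= J x.
have /choice[g Hg] : forall nJ : nat * (R -> R), exists J1 : R -> R, adm r nJ.2 ->
    below_adm nJ.2 J1 /\ forall J', below_adm nJ.2 J' ->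
      \int[mu]_x J1 x <= \int[mu]_x J' x + nJ.1.+1%:R^-1.
  move=> [n J] /=; have [aJ|naJ] := pselect (adm r J); last by exists J.
  pose E := [set (\int[mu]_x J' x)%R | J' in [set J' | below_adm J J']].
  have lE : has_lbound E.
    exists 0 => _ [J' [aJ' _] <-]; apply: Rintegral_ge0 => x _.
    by have [[_ /(_ x)/andP[]]] := aJ'.
  have hE : has_inf E by split => //; exists (\int[mu]_x J x); exists J.
  have n0 : 0 < n.+1%:R^-1 :> R by rewrite invr_gt0.
  have [_ [J1 bJ1 <-] lt1] := inf_adherent n0 hE.
  exists J1 => _; split => // J' bJ'; apply: (le_trans (ltW lt1)).
  by rewrite lerD2r; apply: ge_inf => //; exists J'.
pose u := fix u n := if n is m.+1 then g (m, u m) else J0.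
have au n : adm r (u n) by elim: n => //= n IH; have [[]] := Hg (n, u n) IH.
have uS n x : u n.+1 x <= u n x by have [[_ +] _] := Hg (n, u n) (au n); exact.
have [J aJ [Ju cJ]] := adm_limit r0 au uS.
exists J => // J' aJ' J'J; apply/ler_addgt0Pr => e e0.
have uJ n : \int[mu]_x J x <= \int[mu]_x u n x.
  apply: le_Rintegral => //; [by apply: below_intg; have [] := aJ
    |by apply: below_intg; have [] := au n].
have [n ne] : exists n : nat, n.+1%:R^-1 < e.
  by have [n nP] := ltr_add_invr e0; exists n; rewrite add0r in nP.
apply: (le_trans (uJ n.+1)); have [_ H] := Hg (n, u n) (au n).
apply: (le_trans (H J' _)); last by rewrite lerD2l ltW.
by split => // x; exact: le_trans (Ju n x).
Qed.

Lemma minimal_density : \int[mu]_x (h x * J0 x) = 0 -> \int[mu]_x (phi x * J0 x) < 0 ->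
  exists J A B, [/\ [/\ a0 <= A, A < B, B <= b0 & forall x, 0 < J x <-> A < x < B],
    below J, CD K N J, \int[mu]_x (h x * J x) = 0 &
   (forall P, measurable_fun setT P -> (forall x, 0 <= P x <= J x) -> CD K N P ->
      CD K N (fun x => J x - P x) -> \int[mu]_x (h x * P x) = 0 -> 0 < len P ->
      \int[mu]_x (phi x * P x) < 0) /\
   (forall c, A < c < B ->
      \int[mu]_x (h x * (J x * \1_(`]-oo, c[%classic : set R) x)) <> 0)].
Proof.
move=> HJ0 PJ0; have ba : 0 < b0 - a0 by rewrite subr_gt0.
have ba' : b0 - a0 != 0 by rewrite gt_eqF.
(* With this slope J0 itself is admissible, its length being at most b0 - a0. *)
pose r := \int[mu]_x (phi x * J0 x) / (b0 - a0).
have r0 : r < 0 by rewrite ltr_pdivrMr// mul0r.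
have bJ0 : below J0 by split => // x; rewrite J00 lexx.
have aJ0 : adm r J0.
  split => //; have [_ le] := len_inside bJ0.1 (below_inside bJ0) ab.
  by rewrite -[leLHS](divfK ba') -/r ler_wnM2l// ltW.
have bI J' (I : set R) : below J' -> measurable I -> below (fun x => J' x * \1_I x).
  move=> bJ' mI; apply: (below_cmp bJ').
    by apply: measurable_funM; [exact: bJ'.1|exact: measurable_indic].
  move=> x; have /andP[J1 _] := bJ'.2 x; rewrite indicE.
  by case: (x \in I); rewrite ?mulr1 ?mulr0 ?J1 ?lexx.
have [J1 aJ1 minJ1] := adm_minimal r0 aJ0; have [bJ1 cJ1 HJ1 PJ1 PrJ1] := aJ1.
have [A [B [aA AB Bb JAB suppJ1]]] := support_interval (below_inside bJ1) cJ1 (phi_lt0_len bJ1 PJ1).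
(* Erasing the values at the null points A and B makes the positivity set exactly the open
   interval. *)
pose J x := J1 x * \1_(`]A, B[%classic : set R) x.
have J1ge x : 0 <= J1 x by have [_ /(_ x)/andP[]] := bJ1.
have bJ : below J by apply: bI.
have cJ : CD K N J by apply: CD_restrict => //; exact: interval_is_interval.
have JE x : x != A -> x != B -> J x = J1 x.
  move=> xA xB; rewrite /J indicE mem_setE in_itv/=; case: (boolP (A < x < B)) => [_|nx].
    by rewrite mulr1.
  rewrite mulr0; apply/esym/eqP; rewrite eq_le J1ge andbT leNgt; apply: contra nx => /suppJ1.
  by move=> /andP[Ax xB']; rewrite !lt_neqAle eq_sym xA Ax xB.
have JJ1 x : J x <= J1 x.
  by rewrite /J indicE; case: (_ \in _); rewrite ?mulr1 ?mulr0.
have Jint (g : R -> R) : measurable_fun setT g ->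
    \int[mu]_x (g x * J x) = \int[mu]_x (g x * J1 x).
  move=> mg; apply: (@Rint_ae_eq _ _ _ A B B).
  - by apply: measurable_funM => //; exact: bJ.1.
  - by apply: measurable_funM => //; exact: bJ1.1.
  - by move=> x xA xB _; rewrite JE.
have HJ : \int[mu]_x (h x * J x) = 0 by rewrite Jint.
have PJ : \int[mu]_x (phi x * J x) < 0 by rewrite Jint.
have PrJ : \int[mu]_x (phi x * J x) <= r * len J.
  by rewrite Jint//; apply: (le_trans PrJ1); rewrite ler_wnM2l ?(ltW r0)//; exact: len_le.
have aJ : adm r J by [].
have minJ J' : adm r J' -> (forall x, J' x <= J x) -> \int[mu]_x J x <= \int[mu]_x J' x.
  move=> aJ' J'J; apply: le_trans (minJ1 J' aJ' (fun x => le_trans (J'J x) (JJ1 x))).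
  by apply: le_Rintegral => //; exact: below_intg.
have Jpos x : 0 < J x <-> A < x < B.
  rewrite /J indicE mem_setE in_itv/=; case: (boolP (A < x < B)) => xAB.
    by rewrite mulr1; split => // _; exact: JAB.
  by rewrite mulr0 ltxx.
exists J, A, B; split=> //; split.
  move=> P mP PJb cP cQ HP lP; rewrite ltNge; apply/negP => P0.
  have bP : below P by exact: below_cmp PJb.
  (* If the phi-integral of P were nonnegative, the rest Q would be admissible and of smaller mass
     than J. *)
  pose Q x := J x - P x.
  have QJ x : 0 <= Q x <= J x.
    by have /andP[P1 P2] := PJb x; rewrite /Q subr_ge0 P2 gerBl P1.
  have mQ : measurable_fun setT Q by apply: measurable_funB => //; exact: bJ.1.
  have bQ : below Q by exact: below_cmp QJ.
  have split_int (g : R -> R) : intg (fun x => g x * J x) -> intg (fun x => g x * P x) ->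
      \int[mu]_x (g x * Q x) = \int[mu]_x (g x * J x) - \int[mu]_x (g x * P x).
    move=> ig1 ig2; rewrite -RintegralB//; congr Rintegral.
    by apply/funext => x; rewrite /Q mulrBr.
  have PQ := split_int phi (below_intphi bJ) (below_intphi bP).
  have PQJ : \int[mu]_x (phi x * Q x) <= \int[mu]_x (phi x * J x).
    by rewrite PQ gerBl.
  have aQ : adm r Q.
    split => //.
    - by rewrite (split_int h (below_inth bJ) (below_inth bP)) HJ HP subrr.
    - exact: le_lt_trans PJ.
    - apply: (le_trans PQJ); apply: (le_trans PrJ); rewrite ler_wnM2l ?(ltW r0)//.
      by apply: len_le => // x; have /andP[] := QJ x.
  have := minJ Q aQ (fun x => (andP (QJ x)).2).
  have -> : \int[mu]_x Q x = \int[mu]_x J x - \int[mu]_x P x.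
    by rewrite -RintegralB//; exact: below_intg.
  by apply/negP; rewrite -ltNge gtrBl; exact: mass_gt0.
move=> c cAB HP; have /andP[Ac cB] := cAB.
have [x1 x1c Jx1] : exists2 x, x < c & 0 < J x.
  by exists ((A + c) / 2); [rewrite midf_lt|apply/Jpos; rewrite midf_lt//= (lt_trans _ cB)// midf_lt].
have [x2 cx2 Jx2] : exists2 x, c < x & 0 < J x.
  by exists ((c + B) / 2); [rewrite midf_lt|apply/Jpos; rewrite midf_lt// andbT (lt_trans Ac)// midf_lt].
pose P x := J x * \1_(`]-oo, c[%classic : set R) x.
pose Q x := J x * \1_(`[c, +oo[%classic : set R) x.
have PQE x : J x = P x + Q x.
  rewrite /P /Q !indicE !mem_setE !in_itv/= andbT.
  by case: (ltP x c) => _; rewrite mulr1 mulr0 ?addr0 ?add0r.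
have bP : below P by apply: bI.
have bQ : below Q by apply: bI.
have Jge x : 0 <= J x by have [_ /(_ x)/andP[]] := bJ.
have P0 x : 0 <= P x by have [_ /(_ x)/andP[]] := bP.
have Q0 x : 0 <= Q x by have [_ /(_ x)/andP[]] := bQ.
have cP : CD K N P by apply: CD_restrict => //; exact: interval_is_interval.
have cQ : CD K N Q by apply: CD_restrict => //; exact: interval_is_interval.
have split_int (g : R -> R) : intg (fun x => g x * P x) -> intg (fun x => g x * Q x) ->
    \int[mu]_x (g x * J x) = \int[mu]_x (g x * P x) + \int[mu]_x (g x * Q x).
  move=> ig1 ig2; rewrite -RintegralD//; congr Rintegral.
  by apply/funext => x; rewrite PQE mulrDr.
have HQ : \int[mu]_x (h x * Q x) = 0.
  by have := split_int h (below_inth bP) (below_inth bQ); rewrite HJ HP add0r.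
have ins := below_inside bJ.
have lgt (F : R -> R) u v : below F -> u < v -> (forall x, u < x < v -> 0 < F x) -> 0 < len F.
  move=> bF uv Fp; rewrite -lte_fin lenE//.
  apply: (@lt_le_trans _ _ (mu `]u, v[%classic)).
    by rewrite lebesgue_measure_itv/= lte_fin uv -EFinB lte_fin subr_gt0.
  apply: le_measure; rewrite ?inE//; exact: measurable_gt_set bF.1.
have lP : 0 < len P.
  apply: (lgt P x1 c) => // x /andP[xx1 xc].
  rewrite /P indicE mem_setE in_itv/= xc mulr1.
  by apply: (CD_pos_between ins cJ Jx1 Jx2); rewrite (ltW xx1) ltW// (lt_trans xc).
have lQ : 0 < len Q.
  apply: (lgt Q c x2) => // x /andP[cx xx2].
  rewrite /Q indicE mem_setE in_itv/= (ltW cx) mulr1.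
  by apply: (CD_pos_between ins cJ Jx1 Jx2); rewrite (ltW xx2) ltW// (lt_trans x1c).
have massD : \int[mu]_x J x = \int[mu]_x P x + \int[mu]_x Q x.
  rewrite -RintegralD//; [|exact: below_intg|exact: below_intg].
  by congr Rintegral; apply/funext.
(* Both halves of a balanced cut have less mass than J, so neither is admissible. The two resulting
   strict inequalities add up to a contradiction with the bound for J, since the lengths of the
   halves sum to at most [len J]. *)
have notadm F : below F -> CD K N F -> \int[mu]_x (h x * F x) = 0 -> 0 < len F ->
    (forall x, F x <= J x) -> \int[mu]_x F x < \int[mu]_x J x ->
    r * len F < \int[mu]_x (phi x * F x).
  move=> bF cF HF lF FJ mF; rewrite ltNge; apply/negP => PF.
  have := minJ F; rewrite leNgt mF => H; suff : ~~ true by []; apply: H => //.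
  by split => //; apply: (le_lt_trans PF); rewrite nmulr_rlt0.
have hP := notadm P bP cP HP lP _ _; have hQ := notadm Q bQ cQ HQ lQ _ _.
have : r * len P + r * len Q < \int[mu]_x (phi x * J x).
  rewrite (split_int phi (below_intphi bP) (below_intphi bQ)) ltrD//.
    apply: hP => [x|]; first by rewrite (PQE x) lerDl.
    by rewrite massD ltrDl; exact: mass_gt0.
  apply: hQ => [x|]; first by rewrite (PQE x) lerDr.
  by rewrite massD ltrDr; exact: mass_gt0.
move=> /lt_le_trans/(_ PrJ); rewrite -mulrDr ltr_nM2l// ltNge => /negP; apply.
rewrite -lee_fin EFinD !lenE//.
have mP := measurable_gt_set 0 bP.1; have mQ := measurable_gt_set 0 bQ.1.
rewrite -measureU//.
  apply: le_measure; rewrite ?inE//; [exact: measurableU|exact: measurable_gt_set bJ.1|].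
  move=> x /= [Px|Qx]; rewrite PQE; first by rewrite ltr_wpDr.
  by rewrite ltr_wpDl.
apply/seteqP; split=> // x [/=]; rewrite /P /Q !indicE !mem_setE !in_itv/= andbT.
by case: (ltP x c) => _; rewrite ?mulr0 ltxx.
Qed.

End minimal_density.

(** * Splitting a density by a model *)

Section cutting.
Context {R : realType} (K : R) (N : \bar R).
Hypothesis hN : dimension_range N.
Local Notation mu := (@lebesgue_measure R).
Local Notation intg f := (mu.-integrable setT (EFin \o f)).
Variables (a0 b0 : R).
Hypothesis hl : ((b0 - a0)%:E <= l_delta (delta K N))%E.
Implicit Types J P m : R -> R.

(* [m] is a model density; outside of [D] it stands for [+oo]. *)
Definition cutter (D : R -> bool) m := (forall x, D x -> 0 < m x) /\
  forall x y t, a0 < x < b0 -> a0 < y < b0 -> x < y -> 0 < t < 1 ->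
  let z := (1 - t) * x + t * y in
  (D z -> forall A B, 0 < A -> 0 < B -> (D x -> A <= m x) -> (D y -> B <= m y) ->
     gmean K N t (y - x) A B <= m z) /\
  (D x -> D y -> D z /\ m z <= gmean K N t (y - x) (m x) (m y)).

Definition cut (D : R -> bool) m J x := if D x then Num.min (J x) (m x) else J x.

Lemma cut_le D m J x : cut D m J x <= J x.
Proof. by rewrite /cut; case: ifP => // _; rewrite ge_min lexx. Qed.

Lemma CD_cut D m J : inside a0 b0 J -> CD K N J -> cutter D m -> CD K N (cut D m J).
Proof.
move=> iJ cJ [_ cm] x y t xy Px Py t01.
have Jx := lt_le_trans Px (cut_le D m J x); have Jy := lt_le_trans Py (cut_le D m J y).
have [H _] := cm x y t (iJ _ Jx) (iJ _ Jy) xy t01.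
have dr := inside_range hl (iJ _ Jx) (iJ _ Jy) xy.
have le1 : gmean K N t (y - x) (cut D m J x) (cut D m J y) <= J ((1 - t) * x + t * y).
  apply: le_trans (cJ x y t xy Jx Jy t01).
  by apply: gmean_le => //; exact: cut_le.
rewrite {3}/cut; case: ifP => // Dz; rewrite le_min le1/=.
by apply: H => // Dx; rewrite /cut Dx ge_min lexx orbT.
Qed.

(** The rest is positive only where J > m. There gmean(J - m) + gmean(m) <= gmean(J) <= J z by
    superadditivity, and m z <= gmean(m) because the model attains equality. *)
Lemma CD_cut_rest D m J : inside a0 b0 J -> CD K N J -> cutter D m ->
  CD K N (fun x => J x - cut D m J x).
Proof.
move=> iJ cJ [m0 cm] x y t xy.
have E u : 0 < J u - cut D m J u -> [/\ D u, 0 < m u, cut D m J u = m u & m u < J u].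
  rewrite subr_gt0 /cut; case: ifP => Du; last by rewrite ltxx.
  by rewrite gt_min ltxx/= => mJ; split => //; [exact: m0|rewrite min_r// ltW].
move=> Qx Qy t01; have [Dx mx Ex mJx] := E x Qx; have [Dy my Ey mJy] := E y Qy.
rewrite Ex Ey in Qx Qy *.
have Jx := lt_trans mx mJx; have Jy := lt_trans my mJy.
have dr := inside_range hl (iJ _ Jx) (iJ _ Jy) xy.
have [_ /(_ Dx Dy)[Dz mz]] := cm x y t (iJ _ Jx) (iJ _ Jy) xy t01.
have := gmean_superadd hN t01 dr Qx Qy mx my; rewrite !subrK => H.
rewrite lerBrDr; apply: le_trans (cJ x y t xy Jx Jy t01); apply: le_trans H.
by rewrite lerD2l; apply: le_trans mz; rewrite /cut Dz ge_min lexx orbT.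
Qed.

Lemma measurable_cut D m J : measurable_fun setT D -> measurable_fun setT m ->
  measurable_fun setT J -> measurable_fun setT (cut D m J).
Proof.
by move=> mD mm mJ; apply: measurable_fun_ifT => //; exact: measurable_minr.
Qed.

End cutting.

(** * A one-parameter family of solutions of e'' + dl e = 0 *)

Section affine_levels.
Context {R : realType} (dl A B : R).
Local Notation S := (s_delta dl).

(** The solution with be = 0 vanishes at B, the one with be = 1 at A; those with be in [0, 1] are
    positive on ]A, B[, and the others are not. Being affine in [be], the family is easily
    perturbed. Its powers n - 1 are models. *)
Definition eb (be x : R) := (1 - be) * S (B - x) + be * S (x - A).

Lemma eb_three be x z y : eb be z * S (y - x) = eb be x * S (y - z) + eb be y * S (z - x).
Proof.
rewrite /eb; have H1 := s_delta_three dl x z y B.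
have H2 : S (z - A) * S (y - x) = S (x - A) * S (y - z) + S (y - A) * S (z - x).
  have := s_delta_three dl x z y A; rewrite -![A - _]opprB !s_deltaN !mulNr -!opprD.
  by move/oppr_inj.
by rewrite !mulrDl -!mulrA H1 H2; ring.
Qed.

Lemma eb_conv be x y t : x < y -> ((y - x)%:E < l_delta dl)%E ->
  eb be ((1 - t) * x + t * y) = sg dl (1 - t) (y - x) * eb be x + sg dl t (y - x) * eb be y.
Proof.
move=> xy yl; have d0 : 0 < y - x by rewrite subr_gt0.
have Sd : S (y - x) != 0 by rewrite gt_eqF// s_delta_gt0.
have H := eb_three be x ((1 - t) * x + t * y) y.
have E1 : y - ((1 - t) * x + t * y) = (1 - t) * (y - x) by ring.
have E2 : (1 - t) * x + t * y - x = t * (y - x) by ring.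
rewrite E1 E2 in H; rewrite /sg gt_eqF//; apply: (mulIf Sd); rewrite H.
by move: (eb be x) (eb be y) => u v; field.
Qed.

Lemma continuous_eb be : continuous (eb be).
Proof.
move=> x; apply: cvgD; apply: cvgMr; apply: cvg_s_delta; apply: cvgB; (exact: cvg_cst || exact: cvg_id).
Qed.

Lemma continuous_eb_param x : continuous (fun be => eb be x).
Proof.
move=> be; apply: cvgD; apply: cvgMl; last exact: cvg_id.
by apply: cvgB; [exact: cvg_cst|exact: cvg_id].
Qed.

Lemma ebA be : eb be A = (1 - be) * S (B - A).
Proof. by rewrite /eb subrr s_delta0 mulr0 addr0. Qed.

Lemma ebB be : eb be B = be * S (B - A).
Proof. by rewrite /eb subrr s_delta0 mulr0 add0r. Qed.

Hypothesis AB : A < B.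
Hypothesis hl : ((B - A)%:E <= l_delta dl)%E.

Lemma eb_range x y : A <= x -> y <= B -> x < y -> (A < x \/ y < B) -> 0 < S (y - x).
Proof.
move=> Ax yB xy s; apply: s_delta_gt0; first by rewrite subr_gt0.
by apply: lt_le_trans hl; rewrite lte_fin; case: s => ?; lra.
Qed.

Lemma eb_gt0 be x : 0 <= be <= 1 -> A < x < B -> 0 < eb be x.
Proof.
move=> /andP[b0 b1] /andP[Ax xB].
have S1 : 0 < S (B - x) by apply: eb_range => //; [exact: ltW|left].
have S2 : 0 < S (x - A) by apply: eb_range => //; [exact: ltW|right].
have [->|bn0] := eqVneq be 0; first by rewrite /eb subr0 mul1r mul0r addr0.
rewrite /eb ltr_wpDl//; first by rewrite mulr_ge0 ?subr_ge0// ltW.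
by rewrite mulr_gt0// lt_neqAle eq_sym bn0.
Qed.

Lemma eb_bounded : exists2 C, 0 < C & forall be x, -1 <= be <= 2 -> A <= x <= B ->
  `|eb be x| <= C.
Proof.
have cS : {within `[0, (B - A)], continuous S}.
  exact/continuous_subspaceT/continuous_s_delta.
have BA : 0 <= B - A by rewrite subr_ge0 ltW.
have [u _ Hu] := EVT_max BA cS; have [v _ Hv] := EVT_min BA cS.
pose C := `|S u| + `|S v| + 1.
have HC x : 0 <= x <= B - A -> `|S x| <= C.
  move=> x01; have xi : x \in `[0, (B - A)] by rewrite in_itv.
  rewrite ler_norml; have h1 := Hu x xi; have h2 := Hv x xi.
  have := ler_norm (S u); have := ler_norm (- S v); rewrite normrN /C.
  have := normr_ge0 (S u); have := normr_ge0 (S v).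
  by move=> *; apply/andP; split; lra.
exists (4 * C) => [|be x b12 x12].
  by rewrite /C mulr_gt0// ltr_wpDl// addr_ge0.
have h1 : `|S (B - x)| <= C by apply: HC; lra.
have h2 : `|S (x - A)| <= C by apply: HC; lra.
rewrite /eb (le_trans (ler_normD _ _))// !normrM.
have b1 : `|1 - be| <= 2 by rewrite ler_norml; lra.
have b2 : `|be| <= 2 by rewrite ler_norml; lra.
have -> : 4 * C = 2 * C + 2 * C by ring.
by rewrite lerD// ler_pM.
Qed.

End affine_levels.

(** * Parametric integrals and lower bounds by truncation *)

Section ae_tools.
Context {R : realType}.
Local Notation mu := (@lebesgue_measure R).
Local Notation intg f := (mu.-integrable setT (EFin \o f)).
Implicit Types (f g J rho : R -> R).

Lemma continuous_Rint (F : R -> R -> R) (G : R -> R) :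
  (forall l, measurable_fun setT (F l)) -> (forall l x, `|F l x| <= G x) -> intg G ->
  (forall x, continuous (F^~ x)) -> continuous (fun l => \int[mu]_x F l x).
Proof.
move=> mF FG iG cF l.
have := @continuity_under_integral _ _ _ mu F setT measurableT (l - 1) (l + 1).
move=> /(_ _ _ G iG); apply => //.
- by move=> u _; exact: intg_dom (FG u) iG.
- by apply: aeW => x _ u _; exact: cF.
- by move=> u _; apply: aeW => x _; exact: FG.
- by rewrite inE/= in_itv/= gtrBl ltrDl ltr01.
Qed.

(* Fatou, by truncation and dominated convergence. *)
Lemma Rint_liminf (f_ : nat -> R -> R) (g : R -> R) (W : R) :
  (forall n, measurable_fun setT (f_ n)) -> measurable_fun setT g ->
  (forall n x, 0 <= f_ n x) -> (forall x, 0 <= g x) ->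
  (forall n, intg (f_ n)) -> intg g ->
  {ae mu, forall x, Num.min (f_ n x) (g x) @[n --> \oo] --> g x} ->
  W < \int[mu]_x g x -> \forall n \near \oo, W <= \int[mu]_x f_ n x.
Proof.
move=> mf mg f0 g0 fi gi cv Wg.
have mm n : measurable_fun setT (fun x => Num.min (f_ n x) (g x)) by exact: measurable_minr.
have b n x : `|Num.min (f_ n x) (g x)| <= g x.
  by rewrite ger0_norm ?le_min ?f0 ?g0// ge_min lexx orbT.
have := @Rint_dct _ _ g g mm mg gi b cv => /cvgr_gt/(_ _ Wg).
apply: filterS => n /ltW/le_trans; apply.
apply: le_Rintegral => //; first exact: intg_dom (mm n) (b n) gi.
by move=> x _; rewrite ge_min lexx.
Qed.

Lemma Rint_itv (c u v : R) : u < v ->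
  intg (fun x => c * \1_(`]u, v[%classic : set R) x) /\
  \int[mu]_x (c * \1_(`]u, v[%classic : set R) x) = c * (v - u).
Proof.
move=> uv.
have mI : measurable (`]u, v[%classic : set R) by exact: measurable_itv.
have muI : mu (`]u, v[%classic : set R) = (v - u)%:E.
  by rewrite lebesgue_measure_itv/= lte_fin uv EFinB.
have iI : intg (\1_(`]u, v[%classic : set R) : R -> R).
  by apply: intg_indic => //; rewrite muI ltry.
split; first by apply: (@intg_mul _ (cst c) _ `|c|).
rewrite RintegralZl//; congr (_ * _).
rewrite /Rintegral integral_indic// setIT; exact: (congr1 fine muI).
Qed.

Lemma Rint_unbounded (f_ : nat -> R -> R) (u v W : R) : u < v ->
  (forall n, measurable_fun setT (f_ n)) -> (forall n x, 0 <= f_ n x) ->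
  (forall n, intg (f_ n)) ->
  (forall x, u < x < v -> f_ n x @[n --> \oo] --> +oo) ->
  \forall n \near \oo, W <= \int[mu]_x f_ n x.
Proof.
move=> uv mf f0 fi finf.
(* The rectangle of height T over ]u, v[ has area |W| + 1, which exceeds W. *)
pose T := (`|W| + 1) / (v - u).
have T0 : 0 < T by rewrite divr_gt0 ?subr_gt0// ltr_wpDl.
have [iT IT] := Rint_itv T uv.
apply: (@Rint_liminf _ (fun x => T * \1_(`]u, v[%classic : set R) x)) => //.
- apply: measurable_funM; first exact: measurable_cst.
  by apply: measurable_indic; exact: measurable_itv.
- by move=> x; rewrite mulr_ge0// ltW.
- apply: aeW => x; apply: cvg_trans (near_eq_cvg _) (cvg_cst _).
  have [xI|xI] := boolP (x \in (`]u, v[%classic : set R)); last first.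
    by apply: nearW => n; rewrite indicE (negbTE xI) !mulr0 min_r.
  have xI' : u < x < v by move: xI; rewrite inE/= in_itv.
  have /cvgryPge/(_ T) := finf x xI'; apply: filterS => n nT.
  by rewrite indicE xI mulr1 min_r.
- rewrite IT /T -mulrA mulVf ?mulr1 ?subr_eq0 ?gt_eqF//.
  by rewrite (le_lt_trans (ler_norm W))// ltrDl.
Qed.

(* A multiple [2 ^ i / (2 a)] on each of the intervals [|x - q| < a / 2 ^ i]
   stays below [1 / |x - q|], and each of them contributes [1 / 2]. *)
Lemma inv_dist_unbounded (u v q W : R) : u < v -> q = u \/ q = v ->
  exists g : R -> R, [/\ measurable_fun setT g /\ (forall x, 0 <= g x), intg g,
    forall x, 0 < g x -> u < x < v /\ g x <= `|x - q|^-1 & W < \int[mu]_x g x].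
Proof.
move=> uv qE; pose a := v - u; have a0 : 0 < a by rewrite subr_gt0.
pose lo i := if q == u then u else v - a / 2 ^+ i.
pose hi i := if q == u then u + a / 2 ^+ i else v.
have p2 i : 0 < 2 ^+ i :> R by rewrite exprn_gt0.
have ai i : 0 < a / 2 ^+ i by rewrite divr_gt0.
have aia i : a / 2 ^+ i <= a by rewrite ler_pdivrMr// ler_peMr ?(ltW a0)// exprn_ege1// ler1n.
have len i : hi i - lo i = a / 2 ^+ i by rewrite /hi /lo; case: ifP => _; ring.
have lohi i : lo i < hi i by rewrite -subr_gt0 len.
have sub i x : lo i < x < hi i -> u < x < v /\ `|x - q| < a / 2 ^+ i.
  have := aia i; rewrite /lo /hi /a; case: eqP => [->|qu]; last first.
    have -> : q = v by case: qE.
    by move=> h1 /andP[h2 h3]; rewrite ltr_norml; lra.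
  by move=> h1 /andP[h2 h3]; rewrite ltr_norml; lra.
pose st i (x : R) := 2 ^+ i / (2 * a) * \1_(`]lo i, hi i[%classic : set R) x.
pose g k (x : R) := \sum_(i < k) st i x.
have st0 i x : 0 <= st i x by rewrite /st mulr_ge0// divr_ge0 ?ltW// mulr_gt0.
have g0 k x : 0 <= g k x by apply: sumr_ge0 => i _.
have mst i : measurable_fun setT (st i).
  apply: measurable_funM; first exact: measurable_cst.
  by apply: measurable_indic; exact: measurable_itv.
have mg k : measurable_fun setT (g k) by apply: measurable_sum => i; exact: mst.
have ist i : intg (st i) by exact: (Rint_itv _ (lohi i)).1.
have gS k : g k.+1 = (fun x => g k x + st k x).
  by apply/funext => x; rewrite /g big_ord_recr.
have ig k : intg (g k) /\ \int[mu]_x g k x = k%:R / 2.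
  elim: k => [|k [IH1 IH2]].
    have -> : g 0%N = cst 0 by apply/funext => x; rewrite /g big_ord0.
    split; last by rewrite Rintegral_cst//= !mul0r.
    exact: integrable0.
  rewrite gS; split; first exact: (integrableD measurableT IH1 (ist k)).
  rewrite RintegralD// IH2 (Rint_itv _ (lohi k)).2 len -natr1.
  by have := p2 k; move: (2 ^+ k) => z z0; field; rewrite !gt_eqF.
have gb k x : g k x <= 2 ^+ k / (2 * a) /\ (0 < g k x -> u < x < v /\ g k x <= `|x - q|^-1).
  elim: k => [|k [IH1 IH2]].
    by rewrite /g big_ord0 ltxx; split => //; rewrite divr_ge0 ?mulr_ge0 ?ltW.
  have E2 : 2 ^+ k.+1 / (2 * a) = 2 ^+ k / (2 * a) + 2 ^+ k / (2 * a).
    by rewrite exprS; have := a0; move: (2 ^+ k) => z za; field; rewrite gt_eqF.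
  have k0 : 0 <= 2 ^+ k / (2 * a) by rewrite divr_ge0 ?mulr_ge0 ?ltW.
  rewrite gS /st indicE mem_setE in_itv/=; case: (boolP (lo k < x < hi k)) => xk; last first.
    rewrite mulr0 addr0; split => //; rewrite E2; apply: (le_trans IH1); by rewrite lerDl.
  rewrite mulr1 E2; split; first by rewrite lerD2r.
  move=> _; have [xuv xq] := sub _ _ xk; split => //.
  have xq0 : 0 < `|x - q|.
    rewrite normr_gt0 subr_eq0; apply/eqP => xE; move: xuv; rewrite xE.
    by case: qE => ->; rewrite ltxx ?andbF.
  apply: (@le_trans _ _ (2 ^+ k / a)).
    have -> : 2 ^+ k / a = 2 ^+ k / (2 * a) + 2 ^+ k / (2 * a).
      by have := a0; move: (2 ^+ k) => z za; field; rewrite gt_eqF.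
    by rewrite lerD2r.
  rewrite -[leLHS]invrK lef_pV2 ?posrE ?invr_gt0 ?divr_gt0// invf_div.
  exact: ltW.
have [k kW] : exists k : nat, W < k%:R / 2.
  exists (Num.truncn (`|2 * W|)).+1; rewrite ltr_pdivlMr// mulrC.
  by rewrite (le_lt_trans (ler_norm _))// truncnS_gt.
exists (g k); split => //; [exact: (ig k).1|by move=> x; exact: (gb k x).2|by rewrite (ig k).2].
Qed.

End ae_tools.

(** * Monotone weights against a signed density *)

Section signed_density.
Context {R : realType}.
Local Notation mu := (@lebesgue_measure R).
Local Notation intg f := (mu.-integrable setT (EFin \o f)).
Variables (h J : R -> R) (M A B : R).
Hypothesis (mh : measurable_fun setT h) (hM : forall x, `|h x| <= M).
Hypothesis (mJ : measurable_fun setT J) (iJ : intg J) (J0 : forall x, 0 <= J x).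
Hypothesis (AB : A < B) (Jsupp : forall x, 0 < J x -> A <= x <= B).
Hypothesis HJ : \int[mu]_x (h x * J x) = 0.
Hypothesis Hc : forall c, A < c < B ->
  0 < \int[mu]_x (h x * (J x * \1_(`]-oo, c[%classic : set R) x)).
Implicit Types (rho : R -> R).

Let mI c : measurable_fun setT (\1_(`]-oo, c[%classic : set R) : R -> R).
Proof. exact: measurable_indic. Qed.

Lemma out_support x : ~~ (A <= x <= B) -> J x = 0.
Proof.
by move=> nAB; apply/eqP; rewrite eq_le J0 andbT leNgt; apply: contra nAB => /Jsupp.
Qed.

Lemma head_ge0 c : 0 <= \int[mu]_x (h x * (J x * \1_(`]-oo, c[%classic : set R) x)).
Proof.
have [cA|Ac] := leP c A.
  rewrite (_ : (fun x => _) = cst 0) ?Rintegral_cst//= ?mul0r//.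
  apply/funext => x; rewrite indicE mem_setE in_itv/=; case: ltP => xc; last by rewrite !mulr0.
  by rewrite out_support ?mul0r ?mulr0// negb_and -ltNge (lt_le_trans xc).
have [cB|Bc] := ltP c B; first by rewrite ltW// Hc// Ac.
rewrite (@Rint_ae_eq _ _ (fun x => h x * J x) B B B) ?HJ//.
- by apply: measurable_funM => //; exact: measurable_funM.
- exact: measurable_funM.
- move=> x xB _ _; rewrite indicE mem_setE in_itv/=; case: ltP => xc; first by rewrite mulr1.
  rewrite out_support ?mul0r//.
  rewrite negb_and -!ltNge; apply/orP; right; rewrite lt_neqAle eq_sym xB.
  exact: le_trans Bc xc.
Qed.

(** Inside ]A, B[ a superlevel set of a nonincreasing function is, up to one point, the part to the
    left of its supremum [c]; so the integral is one of the initial integrals of [head_ge0]. *)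
Lemma level_ge0 rho th : measurable_fun setT rho ->
  (forall x y, A < x -> x <= y -> y < B -> rho y <= rho x) ->
  0 <= \int[mu]_x (h x * (J x * \1_([set x | th < rho x]) x)).
Proof.
move=> mr dr; pose U := [set x | th < rho x /\ A < x < B].
have mU : measurable_fun setT (\1_([set x | th < rho x]) : R -> R).
  by apply: measurable_indic; exact: measurable_gt_set.
have [U0|/set0P U0] := eqVneq U set0.
  rewrite (@Rint_ae_eq _ _ (cst 0) A B B) ?Rintegral_cst//= ?mul0r//.
    by apply: measurable_funM => //; exact: measurable_funM.
  move=> x xA xB _; rewrite indic_pred.
  have [xr|xr] := ltP th (rho x); last by rewrite !mulr0.
  rewrite out_support ?mul0r ?mulr0//; apply/negP => /andP[Ax xB'].
  have : U x by split => //; rewrite !lt_neqAle eq_sym xA Ax xB xB'.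
  by rewrite U0.
pose c := sup U.
have uU : has_ubound U by exists B => x [_ /andP[_ /ltW]].
have hU : has_sup U by split.
rewrite (@Rint_ae_eq _ _ (fun x => h x * (J x * \1_(`]-oo, c[%classic : set R) x)) A B c).
- exact: head_ge0.
- by apply: measurable_funM => //; exact: measurable_funM.
- by apply: measurable_funM => //; exact: measurable_funM.
move=> x xA xB xc; have [/andP[Ax xB']|nAB] := boolP (A <= x <= B); last first.
  by rewrite out_support// !mul0r.
have {Ax}Ax : A < x by rewrite lt_neqAle eq_sym xA.
have {xB'}xB' : x < B by rewrite lt_neqAle xB.
congr (_ * (_ * _)); rewrite indic_pred indicE mem_setE in_itv/=; congr (_%:R); congr nat_of_bool.
have [xr|xr] := ltP th (rho x).
  apply/esym; rewrite lt_neqAle xc ub_le_sup//; split => //; by rewrite Ax.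
apply/esym/negbTE; rewrite -leNgt; apply: ge_sup => // y [yr /andP[Ay yB]].
rewrite leNgt; apply/negP => xy; have := dr x y Ax (ltW xy) yB.
by move=> /(lt_le_trans yr)/lt_le_trans/(_ xr); rewrite ltxx.
Qed.

(** For y >= 0 this is the ceiling of y capped at n, written as a sum of indicators. Thus count (m
    rho) / m approximates rho within 1 / m by an average of indicators of level sets. *)
Let count (n : nat) (y : R) : R := \sum_(i < n) (i%:R < y)%R%:R.

Let count_bounds n y : 0 <= y -> [/\ Num.min y n%:R <= count n y, count n y <= n%:R &
  count n y <= y + 1].
Proof.
move=> y0; elim: n => [|n [I1 I2 I3]].
  by rewrite /count big_ord0; split => //; [rewrite ge_min lexx orbT|rewrite addr_ge0].
rewrite /count big_ord_recr/= -/(count n y).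
have [ny|yn] := ltP n%:R y.
  rewrite min_r in I1; last exact: ltW.
  rewrite -natr1; split; rewrite ?lerD2r//; first by rewrite ge_min lerD2r I1 orbT.
  by rewrite (le_trans I2) ?ltW.
rewrite addr0 -natr1; split => //.
  rewrite min_l in I1; last by [].
  by rewrite ge_min I1.
by rewrite (le_trans I2)// lerDl.
Qed.

(* Layer-cake: a monotone weight is a mixture of indicators of initial
   intervals. *)
Lemma nonincreasing_ge0 rho : measurable_fun setT rho -> (forall x, 0 <= rho x <= 1) ->
  (forall x y, A < x -> x <= y -> y < B -> rho y <= rho x) ->
  0 <= \int[mu]_x (h x * (J x * rho x)).
Proof.
move=> mr r01 dr.
have ihJ : intg (fun x => h x * J x) by exact: intg_mul hM iJ.
have mcr (m : nat) : measurable_fun setT (fun x => m%:R * rho x).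
  by apply: measurable_funM => //; exact: measurable_cst.
have mL (n m : nat) : measurable_fun setT (\1_([set x | n%:R < m%:R * rho x]) : R -> R).
  by apply: measurable_indic; exact: measurable_gt_set.
have mc n m : measurable_fun setT (fun x => count n (m%:R * rho x)).
  rewrite /count; apply: measurable_sum => i.
  have -> : (fun x => (i%:R < m%:R * rho x)%R%:R) = \1_([set x | i%:R < m%:R * rho x]) :> (R -> R).
    by apply/funext => x; rewrite indic_pred.
  exact: mL.
have y0 (m : nat) x : 0 <= m%:R * rho x by rewrite mulr_ge0//; case/andP: (r01 x).
have int k m : intg (fun x => h x * (J x * count k (m%:R * rho x))).
  have := @intg_mul _ (fun x => count k (m%:R * rho x)) _ k%:R (mc k m) _ ihJ.
  have -> : (fun x => count k (m%:R * rho x) * (h x * J x)) =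
     (fun x => h x * (J x * count k (m%:R * rho x))) by apply/funext => x; ring.
  apply=> x; have [_ h2 _] := count_bounds k (y0 m x).
  by rewrite ger0_norm// sumr_ge0.
have pos n m : 0 <= \int[mu]_x (h x * (J x * count n (m%:R * rho x))).
  elim: n => [|n IH].
    rewrite (_ : (fun x => _) = cst 0) ?Rintegral_cst//= ?mul0r//.
    by apply/funext => x; rewrite /count big_ord0 !mulr0.
  have E : (fun x => h x * (J x * count n.+1 (m%:R * rho x))) =
      (fun x => h x * (J x * count n (m%:R * rho x)) +
         h x * (J x * \1_([set x | n%:R < m%:R * rho x]) x)).
    by apply/funext => x; rewrite /count big_ord_recr/= indic_pred; ring.
  have iL : intg (fun x => h x * (J x * \1_([set x | n%:R < m%:R * rho x]) x)).
    have := @intg_mul _ _ _ 1 (mL n m) _ ihJ.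
    have -> : (fun x => \1_([set x | n%:R < m%:R * rho x]) x * (h x * J x)) =
       (fun x => h x * (J x * \1_([set x | n%:R < m%:R * rho x]) x)) by apply/funext => x; ring.
    by apply=> x; rewrite indicE; case: (_ \in _); rewrite ?normr1 ?normr0.
  rewrite E RintegralD// addr_ge0//.
  apply: level_ge0; first exact: mcr.
  by move=> x y Ax xy yB; rewrite ler_wpM2l// dr.
have cv : (\int[mu]_x (n.+1%:R^-1 * (h x * (J x * count n.+1 (n.+1%:R * rho x)))))%R
    @[n --> \oo] --> \int[mu]_x (h x * (J x * rho x)).
  have cb n x : count n.+1 (n.+1%:R * rho x) <= n.+1%:R /\ 0 <= count n.+1 (n.+1%:R * rho x).
    by have [_ h2 _] := count_bounds n.+1 (y0 n.+1 x); split=> //; rewrite sumr_ge0.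
  apply: (@Rint_dct _ _ _ (fun x => M * J x)).
  - move=> n; apply: measurable_funM; first exact: measurable_cst.
    by apply: measurable_funM => //; exact: measurable_funM.
  - by apply: measurable_funM => //; exact: measurable_funM.
  - by apply: (@intg_mul _ (cst M) _ `|M|).
  - move=> n x; have [h1 h2] := cb n x.
    have -> : n.+1%:R^-1 * (h x * (J x * count n.+1 (n.+1%:R * rho x))) =
       h x * (J x * (count n.+1 (n.+1%:R * rho x) / n.+1%:R)) by ring.
    rewrite normrM ler_pM// normrM ger0_norm// ger0_norm ?divr_ge0//.
    by rewrite ler_piMr// ler_pdivrMr// mul1r.
  - apply: aeW => x.
    have cx : count n.+1 (n.+1%:R * rho x) / n.+1%:R @[n --> \oo] --> rho x.
      apply: (@squeeze_cvgr _ _ _ _ (fun=> rho x) (fun n => rho x + n.+1%:R^-1)).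
      + apply: nearW => n; have [h1 _ h3] := count_bounds n.+1 (y0 n.+1 x).
        rewrite min_l in h1; last by rewrite ler_piMr//; case/andP: (r01 x).
        apply/andP; split; first by rewrite ler_pdivlMr// mulrC.
        by rewrite ler_pdivrMr// mulrDl mulVf// [rho x * _]mulrC.
      + exact: cvg_cst.
      + by rewrite -[X in _ --> X]addr0; apply: cvgD; [exact: cvg_cst|exact: cvg_harmonic].
    have -> : (fun n => n.+1%:R^-1 * (h x * (J x * count n.+1 (n.+1%:R * rho x)))) =
       (fun n => h x * (J x * (count n.+1 (n.+1%:R * rho x) / n.+1%:R))).
      by apply/funext => n; ring.
    by apply: cvgMr; exact: cvgMr.
rewrite -(cvg_lim _ cv)//; apply: limr_ge; first by apply/cvg_ex; eexists; exact: cv.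
by apply: nearW => n; rewrite RintegralZl// mulr_ge0// invr_ge0.
Qed.

(** The weight 1 - rho is nonincreasing, and the full integral of h J is 0. *)
Lemma nondecreasing_le0 rho : measurable_fun setT rho -> (forall x, 0 <= rho x <= 1) ->
  (forall x y, A < x -> x <= y -> y < B -> rho x <= rho y) ->
  \int[mu]_x (h x * (J x * rho x)) <= 0.
Proof.
move=> mr r01 dr.
have := @nonincreasing_ge0 (fun x => 1 - rho x) _ _ _.
have ihJ : intg (fun x => h x * J x) by exact: intg_mul hM iJ.
have ihJr : intg (fun x => h x * (J x * rho x)).
  have := @intg_mul _ rho _ 1 mr _ ihJ.
  have -> : (fun x => rho x * (h x * J x)) = (fun x => h x * (J x * rho x)).
    by apply/funext => x; ring.
  by apply=> x; have /andP[? ?] := r01 x; rewrite ger0_norm.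
have -> : (fun x => h x * (J x * (1 - rho x))) = (fun x => h x * J x - h x * (J x * rho x)).
  by apply/funext => x; ring.
rewrite RintegralB// HJ sub0r oppr_ge0; apply.
- by apply: measurable_funB => //; exact: measurable_cst.
- by move=> x; have /andP[? ?] := r01 x; lra.
- by move=> x y Ax xy yB; rewrite lerD2l lerN2; exact: dr.
Qed.

End signed_density.

(** * Limits of exponentials and of subsequences *)

Section limits.
Context {R : realType}.

Lemma cvg_expRN (y : nat -> R) : y n @[n --> \oo] --> +oo -> expR (- y n) @[n --> \oo] --> (0 : R).
Proof.
move=> yn; apply/cvgrPdist_lt => e e0; near=> n.
rewrite sub0r normrN ger0_norm ?expR_ge0// expRN.
have ye : e^-1 <= y n by near: n; move/cvgryPge: yn; apply.
rewrite -[ltRHS]invrK ltf_pV2 ?posrE ?expR_gt0 ?invr_gt0//.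
by apply: (le_lt_trans ye); apply: lt_le_trans (expR_ge1Dx _); rewrite ltrDr.
Unshelve. all: by end_near.
Qed.

Lemma cvg_scaled_pinfty (s : nat -> nat) (e : nat -> R) l : (forall n, (n <= s n)%N) ->
  e n @[n --> \oo] --> l -> 0 < l -> (s n).+1%:R * e n @[n --> \oo] --> +oo.
Proof.
move=> sn el l0; apply/cvgryPge => T; near=> n.
have l2 : 0 < l / 2 by rewrite divr_gt0.
have en : l / 2 <= e n.
  by apply: ltW; near: n; apply: (cvgr_gt _ el); lra.
have nT : `|T| / (l / 2) <= n%:R by near: n; exact: nbhs_infty_ger.
apply: (le_trans (ler_norm T)); rewrite ler_pdivrMr// in nT; apply: (le_trans nT).
apply: ler_pM => //; first exact: ltW.
by rewrite ler_nat ltnW// ltnS.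
Unshelve. all: by end_near.
Qed.

Lemma cvg_harmonic_subseq (s : nat -> nat) : (forall n, (n <= s n)%N) ->
  ((s n).+1%:R^-1 : R) @[n --> \oo] --> (0 : R).
Proof.
move=> sn; apply: (@squeeze_cvgr _ _ _ _ (fun=> 0) (fun n => n.+1%:R^-1)).
- apply: nearW => n; rewrite invr_ge0 ler0n/= lef_pV2 ?posrE ?ltr0n//.
  by rewrite ler_nat ltnS.
- exact: cvg_cst.
- exact: cvg_harmonic.
Qed.

(** The line is compactified by u / (1 + |u|): a limit point 1 or -1 gives divergence, and any other
    one bounds the subsequence, from which a convergent one is extracted. *)
Lemma subseq_trichotomy (u : nat -> R) : exists t : nat -> nat, {homo t : m n / (m < n)%N} /\
  [\/ exists l : R, u (t n) @[n --> \oo] --> l, u (t n) @[n --> \oo] --> +oo |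
      u (t n) @[n --> \oo] --> -oo].
Proof.
pose w n := u n / (1 + `|u n|).
have p n : 0 < 1 + `|u n| by rewrite ltr_wpDr.
have w11 n : -1 <= w n <= 1.
  rewrite ler_pdivlMr// ler_pdivrMr// mulN1r mul1r -ler_norml.
  by rewrite lerDr.
have [l [t [l11 tinc tcv]]] := bolzano_weierstrass w11.
have big (sgn : R) (v : nat -> R) : (forall n, v n = sgn * u (t n)) -> `|sgn| = 1 ->
    sgn * w (t n) @[n --> \oo] --> (1 : R) -> v n @[n --> \oo] --> +oo.
  move=> vE s1 cv; apply/cvgryPge => T; near=> n.
  have h : `|T| / (1 + `|T|) < sgn * w (t n).
    near: n; apply: (cvgr_gt _ cv); rewrite ltr_pdivrMr ?ltr_wpDr// mul1r; lra.
  move: h; rewrite /w mulrA -vE ltr_pdivrMr ?ltr_wpDr// => h.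
  have nv : `|v n| = `|u (t n)| by rewrite vE normrM s1 mul1r.
  rewrite -nv mulrAC ltr_pdivlMr// in h.
  have [v0|v0] := leP 0 (v n).
    rewrite (ger0_norm v0) in h; move: h (ler_norm T).
    by move: `|T| => a h1 h2; nra.
  have : 0 <= `|T| * (1 + `|v n|) by rewrite mulr_ge0// addr_ge0.
  have : v n * (1 + `|T|) < 0 by rewrite nmulr_rlt0// ltr_wpDr.
  lra.
have [l1|l1] := eqVneq l 1.
  exists t; split => //; apply: Or32.
  apply: (big 1); [by move=> n; rewrite mul1r|by rewrite normr1|].
  by under eq_fun do rewrite mul1r; rewrite -l1.
have [l2|l2] := eqVneq l (-1).
  exists t; split => //; apply: Or33.
  have : - u (t n) @[n --> \oo] --> +oo.
    apply: (big (-1)); [by move=> n; rewrite mulN1r|by rewrite normrN1|].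
    under eq_fun do rewrite mulN1r.
    by rewrite -[1]opprK -l2; exact: cvgN.
  move=> /cvgryPge H; apply/cvgrNyPle => T; apply: filterS (H (- T)) => n.
  by rewrite lerN2.
have ln : `|l| < 1 by rewrite ltr_norml lt_neqAle eq_sym l2 lt_neqAle l1; case/andP: l11 => -> ->.
pose c := (1 + `|l|) / 2.
have [n0 _ Hn0] : \forall n \near \oo, `|w (t n)| <= c.
  have lc : 0 < (1 - `|l|) / 2 by lra.
  have /cvgrPdist_lt/(_ _ lc) H := tcv.
  near=> n; have : `|l - w (t n)| < (1 - `|l|) / 2 by near: n; exact: H.
  have := ler_normB l (l - w (t n)); rewrite opprB addrCA subrr addr0.
  rewrite /c; move: `|_ - _| => z; lra.
have ub n : - (c / (1 - c)) <= u (t (n + n0)%N) <= c / (1 - c).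
  have := Hn0 (n + n0)%N (leq_addl _ _); rewrite /= /w normrM normfV (ger0_norm (ltW (p _))).
  rewrite ler_pdivrMr// -ler_norml => h.
  have c1 : 0 < 1 - c by rewrite /c; lra.
  rewrite ler_pdivlMr//; move: h; move: `|u (t (n + n0)%N)| => a; lra.
have [l' [t' [_ t'inc t'cv]]] := bolzano_weierstrass ub.
exists (fun n => t (t' n + n0)%N); split; last by apply: Or31; exists l'.
by move=> m n mn; apply: tinc; rewrite ltn_add2r; exact: t'inc.
Unshelve. all: by end_near.
Qed.

Lemma s_delta_lip (dl Y : R) : 0 <= Y ->
  exists2 L, 0 < L & forall y, 0 <= y <= Y -> s_delta dl y <= L * y.
Proof.
move=> Y0; have cC : {within `[0, Y], continuous (c_delta dl)}.
  exact/continuous_subspaceT/continuous_c_delta.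
have [c _ Hc] := EVT_max Y0 cC.
pose L := `|c_delta dl c| + 1; exists L; first by rewrite ltr_wpDl.
move=> y /andP[y0 yY].
have dS (x : R) : is_derive x 1 (fun z => L * z - s_delta dl z) (L * 1 - c_delta dl x).
  have d1 := is_derive_s_delta dl x.
  have d2 : is_derive x 1 (fun z : R => L * z) (L * 1).
    by have := @is_deriveZ _ _ _ (@id R) L x 1 1 (is_derive_id _ _).
  exact: is_deriveB.
have := @is_derive_ge0_le _ (fun z => L * z - s_delta dl z) (fun x => L * 1 - c_delta dl x) 0 y.
rewrite mulr0 s_delta0 subr0 subr_ge0; apply => // x /andP[x0 xy].
rewrite mulr1 subr_ge0; apply: (@le_trans _ _ (c_delta dl c)); last first.
  by rewrite (le_trans (ler_norm _))// lerDl.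
by apply: Hc; rewrite in_itv/= (ltW x0) (le_trans (ltW xy)).
Qed.

End limits.


Lemma scaled_ratio_le {R : realFieldType} (c ax ay jx jy : R) : 0 < c -> 0 < jx -> 0 < jy ->
  jx * ay <= jy * ax -> c * ay / jy <= c * ax / jx.
Proof.
move=> c0 jx0 jy0 le; rewrite ler_pdivrMr// mulrAC ler_pdivlMr// -!mulrA ler_pM2l//.
by rewrite mulrC [leRHS]mulrC.
Qed.

Lemma continuous_root {R : realType} (F : R -> R) (a b : R) : continuous F -> a <= b ->
  (F a <= 0 <= F b) || (F b <= 0 <= F a) -> exists c, a <= c <= b /\ F c = 0.
Proof.
move=> cF ab; move: (erefl (F a)) (erefl (F b)).
move: {1 3}(F a) {1 3}(F b) => u v uE vE H.
have [|c cI c0] := @IVT _ F a b 0 ab (continuous_subspaceT cF).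
  rewrite -uE -vE ge_min le_max.
  by case/orP: H => /andP[h1 h2]; rewrite !uE !vE in h1 h2 *; rewrite ?h1 ?h2 ?orbT.
by exists c; split => //; move: cI; rewrite in_itv.
Qed.

(** These are the two regions for the concentration argument at an end q: a compact interval
    avoiding q, on which the rescaled pieces stay bounded, and an open interval ending at q, on
    which their mass grows. *)
Lemma end_neighborhood {R : realFieldType} (A B q e : R) : A < B -> q = A \/ q = B -> 0 < e ->
  (exists u v, [/\ [/\ A <= u, u <= v & v <= B],
    forall x, A < x < B -> e <= `|x - q| -> u <= x <= v & forall x, u <= x <= v -> x != q]) /\
  exists u v, [/\ u < v, q = u \/ q = v & forall x, u < x < v -> A < x < B /\ `|x - q| < e].
Proof.
move=> AB qE e0.
have [d [d0 dBA de]] : exists d, [/\ 0 < d, d <= B - A & d <= e].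
  by exists (Num.min e (B - A)); split; rewrite ?lt_min ?e0 ?subr_gt0// ge_min lexx ?orbT.
split.
  case: qE => ->.
    exists (A + d), B; split; [by split; lra| |by move=> x ux; rewrite gt_eqF//; lra].
    move=> x /andP[Ax xB] xe; apply/andP; split; last exact: ltW.
    by move: xe; rewrite ger0_norm; lra.
  exists A, (B - d); split; [by split; lra| |by move=> x ux; rewrite lt_eqF//; lra].
  move=> x /andP[Ax xB] xe; apply/andP; split; first exact: ltW.
  by move: xe; rewrite ler0_norm; lra.
case: qE => ->.
  by exists A, (A + d); split; [lra|left|move=> x xi; rewrite ltr_norml; split; lra].
by exists (B - d), B; split; [lra|right|move=> x xi; rewrite ltr_norml; split; lra].
Qed.

(** * From a minimal density to a model *)

Section endgame.
Context {R : realType} (K : R) (N : \bar R).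
Hypothesis hN : dimension_range N.
Local Notation mu := (@lebesgue_measure R).
Local Notation intg f := (mu.-integrable setT (EFin \o f)).
Local Notation dl := (delta K N).
Variables (h phi J : R -> R) (M A B : R).
Hypothesis (ch : continuous h) (cphi : continuous phi).
Hypothesis (hM : forall x, `|h x| <= M) (phiM : forall x, `|phi x| <= M).
Hypothesis (hphi : forall x, h x = 0 -> 0 < phi x).
Hypothesis (AB : A < B) (hl : ((B - A)%:E <= l_delta dl)%E).
Hypothesis (mJ : measurable_fun setT J) (iJ : intg J) (J0 : forall x, 0 <= J x).
Hypothesis (cJ : CD K N J) (Jpos : forall x, 0 < J x <-> A < x < B).
Hypothesis HJ : \int[mu]_x (h x * J x) = 0.
Hypothesis Hc : forall c, A < c < B ->
  0 < \int[mu]_x (h x * (J x * \1_(`]-oo, c[%classic : set R) x)).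
Hypothesis piece : forall P : R -> R, measurable_fun setT P -> (forall x, 0 <= P x <= J x) ->
  CD K N P -> CD K N (fun x => J x - P x) -> \int[mu]_x (h x * P x) = 0 -> 0 < len P ->
  \int[mu]_x (phi x * P x) < 0.

Local Notation IAB := (\1_(`]A, B[%classic : set R)).

Let mh : measurable_fun setT h. Proof. exact: continuous_measurable_fun. Qed.
Let mphi : measurable_fun setT phi. Proof. exact: continuous_measurable_fun. Qed.
Let insJ : inside A B J. Proof. by move=> x /Jpos. Qed.
Let Jsupp x : 0 < J x -> A <= x <= B. Proof. by move=> /Jpos /andP[/ltW -> /ltW]. Qed.
Let Jout x : ~~ (A < x < B) -> J x = 0.
Proof.
by move=> nx; apply/eqP; rewrite eq_le J0 andbT leNgt; apply: contra nx => /Jpos.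
Qed.
Let M0 : 0 <= M. Proof. exact: le_trans (hM 0). Qed.
Let mIAB : measurable_fun setT (IAB : R -> R).
Proof. by apply: measurable_indic; exact: measurable_itv. Qed.
Let IABE x : IAB x = (A < x < B)%R%:R :> R.
Proof. by rewrite indicE mem_setE in_itv. Qed.
Let iIAB : intg (IAB : R -> R).
Proof.
apply: intg_indic; first exact: measurable_itv.
by rewrite lebesgue_measure_itv/= lte_fin AB -EFinB ltry.
Qed.

Lemma intg_dominated (P : R -> R) (C : R) : measurable_fun setT P -> (forall x, `|P x| <= C * IAB x) -> intg P.
Proof.
move=> mP PC; apply: intg_dom mP PC _.
by apply: (@intg_mul _ (cst C) _ `|C|).
Qed.

(** The last inequality is not strict because it comes from a limit; strictness is recovered by the
    constant added to phi in [localization]. *)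
Definition good_model (g : R -> R) := [/\ measurable_fun setT g,
  intg (fun x => g x * IAB x), forall x, A < x < B -> 0 < g x,
  \int[mu]_x (h x * (g x * IAB x)) = 0 & \int[mu]_x (phi x * (g x * IAB x)) <= 0].

Lemma good_model_limit (P : nat -> R -> R) (lam : nat -> R) (g : R -> R) (C : R) :
  (forall n, measurable_fun setT (P n)) -> measurable_fun setT g ->
  (forall n, 0 <= lam n) ->
  (forall n x, 0 <= P n x /\ lam n * P n x <= C * IAB x) ->
  (forall x, A < x < B -> lam n * P n x @[n --> \oo] --> g x) ->
  (forall x, A < x < B -> 0 < g x) ->
  (forall n, \int[mu]_x (h x * P n x) = 0) ->
  (forall n, \int[mu]_x (phi x * P n x) <= 0) ->
  (forall n, intg (P n)) -> good_model g.
Proof.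
move=> mP mg lam0 PC Pg g0 HP PP iP.
have gC x : 0 <= g x * IAB x <= C * IAB x.
  rewrite IABE; case: (boolP (A < x < B)) => xAB; last by rewrite !mulr0 lexx.
  rewrite !mulr1 ltW ?g0//=; rewrite -(cvg_lim _ (Pg x xAB))//; apply: limr_le.
    by apply/cvg_ex; eexists; exact: Pg.
  by apply: nearW => n; have [_] := PC n x; rewrite IABE xAB mulr1.
have mgI : measurable_fun setT (fun x => g x * IAB x) by exact: measurable_funM.
have ig : intg (fun x => g x * IAB x).
  by apply: (@intg_dominated _ C) => // x; have /andP[? ?] := gC x; rewrite ger0_norm.
have cv (k : R -> R) : measurable_fun setT k -> (forall x, `|k x| <= M) ->
    (\int[mu]_x (k x * (lam n * P n x)))%R @[n --> \oo] --> (\int[mu]_x (k x * (g x * IAB x)))%R.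
  move=> mk kM; apply: (@Rint_dct _ _ _ (fun x => M * (C * IAB x))).
  - move=> n; apply: measurable_funM => //; apply: measurable_funM => //; exact: measurable_cst.
  - exact: measurable_funM.
  - have -> : EFin \o (fun x => M * (C * IAB x)) = EFin \o (fun x => (M * C) * IAB x).
      by apply/funext => x /=; rewrite mulrA.
    by apply: (@intg_mul _ (cst (M * C)) _ `|M * C|).
  - move=> n x; have [P0 PCx] := PC n x; rewrite normrM ler_pM// ger0_norm// mulr_ge0//.
  - apply: (@ae_except3 _ _ A B B) => x xA xB _; apply: cvgMr; rewrite IABE.
    case: (boolP (A < x < B)) => xAB; first by rewrite mulr1; exact: Pg.
    rewrite mulr0; apply: cvg_trans (near_eq_cvg _) (cvg_cst 0).
    apply: nearW => n; have [P0 PCx] := PC n x.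
    by apply/eqP; rewrite eq_sym eq_le mulr_ge0// andbT; move: PCx; rewrite IABE (negbTE xAB) mulr0.
have E (k : R -> R) n : measurable_fun setT k -> (forall x, `|k x| <= M) ->
   \int[mu]_x (k x * (lam n * P n x)) = lam n * \int[mu]_x (k x * P n x).
  move=> mk kM; rewrite -RintegralZl//; last exact: intg_mul kM (iP n).
  by congr Rintegral; apply/funext => x; ring.
split => //.
  apply: (cvg_unique _ (cv h mh hM)) => //.
  have Z : (fun n => (\int[mu]_x (h x * (lam n * P n x)))%R) = (fun=> 0).
    by apply/funext => n; rewrite E// HP mulr0.
  by rewrite Z; exact: cvg_cst.
rewrite -(cvg_lim _ (cv phi mphi phiM))//; apply: limr_le.
  by apply/cvg_ex; eexists; exact: (cv phi mphi phiM).
by apply: nearW => n; rewrite E// mulr_ge0_le0.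
Qed.

Lemma piece_le0 (P : R -> R) : measurable_fun setT P -> (forall x, 0 <= P x <= J x) ->
  (forall x, A < x < B -> 0 < P x) -> CD K N P -> CD K N (fun x => J x - P x) ->
  \int[mu]_x (h x * P x) = 0 -> \int[mu]_x (phi x * P x) <= 0.
Proof.
move=> mP bP P0 cP cQ HP; apply: ltW; apply: piece => //.
rewrite /len (_ : [set x | 0 < P x] = `]A, B[%classic).
  by rewrite lebesgue_measure_itv/= lte_fin AB -EFinB/= subr_gt0.
apply/seteqP; split => x /=; rewrite in_itv/= => H; last exact: P0.
by apply/Jpos/(lt_le_trans H); case/andP: (bP x).
Qed.

Lemma cut_bounds (D : R -> bool) (m : R -> R) : (forall x, D x -> 0 < m x) ->
  (forall x, 0 <= cut D m J x <= J x) /\ (forall x, A < x < B -> 0 < cut D m J x).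
Proof.
move=> m0; split => x.
  by rewrite cut_le andbT /cut; case: ifP => // Dx; rewrite le_min J0 ltW// m0.
by move=> /Jpos Jx; rewrite /cut; case: ifP => // Dx; rewrite lt_min Jx m0.
Qed.

Lemma cut_piece (D : R -> bool) (m : R -> R) : measurable_fun setT D -> measurable_fun setT m ->
  cutter K N A B D m -> \int[mu]_x (h x * cut D m J x) = 0 ->
  \int[mu]_x (phi x * cut D m J x) <= 0.
Proof.
move=> mD mm cm HP; have [b1 b2] := cut_bounds cm.1; apply: piece_le0 => //.
- exact: measurable_cut.
- exact: (CD_cut hl insJ cJ cm).
- exact: (CD_cut_rest hN hl insJ cJ cm).
Qed.

Lemma between_intg (P : R -> R) : measurable_fun setT P -> (forall x, 0 <= P x <= J x) -> intg P.
Proof. by move=> mP bP; apply: intg_dom mP _ iJ => x; have /andP[? ?] := bP x; rewrite ger0_norm. Qed.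

(* Rescaled pieces cannot concentrate at a point [q]: one of [h], [- h], [phi]
   is positive there. *)
Lemma no_concentration (P : nat -> R -> R) (q : R) :
  (forall n, measurable_fun setT (P n)) -> (forall n x, 0 <= P n x <= J x) ->
  (forall n, \int[mu]_x (h x * P n x) = 0) ->
  (forall n, \int[mu]_x (phi x * P n x) <= 0) ->
  ~ (forall e, 0 < e -> exists (lam : nat -> R) (C : R), [/\ forall n, 0 <= lam n, 0 <= C,
    \forall n \near \oo, forall x, A < x < B -> e <= `|x - q| -> lam n * P n x <= C &
    forall W, \forall n \near \oo,
      W <= \int[mu]_x (lam n * P n x * \1_([set x | (`|x - q| < e)%R]) x)]).
Proof.
move=> mP bP HP PP conc.
have iP n : intg (P n) by exact: between_intg.
(* Whatever the sign of h q, one of - h, h, phi is positive at q, while its integral against every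
   piece is at most 0. *)
have [k [ck kM kq kP]] : exists k : R -> R, [/\ continuous k, (forall x, `|k x| <= M), 0 < k q &
    forall n, \int[mu]_x (k x * P n x) <= 0].
  have [hq|hq|hq] := ltgtP (h q) 0.
  - exists (fun x => - h x); split.
    + by move=> x; apply: cvgN; exact: ch.
    + by move=> x; rewrite normrN.
    + by rewrite oppr_gt0.
    + move=> n; have -> : (fun x => - h x * P n x) = (fun x => -1 * (h x * P n x)).
        by apply/funext => x; ring.
      by rewrite RintegralZl// ?HP ?mulr0//; exact: intg_mul hM (iP n).
  - by exists h; split => // n; rewrite HP.
  - by exists phi; split => //; exact: hphi.
have mk : measurable_fun setT k by exact: continuous_measurable_fun.
pose eta := k q / 2; have eta0 : 0 < eta by rewrite divr_gt0.
have [e e0 He] : exists2 e, 0 < e & forall x, `|x - q| < e -> eta <= k x.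
  have : \forall x \near q, eta < k x.
    by apply: (cvgr_gt _ (ck q)); rewrite /eta; lra.
  move=> /nbhs_ballP[e /= e0 He]; exists e => // x xq; apply/ltW/He.
  by rewrite /ball/= distrC.
have [lam [C [lam0 C0 Cle big]]] := conc e e0.
(* Away from q the contribution is at least - M C (B - A); mass W near q, where k >= eta, outweighs
   it by 1. *)
pose W := (M * C * (B - A) + 1) / eta.
near \oo => n.
have Wn : W <= \int[mu]_x (lam n * P n x * \1_([set x | (`|x - q| < e)%R]) x).
  by near: n; exact: big.
have Cn : forall x, A < x < B -> e <= `|x - q| -> lam n * P n x <= C by near: n.
have mV : measurable_fun setT (\1_([set x | (`|x - q| < e)%R]) : R -> R).
  apply: measurable_indic.
  have -> : [set x | (`|x - q| < e)%R] = [set x | - e < - `|x - q|].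
    by apply/seteqP; split => x /=; rewrite ltrN2.
  apply: (@measurable_gt_set _ (- e) (fun x => - `|x - q|)).
  apply: continuous_measurable_fun => x; apply: cvgN; apply: cvg_norm.
  by apply: cvgB; [exact: cvg_id|exact: cvg_cst].
have mlP : measurable_fun setT (fun x => lam n * P n x).
  by apply: measurable_funM => //; exact: measurable_cst.
have ilP : intg (fun x => lam n * P n x).
  by apply: (@intg_mul _ (cst (lam n)) _ `|lam n|).
have iV : intg (fun x => lam n * P n x * \1_([set x | (`|x - q| < e)%R]) x).
  have -> : EFin \o (fun x => lam n * P n x * \1_([set x | (`|x - q| < e)%R]) x) =
     EFin \o (fun x => \1_([set x | (`|x - q| < e)%R]) x * (lam n * P n x)).
    by apply/funext => x /=; rewrite mulrC.
  apply: (@intg_mul _ _ _ 1) => // x; rewrite indicE; case: (_ \in _); by rewrite ?normr1 ?normr0.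
have low : \int[mu]_x (eta * (lam n * P n x * \1_([set x | (`|x - q| < e)%R]) x)
             - M * C * IAB x) <= \int[mu]_x (lam n * (k x * P n x)).
  have i1 : intg (fun x => eta * (lam n * P n x * \1_([set x | (`|x - q| < e)%R]) x)).
    by apply: (@intg_mul _ (cst eta) _ `|eta|).
  have i2 : intg (fun x => M * C * IAB x) by apply: (@intg_mul _ (cst (M * C)) _ `|M * C|).
  apply: le_Rintegral => //; first exact: (integrableB measurableT i1 i2).
    by apply: (@intg_mul _ (cst (lam n)) _ `|lam n|) => //; exact: intg_mul kM (iP n).
  move=> x _ /=; have /andP[P0 PJ] := bP n x.
  have MC : 0 <= M * C by rewrite mulr_ge0.
  have lP0 : 0 <= lam n * P n x by rewrite mulr_ge0.
  have -> : lam n * (k x * P n x) = k x * (lam n * P n x) by ring.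
  rewrite IABE indic_pred; case: (ltP `|x - q| e) => xe.
    rewrite mulr1; apply: (@le_trans _ _ (eta * (lam n * P n x))).
      by rewrite gerBl mulr_ge0.
    by rewrite ler_wpM2r// He.
  rewrite !mulr0 sub0r; case: (boolP (A < x < B)) => xAB; last first.
    have -> : P n x = 0 by apply/eqP; rewrite eq_le P0 andbT -(Jout xAB).
    by rewrite !mulr0 oppr0.
  rewrite mulr1 lerNl -mulNr.
  apply: (@le_trans _ _ (M * (lam n * P n x))).
    by rewrite ler_wpM2r// (le_trans (ler_norm _))// normrN.
  by rewrite ler_wpM2l// Cn.
have : \int[mu]_x (lam n * (k x * P n x)) <= 0.
  by rewrite RintegralZl ?mulr_ge0_le0//; exact: intg_mul kM (iP n).
apply/negP; rewrite -ltNge; apply: lt_le_trans low.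
have i1 : intg (fun x => eta * (lam n * P n x * \1_([set x | (`|x - q| < e)%R]) x)).
  by apply: (@intg_mul _ (cst eta) _ `|eta|).
have [i2 I2] := Rint_itv (M * C) AB.
rewrite RintegralB// I2 RintegralZl//.
apply: (@lt_le_trans _ _ (eta * W - M * C * (B - A))); last first.
  by rewrite lerD2r ler_pM2l.
have -> : eta * W = M * C * (B - A) + 1.
  by rewrite /W mulrC divfK// gt_eqF.
by rewrite addrAC subrr add0r.
Unshelve. all: by end_near.
Qed.

(** The zero at c reduces the three-term relation to one product, which expresses [eb] at x through
    its value at the opposite end, B if x < c and A if x > c. For [be] outside [0, 1] the values at
    the two ends have opposite signs. *)
Lemma eb_zero be c x : A < c < B -> eb dl A B be c = 0 -> 0 < s_delta dl (B - A) ->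
  A < x < B -> (be < 0 \/ 1 < be) -> x != c ->
  0 < eb dl A B be x * (be * (x - c)).
Proof.
move=> /andP[Ac cB] ec S0 /andP[Ax xB] bo xc.
have T x' z' y' := eb_three dl A B be x' z' y'.
have pos u v : A < u -> v <= B -> u < v -> 0 < s_delta dl (v - u).
  by move=> Au vB uv; apply: (eb_range hl) => //; [exact: ltW|left].
have pos' u v : A <= u -> v < B -> u < v -> 0 < s_delta dl (v - u).
  by move=> Au vB uv; apply: (eb_range hl) => //; [exact: ltW|right].
have [xl|xl] := ltP x c.
  have := T x c B; rewrite ec mul0r ebB.
  have := pos c B Ac (lexx _) cB; have := pos' x c (ltW Ax) cB xl.
  move: (s_delta dl (B - c)) (s_delta dl (c - x)) (s_delta dl (B - A)) S0 => s1 s2 s3 s30 s20 s10 E.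
  have xc0 : 0 < c - x by rewrite subr_gt0.
  have E2 : eb dl A B be x = - (be * s3 * s2 / s1).
    by apply: (mulIf (lt0r_neq0 s10)); rewrite mulNr divfK ?gt_eqF//; lra.
  have -> : eb dl A B be x * (be * (x - c)) = be ^+ 2 * (s3 * s2 / s1 * (c - x)).
    by rewrite E2; ring.
  rewrite mulr_gt0 ?exprn_even_gt0//=; last by rewrite mulr_gt0// divr_gt0// mulr_gt0.
  by case: bo => [/lt_eqF ->|b1] //; rewrite gt_eqF// (lt_trans _ b1).
have {xl}xl : c < x by rewrite lt_neqAle eq_sym xc.
have := T A c x; rewrite ec mul0r ebA.
have := pos c x Ac (ltW xB) xl; have := pos' A c (lexx _) cB Ac.
move: (s_delta dl (x - c)) (s_delta dl (c - A)) (s_delta dl (B - A)) S0 => s1 s2 s3 s30 s20 s10 E.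
have xc0 : 0 < x - c by rewrite subr_gt0.
have E2 : eb dl A B be x = (be - 1) * s3 * s1 / s2.
  by apply: (mulIf (lt0r_neq0 s20)); rewrite divfK ?gt_eqF//; lra.
have -> : eb dl A B be x * (be * (x - c)) = (be * (be - 1)) * (s3 * s1 / s2 * (x - c)).
  by rewrite E2; ring.
rewrite mulr_gt0//; last by rewrite mulr_gt0// divr_gt0// mulr_gt0.
by case: bo => bo; [rewrite nmulr_rgt0//; lra|rewrite mulr_gt0//; lra].
Qed.

Section selection.
Variable P : nat -> R -> R -> R.
Hypothesis S0 : 0 < s_delta dl (B - A).
Hypothesis mP : forall n be, measurable_fun setT (P n be).
Hypothesis bP : forall n be x, 0 <= P n be x <= J x.
Hypothesis cP : forall n x, continuous (fun be => P n be x).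
Hypothesis limP : forall (s : nat -> nat) (b : nat -> R) (be x : R),
  (forall n, (n <= s n)%N) -> b n @[n --> \oo] --> be -> A < x < B ->
  (0 < eb dl A B be x -> P (s n) (b n) x @[n --> \oo] --> 0) /\
  (eb dl A B be x < 0 -> P (s n) (b n) x @[n --> \oo] --> J x).

(** Outside [0, 1] the solution changes sign at one point c, and the pieces tend to J on the side
    where it is negative and to 0 on the other. For be < 0 that side is ]c, B[, whose h-integral is
    minus an initial integral; for be > 1 it is ]A, c[. *)
Lemma selection_limit (s : nat -> nat) (b : nat -> R) (be : R) : (forall n, (n <= s n)%N) ->
  b n @[n --> \oo] --> be ->
  (be < 0 -> exists2 w : R, w < 0 &
     (\int[mu]_x (h x * P (s n) (b n) x))%R @[n --> \oo] --> w) /\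
  (1 < be -> exists2 w : R, 0 < w &
     (\int[mu]_x (h x * P (s n) (b n) x))%R @[n --> \oo] --> w).
Proof.
move=> sn bn.
have zero : (be < 0 \/ 1 < be) -> exists2 c, A < c < B & eb dl A B be c = 0.
  move=> bo; have ce : {within `[A, B], continuous (eb dl A B be)}.
    by apply: continuous_subspaceT; exact: continuous_eb.
  have [|c cAB ec] := @IVT _ _ _ _ 0 (ltW AB) ce.
    rewrite ebA ebB; move: (s_delta dl (B - A)) S0 => S S0'.
    rewrite ge_min le_max; case: bo => b0; apply/andP; split; apply/orP.
    - by right; rewrite pmulr_lle0// ltW.
    - by left; rewrite pmulr_lge0//; lra.
    - by left; rewrite pmulr_lle0//; lra.
    - by right; rewrite pmulr_lge0//; lra.
  exists c => //; move: cAB; rewrite in_itv/= => /andP[Ac cB].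
  rewrite !lt_neqAle Ac cB !andbT; apply/andP; split.
    apply/eqP => E; move: ec; rewrite -E ebA => /eqP.
    by rewrite mulf_eq0 (gt_eqF S0) orbF => /eqP b1; case: bo; lra.
  apply/eqP => E; move: ec; rewrite E ebB => /eqP.
  by rewrite mulf_eq0 (gt_eqF S0) orbF => /eqP b1; case: bo; lra.
have lim (f : R -> R) c : measurable_fun setT f ->
    (forall x, A < x < B -> x != c -> P (s n) (b n) x @[n --> \oo] --> f x) ->
    (forall x, ~~ (A < x < B) -> f x = 0) ->
    (\int[mu]_x (h x * P (s n) (b n) x))%R @[n --> \oo] --> (\int[mu]_x (h x * f x))%R.
  move=> mf cv f0; apply: (@Rint_dct _ _ _ (fun x => M * J x)).
  - by move=> n; exact: measurable_funM.
  - exact: measurable_funM.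
  - by apply: (@intg_mul _ (cst M) _ `|M|).
  - move=> n x; have /andP[P0 PJ] := bP (s n) (b n) x.
    by rewrite normrM ler_pM// ger0_norm.
  - apply: (@ae_except3 _ _ c c c) => x xc _ _; apply: cvgMr.
    case: (boolP (A < x < B)) => xAB; first exact: cv.
    rewrite f0//; apply: cvg_trans (near_eq_cvg _) (cvg_cst 0); apply: nearW => n.
    by apply/eqP; have := bP (s n) (b n) x; rewrite Jout// eq_sym eq_le => /andP[-> ->].
have mI c : measurable_fun setT (\1_(`]-oo, c[%classic : set R) : R -> R).
  by apply: measurable_indic; exact: measurable_itv.
have IE c x : \1_(`]-oo, c[%classic : set R) x = (x < c)%R%:R :> R.
  by rewrite indicE mem_setE in_itv.
have ihJ : intg (fun x => h x * J x) by exact: intg_mul hM iJ.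
split => bo.
- have [c cAB ec] := zero (or_introl bo).
  exists (- \int[mu]_x (h x * (J x * \1_(`]-oo, c[%classic : set R) x))).
    by rewrite oppr_lt0 Hc.
  have := lim (fun x => J x - J x * \1_(`]-oo, c[%classic : set R) x) c.
  have ihJI : intg (fun x => h x * (J x * \1_(`]-oo, c[%classic : set R) x)).
    have -> : EFin \o (fun x => h x * (J x * \1_(`]-oo, c[%classic : set R) x)) =
       EFin \o (fun x => \1_(`]-oo, c[%classic : set R) x * (h x * J x)).
      by apply/funext => x /=; congr EFin; ring.
    apply: (@intg_mul _ _ _ 1) => // x; rewrite IE; case: (_ < _)%R; by rewrite ?normr1 ?normr0.
  under [in X in (_ -> _ -> _ -> X)]eq_Rintegral do rewrite mulrBr.
  rewrite RintegralB// HJ sub0r; apply.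
  + by apply: measurable_funB => //; exact: measurable_funM.
  + move=> x xAB xc; have := eb_zero cAB ec S0 xAB (or_introl bo) xc.
    rewrite IE; case: (ltP x c) => xl H.
      rewrite mulr1 subrr; apply: (limP sn bn xAB).1.
      by rewrite -(pmulr_lgt0 _ (_ : 0 < be * (x - c)))// nmulr_rgt0// subr_lt0.
    rewrite mulr0 subr0; apply: (limP sn bn xAB).2.
    have {xl}xl : c < x by rewrite lt_neqAle eq_sym xc.
    by rewrite -(nmulr_lgt0 _ (_ : be * (x - c) < 0))// nmulr_rlt0// subr_gt0.
  + by move=> x /Jout ->; rewrite mul0r subrr.
- have [c cAB ec] := zero (or_intror bo).
  exists (\int[mu]_x (h x * (J x * \1_(`]-oo, c[%classic : set R) x))); first exact: Hc.
  apply: (lim _ c).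
  + exact: measurable_funM.
  + have b0 : 0 < be by apply: lt_trans bo.
    move=> x xAB xc; have := eb_zero cAB ec S0 xAB (or_intror bo) xc.
    rewrite IE; case: (ltP x c) => xl H.
      rewrite mulr1; apply: (limP sn bn xAB).2.
      by rewrite -(nmulr_lgt0 _ (_ : be * (x - c) < 0))// pmulr_rlt0// subr_lt0.
    have {xl}xl : c < x by rewrite lt_neqAle eq_sym xc.
    rewrite mulr0; apply: (limP sn bn xAB).1.
    by rewrite -(pmulr_lgt0 _ (_ : 0 < be * (x - c)))// mulr_gt0// subr_gt0.
  + by move=> x /Jout ->; rewrite mul0r.
Qed.

(** For large n the h-integral is negative at parameter -1 and positive at 2, so it has a root
    between. A limit of roots cannot lie outside [0, 1], since there the integrals would converge to
    a nonzero number. *)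
Lemma selection : exists (s : nat -> nat) (b : nat -> R) (be : R),
  [/\ forall n, (n <= s n)%N, 0 <= be <= 1, b n @[n --> \oo] --> be &
      forall n, \int[mu]_x (h x * P (s n) (b n) x) = 0].
Proof.
have cc (be : R) : (fun=> be : R) n @[n --> \oo] --> be by exact: cvg_cst.
have [w1 w10 lim1] := (@selection_limit id (fun=> -1) (-1) (fun n => leqnn n) (cc _)).1 (ltrN10 _).
have [w2 w20 lim2] := (@selection_limit id (fun=> 2) 2 (fun n => leqnn n) (cc _)).2 (ltr1n _ 2).
have ev : \forall n \near \oo, exists be, -1 <= be <= 2 /\ \int[mu]_x (h x * P n be x) = 0.
  near=> n.
  have n1 : \int[mu]_x (h x * P n (-1) x) < 0 by near: n; exact: (cvgr_lt _ lim1).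
  have n2 : 0 < \int[mu]_x (h x * P n 2 x) by near: n; exact: (cvgr_gt _ lim2).
  have cF : continuous (fun be => \int[mu]_x (h x * P n be x)).
    apply: (@continuous_Rint _ (fun be x => h x * P n be x) (fun x => M * J x)).
    - by move=> l; exact: measurable_funM.
    - by move=> l x; have /andP[? ?] := bP n l x; rewrite normrM ler_pM// ger0_norm.
    - by apply: (@intg_mul _ (cst M) _ `|M|).
    - by move=> x be; apply: cvgMr; exact: cP.
  apply: (continuous_root cF); first lra.
  by apply/orP; left; apply/andP; split; exact: ltW.
have [n0 _ Hn0] := ev.
have {}Hn0 n : exists be, -1 <= be <= 2 /\ \int[mu]_x (h x * P (n + n0)%N be x) = 0.
  by apply: Hn0; exact: leq_addl.
have [b Hb] := choice Hn0.
have [be [t [be12 tinc tcv]]] := bolzano_weierstrass (fun n => (Hb n).1).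
have st n : (n <= t n + n0)%N by rewrite (leq_trans (subseq_ge tinc n))// leq_addr.
exists (fun n => (t n + n0)%N), (b \o t), be; split => //; last by move=> n; exact: (Hb (t n)).2.
have zero w : (\int[mu]_x (h x * P (t n + n0)%N ((b \o t) n) x))%R @[n --> \oo] --> w -> w = 0.
  move=> cv; apply: (cvg_unique _ cv) => //.
  have Z : (fun n => (\int[mu]_x (h x * P (t n + n0)%N ((b \o t) n) x))%R) = (fun=> 0).
    by apply/funext => n; rewrite /= (Hb _).2.
  by rewrite Z; exact: cvg_cst.
have [l1 l2] := selection_limit st tcv.
apply/andP; split; rewrite leNgt; apply/negP.
- by move=> /l1[w w0 /zero E]; rewrite E ltxx in w0.
- by move=> /l2[w w0 /zero E]; rewrite E ltxx in w0.
Unshelve. all: by end_near.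
Qed.

End selection.

Lemma cutterZ (D : R -> bool) (m : R -> R) c : 0 < c -> cutter K N A B D m ->
  cutter K N A B D (fun x => c * m x).
Proof.
move=> c0 [m0 cm]; split => [x Dx|x y t xi yi xy t01 z]; first by rewrite mulr_gt0 ?m0.
have [c1 c2] := cm x y t xi yi xy t01; have dr := inside_range hl xi yi xy.
have ci : 0 < c^-1 by rewrite invr_gt0.
split=> [Dz a b a0 b0 ha hb|Dx Dy].
  have H : gmean K N t (y - x) (c^-1 * a) (c^-1 * b) <= m z.
    apply: c1 => //; rewrite ?mulr_gt0// => Dx; rewrite ler_pdivrMl//; [exact: ha|exact: hb].
  by rewrite gmeanZ// ler_pdivrMl in H.
have [Dz H] := c2 Dx Dy; split => //.
by rewrite gmeanZ ?m0// ler_pM2l.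
Qed.

Lemma gmeanE n t d a b : N = n%:E ->
  gmean K N t d a b = pmean (n - 1) (sg dl (1 - t) d) (sg dl t d) a b.
Proof. by move=> ->. Qed.

Lemma gmean_eb n be x y t : N = n%:E -> A < x < B -> A < y < B -> x < y -> 0 < t < 1 ->
  0 < eb dl A B be x -> 0 < eb dl A B be y ->
  gmean K N t (y - x) (eb dl A B be x `^ (n - 1)) (eb dl A B be y `^ (n - 1)) =
  eb dl A B be ((1 - t) * x + t * y) `^ (n - 1).
Proof.
move=> NE xi yi xy t01 ex ey; have [_ dr] := inside_range hl xi yi xy.
have n1 : n - 1 != 0.
  by case: (dimension_exponent hN NE) => p1; [rewrite lt_eqF|rewrite gt_eqF ?(lt_le_trans ltr01)].
have E := eb_conv A B be t xy dr; rewrite E (gmeanE _ _ _ _ NE) /pmean.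
by move: (eb dl A B be x) (eb dl A B be y) ex ey => u v u0 v0; rewrite (powRVK u0 n1) (powRVK v0 n1).
Qed.

Lemma rescaled_min (c g : nat -> R) (a l : R) : 0 < a -> (forall n, 0 < c n) ->
  c n @[n --> \oo] --> 0 -> g n @[n --> \oo] --> l ->
  (c n)^-1 * Num.min a (c n * g n) @[n --> \oo] --> l.
Proof.
move=> a0 c0 cc gl; have cl : c n * g n @[n --> \oo] --> 0 * l by exact: (cvgM cc gl).
rewrite mul0r in cl; apply: cvg_trans (near_eq_cvg _) gl.
move/cvgr_lt: cl => /(_ _ a0); apply: filterS => n cg.
by rewrite min_r ?(ltW cg)// mulKf// gt_eqF.
Qed.

(** * The case n - 1 >= 1: bounded models *)

Section exponent_ge1.
Variable n : R.
Hypothesis (NE : N = n%:E) (n1 : 1 <= n - 1).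
Local Notation p := (n - 1).
Local Notation S := (s_delta dl).

Let p0 : 0 < p. Proof. exact: lt_le_trans n1. Qed.

Let S_gt0 u v : A <= u -> v <= B -> u < v -> (A < u \/ v < B) -> 0 < S (v - u).
Proof. exact: (eb_range hl). Qed.

(** Each inequality keeps only one of the two positive terms of the mean. *)
Lemma ratio_between x z y : A < x -> x < z -> z < y -> y < B ->
  J x * S (y - z) `^ p <= J z * S (y - x) `^ p /\
  J y * S (z - x) `^ p <= J z * S (y - x) `^ p.
Proof.
move=> Ax xz zy yB; have xy := lt_trans xz zy.
have [t [t01 zE]] := conv_between (introT andP (conj xz zy)).
have xAB : A < x < B by rewrite Ax (lt_trans xy).
have yAB : A < y < B by rewrite yB (lt_trans Ax).
have Jx := (Jpos x).2 xAB; have Jy := (Jpos y).2 yAB.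
have := cJ xy Jx Jy t01; rewrite -zE (gmeanE _ _ _ _ NE) /pmean.
have d0 : y - x != 0 by rewrite subr_eq0 gt_eqF.
have Sxy : 0 < S (y - x) by apply: S_gt0; rewrite ?ltW//; left.
have Sxz : 0 < S (z - x) by apply: S_gt0; rewrite ?ltW//; [exact: lt_trans yB|left].
have Szy : 0 < S (y - z) by apply: S_gt0; rewrite ?ltW//; [exact: lt_trans Ax _|left; exact: lt_trans Ax _].
have E1 : sg dl (1 - t) (y - x) = S (y - z) / S (y - x).
  by rewrite /sg (negbTE d0) zE; congr (S _ / _); ring.
have E2 : sg dl t (y - x) = S (z - x) / S (y - x).
  by rewrite /sg (negbTE d0) zE; congr (S _ / _); ring.
rewrite E1 E2 => H.
have w1 : 0 < S (y - z) / S (y - x) by rewrite divr_gt0.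
have w2 : 0 < S (z - x) / S (y - x) by rewrite divr_gt0.
have a1 : 0 < J x `^ p^-1 by rewrite powR_gt0.
have a2 : 0 < J y `^ p^-1 by rewrite powR_gt0.
have pn0 : p != 0 by rewrite gt_eqF.
have key s j : 0 < s -> 0 < j -> s / S (y - x) * j `^ p^-1 <=
    S (y - z) / S (y - x) * J x `^ p^-1 + S (z - x) / S (y - x) * J y `^ p^-1 ->
    j * s `^ p <= J z * S (y - x) `^ p.
  move=> s0 j0 le; have jp : 0 < j `^ p^-1 by rewrite powR_gt0.
  have := le_trans (powR_lepos (mulr_gt0 (divr_gt0 s0 Sxy) jp) le (ltW p0)) H.
  rewrite (powRM p (ltW (divr_gt0 s0 Sxy)) (ltW jp)) (powRKV j0 pn0) => H2.
  rewrite (powR_split p s0 Sxy) mulrC -mulrA mulrC ler_wpM2r ?powR_ge0//.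
by split; apply: key => //; rewrite ?lerDl ?lerDr mulr_ge0// ltW.
Qed.

(** The outer point of [ratio_between] is sent to B or to A. So S(B - x) ^ p / J is nonincreasing
    and S(x - A) ^ p / J is nondecreasing: the extreme models are monotone relative to J. *)
Lemma ratio_ends x y : A < x -> x <= y -> y < B ->
  J x * S (B - y) `^ p <= J y * S (B - x) `^ p /\
  J y * S (x - A) `^ p <= J x * S (y - A) `^ p.
Proof.
move=> Ax; rewrite le_eqVlt => /predU1P[->|xy] yB; first by split.
have SB u : A < u -> u < B -> {for B, continuous (fun w => S (w - u) `^ p)}.
  move=> Au uB; apply: cvg_powR; last apply: cvg_s_delta; last first.
    by apply: cvgB; [exact: cvg_id|exact: cvg_cst].
  by apply: S_gt0 => //; [exact: ltW|left].
have SA u : A < u -> u < B -> {for A, continuous (fun w => S (u - w) `^ p)}.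
  move=> Au uB; apply: cvg_powR; last apply: cvg_s_delta; last first.
    by apply: cvgB; [exact: cvg_cst|exact: cvg_id].
  by apply: S_gt0 => //; [exact: ltW|right].
have xB := lt_trans xy yB; have Ay := lt_trans Ax xy.
split; rewrite -subr_ge0.
- have cv : J y * S (w - x) `^ p - J x * S (w - y) `^ p @[w --> B^'-] -->
      J y * S (B - x) `^ p - J x * S (B - y) `^ p.
    by apply: cvg_at_left_filter; apply: cvgB; apply: cvgMr; exact: SB.
  rewrite -(cvg_lim _ cv)//; apply: limr_ge; first by apply/cvg_ex; eexists; exact: cv.
  near=> w; rewrite subr_ge0.
  have yw : y < w by near: w; exact: nbhs_left_gt.
  have wB : w < B by near: w; exact: nbhs_left_lt.
  exact: (ratio_between Ax xy yw wB).1.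
- have cv : J x * S (y - w) `^ p - J y * S (x - w) `^ p @[w --> A^'+] -->
      J x * S (y - A) `^ p - J y * S (x - A) `^ p.
    by apply: cvg_at_right_filter; apply: cvgB; apply: cvgMr; exact: SA.
  rewrite -(cvg_lim _ cv)//; apply: limr_ge; first by apply/cvg_ex; eexists; exact: cv.
  near=> w; rewrite subr_ge0.
  have wx : w < x by near: w; exact: nbhs_right_lt.
  have Aw : A < w by near: w; exact: nbhs_right_gt.
  exact: (ratio_between Aw wx xy yB).2.
Unshelve. all: by end_near.
Qed.

(** The truncation of [be] to [0, 1]. The intermediate value argument uses continuity on the whole
    line, whereas [eb] is positive on ]A, B[ for parameters in [0, 1] only. *)
Let clip (be : R) := 1 - Num.min 1 (1 - Num.min be 1).

Let clip01 be : 0 <= clip be <= 1.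
Proof.
rewrite /clip; have h1 : Num.min be 1 <= 1 by rewrite ge_min lexx orbT.
move: (Num.min be 1) h1 => z z1; rewrite gerBl subr_ge0 ge_min lexx/= le_min ler01/=; lra.
Qed.

Let clipE be : 0 <= be <= 1 -> clip be = be.
Proof. by move=> /andP[b0 b1]; rewrite /clip (min_l b1) min_r; lra. Qed.

Let clip_cont : continuous clip.
Proof.
move=> be; apply: cvgB; first exact: cvg_cst.
apply: cvg_minr; first exact: cvg_cst.
apply: cvgB; first exact: cvg_cst.
by apply: cvg_minr; [exact: cvg_id|exact: cvg_cst].
Qed.

Let D (x : R) := (A < x < B)%R.
Let m be x := eb dl A B (clip be) x `^ p.

Let mD : measurable_fun setT D.
Proof.
apply: measurable_and; first exact: measurable_fun_ltr.
exact: measurable_fun_ltr.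
Qed.

Let mm be : measurable_fun setT (m be).
Proof.
apply: (measurableT_comp (measurable_powR p)).
by apply: continuous_measurable_fun; exact: continuous_eb.
Qed.

Lemma cutter_ge1 be : cutter K N A B D (m be).
Proof.
have e0 x : A < x < B -> 0 < eb dl A B (clip be) x by move=> xi; exact: eb_gt0.
split => [x Dx|x y t xi yi xy t01 z]; first by rewrite powR_gt0 ?e0.
have zi : A < z < B.
  have /andP[xz zy] := conv_in xy t01; case/andP: xi => Ax _; case/andP: yi => _ yB.
  by rewrite (lt_trans Ax)// (lt_trans _ yB).
have dr := inside_range hl xi yi xy; rewrite /D zi xi yi.
have E := gmean_eb NE xi yi xy t01 (e0 _ xi) (e0 _ yi).
split=> [_ a b a0 b0 ha hb|_ _]; last by rewrite /m E.
by rewrite /m -E; apply: gmean_le => //; [exact: ha|exact: hb].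
Qed.

(** A piece is J times the weight min(1, c m / J), which is monotone for be = 0 and be = 1; this
    gives the two signs at every scale c, and the root lies in [0, 1] from the start. Since the
    models are bounded, the rescaled pieces are dominated and cannot concentrate. *)
Lemma endgame_ge1 : exists2 be, 0 <= be <= 1 & good_model (fun x => eb dl A B be x `^ p).
Proof.
pose c k : R := k.+1%:R^-1; have c0 k : 0 < c k by rewrite invr_gt0.
pose P k be := cut D (fun x => c k * m be x) J.
have cm k be : cutter K N A B D (fun x => c k * m be x) by apply: cutterZ => //; exact: cutter_ge1.
have mcm k be : measurable_fun setT (fun x => c k * m be x).
  by apply: measurable_funM => //; exact: measurable_cst.
have mP k be : measurable_fun setT (P k be) by exact: measurable_cut.
have bP k be x : 0 <= P k be x <= J x by exact: (cut_bounds (cm k be).1).1.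
have PE k be x : P k be x = J x * (if D x then Num.min 1 (c k * m be x / J x) else 0).
  rewrite /P /cut; case: ifP => Dx; last by rewrite mulr0 Jout// -/(D x) Dx.
  have Jx := (Jpos x).2 Dx.
  by rewrite minr_pMr ?ltW// mulr1 [J x * (_ / _)]mulrC divfK// gt_eqF.
have mrho k be : measurable_fun setT (fun x => if D x then Num.min 1 (c k * m be x / J x) else 0).
  apply: measurable_fun_ifT => //; apply: measurable_minr => //.
  apply: measurable_funM => //.
  rewrite (_ : (fun x => (J x)^-1) = (fun x => J x `^ (-1))).
    exact: measurableT_comp (measurable_powR _) mJ.
  by apply/funext => x; rewrite powR_inv1.
have rho01 k be x : 0 <= (if D x then Num.min 1 (c k * m be x / J x) else 0) <= 1.
  case: ifP => Dx; last by rewrite lexx ler01.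
  by rewrite le_min ler01 ge_min lexx divr_ge0// mulr_ge0 ?powR_ge0// ltW.
have inD x y z : A < x -> x <= z -> z <= y -> y < B -> D z.
  by move=> Ax xz zy yB; rewrite /D (lt_le_trans Ax)// (le_lt_trans zy).
have E0 x : m 0 x = S (B - x) `^ p.
  by rewrite /m clipE ?lexx ?ler01// /eb subr0 mul1r mul0r addr0.
have E1 x : m 1 x = S (x - A) `^ p.
  by rewrite /m clipE ?lexx ?ler01// /eb subrr mul1r mul0r add0r.
have F0 k : 0 <= \int[mu]_x (h x * P k 0 x).
  under eq_Rintegral do rewrite PE.
  apply: (nonincreasing_ge0 mh hM mJ iJ J0 Jsupp HJ Hc) => // x y Ax xy yB.
  have Dx := inD _ _ _ Ax (lexx _) xy yB; have Dy := inD _ _ _ Ax xy (lexx _) yB.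
  rewrite Dx Dy le_min ge_min lexx/= ge_min; apply/orP; right.
  have Jx := (Jpos x).2 Dx; have Jy := (Jpos y).2 Dy.
  apply: (scaled_ratio_le (c0 k) Jx Jy); rewrite !E0.
  exact: (ratio_ends Ax xy yB).1.
have F1 k : \int[mu]_x (h x * P k 1 x) <= 0.
  under eq_Rintegral do rewrite PE.
  apply: (nondecreasing_le0 mh hM mJ iJ J0 Jsupp HJ Hc) => // x y Ax xy yB.
  have Dx := inD _ _ _ Ax (lexx _) xy yB; have Dy := inD _ _ _ Ax xy (lexx _) yB.
  rewrite Dx Dy le_min ge_min lexx/= ge_min; apply/orP; right.
  have Jx := (Jpos x).2 Dx; have Jy := (Jpos y).2 Dy.
  apply: (scaled_ratio_le (c0 k) Jy Jx); rewrite !E1.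
  exact: (ratio_ends Ax xy yB).2.
have ex k : exists be, 0 <= be <= 1 /\ \int[mu]_x (h x * P k be x) = 0.
  have cF : continuous (fun be => \int[mu]_x (h x * P k be x)).
    apply: (@continuous_Rint _ (fun be x => h x * P k be x) (fun x => M * J x)).
    - by move=> l; exact: measurable_funM.
    - by move=> l x; have /andP[? ?] := bP k l x; rewrite normrM ler_pM// ger0_norm.
    - by apply: (@intg_mul _ (cst M) _ `|M|).
    - move=> x be; apply: cvgMr; rewrite /P /cut; case: ifP => Dx; last exact: cvg_cst.
      apply: cvg_minr; first exact: cvg_cst.
      apply: cvgMr; rewrite /m; apply: cvg_powR; first exact: eb_gt0.
      apply: (@cvg_for _ (fun be => eb dl A B be x)); first exact: continuous_eb_param.
      exact: clip_cont.
  by apply: (continuous_root cF ler01); apply/orP; right; apply/andP; split.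
have [b Hb] := choice ex.
have [be [t [be01 tinc tcv]]] := bolzano_weierstrass (fun k => (Hb k).1).
exists be => //.
have [Cb Cb0 HCb] := eb_bounded dl AB.
apply: (@good_model_limit (fun k => P (t k) (b (t k))) (fun k => (c (t k))^-1) _ (Cb `^ p)).
- by move=> k; exact: mP.
- apply: (measurableT_comp (measurable_powR p)).
  by apply: continuous_measurable_fun; exact: continuous_eb.
- by move=> k; rewrite invr_ge0 ltW.
- move=> k x; have /andP[P0 _] := bP (t k) (b (t k)) x; split => //.
  rewrite IABE; case: (boolP (A < x < B)) => xAB; last first.
    have /andP[_ PJ] := bP (t k) (b (t k)) x; rewrite Jout// in PJ.
    by have -> : P (t k) (b (t k)) x = 0; [apply/eqP; rewrite eq_le PJ P0|rewrite !mulr0].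
  rewrite mulr1 ler_pdivrMl// /P /cut /D xAB ge_min; apply/orP; right.
  rewrite ler_pM2l// /m; apply: powR_lepos; [exact: eb_gt0| |exact: ltW].
  apply: (le_trans (ler_norm _)); apply: HCb; last by case/andP: xAB => /ltW -> /ltW ->.
  by have := clip01 (b (t k)); move: (clip _) => z; lra.
- move=> x xAB.
  have -> : (fun k => (c (t k))^-1 * P (t k) (b (t k)) x) =
     (fun k => (c (t k))^-1 * Num.min (J x) (c (t k) * eb dl A B (b (t k)) x `^ p)).
    by apply/funext => k; rewrite /P /cut /D xAB /m clipE//; exact: (Hb _).1.
  apply: rescaled_min => //; first exact/Jpos.
    exact: (cvg_subseq tinc (@cvg_harmonic R)).
  apply: cvg_powR; first exact: eb_gt0.
  apply: (@cvg_for _ (fun be => eb dl A B be x)); first exact: continuous_eb_param.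
  exact: tcv.
- by move=> x xAB; rewrite powR_gt0// eb_gt0.
- by move=> k; exact: (Hb _).2.
- by move=> k; apply: cut_piece => //; exact: (Hb _).2.
- by move=> k; exact: between_intg.
Qed.

End exponent_ge1.

(** [eb] is affine in the parameter with slope eb 1 - eb 0, at most 2 Cb in absolute value, so a
    parameter error below d / (2 Cb) costs at most d, half of the minimum for the limit
    parameter. *)
Lemma eb_low (u v be : R) (b : nat -> R) : A <= u -> u <= v -> v <= B ->
  (forall x, u <= x <= v -> 0 < eb dl A B be x) -> b n @[n --> \oo] --> be ->
  exists2 c0, 0 < c0 & \forall n \near \oo, forall x, u <= x <= v -> c0 <= eb dl A B (b n) x.
Proof.
move=> Au uv vB e0 bn.
have ce : {within `[u, v], continuous (eb dl A B be)}.
  by apply: continuous_subspaceT; exact: continuous_eb.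
have [c cI Hcm] := EVT_min uv ce; rewrite in_itv/= in cI.
have c0 := e0 _ cI; pose d := eb dl A B be c / 2; have d0 : 0 < d by rewrite divr_gt0.
have [Cb Cb0 HCb] := eb_bounded dl AB.
exists d => //.
have := bn => /cvgrPdist_lt/(_ (d / (2 * Cb))); rewrite divr_gt0 ?mulr_gt0// => /(_ isT).
apply: filterS => n bd x xI.
have xAB : A <= x <= B by lra.
have h0 : `|eb dl A B 0 x| <= Cb by apply: HCb => //; lra.
have h1 : `|eb dl A B 1 x| <= Cb by apply: HCb => //; lra.
have E : eb dl A B (b n) x = eb dl A B be x - (be - b n) * (eb dl A B 1 x - eb dl A B 0 x).
  by rewrite /eb; ring.
have xc : eb dl A B be c <= eb dl A B be x by apply: Hcm; rewrite in_itv.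
have : (be - b n) * (eb dl A B 1 x - eb dl A B 0 x) <= d.
  apply: (le_trans (ler_norm _)); rewrite normrM.
  have -> : d = d / (2 * Cb) * (2 * Cb) by rewrite divfK// gt_eqF// mulr_gt0.
  apply: ler_pM => //; first exact: ltW.
  by apply: (le_trans (ler_normB _ _)); move: h0 h1; move: `|_| `|_| => ? ?; lra.
by rewrite E; move: xc; rewrite /d; lra.
Qed.

(** * The case n - 1 <= -1: models with poles *)

Section exponent_neg.
Variable n : R.
Hypothesis (NE : N = n%:E) (n1 : n - 1 < 0) (hl' : ((B - A)%:E < l_delta dl)%E).
Local Notation p := (n - 1).
Local Notation S := (s_delta dl).

Let p1 : p <= -1.
Proof.
have [n0|n2] := dimension_finP hN NE; first by rewrite lerBlDr addNr.
by move: n1; rewrite subr_lt0 => /(le_lt_trans n2); rewrite ltNge ler1n.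
Qed.

Let pn0 : p != 0. Proof. by rewrite lt_eqF. Qed.

Let S0 : 0 < S (B - A).
Proof. by apply: s_delta_gt0 => //; rewrite subr_gt0. Qed.

(** With a negative exponent the model tends to +oo at a zero of [eb]; it is read as +oo beyond the
    zero as well, so nothing is cut there. *)
Let D be (x : R) := (0 < eb dl A B be x)%R.
Let m be x := eb dl A B be x `^ p.
Let c k : R := k.+1%:R^-1.
Let c0 k : 0 < c k. Proof. by rewrite invr_gt0. Qed.
Let P k be := cut (D be) (fun x => c k * m be x) J.

Let mD be : measurable_fun setT (D be).
Proof.
apply: measurable_fun_ltr; first exact: measurable_cst.
by apply: continuous_measurable_fun; exact: continuous_eb.
Qed.

Let mm be : measurable_fun setT (m be).
Proof.
apply: (measurableT_comp (measurable_powR p)).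
by apply: continuous_measurable_fun; exact: continuous_eb.
Qed.

(** A value below the model has a power 1 / p above [eb], trivially so where [eb] is not positive.
    The linear relation of [eb_conv] then compares the arguments, and the negative power p reverses
    the inequality. *)
Lemma cutter_neg be : cutter K N A B (D be) (m be).
Proof.
split => [x Dx|x y t xi yi xy t01 z]; first by rewrite powR_gt0.
have dr := inside_range hl xi yi xy.
have E := eb_conv A B be t xy dr.2.
have t1 : 0 < t <= 1 by lra.
have t2 : 0 < 1 - t <= 1 by lra.
have w1 := sg_gt0 t2 dr.1 dr.2; have w2 := sg_gt0 t1 dr.1 dr.2.
split=> [Dz a b a0 b0 ha hb|Dx Dy].
  have key w a' : 0 < a' -> (D be w -> a' <= m be w) -> eb dl A B be w <= a' `^ p^-1.
    move=> a'0 H; have [ew|ew] := ltP 0 (eb dl A B be w); last first.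
      by apply: (le_trans ew); exact: powR_ge0.
    rewrite -{1}(powRVK ew pn0); apply: powR_leneg => //; first exact: H.
    by rewrite invr_le0 ltW.
  rewrite (gmeanE _ _ _ _ NE) /pmean /m; apply: powR_leneg => //; last exact: ltW.
  rewrite -/z in E *; rewrite E; have ka := key _ _ a0 ha; have kb := key _ _ b0 hb.
  by apply: lerD; rewrite ler_pM2l.
split; last by rewrite /m (gmean_eb NE xi yi xy t01 Dx Dy).
by rewrite /D E; apply: addr_gt0; apply: mulr_gt0.
Qed.

Let cm k be : cutter K N A B (D be) (fun x => c k * m be x).
Proof. by apply: cutterZ => //; exact: cutter_neg. Qed.

Let mcm k be : measurable_fun setT (fun x => c k * m be x).
Proof. by apply: measurable_funM => //; exact: measurable_cst. Qed.

Let mP k be : measurable_fun setT (P k be).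
Proof. exact: measurable_cut. Qed.

Let bP k be x : 0 <= P k be x <= J x.
Proof. exact: (cut_bounds (cm k be).1).1. Qed.

(** The pole does no harm: once [eb] is below the level [eta], where the scaled model equals J x,
    the minimum is J x, and this matches the value taken where the model is +oo. *)
Lemma continuous_piece_neg k x : continuous (fun be => P k be x).
Proof.
move=> be; have := J0 x; rewrite le_eqVlt => /predU1P[Jx|Jx].
  rewrite (_ : (fun be => P k be x) = fun=> 0); first exact: cvg_cst.
  by apply/funext => be'; apply/eqP; have := bP k be' x; rewrite -Jx eq_sym eq_le => /andP[-> ->].
pose eta := (J x / c k) `^ p^-1.
have Jc : 0 < J x / c k by rewrite divr_gt0.
have eta0 : 0 < eta by rewrite powR_gt0.
have small be' : eb dl A B be' x < eta -> P k be' x = J x.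
  move=> e; rewrite /P /cut; case: ifP => // Dx; rewrite min_l//.
  rewrite mulrC -ler_pdivrMr// /m.
  by rewrite -[leLHS](powRKV Jc pn0); apply: powR_leneg => //; exact: ltW.
have ce := @continuous_eb_param _ dl A B x be.
have [e|e] := ltP (eb dl A B be x) eta.
  rewrite /continuous_at small//.
  apply: cvg_trans (near_eq_cvg _) (cvg_cst (J x)).
  near=> be'; apply/esym/small; near: be'; exact: (cvgr_lt _ ce _ e).
have e0 : 0 < eb dl A B be x by exact: lt_le_trans e.
have PE : P k be x = Num.min (J x) (c k * m be x) by rewrite /P /cut /D e0.
rewrite /continuous_at PE.
have cv : Num.min (J x) (c k * m be' x) @[be' --> be] --> Num.min (J x) (c k * m be x).
  by apply: cvg_minr; [exact: cvg_cst|apply: cvgMr; exact: cvg_powR].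
apply: cvg_trans (near_eq_cvg _) cv.
near=> be'; have e' : 0 < eb dl A B be' x by near: be'; exact: (cvgr_gt _ ce _ e0).
by rewrite /P /cut /D e'.
Unshelve. all: by end_near.
Qed.

Lemma piece_neg_cvg (s : nat -> nat) (b : nat -> R) (be x : R) : (forall k, (k <= s k)%N) ->
  b k @[k --> \oo] --> be -> A < x < B -> 0 < eb dl A B be x ->
  (c (s k))^-1 * P (s k) (b k) x @[k --> \oo] --> m be x.
Proof.
move=> sk bk xAB e0; have Jx := (Jpos x).2 xAB.
have ce : eb dl A B (b k) x @[k --> \oo] --> eb dl A B be x.
  by apply: (@cvg_for _ (fun be => eb dl A B be x)) bk; exact: continuous_eb_param.
have mk : m (b k) x @[k --> \oo] --> m be x by exact: cvg_powR.
have := @rescaled_min (fun k => c (s k)) (fun k => m (b k) x) (J x) (m be x) Jx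
  (fun k => c0 (s k)) (cvg_harmonic_subseq sk) mk.
apply: cvg_trans; apply: near_eq_cvg.
near=> k; have e : 0 < eb dl A B (b k) x by near: k; exact: (cvgr_gt _ ce _ e0).
by rewrite /P /cut /D e.
Unshelve. all: by end_near.
Qed.

Lemma piece_neg_lim (s : nat -> nat) (b : nat -> R) (be x : R) : (forall k, (k <= s k)%N) ->
  b k @[k --> \oo] --> be -> A < x < B ->
  (0 < eb dl A B be x -> P (s k) (b k) x @[k --> \oo] --> 0) /\
  (eb dl A B be x < 0 -> P (s k) (b k) x @[k --> \oo] --> J x).
Proof.
move=> sk bk xAB; split => e.
  have cv : c (s k) * ((c (s k))^-1 * P (s k) (b k) x) @[k --> \oo] --> 0 * m be x.
    exact: (cvgM (cvg_harmonic_subseq sk) (piece_neg_cvg sk bk xAB e)).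
  rewrite mul0r in cv; apply: cvg_trans cv; apply: near_eq_cvg; apply: nearW => k /=.
  by rewrite mulrA divff ?mul1r// gt_eqF.
have ce : eb dl A B (b k) x @[k --> \oo] --> eb dl A B be x.
  by apply: (@cvg_for _ (fun be => eb dl A B be x)) bk; exact: continuous_eb_param.
apply: cvg_trans (near_eq_cvg _) (cvg_cst (J x)).
near=> k; have ek : eb dl A B (b k) x < 0 by near: k; exact: (cvgr_lt _ ce _ e).
by rewrite /P /cut /D ltNge (ltW ek).
Unshelve. all: by end_near.
Qed.

Lemma piece_neg_le k be x d : A < x < B -> 0 < d -> d <= eb dl A B be x ->
  (c k)^-1 * P k be x <= d `^ p.
Proof.
move=> xAB d0 de; have e0 := lt_le_trans d0 de.
rewrite /P /cut /D e0 ler_pdivrMl// ge_min; apply/orP; right; rewrite ler_pM2l// /m.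
by apply: powR_leneg => //; exact: ltW.
Qed.

(** If the limit parameter is an end of [0, 1], the limit model is S(|x - q|) ^ p with p <= -1,
    which is not integrable at q; by Fatou the rescaled pieces then have unbounded mass near q,
    against [no_concentration]. *)
Lemma no_end_neg (s : nat -> nat) (b : nat -> R) (be q : R) :
  (forall k, (k <= s k)%N) -> b k @[k --> \oo] --> be ->
  (forall k, \int[mu]_x (h x * P (s k) (b k) x) = 0) ->
  q = A \/ q = B -> (forall x, A <= x <= B -> eb dl A B be x = S `|x - q|) -> False.
Proof.
move=> sk bk HP qE Se.
have BA : 0 <= B - A by rewrite subr_ge0 ltW.
have xq x : A <= x <= B -> `|x - q| <= B - A by case: qE => ->; rewrite ler_norml; lra.
have e_gt0 x : A <= x <= B -> x != q -> 0 < eb dl A B be x.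
  move=> xAB nq; rewrite Se//; apply: s_delta_gt0; first by rewrite normr_gt0 subr_eq0.
  by apply: le_lt_trans hl'; rewrite lee_fin xq.
have [L L0 HL] := s_delta_lip dl BA.
apply: (@no_concentration (fun k => P (s k) (b k)) q) => //.
  by move=> k; exact: (cut_piece (mD _) (mcm _ _) (cm _ _) (HP k)).
move=> e e0.
have [[u [v [[Au uv vB] uvE nq]]] [u' [v' [uv' qE' uvE']]]] := end_neighborhood AB qE e0.
have e_uv x : u <= x <= v -> 0 < eb dl A B be x by move=> xi; apply: e_gt0; [lra|exact: nq].
have [d1 d10 Hd1] := eb_low Au uv vB e_uv bk.
exists (fun k => (c (s k))^-1), (d1 `^ p); split.
- by move=> k; rewrite invr_ge0 ltW.
- exact: powR_ge0.
- apply: filterS Hd1 => k Hk x xAB xe; apply: piece_neg_le => //; apply: Hk; exact: uvE.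
move=> W.
(* For 0 < y <= B - A, (L y) ^ p = (L y) ^ -1 (L y) ^ (p + 1) >= ka / y, because p + 1 <= 0. *)
pose ka := L^-1 * (L * (B - A)) `^ (p + 1).
have ka0 : 0 < ka by rewrite mulr_gt0 ?invr_gt0// powR_gt0// mulr_gt0// subr_gt0.
have [g [[mg g0] ig gq Wg]] := inv_dist_unbounded (W / ka) uv' qE'.
pose V : R -> R := \1_([set x | (`|x - q| < e)%R]).
have mV : measurable_fun setT V.
  apply: measurable_indic.
  have -> : [set x | (`|x - q| < e)%R] = [set x | - e < - `|x - q|].
    by apply/seteqP; split => x /=; rewrite ltrN2.
  apply: (@measurable_gt_set _ (- e) (fun x => - `|x - q|)).
  apply: continuous_measurable_fun => x; apply: cvgN; apply: cvg_norm.
  by apply: cvgB; [exact: cvg_id|exact: cvg_cst].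
have V01 x : 0 <= V x <= 1 by rewrite /V indic_pred; case: (_ < _)%R; rewrite ?lexx ?ler01.
have mf k : measurable_fun setT (fun x => (c (s k))^-1 * P (s k) (b k) x).
  by apply: measurable_funM => //; exact: measurable_cst.
have f0 k x : 0 <= (c (s k))^-1 * P (s k) (b k) x.
  by rewrite mulr_ge0 ?invr_ge0 ?(ltW (c0 _))//; case/andP: (bP (s k) (b k) x).
apply: (@Rint_liminf _ _ (fun x => ka * g x)).
- by move=> k; exact: measurable_funM.
- by apply: measurable_funM => //; exact: measurable_cst.
- by move=> k x; rewrite mulr_ge0//; case/andP: (V01 x).
- by move=> x; rewrite mulr_ge0 ?(ltW ka0).
- move=> k; have -> : EFin \o (fun x => (c (s k))^-1 * P (s k) (b k) x * V x) =
     EFin \o (fun x => ((c (s k))^-1 * V x) * P (s k) (b k) x).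
    by apply/funext => x /=; congr EFin; ring.
  apply: (@intg_mul _ _ _ `|(c (s k))^-1|).
  + by apply: measurable_funM => //; exact: measurable_cst.
  + by move=> x; rewrite normrM ler_piMr// ger0_norm; case/andP: (V01 x).
  + exact: between_intg.
- by apply: (@intg_mul _ (cst ka) _ `|ka|).
- apply: aeW => x; have := g0 x; rewrite le_eqVlt => /predU1P[gx|gx].
    rewrite -gx mulr0; apply: cvg_trans (near_eq_cvg _) (cvg_cst 0); apply: nearW => k.
    by rewrite min_r// mulr_ge0//; case/andP: (V01 x).
  have [xi gle] := gq x gx; have [xAB xqe] := uvE' x xi.
  have xAB' : A <= x <= B by lra.
  have xnq : x != q by apply/eqP => E; move: xi; rewrite E; case: qE' => ->; rewrite ltxx ?andbF.
  have y0 : 0 < `|x - q| by rewrite normr_gt0 subr_eq0.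
  have ex := e_gt0 x xAB' xnq.
  have Vx : V x = 1 by rewrite /V indic_pred xqe.
  rewrite -/(V x) Vx; under eq_fun do rewrite mulr1.
  have lim := piece_neg_cvg sk bk xAB ex.
  have kg : ka * g x <= m be x.
    have y1 : 0 <= `|x - q| <= B - A by rewrite ltW// xq.
    have Ly := HL _ y1; have Ly0 : 0 < L * `|x - q| by rewrite mulr_gt0.
    apply: (@le_trans _ _ (ka * `|x - q|^-1)); first by rewrite ler_pM2l.
    apply: (@le_trans _ _ ((L * `|x - q|) `^ p)); last first.
      rewrite /m Se//; apply: powR_leneg => //; last exact: ltW.
      by rewrite -Se.
    rewrite -(@powR_comp1 _ _ (-1) (p + 1))//; last by ring.
    rewrite (powR_inv1 (ltW Ly0)) invfM /ka mulrAC ler_pM2l ?mulr_gt0 ?invr_gt0//.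
    apply: powR_leneg => //; last by rewrite -lerBrDr sub0r.
    by rewrite ler_pM2l// xq.
  have cc : (fun=> ka * g x) k @[k --> \oo] --> ka * g x by exact: cvg_cst.
  have cv : Num.min ((c (s k))^-1 * P (s k) (b k) x) (ka * g x) @[k --> \oo] -->
      Num.min (m be x) (ka * g x) by exact: (cvg_minr lim cc).
  by rewrite (min_r kg) in cv; exact: cv.
- by rewrite RintegralZl// mulrC -ltr_pdivrMr.
Qed.

Lemma endgame_neg : exists2 be, 0 < be < 1 & good_model (fun x => eb dl A B be x `^ p).
Proof.
have [s [b [be [sk be01 bk HP]]]] := selection S0 mP bP continuous_piece_neg piece_neg_lim.
have [E0|be0] := eqVneq be 0.
  exfalso; apply: (no_end_neg sk bk HP (q := B)); first by right.
  move=> x /andP[_ xB]; rewrite E0 /eb subr0 mul1r mul0r addr0.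
  by rewrite ler0_norm ?subr_le0// opprB.
have [E1|be1] := eqVneq be 1.
  exfalso; apply: (no_end_neg sk bk HP (q := A)); first by left.
  move=> x /andP[Ax _]; rewrite E1 /eb subrr mul1r mul0r add0r.
  by rewrite ger0_norm// subr_ge0.
have b0 : 0 < be by rewrite lt_neqAle eq_sym be0; case/andP: be01.
have b1 : be < 1 by rewrite lt_neqAle be1; case/andP: be01.
exists be; first by rewrite b0.
(* For a parameter strictly between 0 and 1 positivity extends to the closed interval, so [eb_low]
   bounds the negative powers uniformly and dominated convergence applies. *)
have e_gt0 x : A <= x <= B -> 0 < eb dl A B be x.
  have [->|xA] := eqVneq x A; first by rewrite ebA mulr_gt0 ?subr_gt0.
  have [->|xB] := eqVneq x B; first by rewrite ebB mulr_gt0.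
  by move=> /andP[h1 h2]; apply: eb_gt0 => //; rewrite !lt_neqAle eq_sym xA xB h1 h2.
have [d1 d10 [n0 _ Hn0]] := eb_low (lexx A) (ltW AB) (lexx B) e_gt0 bk.
have bk' : b (k + n0)%N @[k --> \oo] --> be.
  by apply: (@cvg_subseq _ _ (fun k => (k + n0)%N)) bk => i j; rewrite ltn_add2r.
have sk' k : (k <= s (k + n0))%N by rewrite (leq_trans _ (sk _))// leq_addr.
apply: (@good_model_limit (fun k => P (s (k + n0)%N) (b (k + n0)%N))
   (fun k => (c (s (k + n0)%N))^-1) _ (d1 `^ p)).
- by move=> k; exact: mP.
- exact: mm.
- by move=> k; rewrite invr_ge0 ltW.
- move=> k x; have /andP[P0 PJ] := bP (s (k + n0)%N) (b (k + n0)%N) x; split => //.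
  rewrite IABE; case: (boolP (A < x < B)) => xAB; last first.
    rewrite Jout// in PJ; have -> : P (s (k + n0)%N) (b (k + n0)%N) x = 0.
      by apply/eqP; rewrite eq_le PJ P0.
    by rewrite !mulr0.
  rewrite mulr1; apply: piece_neg_le => //; apply: (Hn0 (k + n0)%N (leq_addl _ _)).
  by case/andP: xAB => /ltW -> /ltW ->.
- move=> x xAB; apply: (piece_neg_cvg sk' bk' xAB); apply: e_gt0.
  by case/andP: xAB => /ltW -> /ltW ->.
- move=> x xAB; rewrite powR_gt0// e_gt0//.
  by case/andP: xAB => /ltW -> /ltW ->.
- by move=> k; exact: HP.
- by move=> k; exact: (cut_piece (mD _) (mcm _ _) (cm _ _) (HP _)).
- by move=> k; exact: between_intg.
Qed.

End exponent_neg.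

(** * The case N = +oo: Gaussian models with free slope *)

Section exponent_infty.
Hypothesis NE : N = +oo%E.

Let SE x : s_delta dl x = x.
Proof. by rewrite NE /s_delta/= ltxx eqxx. Qed.

Let S0 : 0 < s_delta dl (B - A). Proof. by rewrite SE subr_gt0. Qed.

Let ebE be x y : eb dl A B be x = eb dl A B be y + (2 * be - 1) * (x - y).
Proof. by rewrite /eb !SE; ring. Qed.

Let eb_cvg (b : nat -> R) (be x : R) : b k @[k --> \oo] --> be ->
  eb dl A B (b k) x @[k --> \oo] --> eb dl A B be x.
Proof. by move=> bk; apply: (@cvg_for _ (fun be => eb dl A B be x)) bk; exact: continuous_eb_param. Qed.

Let g0 x := expR (- (K * x ^+ 2 / 2)).
Let g00 x : 0 < g0 x. Proof. exact: expR_gt0. Qed.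
(** Here [eb] is an affine function of x. The factor k + 1 replaces the small factors of the finite
    case: it drives the model to 0 where eb > 0 and to +oo where eb < 0, and it lets the slope
    become arbitrarily large. *)
Let m k be x := expR (- (k.+1%:R * eb dl A B be x) - K * x ^+ 2 / 2).
Let P k be := cut predT (m k be) J.

Let PE k be x : P k be x = Num.min (J x) (m k be x). Proof. by []. Qed.

Let mm k be : measurable_fun setT (m k be).
Proof.
apply: (measurableT_comp (@measurable_expR R)); apply: continuous_measurable_fun => x.
apply: cvgB; first by apply: cvgN; apply: cvgMr; exact: continuous_eb.
by apply: cvgMl; apply: cvgMr; exact: exprn_continuous.
Qed.

Lemma cutter_infty k be : cutter K N A B predT (m k be).
Proof.
split => [x _|x y t xi yi xy t01 z]; first exact: expR_gt0.
have dr := inside_range hl xi yi xy.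
have E : gmean K N t (y - x) (m k be x) (m k be y) = m k be z.
  rewrite NE /gmean /m /powR !gt_eqF ?expR_gt0// !expRK -!expRD; congr expR.
  by rewrite (ebE be x z) (ebE be y z) /z; field.
split => [_ a b a0 b0 ha hb|_ _]; last by rewrite E.
by rewrite -E; apply: gmean_le => //; [exact: ha|exact: hb].
Qed.

Let mP k be : measurable_fun setT (P k be).
Proof. by apply: measurable_cut => //; exact: measurable_cst. Qed.

Let bP k be x : 0 <= P k be x <= J x.
Proof. exact: (cut_bounds (cutter_infty k be).1).1. Qed.

Lemma continuous_piece_infty k x : continuous (fun be => P k be x).
Proof.
move=> be; apply: cvg_minr; first exact: cvg_cst.
apply: (@cvg_for _ expR); first exact: continuous_expR.
apply: cvgB; last exact: cvg_cst.
by apply: cvgN; apply: cvgMr; exact: continuous_eb_param.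
Qed.

Let mE k be x : m k be x = expR (- (k.+1%:R * eb dl A B be x)) * g0 x.
Proof. by rewrite /m /g0 -expRD. Qed.

Lemma piece_infty_lim (s : nat -> nat) (b : nat -> R) (be x : R) : (forall k, (k <= s k)%N) ->
  b k @[k --> \oo] --> be -> A < x < B ->
  (0 < eb dl A B be x -> P (s k) (b k) x @[k --> \oo] --> 0) /\
  (eb dl A B be x < 0 -> P (s k) (b k) x @[k --> \oo] --> J x).
Proof.
move=> sk bk xAB; have Jx := (Jpos x).2 xAB; have ce := eb_cvg (x := x) bk; split => e.
  have cm : m (s k) (b k) x @[k --> \oo] --> 0 * g0 x.
    under eq_fun do rewrite mE.
    by apply: cvgM; [apply: cvg_expRN; exact: cvg_scaled_pinfty ce e|exact: cvg_cst].
  rewrite mul0r in cm.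
  apply: (@squeeze_cvgr _ _ _ _ (fun=> 0) (fun k => m (s k) (b k) x)) => //.
    by apply: nearW => k; have /andP[-> _] := bP (s k) (b k) x; rewrite PE ge_min lexx orbT.
  exact: cvg_cst.
have e' : 0 < - eb dl A B be x by rewrite oppr_gt0.
have ce' : - eb dl A B (b k) x @[k --> \oo] --> - eb dl A B be x by exact: cvgN.
have /cvgryPge H := cvg_scaled_pinfty sk ce' e'.
apply: cvg_trans (near_eq_cvg _) (cvg_cst (J x)); near=> k.
rewrite PE min_l// mE -ler_pdivrMr//.
have le : J x / g0 x <= (s k).+1%:R * - eb dl A B (b k) x by near: k; exact: H.
apply: (le_trans le); rewrite mulrN; apply: le_trans (expR_ge1Dx _).
by rewrite lerDr.
Unshelve. all: by end_near.
Qed.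

(** [lam] rescales the model to take the value [g0] at x0, and [kap] is the exponential slope that
    remains around x0; the limit behaviour of [kap] decides everything. *)
Let lam (s : nat -> nat) (b : nat -> R) x0 k := expR ((s k).+1%:R * eb dl A B (b k) x0).
Let kap (s : nat -> nat) (b : nat -> R) k := (s k).+1%:R * (2 * b k - 1).

Let lam0 s b x0 k : 0 < lam s b x0 k. Proof. exact: expR_gt0. Qed.

Let lamPE s b x0 k x : lam s b x0 k * P (s k) (b k) x =
  Num.min (lam s b x0 k * J x) (expR (- (kap s b k * (x - x0))) * g0 x).
Proof.
rewrite PE minr_pMr ?ltW//; congr Num.min; rewrite mE mulrA /lam -expRD.
by congr (expR _ * _); rewrite (ebE (b k) x x0) /kap; ring.
Qed.

Let lam_pinfty (s : nat -> nat) (b : nat -> R) (be x0 : R) : (forall k, (k <= s k)%N) -> b k @[k --> \oo] --> be ->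
  0 <= be <= 1 -> A < x0 < B -> (s k).+1%:R * eb dl A B (b k) x0 @[k --> \oo] --> +oo.
Proof.
move=> sk bk be01 x0AB; apply: (cvg_scaled_pinfty sk (eb_cvg (x := x0) bk)).
exact: eb_gt0.
Qed.

Let g0_bounded : exists2 C, 0 < C & forall x, A < x < B -> g0 x <= C.
Proof.
exists (expR (`|K| * (`|A| + `|B|) ^+ 2 / 2)) => [|x xAB]; first exact: expR_gt0.
rewrite /g0 ler_expR; apply: (le_trans (ler_norm _)); rewrite normrN normrM normfV [`|K * _|]normrM normrX.
rewrite (ger0_norm (ler0n _ 2)) ler_wpM2r ?invr_ge0// ler_wpM2l//.
rewrite ler_pXn2r ?nnegrE ?addr_ge0// ler_norml.
have := ler_norm A; have := ler_norm B; have := ler_norm (- A); have := ler_norm (- B).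
rewrite !normrN; have := normr_ge0 A; have := normr_ge0 B.
by move: xAB; move: `|A| `|B| => a b; lra.
Qed.

(** The exponent is - (sgn kap) (|x - q| - |x0 - q|) with sgn kap tending to +oo: the rescaled model
    stays bounded at points farther from q than x0 and explodes at closer ones. This is
    concentration at q. *)
Lemma no_end_infty (s : nat -> nat) (b : nat -> R) (be q sgn : R) : (forall k, (k <= s k)%N) -> b k @[k --> \oo] --> be ->
  0 <= be <= 1 -> (forall k, \int[mu]_x (h x * P (s k) (b k) x) = 0) ->
  q = A \/ q = B -> sgn * sgn = 1 -> (forall x, A < x < B -> sgn * (x - q) = `|x - q|) ->
  sgn * kap s b k @[k --> \oo] --> +oo -> False.
Proof.
move=> sk bk be01 HP qE sgn2 qs kk.
apply: (@no_concentration (fun k => P (s k) (b k)) q) => //.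
  by move=> k; exact: (cut_piece (measurable_cst _) (mm _ _) (cutter_infty _ _) (HP _)).
move=> e e0; have [_ [u [v [uv qE' uvE]]]] := end_neighborhood AB qE e0.
(* The reference point is within e of q, so that all points at distance at least e fall in the
   bounded region. *)
pose x0 := (u + v) / 2; have x0uv : u < x0 < v by rewrite /x0; lra.
have [x0AB x0q] := uvE _ x0uv.
have [C C0 HC] := g0_bounded; have ll := lam_pinfty sk bk be01 x0AB.
exists (lam s b x0), C; split => [k||//|].
- exact: ltW.
- exact: ltW.
- near=> k; move=> x xAB xe; rewrite lamPE ge_min; apply/orP; right.
  apply: le_trans (HC _ xAB); rewrite ler_piMl ?(ltW (g00 _))// -[leRHS]expR0 ler_expR oppr_le0.
  have -> : kap s b k * (x - x0) = (sgn * kap s b k) * (sgn * (x - q) - sgn * (x0 - q)).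
    by rewrite -[LHS]mul1r -sgn2; ring.
  rewrite !qs// mulr_ge0//; last by rewrite subr_ge0 ltW// (lt_le_trans x0q).
  by near: k; move/cvgryPge: kk; apply.
move=> W.
have [u1 [v1 [uv1 sub]]] : exists u1 v1, u1 < v1 /\ forall x, u1 < x < v1 ->
    (A < x < B /\ `|x - q| < e) /\ 0 < sgn * (x0 - x).
  have key x : u < x < v -> `|x - q| < `|x0 - q| -> (A < x < B /\ `|x - q| < e) /\ 0 < sgn * (x0 - x).
    move=> xuv lt; have [xAB xe] := uvE x xuv; split => //.
    have -> : sgn * (x0 - x) = sgn * (x0 - q) - sgn * (x - q) by ring.
    by rewrite !qs// subr_gt0.
  case: qE' => qE'.
    exists u, x0; split; first by case/andP: x0uv.
    move=> x /andP[ux xx0]; apply: key; first by rewrite ux (lt_trans xx0)//; case/andP: x0uv.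
    have uq : 0 < x - q by rewrite subr_gt0 qE'.
    by rewrite !gtr0_norm ?ltrD2r// subr_gt0 qE'; case/andP: x0uv.
  exists x0, v; split; first by case/andP: x0uv.
  move=> x /andP[ux xx0]; apply: key; first by rewrite xx0 andbT (lt_trans _ ux)//; case/andP: x0uv.
  have uq : x - q < 0 by rewrite subr_lt0 qE'.
  by rewrite !ltr0_norm ?ltrN2 ?ltrD2r// subr_lt0 qE'; case/andP: x0uv.
pose V : R -> R := \1_([set x | (`|x - q| < e)%R]).
have mV : measurable_fun setT V.
  apply: measurable_indic.
  have -> : [set x | (`|x - q| < e)%R] = [set x | - e < - `|x - q|].
    by apply/seteqP; split => x /=; rewrite ltrN2.
  apply: (@measurable_gt_set _ (- e) (fun x => - `|x - q|)).
  apply: continuous_measurable_fun => x; apply: cvgN; apply: cvg_norm.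
  by apply: cvgB; [exact: cvg_id|exact: cvg_cst].
have V01 x : 0 <= V x <= 1 by rewrite /V indic_pred; case: (_ < _)%R; rewrite ?lexx ?ler01.
have mf k : measurable_fun setT (fun x => lam s b x0 k * P (s k) (b k) x).
  by apply: measurable_funM => //; exact: measurable_cst.
have f0 k x : 0 <= lam s b x0 k * P (s k) (b k) x.
  by rewrite mulr_ge0 ?(ltW (lam0 _ _ _ _))//; case/andP: (bP (s k) (b k) x).
apply: (@Rint_unbounded _ _ u1 v1) => //.
- by move=> k; exact: measurable_funM.
- by move=> k x; rewrite mulr_ge0//; case/andP: (V01 x).
- move=> k; have -> : EFin \o (fun x => lam s b x0 k * P (s k) (b k) x * V x) =
     EFin \o (fun x => (lam s b x0 k * V x) * P (s k) (b k) x).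
    by apply/funext => x /=; congr EFin; ring.
  apply: (@intg_mul _ _ _ `|lam s b x0 k|).
  + by apply: measurable_funM => //; exact: measurable_cst.
  + by move=> x; rewrite normrM ler_piMr// ger0_norm; case/andP: (V01 x).
  + exact: between_intg.
- move=> x /sub[[xAB xe] d0]; have Jx := (Jpos x).2 xAB.
  have Vx : V x = 1 by rewrite /V indic_pred xe.
  rewrite -/(V x) Vx; under eq_fun do rewrite mulr1 lamPE.
  apply/cvgryPge => T; near=> k; rewrite le_min; apply/andP; split.
    rewrite -ler_pdivrMr//.
    have h1 : T / J x <= (s k).+1%:R * eb dl A B (b k) x0 by near: k; move/cvgryPge: ll; apply.
    by apply: (le_trans h1); apply: le_trans (expR_ge1Dx _); rewrite lerDr.
  rewrite -ler_pdivrMr//.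
  have -> : - (kap s b k * (x - x0)) = (sgn * kap s b k) * (sgn * (x0 - x)).
    by rewrite -[LHS]mul1r -sgn2; ring.
  apply: le_trans (expR_ge1Dx _); apply: (@le_trans _ _ (sgn * kap s b k * (sgn * (x0 - x)))).
    by rewrite -ler_pdivrMr//; near: k; move/cvgryPge: kk; apply.
  by rewrite lerDr.
Unshelve. all: by end_near.
Qed.

(** Slopes tending to +oo or -oo would concentrate the pieces at A or at B; a finite limit l of the
    slopes gives the model with linear coefficient - l. *)
Lemma endgame_infty : exists ka, good_model (fun x => expR (ka * x - K * x ^+ 2 / 2)).
Proof.
have [s' [b' [be [sk' be01 bk' HP']]]] := selection S0 mP bP continuous_piece_infty piece_infty_lim.
have [t [tinc tri]] := subseq_trichotomy (kap s' b').
pose s k := s' (t k); pose b k := b' (t k).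
have sk k : (k <= s k)%N by rewrite (leq_trans (subseq_ge tinc k)).
have bk : b k @[k --> \oo] --> be := cvg_subseq tinc bk'.
have HP k : \int[mu]_x (h x * P (s k) (b k) x) = 0 by exact: HP'.
case: tri => [[l kl]|kl|kl]; last 2 first.
- exfalso; apply: (no_end_infty sk bk be01 HP (q := A) (sgn := 1)); rewrite ?mulr1//.
  + by left.
  + by move=> x /andP[Ax _]; rewrite mul1r gtr0_norm// subr_gt0.
  + by under eq_fun do rewrite mul1r.
- exfalso; apply: (no_end_infty sk bk be01 HP (q := B) (sgn := -1)).
  + by right.
  + by rewrite mulrNN mulr1.
  + by move=> x /andP[_ xB]; rewrite mulN1r ltr0_norm// subr_lt0.
  + under eq_fun do rewrite mulN1r; apply/cvgryPge => T.
    move/cvgrNyPle: kl => /(_ (- T)); apply: filterS => k /=.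
    by rewrite lerNr.
pose x0 := (A + B) / 2; have x0AB : A < x0 < B by rewrite /x0; move: AB; lra.
have x0d x : A < x < B -> `|x - x0| <= B - A by rewrite ler_norml /x0; lra.
have [C C0 HC] := g0_bounded; have ll := lam_pinfty sk bk be01 x0AB.
have [n0 _ Hn0] : \forall k \near \oo, `|kap s b k| <= `|l| + 1.
  have h1 := cvgrPdist_lt; have /cvgrPdist_lt/(_ 1 ltr01) H := kl.
  near=> k; have : `|l - kap s b k| < 1 by near: k; exact: H.
  have := ler_normB l (l - kap s b k); rewrite opprB addrCA subrr addr0.
  by move: `|_ - _| => z; lra.
pose sh k := (k + n0)%N.
have shc : {homo sh : i j / (i < j)%N} by move=> i j; rewrite ltn_add2r.
pose ka := - l; exists ka.
have eE x : expR (ka * x - K * x ^+ 2 / 2) = expR (- (l * x0)) * (expR (- (l * (x - x0))) * g0 x).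
  by rewrite /g0 -!expRD; congr expR; rewrite /ka; ring.
pose mo x := expR (- (l * x0)) * (expR (- (l * (x - x0))) * g0 x).
have -> : (fun x => expR (ka * x - K * x ^+ 2 / 2)) = mo by apply/funext => x; rewrite eE.
apply: (@good_model_limit (fun k => P (s (sh k)) (b (sh k)))
   (fun k => expR (- (l * x0)) * lam s b x0 (sh k)) mo
   (expR (- (l * x0)) * (expR ((`|l| + 1) * (B - A)) * C))).
- by move=> k; exact: mP.
- rewrite /mo; under eq_fun do rewrite -eE.
  apply: (measurableT_comp (@measurable_expR R)); apply: continuous_measurable_fun => x.
  apply: cvgB; first by apply: cvgMr; exact: cvg_id.
  by apply: cvgMl; apply: cvgMr; exact: exprn_continuous.
- by move=> k; rewrite mulr_ge0 ?expR_ge0.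
- move=> k x; have /andP[P0 PJ] := bP (s (sh k)) (b (sh k)) x; split => //.
  rewrite IABE; case: (boolP (A < x < B)) => xAB; last first.
    rewrite Jout// in PJ; have -> : P (s (sh k)) (b (sh k)) x = 0.
      by apply/eqP; rewrite eq_le PJ P0.
    by rewrite !mulr0.
  rewrite mulr1 -mulrA ler_pM2l ?expR_gt0// lamPE ge_min; apply/orP; right.
  apply: ler_pM; rewrite ?expR_ge0//; last exact: HC.
  rewrite ler_expR; apply: (le_trans (ler_norm _)); rewrite normrN normrM.
  apply: ler_pM => //; first exact: (Hn0 (sh k) (leq_addl _ _)).
  exact: x0d.
- move=> x xAB; have Jx := (Jpos x).2 xAB.
  rewrite /mo; under eq_fun do rewrite -mulrA; apply: cvgMr.
  have gl : expR (- (kap s b (sh k) * (x - x0))) * g0 x @[k --> \oo] --> expR (- (l * (x - x0))) * g0 x.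
    apply: cvgMl; apply: (@cvg_for _ expR); first exact: continuous_expR.
    by apply: cvgN; apply: cvgMl; exact: (cvg_subseq shc kl).
  have cl : expR (- ((s (sh k)).+1%:R * eb dl A B (b (sh k)) x0)) @[k --> \oo] --> (0 : R).
    apply: cvg_expRN; apply: (@lam_pinfty (s \o sh) (b \o sh) be x0 _ (cvg_subseq shc bk)) => // i.
    exact: leq_trans (leq_addr _ _) (sk _).
  have := rescaled_min Jx (fun k => expR_gt0 _) cl gl.
  apply: cvg_trans; apply: near_eq_cvg; apply: nearW => k.
  rewrite -expRN opprK PE; congr (_ * Num.min _ _).
  rewrite mulrA -expRD mE; congr (expR _ * _).
  by rewrite (ebE (b (sh k)) x x0) /kap; ring.
- by move=> x _; rewrite /mo mulr_gt0 ?expR_gt0// mulr_gt0 ?expR_gt0.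
- by move=> k; exact: HP.
- by move=> k; exact: (cut_piece (measurable_cst _) (mm _ _) (cutter_infty _ _) (HP _)).
- by move=> k; exact: between_intg.
Unshelve. all: by end_near.
Qed.

End exponent_infty.

End endgame.

(** * The localization theorem *)

Section localization.
Context {R : realType} (K : R) (N : \bar R).
Hypothesis hN : dimension_range N.
Local Notation mu := (@lebesgue_measure R).
Local Notation intg f := (mu.-integrable setT (EFin \o f)).

Definition model_piece (A B : R) (g : R -> R) := exists r c b, [/\ A < r < B, 0 < c,
  forall x, A - r < x < B - r -> model_domain K N b x &
  forall x, A < x < B -> g x = c * model_density K N b (x - r)].

(** Expanded around any r inside, [eb] is a C(x - r) + d S(x - r) with a > 0. Dividing by a gives
    the base of the model with h / (n - 1) = d / a. *)
Lemma eb_model_piece (A B be n : R) : N = n%:E -> A < B ->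
  (forall x, A < x < B -> 0 < eb (delta K N) A B be x) ->
  model_piece A B (fun x => eb (delta K N) A B be x `^ (n - 1)).
Proof.
move=> NE AB e0.
have n1 : n - 1 != 0.
  by case: (dimension_exponent hN NE) => p1; [rewrite lt_eqF|rewrite gt_eqF ?(lt_le_trans ltr01)].
have [r rAB] : exists r, A < r < B by exists ((A + B) / 2); lra.
set dl := delta K N in e0 *.
pose a := eb dl A B be r; have a0 : 0 < a by exact: e0.
pose d := be * c_delta dl (r - A) - (1 - be) * c_delta dl (B - r).
have eE x : eb dl A B be x = a * c_delta dl (x - r) + d * s_delta dl (x - r).
  rewrite /eb; have -> : B - x = (B - r) - (x - r) by ring.
  have {1}-> : x - A = (r - A) + (x - r) by ring.
  by rewrite (@s_deltaB _ dl (B - r) (x - r)) (@s_deltaD _ dl (r - A) (x - r)) /a /d /eb; ring.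
pose b := (n - 1) * (d / a).
have bE x : model_base K n b (x - r) = eb dl A B be x / a.
  have E : b / (n - 1) = d / a by rewrite /b mulrAC divff// mul1r.
  rewrite /model_base -NE -/dl E eE.
  by have := a0; move: (c_delta _ _) (s_delta _ _) => u v a0'; field; rewrite gt_eqF.
exists r, (a `^ (n - 1)), b; split => //.
- by rewrite powR_gt0.
- move=> x xI; rewrite /model_domain NE; exists `]A - r, B - r[%classic; last first.
    by rewrite /= in_itv.
  split; [exact: interval_is_interval|exact: interval_open| |].
    by rewrite /= in_itv/=; lra.
  move=> y; rewrite /= in_itv/= => yI.
  have -> : y = (y + r) - r by ring.
  by rewrite bE divr_gt0// e0//; lra.
move=> x xI; rewrite /model_density NE bE.
exact: powR_split (e0 _ xI) a0.
Qed.

Lemma exp_model_piece (A B ka : R) : N = +oo%E -> A < B ->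
  model_piece A B (fun x => expR (ka * x - K * x ^+ 2 / 2)).
Proof.
move=> NE AB; have [r rAB] : exists r, A < r < B by exists ((A + B) / 2); lra.
exists r, (expR (ka * r - K * r ^+ 2 / 2)), (ka - K * r); split => [//||x _|x _].
- exact: expR_gt0.
- by rewrite NE.
- by rewrite NE /model_density -expRD; congr expR; field.
Qed.

(** At each point one of h, - h, phi is positive, hence on a ball; were the radii not bounded below
    on [a, b], a limit of bad centers would contradict the ball around it. *)
Lemma continuous_sign_uniform (h phi : R -> R) (a b : R) : continuous h -> continuous phi ->
  (forall x, h x = 0 -> 0 < phi x) ->
  exists e : R, 0 < e /\ forall x, a <= x <= b ->
    (forall y, `|y - x| < e -> 0 < h y) \/ (forall y, `|y - x| < e -> h y < 0) \/
    (forall y, `|y - x| < e -> 0 < phi y).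
Proof.
move=> ch cphi hphi; apply: contrapT => /forallNP H.
pose Q (x e : R) := (forall y, `|y - x| < e -> 0 < h y) \/ (forall y, `|y - x| < e -> h y < 0) \/
    (forall y, `|y - x| < e -> 0 < phi y).
have {}H (n : nat) : exists x, a <= x <= b /\ ~ Q x n.+1%:R^-1.
  apply: contrapT => /forallNP H1; apply: (H n.+1%:R^-1); split; first by rewrite invr_gt0.
  by move=> x xab; apply: contrapT => nQ; apply: (H1 x).
have [u Hu] := choice H.
have [x [t [xab tinc tcv]]] := bolzano_weierstrass (fun n => (Hu n).1).
have [d d0 Hd] : exists2 d, 0 < d & Q x d.
  have ball (k : R -> R) : continuous k -> 0 < k x ->
      exists2 d : R, 0 < d & forall y, `|y - x| < d -> 0 < k y.
    move=> ck k0; have : \forall y \near x, 0 < k y by exact: (cvgr_gt _ (ck x)).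
    move=> /nbhs_ballP[e /= e0 He]; exists e => // y yx; apply: He.
    by rewrite /ball/= distrC.
  have [hx|hx|hx] := ltgtP (h x) 0.
  - have cN : continuous (fun y => - h y) by move=> y; apply: cvgN; exact: ch.
    have nh : 0 < - h x by rewrite oppr_gt0.
    have [d d0 Hd] := ball _ cN nh.
    by exists d => //; right; left => y /Hd; rewrite oppr_gt0.
  - by have [d d0 Hd] := ball h ch hx; exists d => //; left.
  - by have [d d0 Hd] := ball phi cphi (hphi _ hx); exists d => //; right; right.
have d2 : 0 < d / 2 by rewrite divr_gt0.
have := cvg_subseq tinc (@cvg_harmonic R) => /cvgr_lt/(_ _ d2) h1.
near \oo => n.
have xn : `|x - u (t n)| < d / 2 by near: n; move/cvgrPdist_lt: tcv; apply.
have tn : (t n).+1%:R^-1 < d / 2 by near: n; exact: h1.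
apply: (Hu (t n)).2.
have sub y : `|y - u (t n)| < (t n).+1%:R^-1 -> `|y - x| < d.
  move=> yu; have -> : y - x = (y - u (t n)) - (x - u (t n)) by ring.
  apply: (le_lt_trans (ler_normB _ _)); apply: (lt_le_trans (ltrD yu xn)).
  by rewrite [leRHS](splitr d) lerD2r ltW.
by case: Hd => [Hd|[Hd|Hd]]; [left|right; left|right; right] => y /sub/Hd.
Unshelve. all: by end_near.
Qed.

Lemma continuous_head (k : R -> R) : measurable_fun setT k -> intg k ->
  continuous (fun c => \int[mu]_x (k x * \1_(`]-oo, c[%classic : set R) x)).
Proof.
move=> mk ik; have mI c : measurable_fun setT (\1_(`]-oo, c[%classic : set R) : R -> R).
  by apply: measurable_indic; exact: measurable_itv.
have IE c x : \1_(`]-oo, c[%classic : set R) x = (x < c)%R%:R :> R.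
  by rewrite indicE mem_setE in_itv.
move=> c; apply/(@cvg_nbhsP _ R^o) => u uc.
have uc' : (u n : R) @[n --> \oo] --> (c : R) by exact: uc.
apply: (@Rint_dct _ _ _ (fun x => `|k x|)).
- by move=> n; exact: measurable_funM.
- exact: measurable_funM.
- exact: integrable_norm.
- by move=> n x; rewrite normrM ler_piMr// IE; case: (_ < _)%R; rewrite ?normr1 ?normr0.
- apply: (@ae_except3 _ _ c c c) => x xc _ _; apply: cvgMr.
  rewrite IE; under eq_fun do rewrite IE.
  apply: cvg_trans (near_eq_cvg _) (cvg_cst ((x < c)%R%:R : R)).
  have [xl|xl] := ltP x c.
    have ev : \forall n \near \oo, x < u n by exact: (cvgr_gt _ uc' _ xl).
    by near=> n; congr (_%:R); congr nat_of_bool; apply/esym; near: n.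
  have {xl}xl : c < x by rewrite lt_neqAle eq_sym xc.
  have ev : \forall n \near \oo, u n < x by exact: (cvgr_lt _ uc' _ xl).
  near=> n; congr (_%:R); congr nat_of_bool; apply/esym/negbTE.
  by rewrite -leNgt; apply: ltW; near: n.
Unshelve. all: by end_near.
Qed.

(** A continuous function without zeros on an interval has one sign. *)
Lemma head_sign (h J : R -> R) (M A B : R) : measurable_fun setT h -> (forall x, `|h x| <= M) ->
  measurable_fun setT J -> intg J -> (forall x, 0 <= J x) ->
  (forall c, A < c < B -> \int[mu]_x (h x * (J x * \1_(`]-oo, c[%classic : set R) x)) <> 0) ->
  (forall c, A < c < B -> 0 < \int[mu]_x (h x * (J x * \1_(`]-oo, c[%classic : set R) x))) \/
  (forall c, A < c < B -> \int[mu]_x (h x * (J x * \1_(`]-oo, c[%classic : set R) x)) < 0).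
Proof.
move=> mh hM mJ iJ J0 H.
pose F c := \int[mu]_x (h x * (J x * \1_(`]-oo, c[%classic : set R) x)).
have cF : continuous F.
  rewrite (_ : F = fun c => \int[mu]_x (h x * J x * \1_(`]-oo, c[%classic : set R) x)).
    by apply: continuous_head; [exact: measurable_funM|exact: intg_mul hM iJ].
  by apply/funext => c; congr Rintegral; apply/funext => x; rewrite mulrA.
apply: contrapT => /not_orP[/existsNP[c1 /not_implyP[c1AB /negP]]].
rewrite -leNgt => n1 /existsNP[c2 /not_implyP[c2AB /negP]]; rewrite -leNgt => n2.
have [c [cI /H]] : exists c, Num.min c1 c2 <= c <= Num.max c1 c2 /\ F c = 0.
  have [c12|c12] := leP c1 c2; apply: continuous_root => //; [|exact: ltW|].
  - by apply/orP; left; apply/andP.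
  - by apply/orP; right; apply/andP.
apply; move: cI c1AB c2AB; have [c12|c12] := leP c1 c2; lra.
Unshelve. all: by end_near.
Qed.

Theorem localization (h phi J0 : R -> R) (M a0 b0 : R) : continuous h -> continuous phi ->
  (forall x, `|h x| <= M) -> (forall x, `|phi x| <= M) -> (forall x, h x = 0 -> 0 <= phi x) ->
  a0 < b0 -> ((b0 - a0)%:E <= l_delta (delta K N))%E ->
  ((N <= 0)%E -> ((b0 - a0)%:E < l_delta (delta K N))%E) ->
  measurable_fun setT J0 -> intg J0 -> (forall x, 0 <= J0 x) -> inside a0 b0 J0 -> CD K N J0 ->
  \int[mu]_x (h x * J0 x) = 0 -> \int[mu]_x (phi x * J0 x) < 0 ->
  exists A B g, [/\ [/\ a0 <= A, A < B & B <= b0], model_piece A B g,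
    [/\ measurable_fun setT g, forall x, A < x < B -> 0 < g x &
        intg (fun x => g x * \1_(`]A, B[%classic : set R) x)],
    \int[mu]_x (h x * (g x * \1_(`]A, B[%classic : set R) x)) = 0 &
    \int[mu]_x (phi x * (g x * \1_(`]A, B[%classic : set R) x)) < 0].
Proof.
move=> ch cphi hM phiM hphi ab hl hl' mJ0 iJ0 J00 insJ0 cJ0 HJ0 PJ0.
have mJpos := Rintegral_ge0.
pose w := \int[mu]_x (phi x * J0 x); pose q := \int[mu]_x J0 x.
have q0 : 0 <= q by apply: Rintegral_ge0.
(* Then c q <= - w / 2, so the integral of phi + c against J0 is still negative. *)
pose c := - w / (2 * (q + 1)).
have c0 : 0 < c by rewrite divr_gt0 ?oppr_gt0// mulr_gt0// ltr_wpDl.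
have mphi : measurable_fun setT phi by exact: continuous_measurable_fun.
have mh : measurable_fun setT h by exact: continuous_measurable_fun.
pose phi' x := phi x + c.
have cphi' : continuous phi' by move=> x; apply: cvgD; [exact: cphi|exact: cvg_cst].
have mphi' : measurable_fun setT phi' by exact: continuous_measurable_fun.
have hM' x : `|h x| <= M + c by rewrite (le_trans (hM x))// lerDl ltW.
have phiM' x : `|phi' x| <= M + c.
  by rewrite (le_trans (ler_normD _ _))// lerD// ger0_norm// ltW.
have hphi' x : h x = 0 -> 0 < phi' x by move=> /hphi p0; rewrite /phi' ltr_wpDl.
have split_phi (G : R -> R) : intg G ->
    \int[mu]_x (phi' x * G x) = \int[mu]_x (phi x * G x) + c * \int[mu]_x G x.
  move=> iG; rewrite /phi'; under eq_Rintegral do rewrite mulrDl.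
  rewrite RintegralD// ?RintegralZl//; first exact: intg_mul phiM iG.
  by apply: (@intg_mul _ (cst c) _ `|c|).
have PJ0' : \int[mu]_x (phi' x * J0 x) < 0.
  rewrite split_phi// -/w -/q; have q1 : 0 < q + 1 by rewrite ltr_wpDl.
  have : c * q <= c * (q + 1) by rewrite ler_pM2l// lerDl.
  have -> : c * (q + 1) = - w / 2 by rewrite /c; field; rewrite gt_eqF.
  have : w < 0 by [].
  by move: (c * q) => z; lra.
have short := continuous_sign_uniform a0 b0 ch cphi' hphi'.
have [J [A [B [[aA AB Bb Jpos] [mJ bJ] cJ HJ [piece Hc]]]]] :=
  minimal_density hl mh mphi' hM' phiM' short mJ0 iJ0 J00 insJ0 cJ0 ab HJ0 PJ0'.
have J0' x : 0 <= J x by case/andP: (bJ x).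
have iJ : intg J.
  by apply: intg_dom mJ _ iJ0 => x; have /andP[? ?] := bJ x; rewrite ger0_norm.
have lAB : B - A <= b0 - a0 by lra.
have hlAB : ((B - A)%:E <= l_delta (delta K N))%E by apply: le_trans hl; rewrite lee_fin.
have hlAB' : (N <= 0)%E -> ((B - A)%:E < l_delta (delta K N))%E.
  by move=> /hl'; apply: le_lt_trans; rewrite lee_fin.
(* The sign of h is free: replacing h by - h keeps its zeros and the balance condition, and makes
   the initial integrals positive as the three cases require. *)
have key (h' : R -> R) : continuous h' -> (forall x, `|h' x| <= M + c) ->
    (forall x, h' x = 0 -> h x = 0) ->
    (forall P : R -> R, intg P -> \int[mu]_x (h' x * P x) = 0 <-> \int[mu]_x (h x * P x) = 0) ->
    (forall c, A < c < B ->
       0 < \int[mu]_x (h' x * (J x * \1_(`]-oo, c[%classic : set R) x))) ->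
    exists g, model_piece A B g /\ good_model h phi' A B g.
  move=> ch' hM'' hz hint Hc'.
  have hphi'' x : h' x = 0 -> 0 < phi' x by move=> /hz/hphi'.
  have HJ' : \int[mu]_x (h' x * J x) = 0 by apply/hint.
  have piece' (P : R -> R) : measurable_fun setT P -> (forall x, 0 <= P x <= J x) ->
      CD K N P -> CD K N (fun x => J x - P x) -> \int[mu]_x (h' x * P x) = 0 -> 0 < len P ->
      \int[mu]_x (phi' x * P x) < 0.
    move=> mP bP cP cQ HP; apply: piece => //; apply/hint => //.
    by apply: intg_dom mP _ iJ => x; have /andP[? ?] := bP x; rewrite ger0_norm.
  have conv g : good_model h' phi' A B g -> good_model h phi' A B g.
    by move=> [g1 g2 g3 g4 g5]; split => //; apply/hint.
  case NE : N => [n||].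
  - have [p1|p1] := dimension_exponent hN NE.
      have n0 : (N <= 0)%E.
        rewrite NE lee_fin; have [//|n2] := dimension_finP hN NE.
        by move: p1; rewrite subr_lt0 => /(le_lt_trans n2); rewrite ltNge ler1n.
      have [be be01 gm] := endgame_neg hN ch' cphi' hM'' phiM' hphi'' AB hlAB mJ iJ J0' cJ Jpos
        HJ' Hc' piece' NE p1 (hlAB' n0).
      exists (fun x => eb (delta K N) A B be x `^ (n - 1)); split; last exact: conv.
      apply: eb_model_piece => // x; apply: eb_gt0 => //.
      by case/andP: be01 => /ltW -> /ltW ->.
    have [be be01 gm] := endgame_ge1 hN ch' cphi' hM'' phiM' AB hlAB mJ iJ J0' cJ Jpos
      HJ' Hc' piece' NE p1.
    exists (fun x => eb (delta K N) A B be x `^ (n - 1)); split; last exact: conv.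
    by apply: eb_model_piece => // x; apply: eb_gt0.
  - have [ka gm] := endgame_infty hN ch' cphi' hM'' phiM' hphi'' AB hlAB mJ iJ J0' cJ Jpos
      HJ' Hc' piece' NE.
    exists (fun x => expR (ka * x - K * x ^+ 2 / 2)); split; last exact: conv.
    exact: exp_model_piece.
  - by case: hN; rewrite NE// => /andP[].
have [g [mg [g1 g2 g3 g4 g5]]] : exists g, model_piece A B g /\ good_model h phi' A B g.
  have [Hp|Hn] := head_sign mh hM mJ iJ J0' Hc; first exact: key Hp.
  have opp P : intg P -> \int[mu]_x (- h x * P x) = - \int[mu]_x (h x * P x).
    move=> iP; rewrite -mulN1r -RintegralZl//; last exact: intg_mul hM iP.
    by congr Rintegral; apply/funext => x; ring.
  apply: (key (fun x => - h x)).
  - by move=> x; apply: cvgN; exact: ch.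
  - by move=> x; rewrite normrN.
  - by move=> x /eqP; rewrite oppr_eq0 => /eqP.
  - move=> P iP; rewrite opp//; split => [/eqP|->]; last by rewrite oppr0.
    by rewrite oppr_eq0 => /eqP.
  - move=> c' /Hn; rewrite opp ?oppr_gt0//.
    have -> : EFin \o (fun x => J x * \1_(`]-oo, c'[%classic : set R) x) =
       EFin \o (fun x => \1_(`]-oo, c'[%classic : set R) x * J x).
      by apply/funext => x /=; rewrite mulrC.
    apply: (@intg_mul _ _ _ 1) => //.
    by move=> x; rewrite indicE; case: (_ \in _); rewrite ?normr1 ?normr0.
exists A, B, g; split => //.
move: g5; rewrite split_phi// => le; rewrite -subr_lt0.
have : 0 < \int[mu]_x (g x * \1_(`]A, B[%classic : set R) x).
  have gI x : (0 < g x * \1_(`]A, B[%classic : set R) x)%R = (A < x < B)%R.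
    rewrite indicE mem_setE in_itv/=; case: (boolP (A < x < B)) => xI; last by rewrite mulr0 ltxx.
    by rewrite mulr1 g3.
  apply: Rint_gt0 => //.
  - by apply: measurable_funM => //; apply: measurable_indic; exact: measurable_itv.
  - move=> x; rewrite indicE mem_setE in_itv/=; case: (boolP (A < x < B)) => xI; last by rewrite mulr0.
    by rewrite mulr1 ltW// g3.
  - rewrite (_ : [set x | _] = `]A, B[%classic).
      by rewrite lebesgue_measure_itv/= lte_fin AB -EFinB/= lte_fin subr_gt0.
    by apply/seteqP; split => x /=; rewrite gI in_itv.
by move=> /(mulr_gt0 c0); move: le; move: (c * _) => z; rewrite subr0; lra.
Qed.

End localization.

(** * Measures with a density; Brunn-Minkowski on the line *)

Section density_measures.
Context {R : realType}.
Local Notation mu := (@lebesgue_measure R).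
Local Notation intg f := (mu.-integrable setT (EFin \o f)).

Definition density_fun (J : R -> R) & measurable_fun setT J & intg J & (forall x, 0 <= J x) :
  set (measurableTypeR R) -> \bar R := fun V => (\int[mu]_(x in V) (J x)%:E)%E.

Section instances.
Variables (J : R -> R) (mJ : measurable_fun setT J) (iJ : intg J) (J0 : forall x, 0 <= J x).
Local Notation nu := (density_fun mJ iJ J0).

Let nu0 : nu set0 = 0%E. Proof. by rewrite /density_fun integral_set0. Qed.

Let nu_ge0 A : (0 <= nu A)%E.
Proof. by apply: integral_ge0 => x _; rewrite lee_fin. Qed.

Let nu_sigma_additive : semi_sigma_additive nu.
Proof.
move=> /= A mA tA mUA; rewrite /density_fun integral_bigcup//=; last first.
  exact: integrableS iJ.
apply: is_cvg_ereal_nneg_natsum_cond => n _ _.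
by apply: integral_ge0 => /= x ?; rewrite lee_fin.
Qed.

HB.instance Definition _ := isMeasure.Build _ _ _ nu nu0 nu_ge0 nu_sigma_additive.

Let nu_fin : fin_num_fun nu.
Proof.
by move=> A mA; apply: integrable_fin_num => //; exact: integrableS iJ.
Qed.

HB.instance Definition _ := Measure_isFinite.Build _ _ _ nu nu_fin.

Definition density_measure : finite_borel R := nu.

End instances.

Lemma integral_density (nu : finite_borel R) (J f : R -> R) (C : R) :
  measurable_fun setT J -> intg J -> (forall x, 0 <= J x) ->
  (forall A, measurable A -> nu A = (\int[mu]_(x in A) (J x)%:E)%E) ->
  measurable_fun setT f -> (forall x, `|f x| <= C) ->
  (\int[nu]_x (f x)%:E = (\int[mu]_x (f x * J x))%:E)%E.
Proof.
move=> mJ iJ J0 nuE mf fC.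
have ac : nu `<< mu.
  apply/null_content_dominatesP => A mA muA0; rewrite nuE//.
  apply: (null_set_integral mA _ muA0).
  by apply/measurable_funTS/measurable_EFinP.
have C0 : 0 <= C by exact: le_trans (fC 0).
have inu : nu.-integrable setT (EFin \o f).
  have ic : nu.-integrable setT (EFin \o cst C).
    by apply: finite_measure_integrable_cst.
  apply: le_integrable ic => //; first exact/measurable_EFinP.
  by move=> x _ /=; rewrite lee_fin (ger0_norm C0).
have ifJ : intg (fun x => f x * J x) by exact: intg_mul fC iJ.
rewrite -(Radon_Nikodym_change_of_variables ac)//.
rewrite /Rintegral fineK; last exact: integrable_fin_num.
apply: ae_eq_integral => //.
- apply: emeasurable_funM; first exact/measurable_EFinP.
  by apply: (measurable_int mu); exact: Radon_Nikodym_integrable.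
- by apply/measurable_EFinP; exact: measurable_funM.
- have -> : (fun x => (f x * J x)%:E) = ((EFin \o f) \* (EFin \o J))%E.
    by apply/funext => x /=; rewrite EFinM.
  apply: ae_eqe_mul2l; apply: integral_ae_eq => //.
  + exact: Radon_Nikodym_integrable.
  + exact/measurable_EFinP.
  + by move=> E _ mE; rewrite -Radon_Nikodym_integral// -nuE.
Qed.

(** Half-open intervals generate the Borel sets and are stable under intersection; uniqueness is
    applied to the restrictions to the window, as nothing is assumed outside. *)
Lemma finite_measure_window (m1 m2 : finite_borel R) (L : R) :
  (forall c d, - L <= c -> c < d -> d <= L ->
     m1 (`]c, d]%classic : set R) = m2 (`]c, d]%classic : set R)) ->
  forall A : set R, measurable A -> A `<=` `]- L, L]%classic -> m1 A = m2 A.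
Proof.
move=> H A mA AL.
have mW : measurable (`]- L, L]%classic : set (measurableTypeR R)) by exact: measurable_itv.
have WE (m : finite_borel R) : m A = mrestr m mW A by rewrite /mrestr setIidl.
rewrite (WE m1) (WE m2).
apply: (@measure_unique _ R (measurableTypeR R) (@ocitv R) (fun k : nat => `]- k%:R, k%:R]%classic)
  _ _ _ _ (mrestr m1 mW) (mrestr m2 mW)).
- by [].
- exact: ocitvI.
- by move=> i; exact: is_ocitv.
- rewrite -subTset => x _; exists (Num.truncn `|x|).+1 => //=; rewrite in_itv/=.
  have h : `|x| < (Num.truncn `|x|).+1%:R by exact: truncnS_gt.
  by have := ltr_norml x (Num.truncn `|x|).+1%:R; rewrite h => /esym/andP[-> /ltW].
- move=> _ [[a b] _ <-] /=; rewrite /mrestr.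
  have -> : (`]a, b] `&` `]- L, L] = `]Num.max a (- L), Num.min b L])%classic.
    by apply/seteqP; split => x /=; rewrite !in_itv/= gt_max le_min; lra.
  have [le|lt] := leP (Num.min b L) (Num.max a (- L)).
    by rewrite set_itv_ge ?measure0// bnd_simp -leNgt.
  by apply: H => //; rewrite ?le_max ?ge_min lexx ?orbT.
- move=> k; rewrite /mrestr ltey_eq fin_num_measure//; exact: measurableI.
- exact: mA.
Qed.

Lemma lebesgue_affine (a b : R) (A : set R) : 0 < a -> measurable A ->
  measurable [set a * x + b | x in A] /\ mu [set a * x + b | x in A] = (a%:E * mu A)%E.
Proof.
move=> a0 mA; pose S : measurableTypeR R -> measurableTypeR R := fun x => (x - b) / a.
have mS : measurable_fun setT S.
  apply: measurable_funM => //; apply: measurable_funB => //; exact: measurable_cst.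
have SE (B : set R) : S @^-1` B = [set a * x + b | x in B].
  apply/seteqP; split => x /=; rewrite /S.
    by move=> Bx; exists ((x - b) / a) => //; rewrite mulrC divfK ?subrK// gt_eqF.
  by move=> [y By <-]; rewrite addrK mulrC mulKf// gt_eqF.
rewrite -SE; split; first by rewrite -[X in measurable X]setTI; exact: mS.
have ai : 0 <= a^-1 by rewrite invr_ge0 ltW.
have := @lebesgue_measure_unique R (mscale (NngNum ai) (pushforward mu S)).
move=> /(_ mS) U; rewrite (U _ A mA).
  by rewrite /mscale/= /pushforward muleA -EFinM divff ?mul1e// gt_eqF.
move=> _ [[c d] _ <-]; change (mu `]c, d]%classic = (a^-1)%:E * mu (S @^-1` `]c, d]%classic))%E.
  have -> : S @^-1` `]c, d]%classic = `](a * c + b), (a * d + b)]%classic.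
    apply/seteqP; split => x /=; rewrite !in_itv/= /S.
      by rewrite ltr_pdivlMr// ler_pdivrMr//; lra.
    by rewrite ltr_pdivlMr// ler_pdivrMr//; lra.
  rewrite !lebesgue_measure_itv/= !lte_fin ltrD2r ltr_pM2l//.
  case: ifP => _; last by rewrite mule0.
  rewrite -!EFinB -EFinM; congr EFin.
  by have := a0; move=> a00; field; rewrite gt_eqF.
Qed.

(* One-dimensional Brunn-Minkowski: a dilate of [X] to the left and a dilate of
   [Y] to the right share only the point [(1 - t) p + t q]. *)
Lemma lebesgue_brunn_minkowski (X Y Z : set R) (p q t : R) :
  measurable X -> measurable Y -> measurable Z -> 0 < t < 1 ->
  X p -> (forall x, X x -> x <= p) -> Y q -> (forall y, Y y -> q <= y) ->
  (forall x y, X x -> Y y -> Z ((1 - t) * x + t * y)) ->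
  ((1 - t)%:E * mu X + t%:E * mu Y <= mu Z)%E.
Proof.
move=> mX mY mZ t01 Xp pX Yq qY XYZ.
have t0 : 0 < t by case/andP: t01.
have t1 : 0 < 1 - t by lra.
have [mX' <-] := lebesgue_affine (t * q) t1 mX.
have [mY' <-] := lebesgue_affine ((1 - t) * p) t0 mY.
set X' := [set _ | _ in X] in mX' *; set Y' := [set _ | _ in Y] in mY' *.
pose c := (1 - t) * p + t * q.
have mY1 : measurable (Y' `\` [set c]) by apply: measurableD.
have leY : (mu Y' <= mu (Y' `\` [set c]))%E.
  apply: (@le_trans _ _ (mu ((Y' `\` [set c]) `|` [set c]))).
    apply: le_measure; rewrite ?inE//; first exact: measurableU.
    by move=> x Yx; have [->|xc] := eqVneq x c; [right|left; split => //; exact/eqP].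
  apply: (@le_trans _ _ (mu (Y' `\` [set c]) + mu [set c])%E); first exact: measureU2.
  have -> : mu [set c] = 0%E by exact: lebesgue_measure_set1.
  by rewrite adde0.
apply: (le_trans (leeD2l _ leY)).
rewrite -measureU//; last first.
  apply/seteqP; split => // x [[u Xu <-] [[v Yv /= E] nc]].
  apply: nc => /=; rewrite -E /c; have := pX _ Xu; have := qY _ Yv; nra.
apply: le_measure; rewrite ?inE//; first exact: measurableU.
move=> x [[u Xu <-]|[[v Yv <-] _]]; first exact: XYZ.
by rewrite addrC; exact: XYZ.
Qed.

End density_measures.

(** * Bisection along pieces of proportional masses *)

Section bisection.
Context {R : realType}.
Implicit Types (F G H : R -> R).

Section boxes.
Variables (F G H : R -> R) (t : R).
Hypothesis (cF : continuous F) (cG : continuous G).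
Hypothesis (nF : {homo F : x y / x <= y}) (nG : {homo G : x y / x <= y}).

(** F, G, H will be normalized initial masses of A0, A1 and Z: the two sides of a bad box carry the
    same share of A0 and A1, and the mean interval carries a smaller share of Z. *)
Definition bad_box (B : (R * R) * (R * R)) := let: ((x0, x1), (y0, y1)) := B in
  [/\ x0 <= x1, y0 <= y1, F x1 - F x0 = G y1 - G y0 &
   H ((1 - t) * x1 + t * y1) - H ((1 - t) * x0 + t * y0) < F x1 - F x0].

(** The x-side is halved and the y-side is cut at the point m' of equal share. The increments of F
    and of H add up over the two sub-boxes, so at least one of them is bad. *)
Let split_x x0 x1 y0 y1 : bad_box ((x0, x1), (y0, y1)) -> exists x0' x1' y0' y1',
  [/\ bad_box ((x0', x1'), (y0', y1')), x0 <= x0' /\ x1' <= x1, y0 <= y0' /\ y1' <= y1 &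
    x1' - x0' = (x1 - x0) / 2].
Proof.
move=> [x01 y01 FG HF]; pose m := (x0 + x1) / 2.
have [xm mx] : x0 <= m /\ m <= x1 by rewrite /m; split; lra.
have cG' : continuous (fun y => G y - (G y0 + (F m - F x0))).
  by move=> y; apply: cvgB; [exact: cG|exact: cvg_cst].
have [m' [/andP[ym my] Gm]] : exists m', y0 <= m' <= y1 /\ G m' - (G y0 + (F m - F x0)) = 0.
  apply: (continuous_root cG' y01); apply/orP; left.
  by have := nF xm; have := nF mx; lra.
have [lo|hi] := ltP (H ((1 - t) * m + t * m') - H ((1 - t) * x0 + t * y0)) (F m - F x0).
  exists x0, m, y0, m'; split; [split => //; lra|by split|by split|rewrite /m; lra].
exists m, x1, m', y1; split; [split => //; lra|by split|by split|rewrite /m; lra].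
Qed.

Let split_y x0 x1 y0 y1 : bad_box ((x0, x1), (y0, y1)) -> exists x0' x1' y0' y1',
  [/\ bad_box ((x0', x1'), (y0', y1')), x0 <= x0' /\ x1' <= x1, y0 <= y0' /\ y1' <= y1 &
    y1' - y0' = (y1 - y0) / 2].
Proof.
move=> [x01 y01 FG HF]; pose m := (y0 + y1) / 2.
have [ym my] : y0 <= m /\ m <= y1 by rewrite /m; split; lra.
have cF' : continuous (fun x => F x - (F x0 + (G m - G y0))).
  by move=> x; apply: cvgB; [exact: cF|exact: cvg_cst].
have [m' [/andP[xm mx] Fm]] : exists m', x0 <= m' <= x1 /\ F m' - (F x0 + (G m - G y0)) = 0.
  apply: (continuous_root cF' x01); apply/orP; left.
  by have := nG ym; have := nG my; lra.
have [lo|hi] := ltP (H ((1 - t) * m' + t * m) - H ((1 - t) * x0 + t * y0)) (F m' - F x0).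
  exists x0, m', y0, m; split; [split => //; lra|by split|by split|rewrite /m; lra].
exists m', x1, m, y1; split; [split => //; lra|by split|by split|rewrite /m; lra].
Qed.

Let sub (B B' : (R * R) * (R * R)) := [/\ B.1.1 <= B'.1.1, B'.1.2 <= B.1.2,
  B.2.1 <= B'.2.1 & B'.2.2 <= B.2.2].

Let step B : exists B', bad_box B -> [/\ bad_box B', sub B B',
  B'.1.2 - B'.1.1 <= (B.1.2 - B.1.1) / 2 & B'.2.2 - B'.2.1 <= (B.2.2 - B.2.1) / 2].
Proof.
case: B => [[x0 x1] [y0 y1]]; have [bad|nb] := pselect (bad_box ((x0, x1), (y0, y1))); last first.
  by exists ((x0, x1), (y0, y1)).
have [u0 [u1 [v0 [v1 [bad1 [h1 h2] [h3 h4] h5]]]]] := split_x bad.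
have [w0 [w1 [s0 [s1 [bad2 [k1 k2] [k3 k4] k5]]]]] := split_y bad1.
exists ((w0, w1), (s0, s1)) => _; split => //=; first by split => /=; lra.
  by lra.
by lra.
Qed.

Lemma bad_box_point x0 x1 y0 y1 : bad_box ((x0, x1), (y0, y1)) -> exists x y,
  [/\ x0 <= x <= x1, y0 <= y <= y1 & forall e, 0 < e -> exists u0 u1 v0 v1,
    [/\ bad_box ((u0, u1), (v0, v1)), u0 <= x <= u1, v0 <= y <= v1, u1 - u0 < e & v1 - v0 < e]].
Proof.
move=> bad; have [nx Hnx] := choice step.
pose b k := iter k nx ((x0, x1), (y0, y1)).
have bb k : bad_box (b k) by elim: k => //= k /Hnx[].
have sb k : sub (b k) (b k.+1) by have [_ ? _ _] := Hnx _ (bb k).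
have mono (i j : nat) : (i <= j)%N -> sub (b i) (b j).
  move=> /subnK <-; elim: (j - i)%N => [|k IH]; first by split.
  by rewrite addSn; have := sb (k + i)%N; move: IH => [? ? ? ?] [? ? ? ?]; split; lra.
have len k : (b k).1.2 - (b k).1.1 <= (x1 - x0) / 2 ^+ k /\
             (b k).2.2 - (b k).2.1 <= (y1 - y0) / 2 ^+ k.
  elim: k => [|k [I1 I2]]; first by rewrite expr0 !divr1.
  have [_ _ l1 l2] := Hnx _ (bb k); rewrite -!/(b k.+1) in l1 l2.
  rewrite exprSr !invfM !mulrA; split; [apply: (le_trans l1)|apply: (le_trans l2)];
  by rewrite ler_pM2r.
have ord k : (b k).1.1 <= (b k).1.2 /\ (b k).2.1 <= (b k).2.2.
  by have := bb k; case: (b k) => [[? ?] [? ?]] [].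
have cross (i j : nat) : (b i).1.1 <= (b j).1.2 /\ (b i).2.1 <= (b j).2.2.
  have [? ? ? ?] := mono _ _ (leq_maxl i j); have [? ? ? ?] := mono _ _ (leq_maxr i j).
  have [? ?] := ord (maxn i j); split; lra.
pose X := [set (b i).1.1 | i in [set: nat]]; pose Y := [set (b i).2.1 | i in [set: nat]].
have hX : has_sup X by split; [exists (b 0%N).1.1, 0%N|exists (b 0%N).1.2 => _ [i _ <-]; exact: (cross i 0%N).1].
have hY : has_sup Y by split; [exists (b 0%N).2.1, 0%N|exists (b 0%N).2.2 => _ [i _ <-]; exact: (cross i 0%N).2].
have inX k : (b k).1.1 <= sup X <= (b k).1.2.
  apply/andP; split; first by apply: ub_le_sup; [exact: hX.2|exists k].
  by apply: ge_sup; [exact: hX.1|move=> _ [i _ <-]; exact: (cross i k).1].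
have inY k : (b k).2.1 <= sup Y <= (b k).2.2.
  apply/andP; split; first by apply: ub_le_sup; [exact: hY.2|exists k].
  by apply: ge_sup; [exact: hY.1|move=> _ [i _ <-]; exact: (cross i k).2].
exists (sup X), (sup Y); split; [exact: (inX 0%N)|exact: (inY 0%N)|] => e e0.
pose C := `|x1 - x0| + `|y1 - y0| + 1.
have C0 : 0 < C by rewrite ltr_wpDl// addr_ge0.
pose k := (Num.truncn (C / e)).+1.
have kC : C / e < 2 ^+ k.
  apply: (lt_trans (truncnS_gt _)); rewrite -natrX ltr_nat; exact: ltn_expl.
have small w : w <= C -> w / 2 ^+ k < e.
  move=> wC; rewrite ltr_pdivrMr ?exprn_gt0// (le_lt_trans wC)//.
  by rewrite mulrC -ltr_pdivrMr.
exists (b k).1.1, (b k).1.2, (b k).2.1, (b k).2.2; split.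
- by have := bb k; case: (b k) => [[? ?] [? ?]].
- exact: inX.
- exact: inY.
- apply: (le_lt_trans (len k).1); apply: small; rewrite /C.
  by have := ler_norm (x1 - x0); have := normr_ge0 (y1 - y0); lra.
- apply: (le_lt_trans (len k).2); apply: small; rewrite /C.
  by have := ler_norm (y1 - y0); have := normr_ge0 (x1 - x0); lra.
Qed.

End boxes.
End bisection.
Section box_estimates.
Context {R : realFieldType}.
Implicit Types (t u v x y s e : R).

Lemma dist_in_box u0 u1 x s e e' : u0 <= x <= u1 -> u0 <= s <= u1 -> u1 - u0 < e -> e <= e' ->
  `|s - x| < e'.
Proof. by move=> *; rewrite ltr_norml; lra. Qed.

Lemma conv_lt t x y e : 0 < t -> 0 < 1 - t -> x < e -> y < e -> (1 - t) * x + t * y < e.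
Proof.
move=> t0 t1 xe ye; have h1 : (1 - t) * x < (1 - t) * e by rewrite ltr_pM2l.
have h2 : t * y < t * e by rewrite ltr_pM2l.
lra.
Qed.

Lemma slack x : 0 < x < 1 -> exists2 e, 0 < e & x * (1 + e) = 1 - e.
Proof.
move=> /andP[x0 x1]; exists ((1 - x) / (1 + x)); last by field; lra.
by rewrite divr_gt0; lra.
Qed.

Lemma conv_scaled_le t x y u v s e : 0 < t -> 0 < 1 - t -> s * x <= e * u -> s * y <= e * v ->
  s * ((1 - t) * x + t * y) <= e * ((1 - t) * u + t * v).
Proof.
move=> t0 t1 h1 h2; have k1 := ler_wpM2l (ltW t1) h1; have k2 := ler_wpM2l (ltW t0) h2.
have -> : s * ((1 - t) * x + t * y) = (1 - t) * (s * x) + t * (s * y) by ring.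
have -> : e * ((1 - t) * u + t * v) = (1 - t) * (e * u) + t * (e * v) by ring.
exact: lerD.
Qed.

End box_estimates.

(** * The mean inequality for measures with a [CD] density *)

Section mean_inequality.
Context {R : realType} (K : R) (N : \bar R).
Hypothesis hN : dimension_range N.
Local Notation mu := (@lebesgue_measure R).
Local Notation intg f := (mu.-integrable setT (EFin \o f)).

Lemma gmean_swap (t d a b : R) : gmean K N t d a b = gmean K N (1 - t) d b a.
Proof.
have E : 1 - (1 - t) = t by ring.
rewrite /gmean /pmean E; case: N => [n||]; first by rewrite addrC.
- by congr (_ * expR _); [rewrite mulrC|ring].
- by congr (_ * expR _); [rewrite mulrC|ring].
Qed.

Lemma gmean_same (t a : R) : 0 < t < 1 -> 0 < a -> gmean K N t 0 a a = a.
Proof.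
move=> t01 a0; case NE : N => [n||].
- have n1 : n - 1 != 0.
    by case: (dimension_exponent hN NE) => p1; [rewrite lt_eqF|rewrite gt_eqF ?(lt_le_trans ltr01)].
  by rewrite /gmean /pmean /sg eqxx -mulrDl subrK mul1r powRKV.
- by rewrite /gmean expr0n/= mulr0 mul0r expR0 mulr1 (powR_comp1 (t := 1))// ?subrK// powRr1// ltW.
- by rewrite /gmean expr0n/= mulr0 mul0r expR0 mulr1 (powR_comp1 (t := 1))// ?subrK// powRr1// ltW.
Qed.

Lemma distance_range0 : distance_range K N 0.
Proof.
split => //; rewrite /l_delta; case: ifP => dl0; last exact: ltry.
by rewrite lte_fin divr_gt0 ?pi_gt0// sqrtr_gt0.
Qed.

Section core.
Variables (J : R -> R) (A B : R).
Hypothesis (mJ : measurable_fun setT J) (iJ : intg J) (J0 : forall x, 0 <= J x).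
Hypothesis (posJ : forall x, A < x < B -> 0 < J x).
Hypothesis (contJ : forall x, A < x < B -> {for x, continuous J}).
Hypothesis (cJ : CD K N J).
Hypothesis (rngJ : forall x y, 0 < J x -> 0 < J y -> x < y -> distance_range K N (y - x)).

Definition mass (S : set R) := \int[mu]_x (J x * \1_S x).
Let hm (S : set R) c := \int[mu]_x (J x * \1_S x * \1_(`]-oo, c[%classic : set R) x).
Let vol (S : set R) : R := fine (mu S).

Let mI (S : set R) : measurable S -> measurable_fun setT (\1_S : R -> R).
Proof. by move=> mS; apply: measurable_indic. Qed.

Let I01 (S : set R) x : 0 <= (\1_S x : R) <= 1.
Proof. by rewrite indicE; case: (_ \in _); rewrite ?lexx ?ler01. Qed.

Let iI (S : set R) : measurable S -> intg (fun x => J x * \1_S x).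
Proof.
move=> mS; apply: intg_dom iJ; first by apply: measurable_funM => //; exact: mI.
by move=> x; have /andP[? ?] := I01 S x; rewrite ger0_norm ?mulr_ge0// ler_piMr.
Qed.

Lemma mass_ge0 (S : set R) : 0 <= mass S.
Proof. by apply: Rintegral_ge0 => x _; rewrite mulr_ge0//; case/andP: (I01 S x). Qed.

Lemma mass_mono (S S' : set R) : measurable S -> measurable S' -> S `<=` S' -> mass S <= mass S'.
Proof.
move=> mS mS' SS; apply: le_Rintegral => //; [exact: iI|exact: iI|move=> x _].
rewrite ler_wpM2l// !indicE; have [xS|//] := boolP (x \in S).
by rewrite (_ : x \in S') // inE; apply: SS; move: xS; rewrite inE.
Qed.

Let hmB (S : set R) (x0 x1 : R) : measurable S -> x0 <= x1 -> hm S x1 - hm S x0 = mass (S `&` `[x0, x1[).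
Proof.
move=> mS x01; have m0 c : measurable (`]-oo, c[%classic : set R) by exact: measurable_itv.
have ih c : intg (fun x => J x * \1_S x * \1_(`]-oo, c[%classic : set R) x).
  apply: intg_dom iJ.
    by apply: measurable_funM; [apply: measurable_funM => //|]; exact: mI.
  move=> x; have /andP[? ?] := I01 S x; have /andP[? ?] := I01 (`]-oo, c[%classic) x.
  by rewrite ger0_norm ?mulr_ge0// -mulrA ler_piMr// mulr_ile1.
rewrite /hm -RintegralB//; congr Rintegral; apply/funext => x.
rewrite -mulrBr -mulrA; congr (_ * _).
rewrite [in RHS]indicI /= /GRing.mul/= -/(_ * _); congr (_ * _).
rewrite !indicE !mem_setE !in_itv/=.
have [h0|h0] := ltP x x0; first by rewrite (lt_le_trans h0 x01) subrr.
by rewrite subr0.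
Qed.

Let mass_le_vol (S : set R) (C u v : R) : measurable S -> S `<=` `[u, v] -> (forall x, S x -> J x <= C) ->
  mu S = (vol S)%:E /\ mass S <= C * vol S.
Proof.
move=> mS Suv JC; have mSoo : (mu S < +oo)%E.
  apply: le_lt_trans (_ : mu `[u, v]%classic < +oo)%E.
    by apply: le_measure; rewrite ?inE.
  by rewrite lebesgue_measure_itv/=; case: ifP => _; rewrite ?ltry// -EFinB ltry.
have volE : mu S = (vol S)%:E.
  by rewrite /vol fineK// ge0_fin_numE.
split => //; have i1 : intg (\1_S : R -> R) by exact: intg_indic.
have -> : vol S = \int[mu]_x (\1_S x).
  rewrite /Rintegral integral_indic// setIT; exact: (congr1 fine (esym volE)).
rewrite -RintegralZl//; apply: le_Rintegral => //; first exact: iI.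
  by apply: (@intg_mul _ (cst C) _ `|C|).
move=> x _; rewrite indicE; have [xS|_] := boolP (x \in S); last by rewrite !mulr0.
by rewrite !mulr1; apply: JC; move: xS; rewrite inE.
Qed.

Let vol_le_mass (S : set R) (C u v : R) : measurable S -> S `<=` `[u, v] -> (forall x, S x -> C <= J x) ->
  mu S = (vol S)%:E /\ C * vol S <= mass S.
Proof.
move=> mS Suv JC; have mSoo : (mu S < +oo)%E.
  apply: le_lt_trans (_ : mu `[u, v]%classic < +oo)%E.
    by apply: le_measure; rewrite ?inE.
  by rewrite lebesgue_measure_itv/=; case: ifP => _; rewrite ?ltry// -EFinB ltry.
have i1 : intg (\1_S : R -> R) by exact: intg_indic.
have volE : mu S = (vol S)%:E by rewrite /vol fineK// ge0_fin_numE.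
split => //; have -> : vol S = \int[mu]_x (\1_S x).
  rewrite /Rintegral integral_indic// setIT; exact: (congr1 fine (esym volE)).
rewrite -RintegralZl//; apply: le_Rintegral => //; last 2 first.
- exact: iI.
- move=> x _; rewrite indicE; have [xS|_] := boolP (x \in S); last by rewrite !mulr0.
  by rewrite !mulr1; apply: JC; move: xS; rewrite inE.
by apply: (@intg_mul _ (cst C) _ `|C|).
Qed.

Lemma CD_any (x y t : R) : A < x < B -> A < y < B -> 0 < t < 1 ->
  [/\ A < (1 - t) * x + t * y < B, distance_range K N `|x - y| &
      gmean K N t `|x - y| (J x) (J y) <= J ((1 - t) * x + t * y)].
Proof.
move=> xI yI t01; have Jx := posJ xI; have Jy := posJ yI.
have zI : A < (1 - t) * x + t * y < B by case/andP: xI; case/andP: yI; case/andP: t01; nra.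
split => //.
- have [xy|xy|->] := ltgtP x y; last by rewrite subrr normr0; exact: distance_range0.
  + by rewrite ltr0_norm ?subr_lt0// opprB; exact: rngJ.
  + by rewrite gtr0_norm ?subr_gt0//; exact: rngJ.
have [xy|xy|<-] := ltgtP x y.
- by rewrite ltr0_norm ?subr_lt0// opprB; exact: cJ.
- have t01' : 0 < 1 - t < 1 by lra.
  rewrite gtr0_norm ?subr_gt0// gmean_swap; have := cJ xy Jy Jx t01'.
  by have -> : (1 - (1 - t)) * y + (1 - t) * x = (1 - t) * x + t * y by ring.
- rewrite subrr normr0 gmean_same//.
  by have -> : (1 - t) * x + t * x = x by ring.
Qed.

Lemma closed_max (S : set R) (b : R) : closed S -> S !=set0 -> (forall x, S x -> x <= b) ->
  exists2 p, S p & forall x, S x -> x <= p.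
Proof.
move=> cS S0 Sb; have hS : has_ubound S by exists b.
exists (sup S); last by move=> x Sx; exact: ub_le_sup.
by have := closure_sup S0 hS; rewrite -(closure_id S).1.
Qed.

Lemma closed_min (S : set R) (b : R) : closed S -> S !=set0 -> (forall x, S x -> b <= x) ->
  exists2 p, S p & forall x, S x -> p <= x.
Proof.
move=> cS [s Ss] Sb; pose S' := -%R @` S.
have SE : S' = -%R @^-1` S.
  by apply/seteqP; split => x /=; [move=> [y Sy <-]; rewrite opprK|exists (- x) => //; rewrite opprK].
have cS' : closed S'.
  by rewrite SE; apply: preimage_closed => // x _; apply: continuousN; exact: cvg_id.
have [|x [y Sy <-]|p [q Sq <-] pq] := @closed_max S' (- b) cS'.
- by exists (- s), s.
- by rewrite lerN2 Sb.
- exists q => // x Sx; rewrite -lerN2; apply: pq; by exists x.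
Qed.

(** A violation yields bad boxes shrinking to a point (x, y). Near x, y and their mean z the density
    is almost constant, so masses are almost volumes; Brunn-Minkowski, the density inequality at (x,
    y) and [dmean_le_gmean] then contradict badness. Keeping A0 and A1 away from A and B ensures
    continuity and positivity at these points. *)
Lemma mean_inequality_inside (A0 A1 Z : set R) (d t A' B' : R) :
  closed A0 -> closed A1 -> measurable A0 -> measurable A1 -> measurable Z ->
  A < A' -> B' < B -> A0 `<=` `[A', B'] -> A1 `<=` `[A', B'] ->
  (forall x y, A0 x -> A1 y -> Z ((1 - t) * x + t * y)) -> 0 < t < 1 ->
  0 < mass A0 -> 0 < mass A1 -> distance_range K N d ->
  (forall x y u v, A0 x -> A1 y -> 0 < u -> 0 < v -> distance_range K N `|x - y| ->
     dmean K N t d u v <= dmean K N t `|x - y| u v) ->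
  dmean K N t d (mass A0) (mass A1) <= mass Z.
Proof.
move=> cA0 cA1 mA0 mA1 mZ AA' BB' A0s A1s ZS t01 a0 b0 dr hd.
have [t0 t1] : 0 < t /\ 0 < 1 - t by lra.
set a := mass A0 in a0 *; set b := mass A1 in b0 *.
rewrite leNgt; apply/negP => lt.
pose dm := dmean K N t d a b; have dm0 : 0 < dm by exact: dmean_gt0.
have [ka [k0 k1 kZ]] : exists ka, [/\ 0 < ka, ka < 1 & mass Z < ka * dm].
  exists ((mass Z / dm + 1) / 2).
  have q0 : 0 <= mass Z / dm by rewrite divr_ge0 ?mass_ge0// ltW.
  have q1 : mass Z / dm < 1 by rewrite ltr_pdivrMr// mul1r.
  split; [lra|lra|]; rewrite -ltr_pdivrMr//; lra.
have kd0 : 0 < ka * dm by rewrite mulr_gt0.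
(* The factor ka < 1 in H leaves room for the errors 1 + eta and 1 - eta of the almost constant
   densities. *)
pose F c := hm A0 c / a; pose G c := hm A1 c / b; pose H c := hm Z c / (ka * dm).
have hmc (S : set R) : measurable S -> continuous (hm S).
  move=> mS; apply: continuous_head; last exact: iI.
  by apply: measurable_funM => //; exact: mI.
have FE (S : set R) (w x0 x1 : R) : measurable S -> x0 <= x1 ->
    hm S x1 / w - hm S x0 / w = mass (S `&` `[x0, x1[) / w.
  by move=> mS x01; rewrite -mulrBl hmB.
have mono (S : set R) (w : R) : measurable S -> 0 < w -> {homo (fun c => hm S c / w) : x y / x <= y}.
  by move=> mS w0 x y xy; rewrite -subr_ge0 FE// divr_ge0 ?mass_ge0// ltW.
have cF : continuous F by move=> c; apply: cvgMl; exact: hmc.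
have cG : continuous G by move=> c; apply: cvgMl; exact: hmc.
have AB' : A' <= B'.
  rewrite leNgt; apply/negP => BA; have : a = 0; last by move: a0 => /gt_eqF/eqP.
  rewrite /a /mass (_ : A0 = set0).
    by under eq_Rintegral do rewrite indic0 mulr0; rewrite Rintegral_cst// mul0r.
  by rewrite -subset0 => x /A0s; rewrite /= in_itv/=; lra.
have full (S : set R) : S `<=` `[A', B'] -> S `&` `[A', B' + 1[ = S.
  by move=> SS; apply/setIidl => x /SS; rewrite /= !in_itv/=; lra.
(* The right ends are B' + 1 because increments are masses of half-open intervals, which must
   contain B'. *)
have bad : bad_box F G H t ((A', B' + 1), (A', B' + 1)).
  have l1 : A' <= B' + 1 by lra.
  split => //; rewrite !FE// ?full//; first by rewrite !divff// gt_eqF.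
    rewrite divff ?gt_eqF// ltr_pdivrMr// mul1r; apply: le_lt_trans kZ.
    by apply: mass_mono => //; apply: measurableI => //; exact: measurable_itv.
  by move: t0 t1; nra.
have [x [y [xI yI Hxy]]] := bad_box_point cF cG (mono _ _ mA0 a0) (mono _ _ mA1 b0) bad.
have HH z0 z1 : z0 <= z1 -> 0 <= H z1 - H z0 by move=> z01; rewrite subr_ge0; exact: (mono _ _ mZ kd0).
have zle (u0 u1 v0 v1 : R) : u0 <= u1 -> v0 <= v1 -> (1 - t) * u0 + t * v0 <= (1 - t) * u1 + t * v1.
  by move=> *; apply: lerD; rewrite ler_pM2l.
(* Off the closed sets small boxes would have increment 0 for F or G, whereas badness puts this
   increment strictly above the nonnegative one of H. *)
have away (S : set R) (w p : R) : measurable S -> closed S -> ~ S p -> exists2 e : R, 0 < e &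
    forall u0 u1, u0 <= p <= u1 -> u1 - u0 < e -> hm S u1 / w - hm S u0 / w = 0.
  move=> mS cS nS; have : nbhs p (~` S) by apply: open_nbhs_nbhs; split => //; exact: closed_openC.
  move=> /nbhs_ballP[e /= e0 He]; exists e => // u0 u1 pu ue.
  rewrite FE//; last lra.
  rewrite (_ : _ `&` _ = set0).
    by rewrite /mass; under eq_Rintegral do rewrite indic0 mulr0; rewrite Rintegral_cst// !mul0r.
  rewrite -subset0 => s [Ss]; rewrite /= in_itv/= => su; apply: (He s) => //.
  by rewrite /ball/= ltr_norml; lra.
have [xA0|nx] := pselect (A0 x); last first.
  have [e e0 He] := away A0 a x mA0 cA0 nx.
  have [u0 [u1 [v0 [v1 [[u01 v01 _ lt1] xu _ ue _]]]]] := Hxy e e0.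
  have F0 := He _ _ xu ue; rewrite -/(F u1) -/(F u0) in F0; rewrite F0 in lt1.
  by have := HH _ _ (zle _ _ _ _ u01 v01); rewrite leNgt lt1.
have [yA1|ny] := pselect (A1 y); last first.
  have [e e0 He] := away A1 b y mA1 cA1 ny.
  have [u0 [u1 [v0 [v1 [[u01 v01 FG lt1] _ yv _ ve]]]]] := Hxy e e0.
  have G0 := He _ _ yv ve; rewrite -/(G v1) -/(G v0) in G0; rewrite FG G0 in lt1.
  by have := HH _ _ (zle _ _ _ _ u01 v01); rewrite leNgt lt1.
have xAB : A < x < B by have := A0s _ xA0; rewrite /= in_itv/=; lra.
have yAB : A < y < B by have := A1s _ yA1; rewrite /= in_itv/=; lra.
have [zAB xyr cz] := CD_any xAB yAB t01.
set z := (1 - t) * x + t * y in zAB cz.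
have Jx := posJ xAB; have Jy := posJ yAB; have Jz := posJ zAB.
have [eta eta0 eta1] := slack (introT andP (conj k0 k1)).
have radius (p l : R) : A < p < B -> l < J p -> exists2 e : R, 0 < e & forall s, `|s - p| < e -> l < J s.
  move=> pAB lJ; have : \forall s \near p, l < J s by exact: (cvgr_gt _ (contJ pAB)).
  move=> /nbhs_ballP[e /= e0 He]; exists e => // s sp; apply: He.
  by rewrite /ball/= distrC.
have radius' (p l : R) : A < p < B -> J p < l -> exists2 e : R, 0 < e & forall s, `|s - p| < e -> J s < l.
  move=> pAB lJ; have : \forall s \near p, J s < l by exact: (cvgr_lt _ (contJ pAB)).
  move=> /nbhs_ballP[e /= e0 He]; exists e => // s sp; apply: He.
  by rewrite /ball/= distrC.
have [e1 e10 He1] : exists2 e : R, 0 < e & forall s, `|s - x| < e -> J s < (1 + eta) * J x.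
  by apply: radius' => //; rewrite ltr_pMl// ltrDl.
have [e2 e20 He2] : exists2 e : R, 0 < e & forall s, `|s - y| < e -> J s < (1 + eta) * J y.
  by apply: radius' => //; rewrite ltr_pMl// ltrDl.
have [e3 e30 He3] : exists2 e : R, 0 < e & forall s, `|s - z| < e -> (1 - eta) * J z < J s.
  by apply: radius => //; rewrite gtr_pMl// gtrDl oppr_lt0.
have [e [e0 ee1 ee2 ee3]] : exists e, [/\ 0 < e, e <= e1, e <= e2 & e <= e3].
  exists (Num.min e1 (Num.min e2 e3)); split; rewrite ?lt_min ?e10 ?e20 ?e30// !ge_min lexx ?orbT//.
have [u0 [u1 [v0 [v1 [[u01 v01 FG HF] xu yv ue ve]]]]] := Hxy e e0.
set z0 := (1 - t) * u0 + t * v0 in HF; set z1 := (1 - t) * u1 + t * v1 in HF.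
have z01 : z0 <= z1 by exact: zle.
pose la := F u1 - F u0; rewrite -/la in FG HF.
have la0 : 0 < la by apply: le_lt_trans HF; exact: HH.
have ab : mass (A0 `&` `[u0, u1[) = la * a /\ mass (A1 `&` `[v0, v1[) = la * b.
  split; first by rewrite /la /F FE// divfK// gt_eqF.
  by rewrite FG /G FE// divfK// gt_eqF.
pose X := A0 `&` `[u0, u1]; pose Y := A1 `&` `[v0, v1].
have mX : measurable X by apply: measurableI => //; exact: measurable_itv.
have mY : measurable Y by apply: measurableI => //; exact: measurable_itv.
have cX : closed X by apply: closedI => //; exact: interval_closed.
have cY : closed Y by apply: closedI => //; exact: interval_closed.
have mZ' : measurable (Z `&` `[z0, z1[) by apply: measurableI => //; exact: measurable_itv.
have mZ1 : measurable (Z `&` `[z0, z1]) by apply: measurableI => //; exact: measurable_itv.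
have [volX massX] : mu X = (vol X)%:E /\ mass X <= (1 + eta) * J x * vol X.
  apply: (@mass_le_vol _ _ u0 u1) => //; first by move=> s [].
  move=> s [_]; rewrite /= in_itv/= => su; apply/ltW/He1; exact: dist_in_box xu su ue ee1.
have [volY massY] : mu Y = (vol Y)%:E /\ mass Y <= (1 + eta) * J y * vol Y.
  apply: (@mass_le_vol _ _ v0 v1) => //; first by move=> s [].
  move=> s [_]; rewrite /= in_itv/= => su; apply/ltW/He2; exact: dist_in_box yv su ve ee2.
have zd : z1 - z0 < e.
  have -> : z1 - z0 = (1 - t) * (u1 - u0) + t * (v1 - v0) by rewrite /z1 /z0; ring.
  exact: conv_lt.
have zz : z0 <= z <= z1.
  by apply/andP; split; apply: zle; case/andP: xu; case/andP: yv.
have [volZ massZ] : mu (Z `&` `[z0, z1[) = (vol (Z `&` `[z0, z1[))%:E /\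
    (1 - eta) * J z * vol (Z `&` `[z0, z1[) <= mass (Z `&` `[z0, z1[).
  apply: (@vol_le_mass _ _ z0 z1) => //.
    by move=> s []; rewrite /= !in_itv/= => _ /andP[-> /ltW].
  move=> s [_]; rewrite /= in_itv/= => su; apply/ltW/He3; apply: dist_in_box zz _ zd ee3.
  by case/andP: su => -> /ltW.
(* Brunn-Minkowski uses the last point of X and the first point of Y, hence closed slices; the added
   right end z1 of the mean interval is null. *)
have bm : (1 - t) * vol X + t * vol Y <= vol (Z `&` `[z0, z1[).
  have [p Xp pX] := closed_max cX (ex_intro _ x (conj xA0 xu)) (fun s (h : X s) => (andP h.2).2).
  have [q Yq qY] := closed_min cY (ex_intro _ y (conj yA1 yv)) (fun s (h : Y s) => (andP h.2).1).
  rewrite -lee_fin EFinD !EFinM -volX -volY -volZ.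
  apply: le_trans (_ : mu (Z `&` `[z0, z1]) <= _)%E.
    apply: (lebesgue_brunn_minkowski mX mY mZ1 t01 Xp pX Yq qY) => r s [rA ru] [sA sv].
    split; first exact: ZS.
    move: ru sv; rewrite /= !in_itv/= => /andP[? ?] /andP[? ?].
    by apply/andP; split; exact: zle.
  apply: (@le_trans _ _ (mu (Z `&` `[z0, z1[) + mu [set z1])%E).
    apply: le_trans (measureU2 _ _ _) => //.
    apply: le_measure; rewrite ?inE//; first exact: measurableU.
    move=> s [Zs]; rewrite /= in_itv/= => /andP[s0 s1].
    have [->|sn] := eqVneq s z1; [by right|left; split => //].
    by rewrite /= in_itv/= s0 lt_neqAle sn s1.
  have -> : mu [set z1] = 0%E by exact: lebesgue_measure_set1.
  by rewrite adde0.
have lX : la * a <= (1 + eta) * J x * vol X.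
  apply: le_trans massX; rewrite -ab.1; apply: mass_mono.
  - by apply: measurableI => //; exact: measurable_itv.
  - exact: mX.
  - by move=> s [sA]; rewrite /= in_itv/= => /andP[s0 /ltW s1]; split; rewrite //= in_itv/= s0.
have lY : la * b <= (1 + eta) * J y * vol Y.
  apply: le_trans massY; rewrite -ab.2; apply: mass_mono.
  - by apply: measurableI => //; exact: measurable_itv.
  - exact: mY.
  - by move=> s [sA]; rewrite /= in_itv/= => /andP[s0 /ltW s1]; split; rewrite //= in_itv/= s0.
have low : ka * dm * la <= mass (Z `&` `[z0, z1[).
  apply: le_trans massZ; have e1' : 0 < 1 - eta by rewrite -eta1 mulr_gt0// ltr_wpDl.
  have g1 : dm <= J z * ((1 - t) * (a / J x) + t * (b / J y)).
    apply: (le_trans (hd x y a b xA0 yA1 a0 b0 xyr)).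
    apply: (le_trans (dmean_le_gmean hN t01 xyr a0 b0 Jx Jy)).
    apply: ler_wpM2r => //; apply: ltW; apply: addr_gt0; apply: mulr_gt0 => //; exact: divr_gt0.
  have g2 : la * ((1 - t) * (a / J x) + t * (b / J y)) <= (1 + eta) * vol (Z `&` `[z0, z1[).
    have x1 : la * (a / J x) <= (1 + eta) * vol X.
      by rewrite mulrA ler_pdivrMr// mulrAC.
    have y1 : la * (b / J y) <= (1 + eta) * vol Y.
      by rewrite mulrA ler_pdivrMr// mulrAC.
    apply: le_trans (_ : (1 + eta) * ((1 - t) * vol X + t * vol Y) <= _).
      exact: conv_scaled_le.
    by rewrite ler_pM2l// ltr_wpDl.
  rewrite -eta1.
  apply: (@le_trans _ _ (ka * la * (J z * ((1 - t) * (a / J x) + t * (b / J y))))).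
    by rewrite mulrAC ler_wpM2l// mulr_ge0// ltW.
  have := ler_wpM2l (ltW Jz) g2 => /(ler_wpM2l (ltW k0)).
  have alg1 (p q r w : R) : p * q * (r * w) = p * (r * (q * w)) by ring.
  have alg2 (p q r w : R) : p * q * r * w = p * (r * (q * w)) by ring.
  by rewrite alg1 alg2.
move: HF; rewrite /H FE// ltr_pdivrMr// mulrC ltNge low //.
Qed.

End core.
End mean_inequality.

(** * Model measures satisfy the mean inequality *)

Section model_measures.
Context {R : realType} (K : R) (N : \bar R).
Hypothesis hN : dimension_range N.
Local Notation mu := (@lebesgue_measure R).
Local Notation intg f := (mu.-integrable setT (EFin \o f)).

Lemma massE (J : R -> R) (S : set R) : measurable S -> measurable_fun setT J -> intg J ->
  (\int[mu]_(x in S) (J x)%:E = (mass J S)%:E)%E.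
Proof.
move=> mS mJ iJ; rewrite /mass /Rintegral fineK; last first.
  apply: integrable_fin_num => //.
  rewrite (_ : (fun x => _) = EFin \o (fun x => \1_S x * J x)); last first.
    by apply/funext => x /=; rewrite mulrC.
  apply: (@intg_mul _ _ _ 1) => //.
  by move=> x; rewrite indicE; case: (_ \in _); rewrite ?normr1 ?normr0.
rewrite [LHS]integral_mkcond; congr integral; apply/funext => x; rewrite patchE indicE.
by case: ifP => _; rewrite ?mulr1 ?mulr0.
Qed.

(** A0 and A1 are exhausted by their parts inside [A + 1 / (n + 1), B - 1 / (n + 1)]. Eventually
    these carry more than a fraction ka of the masses, and homogeneity of [dmean] turns a strict
    violation into one for the parts. *)
Lemma mean_inequality_compact (J : R -> R) (A B d t : R) (A0 A1 Z : set R) :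
  measurable_fun setT J -> intg J -> (forall x, 0 <= J x) ->
  (forall x, 0 < J x <-> A < x < B) -> (forall x, A < x < B -> {for x, continuous J}) ->
  CD K N J -> (forall x y, 0 < J x -> 0 < J y -> x < y -> distance_range K N (y - x)) ->
  closed A0 -> closed A1 -> measurable A0 -> measurable A1 -> measurable Z ->
  (forall x y, A0 x -> A1 y -> Z ((1 - t) * x + t * y)) -> 0 < t < 1 ->
  0 < mass J A0 -> 0 < mass J A1 -> distance_range K N d ->
  (forall x y u v, A0 x -> A1 y -> 0 < u -> 0 < v -> distance_range K N `|x - y| ->
     dmean K N t d u v <= dmean K N t `|x - y| u v) ->
  dmean K N t d (mass J A0) (mass J A1) <= mass J Z.
Proof.
move=> mJ iJ J0 posJ cont cJ rng cA0 cA1 mA0 mA1 mZ ZS t01 a0 b0 dr hd.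
rewrite leNgt; apply/negP => lt.
pose dm := dmean K N t d (mass J A0) (mass J A1); have dm0 : 0 < dm by exact: dmean_gt0.
have [ka [k0 k1 kZ]] : exists ka, [/\ 0 < ka, ka < 1 & mass J Z < ka * dm].
  exists ((mass J Z / dm + 1) / 2).
  have q0 : 0 <= mass J Z / dm by rewrite divr_ge0 ?(mass_ge0 J0)// ltW.
  have q1 : mass J Z / dm < 1 by rewrite ltr_pdivrMr// mul1r.
  split; [lra|lra|]; rewrite -ltr_pdivrMr//; lra.
pose E n : set R := `[A + n.+1%:R^-1, B - n.+1%:R^-1]%classic.
have cE n : closed (E n) by exact: interval_closed.
have mE n : measurable (E n) by exact: measurable_itv.
have cv S : measurable S -> mass J (S `&` E n) @[n --> \oo] --> mass J S.
  move=> mS; apply: (@Rint_dct _ _ _ J) => //.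
  - by move=> n; apply: measurable_funM => //; apply: measurable_indic; exact: measurableI.
  - by apply: measurable_funM => //; exact: measurable_indic.
  - move=> n x; rewrite indicE; case: (_ \in _); rewrite ?mulr1 ?mulr0 ?normr0//.
    by rewrite ger0_norm.
  - apply: aeW => x; have [xI|xI] := boolP (A < x < B); last first.
      have -> : J x = 0 by apply/eqP; rewrite eq_le J0 andbT leNgt; apply: contra xI => /posJ.
      by under eq_fun do rewrite mul0r; rewrite mul0r; exact: cvg_cst.
    have [Ax xB] := andP xI.
    have ev1 : \forall n \near \oo, (n.+1%:R^-1 : R) < x - A.
      by apply: (cvgr_lt _ (@cvg_harmonic R)); rewrite subr_gt0.
    have ev2 : \forall n \near \oo, (n.+1%:R^-1 : R) < B - x.
      by apply: (cvgr_lt _ (@cvg_harmonic R)); rewrite subr_gt0.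
    apply: cvg_trans (near_eq_cvg _) (cvg_cst _); near=> n.
    congr (_ * _); rewrite !indicE in_setI (_ : x \in E n) ?andbT// inE /E/= in_itv/=.
    have h1 : n.+1%:R^-1 < x - A by near: n.
    have h2 : n.+1%:R^-1 < B - x by near: n.
    by move: h1 h2; move: (n.+1%:R^-1) => e; lra.
have kam S : 0 < mass J S -> ka * mass J S < mass J S by move=> h; rewrite gtr_pMl.
near \oo => n.
have h0 : ka * mass J A0 < mass J (A0 `&` E n) by near: n; exact: (cvgr_gt _ (cv _ mA0) _ (kam _ a0)).
have h1 : ka * mass J A1 < mass J (A1 `&` E n) by near: n; exact: (cvgr_gt _ (cv _ mA1) _ (kam _ b0)).
have ka0 : 0 < ka * mass J A0 by rewrite mulr_gt0.
have kb0 : 0 < ka * mass J A1 by rewrite mulr_gt0.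
have n0 : 0 < (n.+1%:R^-1 : R) by rewrite invr_gt0.
have : dmean K N t d (mass J (A0 `&` E n)) (mass J (A1 `&` E n)) <= mass J Z.
  apply: (mean_inequality_inside hN mJ iJ J0 (fun x => (posJ x).2) cont cJ rng
    (A' := A + n.+1%:R^-1) (B' := B - n.+1%:R^-1)) => //.
  - exact: closedI.
  - exact: closedI.
  - exact: measurableI.
  - exact: measurableI.
  - by rewrite ltrDl; exact: n0.
  - by rewrite gtrBl; exact: n0.
  - by move=> x y [xA _] [yA _]; exact: ZS.
  - exact: lt_trans h0.
  - exact: lt_trans h1.
  - by move=> x y u v [xA _] [yA _]; exact: hd.
apply/negP; rewrite -ltNge; apply: (lt_le_trans kZ).
have Ed := dmeanZ t01 dr k0 a0 b0; rewrite /dm -Ed.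
exact: (dmean_le hN t01 dr ka0 kb0 (ltW h0) (ltW h1)).
Unshelve. all: by end_near.
Qed.

Lemma base_three (dl b x z y : R) :
  (c_delta dl z + b * s_delta dl z) * s_delta dl (y - x) =
  (c_delta dl x + b * s_delta dl x) * s_delta dl (y - z) +
  (c_delta dl y + b * s_delta dl y) * s_delta dl (z - x).
Proof. by rewrite !s_deltaB; ring. Qed.

(** A shift by half a period reverses the sign, so two points where the base is positive throughout
    are closer than [l_delta]; see [model_range]. *)
Lemma base_shift (dl b x : R) : 0 < dl ->
  c_delta dl (x + pi / Num.sqrt dl) + b * s_delta dl (x + pi / Num.sqrt dl) =
  - (c_delta dl x + b * s_delta dl x).
Proof.
move=> d0; have s0 : Num.sqrt dl != 0 by rewrite gt_eqF// sqrtr_gt0.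
have E : Num.sqrt dl * (x + pi / Num.sqrt dl) = Num.sqrt dl * x + pi by field.
by rewrite /c_delta /s_delta d0 E cosDpi sinDpi; field.
Qed.

Section domain.
Variable h : R.
Local Notation U := (model_domain K N h).

Lemma model_domain_itv x z y : U x -> U y -> x <= z <= y -> U z.
Proof.
rewrite /model_domain; case: N => [n||]//.
move=> [I [iI oI I0 bI] Ix] [I' [iI' oI' I'0 bI'] I'y] /andP[xz zy].
have [z0|z0] := leP 0 z.
  by exists I' => //; apply: (iI' 0 y) => //; rewrite z0.
by exists I => //; apply: (iI x 0) => //; rewrite xz ltW.
Qed.

Lemma model_domain0 : U 0 \/ forall x, ~ U x.
Proof.
rewrite /model_domain; case: N => [n||]; [|by left|by left].
have [[I HI]|nI] := pselect (exists I : set R, [/\ is_interval I, open I, I 0 &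
    forall x, I x -> 0 < model_base K n h x]).
  by left; exists I => //; case: HI.
by right => x [I HI _]; apply: nI; exists I.
Qed.

Lemma model_base_gt0 n x : N = n%:E -> U x -> 0 < model_base K n h x.
Proof. by move=> ->; case=> I [_ _ _]; apply. Qed.

Lemma model_density_gt0 x : U x -> 0 < model_density K N h x.
Proof.
case NE : N => [n||] Ux; rewrite /model_density ?expR_gt0//.
by rewrite powR_gt0//; apply: model_base_gt0 => //; rewrite NE.
Qed.

Lemma model_range x y : U x -> U y -> x < y -> distance_range K N (y - x).
Proof.
move=> Ux Uy xy; split; first by rewrite subr_ge0 ltW.
rewrite /l_delta; case: ifP => d0; last exact: ltry.
rewrite lte_fin ltNge; apply/negP => le.
case NE : N => [n||]; rewrite NE/= ?ltxx// in d0 le.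
pose l := pi / Num.sqrt (K / (n - 1)).
have l0 : 0 < l by rewrite divr_gt0 ?pi_gt0// sqrtr_gt0.
have Uz : U (x + l).
  by apply: model_domain_itv Ux Uy _; rewrite lerDl ltW//= -lerBrDl.
have bx := model_base_gt0 NE Ux; have := model_base_gt0 NE Uz.
by rewrite /model_base base_shift// oppr_gt0 => /(lt_trans bx); rewrite ltxx.
Qed.

(** The base solves the linear equation, so it obeys the interpolation [base_three], and taking
    powers gives equality in the mean. For infinite N this is a quadratic identity in the
    exponent. *)
Lemma model_density_conv x y t : U x -> U y -> x < y -> 0 < t < 1 ->
  gmean K N t (y - x) (model_density K N h x) (model_density K N h y) =
  model_density K N h ((1 - t) * x + t * y).
Proof.
move=> Ux Uy xy t01; case NE : N => [n||].
- rewrite /gmean /model_density -NE.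
  have n1 : n - 1 != 0.
    by case: (dimension_exponent hN NE) => p1; [rewrite lt_eqF|rewrite gt_eqF ?(lt_le_trans ltr01)].
  have bx := model_base_gt0 NE Ux; have by' := model_base_gt0 NE Uy.
  have [_ dr] := model_range Ux Uy xy; have d0 : 0 < y - x by rewrite subr_gt0.
  have Sd : 0 < s_delta (delta K N) (y - x) by exact: s_delta_gt0.
  have E1 : y - ((1 - t) * x + t * y) = (1 - t) * (y - x) by ring.
  have E2 : (1 - t) * x + t * y - x = t * (y - x) by ring.
  have := base_three (delta K N) (h / (n - 1)) x ((1 - t) * x + t * y) y.
  rewrite E1 E2 => H.
  have key : sg (delta K N) (1 - t) (y - x) * model_base K n h x +
      sg (delta K N) t (y - x) * model_base K n h y = model_base K n h ((1 - t) * x + t * y).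
    rewrite /sg gt_eqF// /model_base -NE; apply: (mulIf (lt0r_neq0 Sd)); rewrite H.
    by rewrite mulrDl mulrAC divfK ?gt_eqF// [X in _ + X]mulrAC divfK ?gt_eqF// mulrC [X in _ + X]mulrC.
  move: (model_base K n h x) (model_base K n h y) (model_base K n h _) key bx by' => u v w key u0 v0.
  by rewrite /pmean (powRVK u0 n1) (powRVK v0 n1) key.
- by rewrite /gmean /model_density /powR !gt_eqF ?expR_gt0// !expRK -!expRD; congr expR; field.
- by rewrite /gmean /model_density /powR !gt_eqF ?expR_gt0// !expRK -!expRD; congr expR; field.
Qed.

Lemma model_base_continuous n : continuous (model_base K n h).
Proof.
move=> x; apply: cvgD; first exact: continuous_c_delta.
by apply: cvgMr; exact: continuous_s_delta.
Qed.

Lemma expquad_continuous : continuous (fun x : R => expR (h * x - K * x ^+ 2 / 2)).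
Proof.
move=> x; apply: (@cvg_for _ expR); first exact: continuous_expR.
apply: cvgB; first by apply: cvgMr; exact: cvg_id.
by apply: cvgMl; apply: cvgMr; exact: exprn_continuous.
Qed.

Lemma model_density_continuous x : U x -> {for x, continuous (model_density K N h)}.
Proof.
case NE : N => [n||] Ux; rewrite /model_density; [|exact: expquad_continuous|exact: expquad_continuous].
apply: cvg_powR; last exact: model_base_continuous.
by apply: model_base_gt0 => //; rewrite NE.
Qed.

Lemma measurable_model_density : measurable_fun setT (model_density K N h).
Proof.
case: N => [n||]; rewrite /model_density;
  try by apply: continuous_measurable_fun; exact: expquad_continuous.
apply: (measurableT_comp (measurable_powR _)); apply: continuous_measurable_fun.
exact: model_base_continuous.
Qed.

(* [U] is an interval around [0]. *)
Lemma closure_model_domain y : closure U y -> ~ U y -> y = sup U \/ y = inf U.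
Proof.
move=> cy ny; case: model_domain0 => [U0|nU]; last first.
  by have [u [/nU]] := cy setT filterT.
have near e : 0 < e -> exists2 u, U u & `|u - y| < e.
  move=> e0; have [u [Uu yu]] := cy _ (nbhsx_ballx y e e0).
  by exists u => //; rewrite distrC.
have [y0|y0] := leP 0 y.
  left; have uy : ubound U y.
    by move=> u Uu; rewrite leNgt; apply/negP => yu; apply: ny; apply: (model_domain_itv U0 Uu); rewrite y0 ltW.
  apply/eqP; rewrite eq_le; apply/andP; split; last by apply: ge_sup => //; exists 0.
  rewrite leNgt; apply/negP => lt.
  have [u Uu uyy] : exists2 u, U u & `|u - y| < y - sup U by apply: near; rewrite subr_gt0.
  have us : u <= sup U by apply: ub_le_sup => //; exists y.
  by move: uyy; rewrite ltr_norml; lra.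
right; have uy : lbound U y.
  by move=> u Uu; rewrite leNgt; apply/negP => yu; apply: ny; apply: (model_domain_itv Uu U0); rewrite !ltW.
apply/eqP; rewrite eq_le; apply/andP; split; first by apply: lb_le_inf => //; exists 0.
rewrite leNgt; apply/negP => lt.
have [u Uu uyy] : exists2 u, U u & `|u - y| < inf U - y by apply: near; rewrite subr_gt0.
have us : inf U <= u by apply: ge_inf => //; exists y.
by move: uyy; rewrite ltr_norml; lra.
Qed.

End domain.

Lemma interval_hull (W : set R) (L : R) : is_interval W -> (forall x, W x -> `|x| <= L) ->
  exists A B, (forall x, A < x < B -> W x) /\ (forall x, W x -> A <= x <= B).
Proof.
move=> iW WL; have [W0|/set0P [w Ww]] := eqVneq W set0.
  by exists 0, 0; split; [move=> x; lra|rewrite W0].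
have uW : has_ubound W by exists L => x /WL; rewrite ler_norml => /andP[].
have lW : has_lbound W by exists (- L) => x /WL; rewrite ler_norml => /andP[].
exists (inf W), (sup W); split => x; last first.
  by move=> Wx; rewrite ge_inf//= ub_le_sup.
move=> /andP[ix xs].
have [u Wu ux] := inf_lt (ex_intro _ w Ww) ix.
have [v Wv xv] := sup_gt (ex_intro _ w Ww) xs.
by apply: (iW u v) => //; rewrite !ltW.
Qed.

(** In a bounded window the interval I' has real end points, and the density can be modified at four
    points at most: the ends of the windowed interval and of the domain. This gives a density
    positive exactly on an open interval, with the same masses in the window. *)
Lemma model_window (D : \bar R) (xi : finite_borel R) (L : R) : MMKND K N D xi ->
  exists J A B, [/\ measurable_fun setT J, intg J, (forall x, 0 <= J x) &
    (forall x, 0 < J x <-> A < x < B)] /\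
  [/\ (forall x, A < x < B -> {for x, continuous J}), CD K N J,
    (forall x y, 0 < J x -> 0 < J y -> x < y -> distance_range K N (y - x)) &
    forall S, measurable S -> S `<=` `]- L, L[%classic -> xi S = (mass J S)%:E].
Proof.
move=> [J0 [c [r [h [I' [[mJ0 J00] xiE c0 [iI' I'U _] J0E]]]]]].
pose U := model_domain K N h.
pose W : set R := [set y | [/\ U y, I' y & `|y + r| < L]].
have iW : is_interval W.
  move=> x y [Ux I'x xL] [Uy I'y yL] z xzy; split.
  - exact: model_domain_itv Ux Uy xzy.
  - exact: iI' I'x I'y _ xzy.
  - by move: xL yL xzy; rewrite !ltr_norml; lra.
have [|a [b [abW Wab]]] := @interval_hull W (`|L| + `|r|) iW.
  move=> x [_ _ xL]; have -> : x = (x + r) - r by ring.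
  by rewrite (le_trans (ler_normB _ _))// lerD2r (le_trans (ltW xL))// ler_norm.
pose J x := c * model_density K N h (x - r) * \1_(`]a, b[%classic : set R) (x - r).
have IE y : \1_(`]a, b[%classic : set R) y = (a < y < b)%R%:R :> R by rewrite indicE mem_setE in_itv.
have JE x : J x = if (a < x - r < b)%R then c * model_density K N h (x - r) else 0.
  by rewrite /J IE; case: ifP => _; rewrite ?mulr1 ?mulr0.
have dU y : a < y < b -> U y by move=> /abW[].
have posJ x : 0 < J x <-> a + r < x < b + r.
  have -> : (a + r < x < b + r) = (a < x - r < b) by rewrite ltrBrDr ltrBlDr.
  rewrite JE; case: ifP => xI; last by rewrite ltxx.
  by split => // _; rewrite mulr_gt0//; apply: model_density_gt0; exact: dU.
have J_ge0 x : 0 <= J x.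
  rewrite JE; case: ifP => xI //; rewrite ltW// mulr_gt0//; apply: model_density_gt0; exact: dU.
have mshift : measurable_fun setT (fun x : R => x - r).
  by apply: measurable_funB => //; exact: measurable_cst.
have mJ : measurable_fun setT J.
  apply: measurable_funM; first apply: measurable_funM.
  - exact: measurable_cst.
  - exact: (measurableT_comp (measurable_model_density h) mshift).
  - have mI : measurable_fun setT (\1_(`]a, b[%classic : set R) : R -> R).
      by apply: measurable_indic; exact: measurable_itv.
    exact: (measurableT_comp mI mshift).
have JJ0 x : x \notin [:: a + r; b + r; sup U + r; inf U + r] -> `|x| < L -> J x = J0 x.
  rewrite !inE !negb_or => /and4P[xa xb xs xi'] xL.
  have nE : ~ (closure U `\` U) (x - r).
    by move=> [cU nU]; case: (closure_model_domain cU nU) => E;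
       [move: xs|move: xi']; rewrite -E subrK eqxx.
  have -> : J0 x = J0 ((x - r) + r) by rewrite subrK.
  rewrite J0E// JE indicE; case: ifP => xI.
    have [_ I'x _] := abW _ xI; by rewrite (_ : x - r \in I') ?mulr1// inE.
  have [xI'|] := boolP (x - r \in I'); last by rewrite mulr0.
  rewrite inE in xI'; exfalso; move/negP: xI; apply.
  have Ux : U (x - r).
    by apply: contrapT => nU; apply: nE; split => //; exact: I'U.
  have /Wab : W (x - r) by split => //; rewrite subrK.
  rewrite !le_eqVlt => /andP[/orP[/eqP E|->] /orP[/eqP E'|->]] //.
  - by move: xa; rewrite E subrK eqxx.
  - by move: xa; rewrite E subrK eqxx.
  - by move: xb; rewrite -E' subrK eqxx.
have null : mu [set` [:: a + r; b + r; sup U + r; inf U + r]] = 0%E.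
  by apply: countable_lebesgue_measure0; apply: finite_set_countable; exact: finite_seq.
have mnull : measurable ([set` [:: a + r; b + r; sup U + r; inf U + r]] : set R).
  by apply: countable_measurable; [exact: measurable_set1|apply: finite_set_countable; exact: finite_seq].
have Jint S : measurable S -> S `<=` `]- L, L[%classic ->
    (\int[mu]_(x in S) (J x)%:E = \int[mu]_(x in S) (J0 x)%:E)%E.
  move=> mS SL; apply: ae_eq_integral => //; [exact/measurable_funTS/measurable_EFinP|
    exact/measurable_funTS/measurable_EFinP|].
  exists [set` [:: a + r; b + r; sup U + r; inf U + r]]; split => // x /=.
  move=> nx; apply: contrapT => xn; apply: nx => Sx; congr EFin; apply: JJ0.
    by apply/negP.
  by have := SL _ Sx; rewrite /= in_itv/= ltr_norml.
pose WL : set R := `]- L, L[%classic.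
have mL : measurable WL by exact: measurable_itv.
have iJ : intg J.
  apply/integrableP; split; first exact/measurable_EFinP.
  have -> : (fun x => `|(EFin \o J) x|)%E = (fun x => (J x)%:E) by apply/funext => x /=; rewrite ger0_norm.
  have -> : (\int[mu]_x (J x)%:E = \int[mu]_(x in WL) (J x)%:E)%E.
    rewrite [RHS]integral_mkcond; congr integral; apply/funext => x; rewrite patchE.
    case: ifPn => // xL; congr EFin; apply/eqP; rewrite eq_le J_ge0 andbT leNgt.
    apply: contra xL => /posJ xI; have /abW[_ _] : a < x - r < b by lra.
    by rewrite subrK ltr_norml inE /WL/= in_itv.
  rewrite Jint// -xiE//; have := fin_num_measure xi _ mL.
  by rewrite ge0_fin_numE.
exists J, (a + r), (b + r); split; first by split.
have inU x : 0 < J x -> U (x - r) by move=> /posJ xI; apply: dU; lra.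
have JpE x : 0 < J x -> J x = c * model_density K N h (x - r).
  by move=> /posJ xI; rewrite JE ifT//; lra.
have rng x y : 0 < J x -> 0 < J y -> x < y -> distance_range K N (y - x).
  move=> Jx Jy xy; have -> : y - x = (y - r) - (x - r) by ring.
  by apply: (@model_range h); rewrite ?ltrD2r//; exact: inU.
split => //.
- move=> x xI; have xI' : a < x - r < b by lra.
  have cv : {for x, continuous (fun x => c * model_density K N h (x - r))}.
    apply: cvgMr; apply: (@cvg_for _ (model_density K N h)).
      by apply: model_density_continuous; exact: dU.
    by apply: cvgB; [exact: cvg_id|exact: cvg_cst].
  rewrite /prop_for /continuous_at JE xI'; apply: cvg_trans cv; apply: near_eq_cvg.
  have : \forall y \near x, y \in `]a + r, b + r[ by apply: near_in_itvoo; rewrite in_itv.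
  by apply: filterS => y; rewrite in_itv/= => yI; rewrite JE ifT//; lra.
- move=> x y t xy Jx Jy t01.
  have Jz : 0 < J ((1 - t) * x + t * y).
    apply/posJ; move: Jx Jy => /posJ/andP[xa _] /posJ/andP[_ yb].
    have /andP[xz zy] := conv_in xy t01.
    by apply/andP; split; [exact: lt_trans xz|exact: lt_trans yb].
  rewrite (JpE _ Jx) (JpE _ Jy) (JpE _ Jz).
  have d1 := model_density_gt0 (inU _ Jx); have d2 := model_density_gt0 (inU _ Jy).
  have E := gmeanZ hN t01 (rng _ _ Jx Jy xy) c0 d1 d2; rewrite E.
  have -> : y - x = (y - r) - (x - r) by ring.
  have -> : (1 - t) * x + t * y - r = (1 - t) * (x - r) + t * (y - r) by ring.
  by rewrite model_density_conv// ?ltrD2r//; exact: inU.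
- by move=> S mS SL; rewrite xiE// -Jint// massE.
Qed.

(** If the limit does not exist, [lim] returns its default value 0, whence the hypothesis 0 <= l. *)
Lemma lim_le_of_cvg (F : set_system R) (f : R -> \bar R) (l : \bar R) : (0 <= l)%E ->
  (forall l', f s @[s --> F] --> l' -> (l' <= l)%E) -> (lim (f s @[s --> F]) <= l)%E.
Proof.
move=> l0 H; have [c|nc] := pselect (cvg (f s @[s --> F])); first exact: H.
by rewrite dvgP.
Qed.

(** Upper semicontinuity of the mass: the open neighbourhoods of radius 1 / (n + 1) of a closed set
    decrease to it and eventually contain the sets that approach it. *)
Lemma thickening_limit (xi : finite_borel R) (S : set R) (Zs : R -> set R)
    (F : set_system R) (FF : ProperFilter F) (f : R -> \bar R) (l : \bar R) :
  closed S ->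
  (forall e : R, 0 < e -> \forall s \near F, forall z, Zs s z -> exists2 y, S y & `|y - z| < e) ->
  (\forall s \near F, measurable (Zs s) /\ (f s <= xi (Zs s))%E) ->
  f s @[s --> F] --> l -> (l <= xi S)%E.
Proof.
move=> cS sub fle fl.
pose T n : set R := \bigcup_(y in S) ball y (n.+1%:R^-1 : R).
have oT n : open (T n) by apply: bigcup_open => y _; exact: ball_open.
have mT n : measurable (T n) by exact: open_measurable.
have mS : measurable S by exact: closed_measurable.
have TS : \bigcap_n T n = S.
  apply/seteqP; split => x; last first.
    by move=> Sx n _; exists x => //; apply: ballxx; rewrite invr_gt0.
  move=> Tx; apply: cS => V /nbhs_ballP[e /= e0 eV].
  have [n ne] : exists n : nat, n.+1%:R^-1 < e.
    exists (Num.truncn e^-1); rewrite -[ltRHS]invrK ltf_pV2 ?posrE ?invr_gt0//.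
    exact: truncnS_gt.
  have [y Sy yx] := Tx n I; exists y; split => //; apply: eV.
  by apply: ball_sym; apply: le_ball yx; exact: ltW.
have lT n : (l <= xi (T n))%E.
  have c : cvg (f s @[s --> F]) by apply/cvg_ex; exists l.
  have <- : lim (f s @[s --> F]) = l by exact/cvg_lim.
  apply: lime_le => //.
  have n0 : 0 < (n.+1%:R^-1 : R) by rewrite invr_gt0.
  have := sub _ n0; have := fle; apply: filterS2 => s [mZ le] Zsub.
  apply: (le_trans le); apply: le_measure; [by rewrite inE|by rewrite inE; exact: mT|].
  by move=> z /Zsub[y Sy yz]; exists y.
have := @nonincreasing_cvg_mu _ _ _ xi T _ mT _ _; rewrite TS => cv.
have {}cv : (xi \o T) x @[x --> \oo] --> xi S.
  apply: cv => //.
    have := fin_num_measure xi _ (mT 0%N); by rewrite ge0_fin_numE.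
  move=> n m nm; apply/subsetPset => x [y Sy yx]; exists y => //.
  by apply: le_ball yx; rewrite lef_pV2 ?posrE// ler_nat.
have <- : lim ((xi \o T) x @[x --> \oo]) = xi S by exact/cvg_lim.
apply: lime_ge; first by apply/cvg_ex; exists (xi S).
by apply: nearW => n; exact: lT.
Qed.

Lemma compact_minkowski_mean (t : R) (A0 A1 : set R) : compact A0 -> compact A1 ->
  compact (minkowski_mean t A0 A1).
Proof.
move=> c0 c1.
have -> : minkowski_mean t A0 A1 = (fun z : R * R => (1 - t) * z.1 + t * z.2) @` (A0 `*` A1).
  apply/seteqP; split => z; first by move=> [x Ax [y Ay <-]]; exists (x, y).
  by move=> [[x y] [Ax Ay] <-]; exists x => //; exists y.
apply: continuous_compact; last exact: compact_setX.
apply: continuous_subspaceT => z; apply: cvgD; apply: cvgMr; [exact: cvg_fst|exact: cvg_snd].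
Qed.

Lemma compact_window (A : set R) : compact A -> exists2 L, 0 < L & A `<=` `]- L, L[%classic.
Proof.
move=> /compact_bounded[M [_ HM]]; exists (`|M| + 1); first by rewrite ltr_wpDl.
move=> x Ax; rewrite /= in_itv/= -ltr_norml.
have : M < `|M| + 1 / 2 by have := ler_norm M; lra.
by move/HM => /(_ x Ax) /=; have := ler_norm M; lra.
Qed.

Lemma theta_bounds (A0 A1 : set R) : compact A0 -> compact A1 -> A0 !=set0 -> A1 !=set0 ->
  0 <= theta_K K A0 A1 /\ forall x y, A0 x -> A1 y ->
    (0 <= K -> theta_K K A0 A1 <= `|x - y|) /\ (K < 0 -> `|x - y| <= theta_K K A0 A1).
Proof.
move=> c0 c1 [x0 Ax0] [y0 Ay0]; rewrite /theta_K; set dists := [set _ | _ in _ & _ in _].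
have d0 : dists `|x0 - y0| by exists x0 => //; exists y0.
have lb : has_lbound dists by exists 0 => _ [x _ [y _ <-]].
have [L0 L00 H0] := compact_window c0; have [L1 L10 H1] := compact_window c1.
have ub : has_ubound dists.
  exists (L0 + L1) => _ [x /H0 + [y /H1 + <-]]; rewrite /= !in_itv/= => hx hy.
  by rewrite ler_norml; lra.
have [K0|K0] := leP 0 K; split.
- by apply: lb_le_inf; [exists (`|x0 - y0|)|move=> _ [x _ [y _ <-]]].
- move=> x y Ax Ay; split => [_|//].
  by apply: ge_inf => //; exists x => //; exists y.
- by apply: le_trans (ub_le_sup ub d0).
- move=> x y Ax Ay; split => [//|_].
  by apply: ub_le_sup => //; exists x => //; exists y.
Qed.

(** For K >= 0 the distance is an infimum, so it is bounded by that of two points of positive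
    density and lies in the range. For K < 0 it is a supremum and may leave the range, but then the
    mean is 0. *)
Lemma MMKND_mean_inequality (D : \bar R) (xi : finite_borel R) (A0 A1 : set R) (t : R) :
  MMKND K N D xi -> compact A0 -> compact A1 -> 0 < t < 1 ->
  0 < fine (xi A0) -> 0 < fine (xi A1) ->
  (distorted_mean K N t (theta_K K A0 A1) (fine (xi A0)) (fine (xi A1))
    <= xi (minkowski_mean t A0 A1))%E.
Proof.
move=> xiM c0 c1 t01 a0 b0.
have [L0 L00 H0] := compact_window c0; have [L1 L10 H1] := compact_window c1.
pose L := L0 + L1.
have [J [A [B [[mJ iJ J0 posJ] [cont cJ rng xiE]]]]] := model_window L xiM.
have cl (A' : set R) : compact A' -> closed A' by move=> cA; apply: compact_closed => //; exact: Rhausdorff.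
have mc (A' : set R) : compact A' -> measurable A' by move=> /cl/closed_measurable.
have cZ := compact_minkowski_mean (t := t) c0 c1.
have s0 : A0 `<=` `]- L, L[%classic by move=> x /H0; rewrite /= !in_itv/= /L; lra.
have s1 : A1 `<=` `]- L, L[%classic by move=> x /H1; rewrite /= !in_itv/= /L; lra.
have sZ : minkowski_mean t A0 A1 `<=` `]- L, L[%classic.
  move=> _ [x /s0 + [y /s1 + <-]]; rewrite /= !in_itv/= => hx hy.
  by case/andP: hx; case/andP: hy; case/andP: t01; nra.
have e0 := xiE _ (mc _ c0) s0; have e1 := xiE _ (mc _ c1) s1.
rewrite e0 e1 /= (xiE _ (mc _ cZ) sZ); rewrite e0 /= in a0; rewrite e1 /= in b0.
have point S : 0 < mass J S -> exists2 x, S x & 0 < J x.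
  move=> m0; apply: contrapT => nx; move: m0; rewrite /mass.
  have -> : (fun x => J x * \1_S x) = cst 0.
    apply/funext => x; rewrite indicE /=; have [xS|_] := boolP (x \in S); last by rewrite mulr0.
    rewrite mulr1; apply/eqP; rewrite eq_le J0 andbT leNgt; apply/negP => Jx; apply: nx.
    by exists x => //; move: xS; rewrite inE.
  by rewrite Rintegral_cst//= mul0r ltxx.
have [x Ax Jx] := point _ a0; have [y Ay Jy] := point _ b0.
have [th0 thb] := theta_bounds c0 c1 (ex_intro _ x Ax) (ex_intro _ y Ay).
set d := theta_K K A0 A1 in th0 thb *.
have xyr : distance_range K N `|x - y|.
  have [xy|xy|->] := ltgtP x y; last by rewrite subrr normr0; exact: distance_range0.
  - by rewrite ltr0_norm ?subr_lt0// opprB; exact: rng.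
  - by rewrite gtr0_norm ?subr_gt0//; exact: rng.
have conclude : distance_range K N d ->
    (distorted_mean K N t d (mass J A0) (mass J A1) <= (mass J (minkowski_mean t A0 A1))%:E)%E.
  move=> dr; rewrite distorted_meanE// lee_fin.
  apply: (mean_inequality_compact mJ iJ J0 posJ cont cJ rng) => //;
    try exact: mc; try exact: cl.
  - by move=> x' y' Ax' Ay'; exists x' => //; exists y'.
  move=> x' y' u v Ax' Ay' u0 v0 dr'; have [b1 b2] := thb _ _ Ax' Ay'.
  have [K0|K0] := leP 0 K.
    exact: (dmean_le_dist hN t01 th0 (b1 K0) dr' u0 v0).1.
  exact: (dmean_le_dist hN t01 (normr_ge0 _) (b2 K0) dr u0 v0).2 (ltW K0).
have [K0|K0] := leP 0 K.
  apply: conclude; split => //; apply: le_lt_trans xyr.2.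
  by rewrite lee_fin; exact: (thb _ _ Ax Ay).1.
have [dl|dl] := ltP d%:E (l_delta (delta K N)); first by apply: conclude; split.
have d_gt0 : 0 < d.
  rewrite lt_neqAle th0 andbT; apply/eqP => E; move: dl; rewrite -E leNgt.
  by move/negP; apply; exact: (distance_range0 K N).2.
rewrite ((distorted_mean_far hN t01 d_gt0 dl a0 b0).2 K0) lee_fin.
exact: mass_ge0.
Qed.

(** At t = 0 and t = 1 the mean of the sets is A0 or A1, approached uniformly by the means at nearby
    s, and [thickening_limit] passes the open case to the limit. *)
Lemma MMKND_mean_inequality_full (D : \bar R) (xi : finite_borel R) (A0 A1 : set R) (t : R) :
  MMKND K N D xi -> compact A0 -> compact A1 -> 0 <= t <= 1 ->
  (distorted_mean K N t (theta_K K A0 A1) (fine (xi A0)) (fine (xi A1))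
    <= xi (minkowski_mean t A0 A1))%E.
Proof.
move=> xiM c0 c1 /andP[t0 t1].
have [ab0|ab] := eqVneq (fine (xi A0) * fine (xi A1)) 0.
  by rewrite /distorted_mean ab0 eqxx.
have a0 : 0 < fine (xi A0).
  by rewrite lt_neqAle fine_ge0// andbT eq_sym; move: ab; rewrite mulf_eq0 negb_or => /andP[].
have b0 : 0 < fine (xi A1).
  by rewrite lt_neqAle fine_ge0// andbT eq_sym; move: ab; rewrite mulf_eq0 negb_or => /andP[].
have nonempty (S : set R) : 0 < fine (xi S) -> S !=set0.
  by move=> h; apply/set0P/eqP => E; move: h; rewrite E measure0 ltxx.
have [x0 Ax0] := nonempty _ a0; have [y0 Ay0] := nonempty _ b0.
have mZ s : measurable (minkowski_mean s A0 A1 : set R).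
  by apply: closed_measurable; apply: compact_closed; [exact: Rhausdorff|exact: compact_minkowski_mean].
have cl (A' : set R) : compact A' -> closed A' by move=> cA; apply: compact_closed => //; exact: Rhausdorff.
have [L0 L00 H0] := compact_window c0; have [L1 L10 H1] := compact_window c1.
have L_gt0 : 0 < L0 + L1 by rewrite addr_gt0.
have inner s : 0 < s < 1 ->
    (distorted_mean_inner K N (theta_K K A0 A1) (fine (xi A0)) (fine (xi A1)) s
      <= xi (minkowski_mean s A0 A1))%E.
  move=> s01; have := MMKND_mean_inequality xiM c0 c1 s01 a0 b0.
  rewrite /distorted_mean (negbTE ab) gt_eqF; last by case/andP: s01.
  by rewrite lt_eqF; last by case/andP: s01.
have [t00|tn0] := eqVneq t 0.
  have -> : minkowski_mean t A0 A1 = A0.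
    rewrite t00; apply/seteqP; split => x; first by move=> [u Au [v _ <-]]; rewrite subr0 mul1r mul0r addr0.
    by move=> Ax; exists x => //; exists y0 => //; rewrite subr0 mul1r mul0r addr0.
  rewrite /distorted_mean (negbTE ab) t00 eqxx; apply: lim_le_of_cvg => // l fl.
  have s_near : \forall s \near 0^'+, 0 < (s : R) < 1.
    by near=> s; apply/andP; split; near: s; [exact: nbhs_right_gt|exact: nbhs_right_lt].
  apply: (@thickening_limit xi A0 (fun s => minkowski_mean s A0 A1) _ _ _ _ (cl _ c0) _ _ fl).
    move=> e e0; near=> s; move=> _ [x Ax [y Ay <-]]; exists x => //.
    have s0 : 0 < s by near: s; exact: nbhs_right_gt.
    have se : s < e / (L0 + L1) by near: s; apply: nbhs_right_lt; exact: divr_gt0.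
    have -> : x - ((1 - s) * x + s * y) = s * (x - y) by ring.
    rewrite normrM gtr0_norm//; rewrite ltr_pdivlMr// in se; apply: le_lt_trans se.
    apply: ler_wpM2l; first exact: ltW.
    have := H0 _ Ax; have := H1 _ Ay; rewrite /= !in_itv/= => hx hy.
    by rewrite ler_norml; lra.
  by apply: filterS s_near => s s01; split; [exact: mZ|exact: inner].
have [t11|tn1] := eqVneq t 1.
  have -> : minkowski_mean t A0 A1 = A1.
    rewrite t11; apply/seteqP; split => x; first by move=> [u Au [v Av <-]]; rewrite subrr mul1r mul0r add0r.
    by move=> Ax; exists x0 => //; exists x => //; rewrite subrr mul1r mul0r add0r.
  rewrite /distorted_mean (negbTE ab) t11 oner_eq0 eqxx; apply: lim_le_of_cvg => // l fl.
  have s_near : \forall s \near 1^'-, 0 < (s : R) < 1.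
    by near=> s; apply/andP; split; near: s; [exact: nbhs_left_gt|exact: nbhs_left_lt].
  apply: (@thickening_limit xi A1 (fun s => minkowski_mean s A0 A1) _ _ _ _ (cl _ c1) _ _ fl).
    move=> e e0; near=> s; move=> _ [x Ax [y Ay <-]]; exists y => //.
    have s1 : s < 1 by near: s; exact: nbhs_left_lt.
    have se : 1 - e / (L0 + L1) < s.
      by near: s; apply: nbhs_left_gt; rewrite gtrBl divr_gt0.
    have {}se : 1 - s < e / (L0 + L1) by lra.
    have -> : y - ((1 - s) * x + s * y) = (1 - s) * (y - x) by ring.
    have s1' : 0 < 1 - s by rewrite subr_gt0.
    rewrite normrM gtr0_norm//; rewrite ltr_pdivlMr// in se; apply: le_lt_trans se.
    apply: ler_wpM2l; first exact: ltW.
    have := H0 _ Ax; have := H1 _ Ay; rewrite /= !in_itv/= => hx hy.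
    by rewrite ler_norml; lra.
  by apply: filterS s_near => s s01; split; [exact: mZ|exact: inner].
apply: (MMKND_mean_inequality xiM) => //.
by rewrite !lt_neqAle eq_sym tn0 tn1 t0.
Unshelve. all: by end_near.
Qed.

Lemma MMKND_diam (D : \bar R) (xi : finite_borel R) : MMKND K N D xi ->
  (diam (msupport xi) <= D)%E.
Proof.
move=> xiM; have [J [c [r [h [I' [[mJ J0] xiE c0 [iI' I'U /andP[_ dI']] JE]]]]]] := xiM.
rewrite /diam ge_max; apply/andP; split.
  by apply: le_trans dI'; rewrite le_max lexx.
apply: ge_ereal_sup => _ [x sx [y sy <-]]; apply: le_trans dI'.
(* A ball around a support point has positive mass, so it meets I' + r; the at most two boundary
   points where the density is unconstrained are null. *)
have hit z e : msupport xi z -> 0 < e -> exists2 u, I' u & `|u + r - z| < e.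
  move=> sz e0; apply: contrapT => nu.
  have zU : ball z e z by exact: ballxx.
  have := sz _ (ball_open z e) zU; apply/negP; rewrite -leNgt.
  have mB : measurable (ball z e : set R) by apply: open_measurable; exact: ball_open.
  rewrite xiE//; set E : set R := [set` [:: sup (model_domain K N h) + r; inf (model_domain K N h) + r]].
  have mE : measurable E.
    by apply: countable_measurable; [exact: measurable_set1|apply: finite_set_countable; exact: finite_seq].
  have nE : mu E = 0%E.
    by apply: countable_lebesgue_measure0; apply: finite_set_countable; exact: finite_seq.
  rewrite (@ae_eq_integral _ _ _ mu (ball z e) (cst 0%E))//.
  + by rewrite integral0.
  + exact/measurable_funTS/measurable_EFinP.
  exists E; split => // u /= nx; apply: contrapT => uE; apply: nx => zu.
  have -> : J u = J ((u - r) + r) by rewrite subrK.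
  rewrite JE.
    rewrite indicE; have [uI|_] := boolP (u - r \in I'); last by rewrite mulr0.
    exfalso; apply: nu; exists (u - r); first by move: uI; rewrite inE.
    by rewrite subrK distrC.
  move=> [cU nU]; apply: uE; rewrite /E /= !inE.
  by case: (closure_model_domain cU nU) => <-; rewrite subrK eqxx ?orbT.
apply/lee_addgt0Pr => e e0; have e2 : 0 < e / 2 by rewrite divr_gt0.
have [u Iu ux] := hit x _ sx e2; have [v Iv vy] := hit y _ sy e2.
have le : (`|u - v|%:E <= diam I')%E.
  by rewrite le_max; apply/orP; right; apply: ereal_sup_ubound; exists u => //; exists v.
apply: le_trans (leeD2r _ le); rewrite -EFinD lee_fin.
have -> : x - y = (u - v) - (u + r - x) + (v + r - y) by ring.
apply: (le_trans (ler_normD _ _)).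
have := ler_normB (u - v) (u + r - x); move: ux vy.
by move: (`|u + r - x|) (`|v + r - y|) (`|u - v|) (`|u - v - (u + r - x)|) => *; lra.
Qed.

Theorem MMKND_MKND (D : \bar R) : MMKND K N D `<=` MKND K N D.
Proof.
move=> xi xiM; split; first exact: MMKND_diam.
by move=> A0 A1 t; exact: (MMKND_mean_inequality_full xiM).
Qed.

End model_measures.

(** * Comparison of additive functions of intervals *)

Section additive_comparison.
Context {R : realType}.
Implicit Types (F : R -> R -> R) (c d x e r s W : R).

Definition interval_additive F :=
  (forall c x d, c <= x <= d -> F c d = F c x + F x d) /\ (forall c d, c <= d -> 0 <= F c d).

Lemma interval_comparison F1 F2 c d : interval_additive F1 -> interval_additive F2 ->
  (forall s W, c <= s < d -> (forall u, s < u <= d -> F1 u d <= W) -> F1 s d <= W) ->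
  (forall x r, c < x <= d -> 0 < r -> exists2 e, 0 < e < r & F1 (x - e) x <= F2 (x - e) x) ->
  c <= d -> F1 c d <= F2 c d.
Proof.
move=> [A1 P1] [A2 P2] lim step cd.
have F0 F : (forall c x d, c <= x <= d -> F c d = F c x + F x d) -> F d d = 0.
  by move=> AF; have := AF d d d; rewrite lexx => /(_ isT); lra.
pose S : set R := [set s | c <= s <= d /\ F1 s d <= F2 s d].
have Sd : S d by split; [rewrite cd lexx|rewrite !F0].
have lb : has_lbound S by exists c => s [/andP[]].
have sd : inf S <= d by exact: ge_inf.
have cs : c <= inf S by apply: lb_le_inf; [exists d|move=> s [/andP[]]].
have sF : F1 (inf S) d <= F2 (inf S) d.
  move: sd; rewrite le_eqVlt => /predU1P[->|sd]; first by rewrite !F0.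
  apply: lim; first by rewrite cs.
  move=> u /andP[su ud]; have [v [/andP[cv vd] Fv] vu] := inf_lt (ex_intro _ d Sd) su.
  have sv : inf S <= v by apply: ge_inf => //; split => //; rewrite cv.
  have E1 : F1 v d = F1 v u + F1 u d by apply: A1; rewrite ud andbT ltW.
  have E2 : F2 (inf S) d = F2 (inf S) v + F2 v d by apply: A2; rewrite sv.
  by have := P1 v u (ltW vu); have := P2 (inf S) v sv; lra.
move: cs; rewrite le_eqVlt => /predU1P[->//|cs].
have sc : 0 < inf S - c by rewrite subr_gt0.
have [|e /andP[e0 es] He] := step (inf S) (inf S - c) _ sc; first by rewrite cs.
have : inf S <= inf S - e.
  apply: ge_inf => //; split; first by apply/andP; split; lra.
  have I : inf S - e <= inf S <= d by rewrite sd andbT gerBl ltW.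
  rewrite (A1 _ _ _ I) (A2 _ _ _ I); exact: lerD.
by lra.
Qed.

Lemma linear_additive C : 0 <= C -> interval_additive (fun c d => C * (d - c)).
Proof.
move=> C0; split=> [c x d _|c d cd]; first by ring.
by rewrite mulr_ge0// subr_ge0.
Qed.

End additive_comparison.

(** * Masses of intervals *)

Section borel_intervals.
Context {R : realType} (xi : finite_borel R).
Implicit Types (S T : set R) (c d x W : R).

Definition bmass S : R := fine (xi S).
Definition imass c d : R := bmass `]c, d]%classic.

Lemma bmassE S : measurable S -> xi S = (bmass S)%:E.
Proof. by move=> mS; rewrite /bmass fineK//; exact: fin_num_measure. Qed.

Lemma bmass_ge0 S : 0 <= bmass S.
Proof. by rewrite fine_ge0. Qed.

Lemma bmass_mono S T : measurable S -> measurable T -> S `<=` T -> bmass S <= bmass T.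
Proof.
by move=> mS mT ST; rewrite -lee_fin -!bmassE//; apply: le_measure; rewrite ?inE.
Qed.

Lemma bmassU S T : measurable S -> measurable T -> S `&` T = set0 ->
  bmass (S `|` T) = bmass S + bmass T.
Proof.
move=> mS mT ST; apply: EFin_inj; rewrite EFinD -!bmassE//; last exact: measurableU.
by rewrite measureU.
Qed.

Lemma bmassU_le S T : measurable S -> measurable T -> bmass (S `|` T) <= bmass S + bmass T.
Proof.
move=> mS mT; rewrite -lee_fin EFinD -!bmassE//; last exact: measurableU.
exact: measureU2.
Qed.

Lemma bmass_bigcup_le (F : nat -> set R) W : (forall n, measurable (F n)) ->
  (forall n m, (n <= m)%N -> F n `<=` F m) -> (forall n, bmass (F n) <= W) ->
  bmass (\bigcup_n F n) <= W.
Proof.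
move=> mF nF FW; have mU : measurable (\bigcup_n F n) by exact: bigcup_measurable.
have cv : (xi \o F) n @[n --> \oo] --> xi (\bigcup_n F n).
  by apply: nondecreasing_cvg_mu => // n m nm; apply/subsetPset; exact: nF.
rewrite -lee_fin -bmassE//.
have <- : lim ((xi \o F) n @[n --> \oo]) = xi (\bigcup_n F n) by exact/cvg_lim.
apply: lime_le; first by apply/cvg_ex; exists (xi (\bigcup_n F n)).
by apply: nearW => n /=; rewrite bmassE ?lee_fin.
Qed.

Lemma imass_additive : interval_additive imass.
Proof.
split=> [c x d /andP[cx xd]|c d _]; last exact: bmass_ge0.
rewrite /imass -bmassU; [|exact: measurable_itv|exact: measurable_itv|].
  congr bmass; apply/seteqP; split => z /=; rewrite !in_itv/=.
    by move=> /andP[cz zd]; have [zx|xz] := leP z x; [left|right]; rewrite ?cz ?zd.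
  by move=> [/andP[cz zx]|/andP[xz zd]]; apply/andP; split => //; lra.
by apply/seteqP; split => z //= []; rewrite !in_itv/=; lra.
Qed.

Let scaled_lt c d x : c < d -> c < x -> exists n : nat, forall m, (n <= m)%N ->
  (d - c) / m.+1%:R < x - c.
Proof.
move=> cd cx; exists (Num.truncn ((d - c) / (x - c))) => m nm.
have xc : 0 < x - c by rewrite subr_gt0.
rewrite ltr_pdivrMr// mulrC -ltr_pdivrMr//; apply: lt_le_trans (truncnS_gt _) _.
by rewrite ler_nat.
Qed.

Let frac_mono (n m : nat) c d : c < d -> (n <= m)%N -> (d - c) / m.+1%:R <= (d - c) / n.+1%:R.
Proof.
move=> cd nm; have h : 0 <= d - c by rewrite subr_ge0; exact: ltW.
by rewrite ler_wpM2l// lef_pV2 ?posrE// ler_nat.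
Qed.

Let frac_gt0 (n : nat) c d : c < d -> 0 < (d - c) / n.+1%:R.
Proof. by move=> cd; rewrite divr_gt0// subr_gt0. Qed.

Let frac_le (n : nat) c d : c < d -> (d - c) / n.+1%:R <= d - c.
Proof.
move=> cd; have h : 0 <= d - c by rewrite subr_ge0; exact: ltW.
by rewrite ler_pdivrMr// ler_peMr// ler1n.
Qed.

Lemma imass_left_limit c d W : c < d -> (forall u, c < u <= d -> imass u d <= W) ->
  imass c d <= W.
Proof.
move=> cd H; rewrite /imass.
have -> : `]c, d]%classic = \bigcup_n `](c + (d - c) / n.+1%:R), d]%classic :> set R.
  apply/seteqP; split => x /=.
    rewrite in_itv/= => /andP[cx xd]; have [n /(_ n (leqnn n)) Hn] := scaled_lt cd cx.
    by exists n => //=; rewrite in_itv/= xd andbT; move: Hn; move: (_ / _) => q; lra.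
  move=> [n _ /=]; rewrite !in_itv/=; have := frac_gt0 n cd; move: (_ / _) => q; lra.
apply: bmass_bigcup_le.
- by move=> n; exact: measurable_itv.
- by move=> n m nm x /=; rewrite !in_itv/=; have := frac_mono cd nm; move: (_ / _) (_ / _) => q q'; lra.
- by move=> n; apply: H; have := frac_gt0 n cd; have := frac_le n cd; move: (_ / _) => q; lra.
Qed.

Lemma imass_right_limit c d W : c < d -> (forall u, c <= u < d -> imass c u <= W) ->
  bmass `]c, d[%classic <= W.
Proof.
move=> cd H.
have -> : `]c, d[%classic = \bigcup_n `]c, (d - (d - c) / n.+1%:R)]%classic :> set R.
  apply/seteqP; split => x /=.
    rewrite in_itv/= => /andP[cx xd].
    have dx : - d < - x by rewrite ltrN2.
    have dc : - d < - c by rewrite ltrN2.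
    have [n /(_ n (leqnn n)) Hn] := scaled_lt dc dx.
    exists n => //=; rewrite in_itv/= cx/=; move: Hn.
    have -> : - c - - d = d - c by ring.
    by move: (_ / _) => q; lra.
  move=> [n _ /=]; rewrite !in_itv/=; have := frac_gt0 n cd; move: (_ / _) => q; lra.
apply: bmass_bigcup_le.
- by move=> n; exact: measurable_itv.
- by move=> n m nm x /=; rewrite !in_itv/=; have := frac_mono cd nm; move: (_ / _) (_ / _) => q q'; lra.
- by move=> n; apply: H; have := frac_gt0 n cd; have := frac_le n cd; move: (_ / _) => q; lra.
Qed.

(** The complements of the punctured balls increase to the whole line, so the masses of the
    punctured balls tend to 0: a mass that stays near x without sitting at x is impossible. *)
Lemma bmass_punctured_le x W :
  (forall e, 0 < e -> W <= bmass [set z | 0 < `|z - x| < e]) -> W <= 0.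
Proof.
move=> H; pose P (n : nat) : set R := [set z | 0 < `|z - x| < n.+1%:R^-1].
have mP n : measurable (P n).
  rewrite (_ : P n = (ball x n.+1%:R^-1 : set R) `\` [set x]).
    by apply: measurableD => //; apply: open_measurable; exact: ball_open.
  apply/seteqP; split => z; rewrite /P /ball /= normr_gt0 subr_eq0 distrC.
    by move=> /andP[/eqP].
  by move=> [-> /eqP ->].
pose F n := ~` P n.
have mF n : measurable (F n) by exact: measurableC.
have FP n : bmass (F n) = bmass setT - bmass (P n).
  have -> : setT = F n `|` P n by rewrite setUC setUv.
  by rewrite bmassU ?addrK//; rewrite setIC setICr.
suff : bmass (\bigcup_n F n) <= bmass setT - W.
  rewrite (_ : \bigcup_n F n = setT); first by lra.
  rewrite -subTset => z _; have [->|zx] := eqVneq z x.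
    by exists 0%N => //; rewrite /F /P /= subrr normr0 ltxx.
  have zx0 : 0 < `|z - x| by rewrite normr_gt0 subr_eq0.
  exists (Num.truncn `|z - x|^-1) => //; rewrite /F /P /= zx0/=; apply/negP; rewrite -leNgt.
  by rewrite -[leRHS]invrK lef_pV2 ?posrE ?invr_gt0// ltW// truncnS_gt.
apply: bmass_bigcup_le => //.
- move=> n m nm z; rewrite /F /P /= => nz /andP[z0 zm]; apply: nz; rewrite z0/=.
  by apply: (lt_le_trans zm); rewrite lef_pV2 ?posrE// ler_nat.
- by move=> n; rewrite FP lerD2l lerN2; apply: H; rewrite invr_gt0.
Qed.

End borel_intervals.

(** * The mean near an end and with a large value there *)

Section limits_of_gmean.
Context {R : realType} (K : R) (N : \bar R).
Hypothesis hN : dimension_range N.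

Lemma gmean_cvg_left (T : Type) (F : set_system T) {FF : Filter F} (t_ d_ : T -> R) (d a b : R) :
  0 < d -> distance_range K N d -> 0 < a -> 0 < b ->
  t_ z @[z --> F] --> (0 : R) -> d_ z @[z --> F] --> d ->
  gmean K N (t_ z) (d_ z) a b @[z --> F] --> a.
Proof.
move=> d0 [_ dl] a0 b0 ct cd.
have c1t : 1 - t_ z @[z --> F] --> (1 : R).
  by rewrite -[X in _ --> X]subr0; apply: cvgB => //; exact: cvg_cst.
have infinite : a `^ (1 - t_ z) * b `^ t_ z * expR (K * t_ z * (1 - t_ z) * d_ z ^+ 2 / 2)
    @[z --> F] --> a.
  have powc (c l : R) (u : T -> R) : 0 < c -> u z @[z --> F] --> l -> c `^ u z @[z --> F] --> c `^ l.
    move=> c0 cu; rewrite /powR gt_eqF//; apply: cvg_for; first exact: continuous_expR.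
    by apply: cvgMl.
  have E : a `^ 1 * b `^ 0 * expR (K * 0 * 1 * d ^+ 2 / 2) = a.
    by rewrite powRr1 ?ltW// powRr0 mulr0 !mul0r expR0 !mulr1.
  rewrite -[X in _ --> X]E; apply: cvgM; first by apply: cvgM; exact: powc.
  apply: cvg_for; first exact: continuous_expR.
  apply: cvgMl; apply: cvgM.
    by apply: cvgM; [exact: cvgMr|exact: c1t].
  by apply: (cvg_for (g := fun y : R => y ^+ 2)) => //; exact: exprn_continuous.
case NE : N => [n||]; rewrite /gmean//.
have n1 : n - 1 != 0.
  by case: (dimension_exponent hN NE) => p1; [rewrite lt_eqF|rewrite gt_eqF ?(lt_le_trans ltr01)].
rewrite NE in dl.
have Sd : 0 < s_delta (delta K n%:E) d by exact: s_delta_gt0.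
have sgc (u : T -> R) (l : R) : u z @[z --> F] --> l ->
    sg (delta K n%:E) (u z) (d_ z) @[z --> F] --> s_delta (delta K n%:E) (l * d) / s_delta (delta K n%:E) d.
  move=> cu; apply: cvg_trans (near_eq_cvg _) _; last first.
    apply: cvgM; first by apply: cvg_s_delta; apply: cvgM; [exact: cu|exact: cd].
    apply: cvgV; first by rewrite gt_eqF.
    by apply: cvg_s_delta; exact: cd.
  have ev : \forall z \near F, 0 < d_ z by apply: (cvgr_gt _ cd).
  by apply: filterS ev => z dz; rewrite /sg gt_eqF.
rewrite /pmean -[X in _ --> X](powRKV a0 n1); apply: cvg_powR; first exact: powR_gt0.
have E : s_delta (delta K n%:E) (1 * d) / s_delta (delta K n%:E) d * a `^ (n - 1)^-1 +
    s_delta (delta K n%:E) (0 * d) / s_delta (delta K n%:E) d * b `^ (n - 1)^-1 = a `^ (n - 1)^-1.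
  by rewrite mul1r divff ?gt_eqF// mul0r s_delta0 !mul0r addr0 mul1r.
rewrite -[X in _ --> X]E; apply: cvgD; apply: cvgMl; exact: sgc.
Qed.

(* An atom at one end and a positive density at the other one force a density
   of order at least [1 / t] in between. *)
Lemma gmean_blowup (d b : R) : 0 < d -> distance_range K N d -> 0 < b ->
  exists ka t0, [/\ 0 < ka, 0 < t0 & forall t C, 0 < t < 1 -> t < t0 -> C < ka / t ->
    exists2 A, 0 < A & C < gmean K N t d A b].
Proof.
move=> d0 dr b0; have [_ dl] := dr.
have infinite t C : 0 < t < 1 -> exists2 A, 0 < A &
    C < A `^ (1 - t) * b `^ t * expR (K * t * (1 - t) * d ^+ 2 / 2).
  move=> /andP[t0 t1]; set E := expR _; have E0 : 0 < E by exact: expR_gt0.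
  have q0 : 0 < (`|C| + 1) / (b `^ t * E) by rewrite divr_gt0 ?mulr_gt0 ?powR_gt0// ltr_wpDl.
  have n1 : 1 - t != 0 by rewrite gt_eqF// subr_gt0.
  exists (((`|C| + 1) / (b `^ t * E)) `^ (1 - t)^-1); first exact: powR_gt0.
  have h := powRKV q0 n1; rewrite h -mulrA divfK ?gt_eqF ?mulr_gt0 ?powR_gt0//.
  by have := ler_norm C; lra.
case NE : N => [n||].
- have [p1|p1] := dimension_exponent hN NE; last first.
    exists 1, 1; split => // t C t01 _ _.
    have w10 : 0 < sg (delta K n%:E) (1 - t) d.
      by apply: sg_gt0; rewrite -?NE ?ltW//; case/andP: t01 => *; lra.
    have w20 : 0 < sg (delta K n%:E) t d.
      by apply: sg_gt0; rewrite -?NE ?ltW//; case/andP: t01 => *; lra.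
    rewrite /gmean /pmean; move: (sg (delta K n%:E) (1 - t) d) (sg (delta K n%:E) t d) w10 w20 => w1 w2 w10 w20.
    have p0 : 0 < n - 1 by exact: lt_le_trans p1.
    have C1 : 0 < `|C| + 1 by rewrite ltr_wpDl.
    pose A := (`|C| + 1) / w1 `^ (n - 1).
    have A0 : 0 < A by rewrite divr_gt0// powR_gt0.
    have wA : 0 < w1 * A `^ (n - 1)^-1 by rewrite mulr_gt0// powR_gt0.
    have wb : 0 < w2 * b `^ (n - 1)^-1 by rewrite mulr_gt0// powR_gt0.
    exists A => //; apply: (@lt_le_trans _ _ ((w1 * A `^ (n - 1)^-1) `^ (n - 1))); last first.
      by apply: powR_lepos => //; [rewrite lerDl; exact: ltW|exact: ltW].
    have h := powRKV A0 (lt0r_neq0 p0); rewrite powRM ?powR_ge0 ?(ltW w10)// h mulrC divfK ?gt_eqF ?powR_gt0//.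
    by have := ler_norm C; lra.
  have Sd : 0 < s_delta (delta K n%:E) d by apply: s_delta_gt0 => //; rewrite -NE.
  have [l l0 lip] := s_delta_lip (delta K n%:E) (ltW d0).
  pose la := 2 * l * d / s_delta (delta K n%:E) d.
  have la0 : 0 < la by rewrite divr_gt0 ?mulr_gt0.
  exists (b / la), la^-1; split; [by rewrite divr_gt0|by rewrite invr_gt0|].
  move=> t C t01 tla Cb; have /andP[t0 t1] := t01.
  have w20 : 0 < sg (delta K n%:E) t d.
    by apply: sg_gt0; rewrite -?NE ?ltW//; lra.
  have w2l : 2 * sg (delta K n%:E) t d <= la * t.
    have h : s_delta (delta K n%:E) (t * d) <= l * (t * d) by apply: lip; nra.
    have -> : la * t = 2 * (l * (t * d) / s_delta (delta K n%:E) d).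
      by rewrite /la; field; rewrite gt_eqF.
    by rewrite /sg gt_eqF// ler_pM2l// ler_pM2r ?invr_gt0.
  have w10 : 0 < sg (delta K n%:E) (1 - t) d.
    by apply: sg_gt0; rewrite -?NE ?ltW//; lra.
  rewrite /gmean /pmean; move: (sg (delta K n%:E) (1 - t) d) (sg (delta K n%:E) t d) w10 w20 w2l => w1 w2 w10 w20 w2l.
  have w0 : 0 < w2 / w1 by rewrite divr_gt0.
  (* This A makes the two terms of the mean equal, so that the mean is (2 w2) ^ (n - 1) b; since 2
     w2 <= la t <= 1 and n - 1 <= -1, it is at least b / (la t). *)
  exists ((w2 / w1) `^ (n - 1) * b); first by rewrite mulr_gt0// powR_gt0.
  have h : ((w2 / w1) `^ (n - 1) * b) `^ (n - 1)^-1 = w2 / w1 * b `^ (n - 1)^-1.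
    by rewrite powRM ?powR_ge0 ?ltW//; congr (_ * _); apply: powRVK => //; rewrite lt_eqF.
  have -> : w1 * ((w2 / w1) `^ (n - 1) * b) `^ (n - 1)^-1 + w2 * b `^ (n - 1)^-1 =
      (2 * w2) * b `^ (n - 1)^-1 by rewrite h; field; rewrite gt_eqF.
  have n1 : n - 1 != 0 by rewrite lt_eqF.
  have h2 := powRKV b0 n1.
  rewrite powRM ?powR_ge0 ?mulr_ge0 ?(ltW w20)// h2.
  apply: (lt_le_trans Cb); rewrite -[in X in X <= _]mulrA mulrC ler_pM2r// -invfM.
  have lt1 : la * t <= 1 by rewrite mulrC -ler_pdivlMr// mul1r; exact: ltW.
  have le1 : n - 1 <= -1 by case: (dimension_finP hN NE); lra.
  have w22 : 0 < 2 * w2 by rewrite mulr_gt0.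
  apply: (@le_trans _ _ ((la * t) `^ (n - 1))); last by apply: powR_leneg => //; exact: ltW.
  have lat : 0 <= la * t by apply: mulr_ge0; exact: ltW.
  rewrite -powR_inv1//.
  by apply: ger_powR le1; rewrite mulr_gt0.
- by exists 1, 1; split => // t C t01 _ _; exact: infinite.
- by exists 1, 1; split => // t C t01 _ _; exact: infinite.
Qed.

End limits_of_gmean.

(** * The lower left density of a measure satisfying the mean inequality *)

Section lower_density.
Context {R : realType} (K : R) (N D : \bar R) (xi : finite_borel R).
Hypothesis hN : dimension_range N.
Hypothesis hDl : 0 < delta K N -> K < 0 -> (D < l_delta (delta K N))%E.
Hypothesis hM : MKND K N D xi.
Implicit Types (x y z a b c d e r t C : R).
Local Notation m := (bmass xi).
Local Notation itv a b := (`[a, b]%classic : set R).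

Lemma right_nearP (P : R -> Prop) : (\forall e \near 0^'+, P e) ->
  exists2 r, 0 < r & forall e, 0 < e < r -> P e.
Proof.
move=> [r /= r0 H]; exists r => // e /andP[e0 er]; apply: H => //=.
by rewrite sub0r normrN gtr0_norm.
Qed.

Let mitv a b : measurable (itv a b).
Proof. exact: measurable_itv. Qed.

(** Left intervals are used at every point because the mean of two of them is again a left interval
    of the mean point. They are closed, so that an atom at x makes every c admissible. *)
Definition lower_left x c := exists2 r, 0 < r & forall e, 0 < e < r -> c * e <= m (itv (x - e) x).
Definition charged x := exists2 c, 0 < c & lower_left x c.

Lemma lower_left_le x c c' : lower_left x c -> c' <= c -> lower_left x c'.
Proof.
move=> [r r0 H] cc; exists r => // e er; apply: le_trans (H e er).
by rewrite ler_wpM2r//; case/andP: er => /ltW.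
Qed.

Lemma lower_left0 x : lower_left x 0.
Proof. by exists 1 => // e _; rewrite mul0r bmass_ge0. Qed.

Lemma not_lower_left x c r : ~ lower_left x c -> 0 < r ->
  exists2 e, 0 < e < r & m (itv (x - e) x) < c * e.
Proof.
move=> nG r0; apply: contrapT => H; apply: nG; exists r => // e er.
by rewrite leNgt; apply/negP => lt; apply: H; exists e.
Qed.

Lemma lower_left_half x c : lower_left x c -> exists2 r, 0 < r &
  forall e, 0 < e < r -> c * e <= imass xi (x - e) x.
Proof.
move=> [r r0 H]; exists r => // e /andP[e0 er]; rewrite leNgt; apply/negP => lt.
have i0 : 0 <= imass xi (x - e) x by exact: bmass_ge0.
have c0 : 0 < c by rewrite -(pmulr_lgt0 _ e0); exact: le_lt_trans lt.
(* The closed interval of length e' < e lies in the half-open one of length e, and e' is chosen so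
   that c e' still exceeds the mass of the latter. *)
pose e' := (imass xi (x - e) x / c + e) / 2.
have q1 : imass xi (x - e) x / c < e by rewrite ltr_pdivrMr// mulrC.
have q0 : 0 <= imass xi (x - e) x / c by rewrite divr_ge0// ltW.
have e'0 : 0 < e' < r by rewrite /e'; lra.
have := H e' e'0; apply/negP; rewrite -ltNge.
apply: (@le_lt_trans _ _ (imass xi (x - e) x)).
  rewrite /imass; apply: bmass_mono; [exact: measurable_itv|exact: measurable_itv|].
  by move=> z /=; rewrite !in_itv/= /e'; lra.
by rewrite mulrC -ltr_pdivrMr// /e'; lra.
Qed.

Lemma charged_mass x e : charged x -> 0 < e -> 0 < m (itv (x - e) x).
Proof.
move=> [c c0 [r r0 H]] e0.
have h : 0 < Num.min e (r / 2) by rewrite lt_min e0/= divr_gt0.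
have h1 : Num.min e (r / 2) <= e by rewrite ge_min lexx.
have h2 : Num.min e (r / 2) <= r / 2 by rewrite ge_min lexx orbT.
apply: (@lt_le_trans _ _ (c * Num.min e (r / 2))); first by rewrite mulr_gt0.
apply: (le_trans (H _ _)); first by rewrite h/=; lra.
by apply: bmass_mono => // z /=; rewrite !in_itv/=; lra.
Qed.

Lemma charged_support x : charged x -> msupport xi x.
Proof.
move=> px U oU Ux; have /nbhs_ballP[e /= e0 eU] : nbhs x U by exact: open_nbhs_nbhs.
have e2 : 0 < e / 2 by rewrite divr_gt0.
have mU : measurable U by exact: open_measurable.
rewrite bmassE// lte_fin; apply: lt_le_trans (charged_mass px e2) _.
apply: bmass_mono => // z; rewrite /= in_itv/= => hz; apply: eU.
by rewrite /ball/= ltr_norml; lra.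
Qed.

Lemma charged_diam x y : charged x -> charged y -> (`|x - y|%:E <= D)%E.
Proof.
move=> /charged_support sx /charged_support sy; apply: le_trans hM.1.
by rewrite /diam le_max; apply/orP; right; apply: ereal_sup_ubound; exists x => //; exists y.
Qed.

Lemma theta_itv x0 x1 y0 y1 : x0 <= x1 -> x1 < y0 -> y0 <= y1 ->
  theta_K K (itv x0 x1) (itv y0 y1) = if 0 <= K then y0 - x1 else y1 - x0.
Proof.
move=> hx xy hy.
have Ix a b : a <= b -> (itv a b) a /\ (itv a b) b.
  by move=> ab; rewrite /= !in_itv/= !lexx ab.
have [X0 X1] := Ix _ _ hx; have [Y0 Y1] := Ix _ _ hy.
have [_ thb] := theta_bounds K (segment_compact (a := x0) (b := x1))
  (segment_compact (a := y0) (b := y1)) (ex_intro _ _ X0) (ex_intro _ _ Y0).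
have dist x y : itv x0 x1 x -> itv y0 y1 y -> `|x - y| = y - x.
  by rewrite /= !in_itv/= => hx' hy'; rewrite ltr0_norm; lra.
have nonempty : [set `|x - y| | x in itv x0 x1 & y in itv y0 y1] !=set0.
  by exists `|x0 - y0|; exists x0 => //; exists y0.
apply/eqP; rewrite eq_le; case: ifPn => K0; apply/andP; split.
- by rewrite -(dist _ _ X1 Y0); exact: (thb _ _ X1 Y0).1.
- rewrite /theta_K K0; apply: lb_le_inf => // _ [x Ix' [y Iy <-]].
  by rewrite dist//; move: Ix' Iy; rewrite /= !in_itv/=; lra.
- rewrite /theta_K (negbTE K0); apply: ge_sup => // _ [x Ix' [y Iy <-]].
  by rewrite dist//; move: Ix' Iy; rewrite /= !in_itv/=; lra.
- by rewrite -(dist _ _ X0 Y1); apply: (thb _ _ X0 Y1).2; rewrite ltNge.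
Qed.

Lemma interval_mean x0 x1 y0 y1 t : 0 < t < 1 ->
  (distorted_mean K N t (theta_K K (itv x0 x1) (itv y0 y1)) (m (itv x0 x1)) (m (itv y0 y1))
   <= (m (itv ((1 - t) * x0 + t * y0) ((1 - t) * x1 + t * y1)))%:E)%E.
Proof.
move=> t01; have t01' : 0 <= t <= 1 by case/andP: t01 => *; apply/andP; split; exact: ltW.
apply: le_trans (hM.2 _ _ _ (@segment_compact _ _ _) (@segment_compact _ _ _) t01') _.
rewrite -bmassE//; apply: le_measure; rewrite ?inE//.
  apply: closed_measurable; apply: compact_closed; first exact: Rhausdorff.
  by apply: compact_minkowski_mean; exact: segment_compact.
move=> _ [x + [y + <-]]; rewrite /= !in_itv/= => /andP[a1 a2] /andP[b1 b2].
have /andP[s0 s1] := t01; have s1' : 0 < 1 - t by rewrite subr_gt0.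
by apply/andP; split; apply: lerD; rewrite ler_pM2l.
Qed.

(** The intervals of lengths al e / s and be e / s to the left of x and y have a mean of length
    exactly e to the left of z. With [al], [be] from the equality case, the masses a al and b be
    turn the mean of masses into gmean times s, and the strict inequality absorbs the small change
    of distance. *)
Lemma lower_left_CD_lt x y a b t C : x < y -> lower_left x a -> lower_left y b ->
  0 < a -> 0 < b -> distance_range K N (y - x) -> 0 < t < 1 ->
  C < gmean K N t (y - x) a b -> lower_left ((1 - t) * x + t * y) C.
Proof.
move=> xy [ra ra0 Ha] [rb rb0 Hb] a0 b0 dr t01 Cg; have /andP[t0 t1] := t01.
have [al [be [al0 be0 E]]] := gmean_attained hN t01 dr a0 b0.
have t1' : 0 < 1 - t by rewrite subr_gt0.
pose s := (1 - t) * al + t * be; have s0 : 0 < s by rewrite addr_gt0// mulr_gt0.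
(* This is [theta_K] of the two intervals: their gap if K >= 0, the distance of their far ends if K
   < 0. *)
pose dist (e : R) := if 0 <= K then y - x - be * (e / s) else y - x + al * (e / s).
have cs c : c * (e / s) @[e --> 0^'+] --> (0 : R).
  have E0 : c * (0 / s) = 0 by rewrite mul0r mulr0.
  rewrite -[X in _ --> X]E0; apply: cvgMr; apply: cvgMl.
  by apply: cvg_at_right_filter; exact: cvg_id.
have cd : dist e @[e --> 0^'+] --> y - x.
  have E1 : y - x - 0 = y - x by rewrite subr0.
  have E2 : y - x + 0 = y - x by rewrite addr0.
  rewrite /dist; case: (0 <= K).
    by rewrite -[X in _ --> X]E1; apply: cvgB; [exact: cvg_cst|exact: cs].
  by rewrite -[X in _ --> X]E2; apply: cvgD; [exact: cvg_cst|exact: cs].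
have d0 : 0 < y - x by rewrite subr_gt0.
have aal : 0 < al * a by rewrite mulr_gt0. have bbe : 0 < be * b by rewrite mulr_gt0.
have cv : dmean K N t (dist e) (al * a) (be * b) @[e --> 0^'+] --> dmean K N t (y - x) (al * a) (be * b).
  exact: cvg_dmean.
have lt : C * s < dmean K N t (y - x) (al * a) (be * b) by rewrite E ltr_pM2r.
have ev1 : \forall e \near 0^'+, C * s < dmean K N t (dist e) (al * a) (be * b).
  exact: (cvgr_gt _ cv _ lt).
have ev2 : \forall e \near 0^'+, distance_range K N (dist e) by exact: (distance_range_near d0 dr cd).
have ev3 : \forall e \near 0^'+, al * (e / s) < ra by apply: (cvgr_lt _ (cs al)).
have ev4 : \forall e \near 0^'+, be * (e / s) < rb by apply: (cvgr_lt _ (cs be)).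
have ev5 : \forall e \near 0^'+, be * (e / s) < y - x by apply: (cvgr_lt _ (cs be)).
have [r r0 Hr] : exists2 r, 0 < r & forall e, 0 < e < r ->
    [/\ C * s < dmean K N t (dist e) (al * a) (be * b), distance_range K N (dist e),
        al * (e / s) < ra, be * (e / s) < rb & be * (e / s) < y - x].
  by apply: right_nearP; near=> e; split; near: e.
exists r => // e er; have [H1 H2 H3 H4 H5] := Hr _ er.
have e0 : 0 < e by case/andP: er.
have es : 0 < e / s by rewrite divr_gt0.
have ea : 0 < al * (e / s) by rewrite mulr_gt0.
have eb : 0 < be * (e / s) by rewrite mulr_gt0.
have := interval_mean (x - al * (e / s)) x (y - be * (e / s)) y t01.
have -> : theta_K K (itv (x - al * (e / s)) x) (itv (y - be * (e / s)) y) = dist e.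
  rewrite theta_itv ?gerBl ?(ltW ea) ?(ltW eb)//; last by rewrite ltrBrDr addrC -ltrBrDr.
  by rewrite /dist; case: (0 <= K); ring.
have Ha' := Ha (al * (e / s)); rewrite ea H3 in Ha'; have {}Ha' := Ha' isT.
have Hb' := Hb (be * (e / s)); rewrite eb H4 in Hb'; have {}Hb' := Hb' isT.
have A0 : 0 < a * (al * (e / s)) by rewrite mulr_gt0.
have B0 : 0 < b * (be * (e / s)) by rewrite mulr_gt0.
rewrite distorted_meanE//; [|exact: lt_le_trans Ha'|exact: lt_le_trans Hb'].
have -> : (1 - t) * (x - al * (e / s)) + t * (y - be * (e / s)) = (1 - t) * x + t * y - e.
  have Es : e / s * s = e by rewrite divfK ?gt_eqF.
  by rewrite -[X in _ = _ - X]Es /s; ring.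
rewrite lee_fin; apply: le_trans.
apply: le_trans (dmean_le hN t01 H2 A0 B0 Ha' Hb').
have -> : a * (al * (e / s)) = e / s * (al * a) by ring.
have -> : b * (be * (e / s)) = e / s * (be * b) by ring.
rewrite dmeanZ//.
have -> : C * e = e / s * (C * s) by rewrite mulrCA divfK ?gt_eqF.
by rewrite ler_pM2l// ltW.
Unshelve. all: by end_near.
Qed.

Lemma lower_left_CD x y a b t C : x != y -> lower_left x a -> lower_left y b ->
  0 < a -> 0 < b -> distance_range K N `|y - x| -> 0 < t < 1 ->
  C < gmean K N t `|y - x| a b -> lower_left ((1 - t) * x + t * y) C.
Proof.
move=> xy Ga Gb a0 b0 dr t01 Cg; have [lt|gt|E] := ltgtP x y; last by rewrite E eqxx in xy.
  by rewrite gtr0_norm ?subr_gt0// in dr Cg; exact: lower_left_CD_lt Cg.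
rewrite ltr0_norm ?subr_lt0// opprB in dr Cg.
have -> : (1 - t) * x + t * y = (1 - (1 - t)) * y + (1 - t) * x by ring.
have t01' : 0 < 1 - t < 1 by lra.
by rewrite gmean_swap in Cg; exact: lower_left_CD_lt Cg.
Qed.

(** For K > 0 a distance beyond [l_delta] would leave two charged intervals still that far apart,
    forcing infinite mass; for K < 0 the diameter bound and D < l_delta exclude it. *)
Lemma charged_range_weak x y : charged x -> charged y -> x < y ->
  ((y - x)%:E <= l_delta (delta K N))%E.
Proof.
move=> px py xy; rewrite leNgt; apply/negP => lt.
have d0 : 0 < delta K N by move: lt; rewrite /l_delta; case: ifP.
have K0 : 0 < K.
  rewrite ltNge; apply/negP; rewrite le_eqVlt => /predU1P[K0|K0].
    by move: d0; rewrite K0 /delta; case: N => [n||]; rewrite ?mul0r ltxx.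
  have := charged_diam py px; rewrite gtr0_norm ?subr_gt0// => le.
  by have := lt_le_trans (lt_trans (hDl d0 K0) lt) le; rewrite ltxx.
pose l := pi / Num.sqrt (delta K N).
have lE : l_delta (delta K N) = l%:E by rewrite /l_delta d0.
have l0 : 0 < l by rewrite divr_gt0 ?pi_gt0// sqrtr_gt0.
rewrite lE lte_fin in lt.
pose e := (y - x - l) / 2; have e0 : 0 < e by rewrite /e; lra.
have t01 : 0 < (1 / 2 : R) < 1 by lra.
have := interval_mean (x - e) x (y - e) y t01.
have xx : x - e <= x by lra.
have yy : y - e <= y by lra.
have xye : x < y - e by rewrite /e; lra.
rewrite theta_itv// (ltW K0); have th0 : 0 < y - e - x by lra.
have far : (l_delta (delta K N) <= (y - e - x)%:E)%E by rewrite lE lee_fin /e; lra.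
by rewrite ((distorted_mean_far hN t01 th0 far (charged_mass px e0) (charged_mass py e0)).1 K0) leye_eq.
Qed.

(** At a point that is not charged, some arbitrarily short left interval has mass below any
    prescribed slope; comparison with linear functions of small slope gives mass 0. *)
Lemma uncharged_null c d : c <= d -> (forall x, c < x <= d -> ~ charged x) -> imass xi c d = 0.
Proof.
rewrite le_eqVlt => /predU1P[->|cd] nx.
  by rewrite /imass set_itv_ge -?leNgt ?bnd_simp// /bmass measure0.
apply/eqP; rewrite eq_le bmass_ge0 andbT; apply/ler_addgt0Pr => e e0; rewrite add0r.
have dc : 0 < d - c by rewrite subr_gt0.
have ed : 0 < e / (d - c) by rewrite divr_gt0.
have <- : e / (d - c) * (d - c) = e by rewrite divfK ?gt_eqF.
apply: (@interval_comparison _ (imass xi) _ _ _ (imass_additive xi) (linear_additive (ltW ed))).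
- by move=> s W /andP[cs sd]; exact: imass_left_limit.
- move=> x r xI r0; have nG : ~ lower_left x (e / (d - c)) by move=> G; apply: (nx _ xI); exists (e / (d - c)).
  have [u /andP[u0 ur] lt] := not_lower_left nG r0; exists u; first by rewrite u0.
  have -> : x - (x - u) = u by ring.
  apply: le_trans (ltW lt).
  rewrite /imass; apply: bmass_mono; [exact: measurable_itv|exact: measurable_itv|].
  by move=> z /=; rewrite !in_itv/= => /andP[/ltW -> ->].
- exact: ltW.
Qed.

Lemma uncharged_null_open c d : (forall x, c < x < d -> ~ charged x) ->
  m (`]c, d[%classic : set R) = 0.
Proof.
move=> nx; have [dc|cd] := leP d c.
  by rewrite set_itv_ge -?leNgt ?bnd_simp// /bmass measure0.
apply/eqP; rewrite eq_le bmass_ge0 andbT; apply: imass_right_limit => // u /andP[cu ud].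
rewrite uncharged_null// => x /andP[cx xu]; apply: nx; rewrite cx.
exact: le_lt_trans ud.
Qed.

(** The open interval to the left is null, while closed left intervals have positive mass; the point
    itself must carry it. *)
Lemma atom_of_left_gap x r : charged x -> 0 < r -> (forall z, x - r < z < x -> ~ charged z) ->
  0 < m [set x].
Proof.
move=> px r0 nz; have r2 : 0 < r / 2 by rewrite divr_gt0.
have := charged_mass px r2; have null := uncharged_null_open nz.
have mo : measurable (`]x - r, x[%classic : set R) by exact: measurable_itv.
have := bmassU_le xi mo (measurable_set1 x); rewrite null add0r => le1 lt1.
apply: lt_le_trans le1; apply: lt_le_trans lt1 _; apply: bmass_mono => //.
  by apply: measurableU => //; exact: measurable_set1.
move=> z /=; rewrite !in_itv/= => /andP[h1]; rewrite le_eqVlt => /predU1P[->|zx]; first by right.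
by left; apply/andP; split => //; lra.
Qed.

Lemma atom_lower_left x C : 0 < m [set x] -> lower_left x C.
Proof.
move=> m0; have C1 : 0 < `|C| + 1 by rewrite ltr_wpDl.
exists (m [set x] / (`|C| + 1)); first by rewrite divr_gt0.
move=> e /andP[e0]; rewrite ltr_pdivlMr// => h.
apply: (@le_trans _ _ (m [set x])).
  apply: le_trans (ltW h); rewrite mulrC; apply: ler_wpM2l; first exact: ltW.
  by have := ler_norm C; lra.
apply: bmass_mono; [exact: measurable_set1|exact: mitv|].
by move=> z /= ->; rewrite in_itv/= lexx andbT; lra.
Qed.

Lemma lower_left_imass c d C : 0 <= C -> c <= d -> (forall x, c < x <= d -> lower_left x C) ->
  C * (d - c) <= imass xi c d.
Proof.
move=> C0 cd G.
apply: (@interval_comparison _ (fun c d => C * (d - c)) _ c d (linear_additive C0) (imass_additive xi)) => //.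
- move=> s W /andP[cs sd] H; rewrite leNgt; apply/negP => lt.
  have ds : 0 < d - s by rewrite subr_gt0.
  have C0' : 0 <= W by have := H d; rewrite sd lexx subrr mulr0 => /(_ isT).
  have C1 : 0 < C by rewrite -(pmulr_lgt0 _ ds); exact: le_lt_trans lt.
  have q : W / C < d - s by rewrite ltr_pdivrMr// mulrC.
  have := H ((s + (d - W / C)) / 2); have q0 : 0 <= W / C by rewrite divr_ge0.
  have uI : s < (s + (d - W / C)) / 2 <= d by lra.
  rewrite uI => /(_ isT); apply/negP; rewrite -ltNge mulrC -ltr_pdivrMr//; lra.
- move=> x r xI r0; have [s s0 Hs] := lower_left_half (G _ xI).
  have h : 0 < Num.min r s by rewrite lt_min r0.
  have h1 : Num.min r s <= r by rewrite ge_min lexx.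
  have h2 : Num.min r s <= s by rewrite ge_min lexx orbT.
  exists (Num.min r s / 2); first by lra.
  rewrite (_ : x - (x - Num.min r s / 2) = Num.min r s / 2); last by ring.
  by apply: Hs; lra.
Qed.

(** Infinite density at x would spread towards y: by [gmean_blowup] the points with parameter t in
    [s / 2, s] have density at least ka / (2 s), and they fill a length s d / 2. So each punctured
    ball around x would have mass at least ka d / 4. *)
Lemma unbounded_lower_left x y : x != y -> distance_range K N `|y - x| -> charged y ->
  ~ forall C, lower_left x C.
Proof.
move=> xy dr [b b0 Gb] Gx; set d := `|y - x| in dr.
have d0 : 0 < d by rewrite normr_gt0 subr_eq0 eq_sym.
have [ka [t0 [ka0 t00 H]]] := gmean_blowup hN d0 dr b0.
suff : ka * d / 4 <= 0 by rewrite leNgt divr_gt0// mulr_gt0.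
apply: (@bmass_punctured_le _ xi x) => e e0.
(* The bounds serve in turn the range of [gmean_blowup], the condition t < 1, and the requirement
   that the points stay within e of x. *)
pose s := Num.min (Num.min (t0 / 2) (1 / 2)) (e / d / 2).
have s0 : 0 < s by rewrite !lt_min !divr_gt0.
have s1 : s <= 1 / 2 by rewrite !ge_min lexx orbT.
have s2 : s <= t0 / 2 by rewrite !ge_min lexx.
have s3 : s * d <= e / 2.
  by rewrite -ler_pdivlMr// mulrAC /s ge_min [X in _ || X]lexx orbT.
have sd0 : 0 < s * d by rewrite mulr_gt0.
have Gt t : s / 2 <= t <= s -> lower_left ((1 - t) * x + t * y) (ka / (2 * s)).
  move=> tI; have tp : 0 < t by lra.
  have [|||A A0 CA] := H t (ka / (2 * s)); [lra|lra| |].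
    by rewrite ltr_pM2l// ltf_pV2 ?posrE ?mulr_gt0//; lra.
  by apply: (lower_left_CD xy (Gx A) Gb A0 b0 dr _ CA); lra.
have C0 : 0 <= ka / (2 * s) by rewrite divr_ge0 ?mulr_ge0 ?(ltW ka0) ?(ltW s0).
have E : ka * d / 4 = ka / (2 * s) * (s * d / 2) by field; rewrite gt_eqF.
have conclude c : (forall z, c < z <= c + s * d / 2 -> exists2 t, s / 2 <= t <= s & z = (1 - t) * x + t * y) ->
    ka * d / 4 <= m [set z | 0 < `|z - x| < e].
  move=> Hc; have cc : c <= c + s * d / 2 by lra.
  have := lower_left_imass C0 cc; rewrite (_ : c + s * d / 2 - c = s * d / 2); last by ring.
  rewrite -E => le; apply: (le_trans (le _)).
    by move=> z /Hc[t tI ->]; exact: Gt.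
  apply: bmass_mono; [exact: measurable_itv| |].
    rewrite (_ : [set z | _] = (ball x e : set R) `\` [set x]).
      by apply: measurableD => //; apply: open_measurable; exact: ball_open.
    apply/seteqP; split => z; rewrite /ball /= normr_gt0 subr_eq0 distrC.
      by move=> /andP[/eqP].
    by move=> [-> /eqP ->].
  move=> z; rewrite /= in_itv/= => /Hc[t tI ->].
  have -> : (1 - t) * x + t * y - x = t * (y - x) by ring.
  have tp : 0 < t by lra.
  rewrite normrM gtr0_norm// mulr_gt0//=.
  have : t * d <= s * d by rewrite ler_pM2r//; case/andP: tI.
  by rewrite -/d; lra.
have [lt|gt|] := ltgtP x y; last by move/eqP; rewrite (negbTE xy).
  have dE : d = y - x by rewrite /d gtr0_norm// subr_gt0.
  apply: (conclude (x + s * d / 2)) => z zI; exists ((z - x) / d).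
    by rewrite ler_pdivlMr// ler_pdivrMr//; lra.
  by rewrite dE; field; rewrite -dE gt_eqF.
have dE : d = x - y by rewrite /d ltr0_norm ?opprB// subr_lt0.
apply: (conclude (x - s * d)) => z zI; exists ((x - z) / d).
  by rewrite ler_pdivlMr// ler_pdivrMr//; lra.
by rewrite dE; field; rewrite -dE gt_eqF.
Qed.

(** Suppose the distance equals [l_delta], so that K > 0. Charged points left of x would be too far
    from y, so x is an atom. A charged point between contradicts [unbounded_lower_left]; otherwise y
    is an atom as well, and the mean of the two points would have infinite mass. *)
Lemma charged_range x y : charged x -> charged y -> x < y -> distance_range K N (y - x).
Proof.
move=> px py xy; have d0 : 0 < y - x by rewrite subr_gt0.
split; first exact: ltW.
rewrite lt_neqAle charged_range_weak// andbT; apply/negP => /eqP lE.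
have dl0 : 0 < delta K N by move: lE; rewrite /l_delta; case: ifP.
have K0 : 0 < K.
  rewrite ltNge; apply/negP; rewrite le_eqVlt => /predU1P[K0|K0].
    by move: dl0; rewrite K0 /delta; case: N => [n||]; rewrite ?mul0r ltxx.
  have := charged_diam py px; rewrite gtr0_norm ?subr_gt0// lE => le.
  by have := lt_le_trans (hDl dl0 K0) le; rewrite ltxx.
have ax : 0 < m [set x].
  apply: (atom_of_left_gap px ltr01) => z /andP[_ zx] pz.
  have := charged_range_weak pz py (lt_trans zx xy); rewrite -lE lee_fin; lra.
have unb C : lower_left x C by exact: atom_lower_left.
have [[z [zI pz]]|nz] := pselect (exists z, x < z < y /\ charged z).
  have [xz zy] := andP zI.
  apply: (@unbounded_lower_left x z _ _ pz unb); first by rewrite lt_eqF.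
  split; first exact: normr_ge0.
  by rewrite gtr0_norm ?subr_gt0// -lE lte_fin; lra.
have ay : 0 < m [set y].
  apply: (atom_of_left_gap py d0) => z zI pz; apply: nz; exists z; split => //.
  by move: zI; rewrite (_ : y - (y - x) = x); last by ring.
have t01 : 0 < (1 / 2 : R) < 1 by lra.
have := interval_mean x x y y t01; rewrite theta_itv// (ltW K0) !set_itv1.
have far : (l_delta (delta K N) <= (y - x)%:E)%E by rewrite lE.
by rewrite ((distorted_mean_far hN t01 d0 far ax ay).1 K0) leye_eq.
Qed.

Lemma charged_range_norm x y : charged x -> charged y -> x != y -> distance_range K N `|y - x|.
Proof.
move=> px py; case: ltgtP => // xy _.
  by rewrite gtr0_norm ?subr_gt0//; exact: charged_range.
by rewrite ltr0_norm ?subr_lt0// opprB; exact: charged_range.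
Qed.

Lemma charged_itv x z y : charged x -> charged y -> x <= z <= y -> charged z.
Proof.
move=> px py /andP[]; rewrite le_eqVlt => /predU1P[<-//|xz]; rewrite le_eqVlt => /predU1P[->//|zy].
have xy := lt_trans xz zy; have dr := charged_range px py xy.
have [t [t01 ->]] : exists t, 0 < t < 1 /\ z = (1 - t) * x + t * y by apply: conv_between; rewrite xz.
have [a a0 Ga] := px; have [b b0 Gb] := py.
have g0 : 0 < gmean K N t (y - x) a b by exact: gmean_gt0.
exists (gmean K N t (y - x) a b / 2); first by rewrite divr_gt0.
by apply: (lower_left_CD_lt xy Ga Gb a0 b0 dr t01); lra.
Qed.

End lower_density.

(** * From lower left densities to absolute continuity *)

Section density_intervals.
Context {R : realType}.
Local Notation mu := (@lebesgue_measure R).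
Local Notation intg f := (mu.-integrable setT (EFin \o f)).
Variables (J : R -> R) (mJ : measurable_fun setT J) (iJ : intg J) (J0 : forall x, 0 <= J x).
Implicit Types (c d C : R).
Local Notation nu := (density_measure mJ iJ J0).

Let mI c d : measurable (`]c, d]%classic : set R).
Proof. exact: measurable_itv. Qed.

Let cst_itv C c d : c <= d -> (\int[mu]_(x in `]c, d]%classic) (cst C%:E x) = (C * (d - c))%:E)%E.
Proof.
move=> cd; rewrite integral_cst// EFinM; congr (_ * _)%E.
have muI : mu (`]c, d]%classic : set R) = (d - c)%:E.
  rewrite lebesgue_measure_itv/= lte_fin -EFinB.
  by move: cd; rewrite le_eqVlt => /predU1P[->|->//]; rewrite ltxx subrr.
exact: muI.
Qed.

Lemma imass_density_le c d C : c <= d -> (forall z, c < z <= d -> J z <= C) ->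
  imass nu c d <= C * (d - c).
Proof.
move=> cd JC; rewrite -lee_fin -bmassE//.
change (\int[mu]_(x in `]c, d]%classic) (J x)%:E <= (C * (d - c))%:E)%E.
rewrite -cst_itv//; move: cd; rewrite le_eqVlt => /predU1P[->|cd].
  by rewrite set_itv_ge ?bnd_simp ?ltxx// !integral_set0.
have C0 : 0 <= C by apply: le_trans (J0 d) (JC _ _); rewrite cd lexx.
apply: ge0_le_integral.
- exact: mI.
- by move=> z _; rewrite lee_fin.
- exact/measurable_funTS/measurable_EFinP.
- exact: measurable_cst.
- by move=> z; rewrite /= in_itv/= lee_fin; exact: JC.
Qed.

Lemma imass_density_ge c d C : c <= d -> 0 <= C -> (forall z, c < z < d -> C <= J z) ->
  C * (d - c) <= imass nu c d.
Proof.
move=> cd C0 JC; rewrite -lee_fin -bmassE//.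
change ((C * (d - c))%:E <= \int[mu]_(x in `]c, d]%classic) (J x)%:E)%E.
have -> : ((C * (d - c))%:E = \int[mu]_(x in `]c, d[%classic) (cst C%:E x))%E.
  rewrite integral_cst ?EFinM; last exact: measurable_itv.
  have muI : mu (`]c, d[%classic : set R) = (d - c)%:E.
    rewrite lebesgue_measure_itv/= lte_fin -EFinB.
    by move: cd; rewrite le_eqVlt => /predU1P[->|->//]; rewrite ltxx subrr.
  by congr (_ * _)%E; rewrite -muI.
have mo : measurable (`]c, d[%classic : set R) by exact: measurable_itv.
apply: (@le_trans _ _ (\int[mu]_(x in `]c, d[%classic) (J x)%:E)%E).
  apply: ge0_le_integral.
  - exact: mo.
  - by move=> z _; rewrite lee_fin.
  - exact: measurable_cst.
  - exact/measurable_funTS/measurable_EFinP.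
  - by move=> z; rewrite /= in_itv/= lee_fin; exact: JC.
apply: ge0_subset_integral => //.
- exact/measurable_funTS/measurable_EFinP.
- by move=> z _; rewrite lee_fin.
- by move=> z /=; rewrite !in_itv/= => /andP[-> /ltW].
Qed.

End density_intervals.

Lemma interval_length_le {R : realType} (a b : R) (E : \bar R) : a < b ->
  (forall x y, a < x -> x < y -> y < b -> ((y - x)%:E <= E)%E) -> ((b - a)%:E <= E)%E.
Proof.
move=> ab H; case: E H => [e||] H; last 2 first.
- exact: leey.
- have : (((a + 2 * b) / 3 - (2 * a + b) / 3)%:E <= -oo)%E by apply: H; lra.
  by rewrite leeNy_eq.
rewrite lee_fin leNgt; apply/negP => lt.
pose h := (b - a - Num.max e 0) / 3.
have e0 : 0 <= Num.max e 0 by rewrite le_max lexx orbT.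
have e1 : e <= Num.max e 0 by rewrite le_max lexx.
have e2 : Num.max e 0 < b - a by rewrite gt_max lt subr_gt0.
have := H (a + h) (b - h); rewrite lee_fin /h; move: (Num.max e 0) e0 e1 e2 => q; lra.
Qed.

Section density.
Context {R : realType} (K : R) (N D : \bar R) (xi : finite_borel R).
Hypothesis hN : dimension_range N.
Hypothesis hDl : 0 < delta K N -> K < 0 -> (D < l_delta (delta K N))%E.
Hypothesis hM : MKND K N D xi.
Local Notation mu := (@lebesgue_measure R).
Local Notation intg f := (mu.-integrable setT (EFin \o f)).
Implicit Types (x y z w c t : R).
Hypothesis two : forall x, charged xi x -> exists2 y, charged xi y & x != y.

(** The supremum is over a bounded set: by [two] a charged point has a charged companion, and
    [unbounded_lower_left] then forbids infinite density. *)
Definition dens x : R := sup [set c | lower_left xi x c].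

Lemma not_all_lower_left x : exists2 C, 0 <= C & ~ lower_left xi x C.
Proof.
have [px|nx] := pselect (charged xi x); last first.
  by exists 1 => // G; apply: nx; exists 1.
have [y py xy] := two px; have dr := charged_range_norm hN hDl hM px py xy.
have nub : ~ (forall C, lower_left xi x C) := unbounded_lower_left hN hM xy dr py.
apply: contrapT => H; apply: nub => C.
apply: (lower_left_le (c := Num.max C 0)); last by rewrite le_max lexx.
by apply: contrapT => nG; apply: H; exists (Num.max C 0); rewrite // le_max lexx orbT.
Qed.

Lemma dens_gt c x : c < dens x -> lower_left xi x c.
Proof.
move=> cx; have [u Gu /ltW cu] := sup_gt (ex_intro _ 0 (lower_left0 xi x)) cx.
exact: lower_left_le Gu cu.
Qed.

Lemma dens_ge c x : lower_left xi x c -> c <= dens x.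
Proof.
move=> G; apply: ub_le_sup => //; have [C C0 nG] := not_all_lower_left x.
exists C => u Gu; rewrite leNgt; apply/negP => Cu; apply: nG.
by apply: lower_left_le Gu _; exact: ltW.
Qed.

Lemma dens_ge0 x : 0 <= dens x.
Proof. by apply: dens_ge; exact: lower_left0. Qed.

Lemma dens_charged x : 0 < dens x <-> charged xi x.
Proof.
split=> [d0|[c c0 G]]; last exact: lt_le_trans (dens_ge G).
by exists (dens x / 2); [lra|apply: dens_gt; lra].
Qed.

(** Only values below the suprema are known to be lower densities, so [lower_left_CD] is applied to
    ka times the suprema, and homogeneity lets ka < 1 absorb the loss. *)
Lemma dens_CD x y t : charged xi x -> charged xi y -> x != y -> 0 < t < 1 ->
  gmean K N t `|y - x| (dens x) (dens y) <= dens ((1 - t) * x + t * y).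
Proof.
move=> px py xy t01; have dr := charged_range_norm hN hDl hM px py xy.
have dx := (dens_charged x).2 px; have dy := (dens_charged y).2 py.
set z := (1 - t) * x + t * y; rewrite leNgt; apply/negP.
set g := gmean _ _ _ _ _ _ => lt; have g0 : 0 < g by exact: gmean_gt0.
have q0 : 0 <= dens z / g by rewrite divr_ge0 ?dens_ge0// ltW.
have q1 : dens z / g < 1 by rewrite ltr_pdivrMr// mul1r.
pose ka := (dens z / g + 1) / 2.
have ka0 : 0 < ka by rewrite /ka; lra.
have ka1 : ka < 1 by rewrite /ka; lra.
have zk : dens z < ka * g by rewrite -ltr_pdivrMr// /ka; lra.
have Gx : lower_left xi x (ka * dens x) by apply: dens_gt; rewrite gtr_pMl.
have Gy : lower_left xi y (ka * dens y) by apply: dens_gt; rewrite gtr_pMl.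
have : lower_left xi z ((dens z + ka * g) / 2).
  rewrite /z; apply: (lower_left_CD hN hM xy Gx Gy _ _ dr t01); [exact: mulr_gt0|exact: mulr_gt0|].
  by rewrite (gmeanZ hN t01 dr ka0 dx dy) -/g; lra.
by move/dens_ge; lra.
Qed.

Lemma charged_conv x y t : charged xi x -> charged xi y -> x != y -> 0 < t < 1 ->
  charged xi ((1 - t) * x + t * y).
Proof.
move=> px py xy t01; apply/dens_charged; apply: lt_le_trans (dens_CD px py xy t01).
by apply: gmean_gt0 => //; [exact: (charged_range_norm hN hDl hM)|exact/dens_charged|exact/dens_charged].
Qed.

Lemma dens_lsc x y c : charged xi x -> charged xi y -> x != y -> c < dens x ->
  exists2 r, 0 < r & forall t, 0 < t < r -> t < 1 -> c < dens ((1 - t) * x + t * y).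
Proof.
move=> px py xy cx; have dr := charged_range_norm hN hDl hM px py xy.
have d0 : 0 < `|y - x| by rewrite normr_gt0 subr_eq0 eq_sym.
have dx := (dens_charged x).2 px; have dy := (dens_charged y).2 py.
have cv : gmean K N t `|y - x| (dens x) (dens y) @[t --> 0^'+] --> dens x.
  apply: (gmean_cvg_left hN d0 dr dx dy); last exact: cvg_cst.
  by apply: cvg_at_right_filter; exact: cvg_id.
have ev : \forall t \near 0^'+, c < gmean K N t `|y - x| (dens x) (dens y) by exact: (cvgr_gt _ cv).
have [r r0 Hr] := right_nearP ev; exists r => // t tr t1.
by apply: lt_le_trans (Hr _ tr) (dens_CD px py xy _); rewrite t1 andbT; case/andP: tr.
Qed.

(** The moving point z lies beyond x as seen from y, so x is between z and y, at parameter u / (1 +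
    u). If dens z >= c, then dens x is at least a mean of c and dens y, which tends to c as z tends
    to x. *)
Lemma dens_usc x y c : charged xi x -> charged xi y -> x != y -> dens x < c ->
  exists2 r, 0 < r & forall u, 0 < u < r -> charged xi (x + u * (x - y)) ->
    dens (x + u * (x - y)) < c.
Proof.
move=> px py xy cx; have dr := charged_range_norm hN hDl hM px py xy.
have d0 : 0 < `|y - x| by rewrite normr_gt0 subr_eq0 eq_sym.
have dx := (dens_charged x).2 px; have dy := (dens_charged y).2 py.
have c0 : 0 < c by exact: lt_trans cx.
have cu : u @[u --> 0^'+] --> (0 : R) by apply: cvg_at_right_filter; exact: cvg_id.
have c1u : 1 + u @[u --> 0^'+] --> (1 : R).
  have E : 1 + 0 = 1 :> R by rewrite addr0.
  by rewrite -[X in _ --> X]E; apply: cvgD => //; exact: cvg_cst.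
have cv : gmean K N (u / (1 + u)) ((1 + u) * `|y - x|) c (dens y) @[u --> 0^'+] --> c.
  apply: (gmean_cvg_left hN d0 dr c0 dy).
    have E : (0 : R) / 1 = 0 by rewrite mul0r.
    by rewrite -[X in _ --> X]E; apply: cvgM => //; apply: cvgV => //; exact: oner_neq0.
  have E : 1 * `|y - x| = `|y - x| by rewrite mul1r.
  by rewrite -[X in _ --> X]E; apply: cvgMl.
have ev : \forall u \near 0^'+, dens x < gmean K N (u / (1 + u)) ((1 + u) * `|y - x|) c (dens y).
  exact: (cvgr_gt _ cv).
have [r r0 Hr] := right_nearP ev; exists r => // u ur pz.
have /andP[u0 _] := ur; set z := x + u * (x - y) in pz *.
have u1 : 0 < 1 + u by rewrite addr_gt0.
have yz : y - z = (1 + u) * (y - x) by rewrite /z; ring.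
have yx : y - x != 0 by rewrite subr_eq0 eq_sym.
have zy : z != y by rewrite eq_sym -subr_eq0 yz mulf_neq0// gt_eqF.
have t01 : 0 < u / (1 + u) < 1 by rewrite divr_gt0//= ltr_pdivrMr// mul1r ltrDr.
rewrite ltNge; apply/negP => cz; have := Hr _ ur; apply/negP; rewrite -leNgt.
have dr' := charged_range_norm hN hDl hM pz py zy.
have E : `|y - z| = (1 + u) * `|y - x| by rewrite yz normrM gtr0_norm.
have h1 := gmean_le t01 dr' c0 dy cz (lexx (dens y)); rewrite -E; apply: (le_trans h1).
have := dens_CD pz py zy t01; congr (_ <= dens _).
by rewrite /z; field; rewrite gt_eqF.
Qed.

Let dens_side x y w e : charged xi x -> charged xi y -> charged xi w -> 0 < (x - w) * (y - x) ->
  0 < e -> exists2 r, 0 < r & forall t, 0 < t < r ->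
    `|dens x - dens ((1 - t) * x + t * y)| < e.
Proof.
move=> px py pw s0 e0.
have xy : x != y by apply/eqP => E; move: s0; rewrite E subrr mulr0 ltxx.
have xw : x != w by apply/eqP => E; move: s0; rewrite E subrr mul0r ltxx.
have [|r1 r10 H1] := @dens_lsc x y (dens x - e) px py xy; first by rewrite gtrBl.
have [|r2 r20 H2] := @dens_usc x w (dens x + e) px pw xw; first by rewrite ltrDl.
have q0 : 0 < (y - x) / (x - w).
  have -> : (y - x) / (x - w) = (x - w) * (y - x) / (x - w) ^+ 2.
    by field; rewrite subr_eq0.
  by rewrite divr_gt0// exprn_even_gt0//= subr_eq0.
pose r := Num.min (Num.min r1 1) (r2 / ((y - x) / (x - w))).
have r0 : 0 < r by rewrite !lt_min r10 ltr01 divr_gt0.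
have rr1 : r <= r1 by rewrite !ge_min lexx.
have r1' : r <= 1 by rewrite !ge_min lexx orbT.
have rr2 : r <= r2 / ((y - x) / (x - w)) by rewrite !ge_min lexx orbT.
exists r => // t /andP[t0 tr].
have t1 : t < 1 by exact: lt_le_trans r1'.
have t01 : 0 < t < 1 by rewrite t0.
have h1 := H1 t; rewrite t0 (lt_le_trans tr rr1) in h1; have {}h1 := h1 isT t1.
have pz := charged_conv px py xy t01.
have E : x + t * ((y - x) / (x - w)) * (x - w) = (1 - t) * x + t * y.
  by field; rewrite subr_eq0.
have h2 := H2 (t * ((y - x) / (x - w))); rewrite E mulr_gt0//= in h2.
have tr2 : t * ((y - x) / (x - w)) < r2 by rewrite -ltr_pdivlMr//; exact: lt_le_trans rr2.
have {}h2 := h2 tr2 pz.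
by rewrite ltr_norml; lra.
Qed.

Lemma dens_continuous x y1 y2 : charged xi y1 -> charged xi y2 -> y1 < x < y2 ->
  {for x, continuous dens}.
Proof.
move=> p1 p2 xI; have /andP[yx xy] := xI.
have px : charged xi x by apply: (charged_itv hN hDl hM p1 p2); rewrite !ltW.
apply/cvgrPdist_lt => e e0.
have [r1 r10 H1] : exists2 r, 0 < r & forall t, 0 < t < r -> `|dens x - dens ((1 - t) * x + t * y2)| < e.
  by apply: (dens_side px p2 p1) => //; rewrite mulr_gt0// subr_gt0.
have [r2 r20 H2] : exists2 r, 0 < r & forall t, 0 < t < r -> `|dens x - dens ((1 - t) * x + t * y1)| < e.
  by apply: (dens_side px p1 p2) => //; rewrite nmulr_lgt0 subr_lt0.
have d1 : 0 < y2 - x by rewrite subr_gt0.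
have d2 : 0 < x - y1 by rewrite subr_gt0.
have s1 : 0 < r1 * (y2 - x) by rewrite mulr_gt0.
have s2 : 0 < r2 * (x - y1) by rewrite mulr_gt0.
apply/nbhs_ballP; exists (Num.min (r1 * (y2 - x)) (r2 * (x - y1))).
  by rewrite /= lt_min s1.
move=> z; rewrite /ball/= lt_min => /andP[z1 z2].
have [zx|xz|<-] := ltgtP z x; last by rewrite subrr normr0.
- have -> : z = (1 - (x - z) / (x - y1)) * x + (x - z) / (x - y1) * y1 by field; rewrite gt_eqF.
  apply: H2; rewrite divr_gt0 ?subr_gt0//= ltr_pdivrMr//.
  by rewrite gtr0_norm ?subr_gt0 in z2.
- have -> : z = (1 - (z - x) / (y2 - x)) * x + (z - x) / (y2 - x) * y2 by field; rewrite gt_eqF.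
  apply: H1; rewrite divr_gt0 ?subr_gt0//= ltr_pdivrMr//.
  by rewrite ltr0_norm ?subr_lt0 ?opprB in z1.
Qed.

Section hull.
Variables (L a b : R).
Hypothesis ab : a < b.
Hypothesis inC : forall x, a < x < b -> charged xi x.
Hypothesis outC : forall x, - L <= x <= L -> charged xi x -> a <= x <= b.

Let I : set R := `]a, b[%classic.
Definition idens x := dens x * \1_I x.

Let IE x : \1_I x = (a < x < b)%R%:R :> R.
Proof. by rewrite indicE mem_setE in_itv. Qed.

Lemma idens_in x : a < x < b -> idens x = dens x.
Proof. by move=> xI; rewrite /idens IE xI mulr1. Qed.

Lemma idens_out x : ~~ (a < x < b) -> idens x = 0.
Proof. by move=> xI; rewrite /idens IE (negbTE xI) mulr0. Qed.

Lemma idens_ge0 x : 0 <= idens x.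
Proof. by rewrite /idens mulr_ge0 ?dens_ge0// IE ler0n. Qed.

Lemma idens_le x : idens x <= dens x.
Proof. by rewrite /idens ler_piMr ?dens_ge0// IE lern1 leq_b1. Qed.

Lemma dens_interior_continuous x : a < x < b -> {for x, continuous dens}.
Proof.
move=> xI; apply: (@dens_continuous x ((a + x) / 2) ((x + b) / 2)); try (apply: inC; lra).
by lra.
Qed.

Lemma measurable_idens : measurable_fun setT idens.
Proof.
have -> : idens = dens \_ I.
  by apply/funext => x; rewrite patchE /idens indicE; case: (x \in I); rewrite ?mulr1 ?mulr0.
have oI : open I by exact: interval_open.
have cI : {in I, continuous dens}.
  by move=> x; rewrite inE /I /= in_itv/=; exact: dens_interior_continuous.
have mI : measurable (I : set (measurableTypeR R)) by exact: measurable_itv.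
have mf : measurable_fun (I : set (measurableTypeR R)) (dens : measurableTypeR R -> R).
  have := @open_continuous_measurable_fun R I dens oI cI; exact.
exact: ((measurable_restrictT _ mI).1 mf).
Qed.

Lemma idens_inside : inside a b idens.
Proof. by move=> x; apply: contraTT => /idens_out ->; rewrite ltxx. Qed.

Lemma idens_CD : CD K N idens.
Proof.
move=> x y t xy /idens_inside xI /idens_inside yI t01.
have zI : a < (1 - t) * x + t * y < b.
  case/andP: (conv_in xy t01) => h1 h2; case/andP: xI => h3 _; case/andP: yI => _ h4.
  by apply/andP; split; [exact: lt_trans h1|exact: lt_trans h4].
rewrite !idens_in//; have := dens_CD (inC xI) (inC yI) _ t01.
by rewrite lt_eqF// gtr0_norm ?subr_gt0//; exact.
Qed.

Section truncated.
Variable n : nat.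
Let k : R := 1 - n.+1%:R^-1.

Definition tdens x := Num.min (k * idens x) n%:R * \1_(`]a, (b - n.+1%:R^-1)[%classic : set R) x.

Let v0 : 0 < (n.+1%:R^-1 : R).
Proof. by rewrite invr_gt0. Qed.

Let k01 : 0 <= k < 1.
Proof. by rewrite /k gtrBl v0 andbT subr_ge0 invf_le1// ler1n. Qed.

Let TE x : \1_(`]a, (b - n.+1%:R^-1)[%classic : set R) x = (a < x < b - n.+1%:R^-1)%R%:R :> R.
Proof. by rewrite indicE mem_setE in_itv. Qed.

Let base_ge0 x : 0 <= Num.min (k * idens x) n%:R.
Proof. by rewrite le_min ler0n mulr_ge0 ?idens_ge0//; case/andP: k01. Qed.

Lemma tdens_ge0 x : 0 <= tdens x.
Proof. by rewrite /tdens mulr_ge0// TE ler0n. Qed.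

Lemma tdens_out x : ~~ (a < x < b - n.+1%:R^-1) -> tdens x = 0.
Proof. by move=> xI; rewrite /tdens TE (negbTE xI) mulr0. Qed.

Lemma tdens_le x : tdens x <= k * dens x.
Proof.
have /andP[k0 _] := k01; apply: (@le_trans _ _ (k * idens x)).
  rewrite /tdens TE; apply: (@le_trans _ _ (Num.min (k * idens x) n%:R)).
    by rewrite ler_piMr// lern1 leq_b1.
  by rewrite ge_min lexx.
by apply: ler_wpM2l => //; exact: idens_le.
Qed.

Lemma measurable_tdens : measurable_fun setT tdens.
Proof.
apply: measurable_funM; last by apply: measurable_indic; exact: measurable_itv.
apply: measurable_minr; last exact: measurable_cst.
by apply: measurable_funM; [exact: measurable_cst|exact: measurable_idens].
Qed.

Lemma intg_tdens : intg tdens.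
Proof.
have [iI _] := Rint_itv n%:R ab; apply: intg_dom iI; first exact: measurable_tdens.
move=> x; rewrite ger0_norm ?tdens_ge0//; have [xI|xI] := boolP (a < x < b - n.+1%:R^-1).
  rewrite /tdens TE xI mulr1 -/I IE (_ : a < x < b) ?mulr1 ?ge_min ?lexx ?orbT//.
  by case/andP: xI => -> /= xb; rewrite (lt_trans xb)// gtrBl.
by rewrite tdens_out// mulr_ge0// -/I IE ler0n.
Qed.

(** At an interior point x the value c1 between k dens x and dens x is a lower left density of xi
    and, by continuity of [dens], an upper bound for [tdens] nearby; elsewhere [tdens] vanishes on
    short left intervals. *)
Lemma tdens_comparison c d : c <= d ->
  imass (density_measure measurable_tdens intg_tdens tdens_ge0) c d <= imass xi c d.
Proof.
move=> cd; set nu := density_measure _ _ _.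
apply: (interval_comparison (imass_additive nu) (imass_additive xi)) => //.
  by move=> s W /andP[_ sd]; exact: imass_left_limit.
move=> x r _ r0.
have vanish e : 0 < e < r -> (forall z, x - e < z <= x -> tdens z = 0) ->
    imass nu (x - e) x <= imass xi (x - e) x.
  move=> /andP[e0 _] H; apply: (@le_trans _ _ 0); last exact: bmass_ge0.
  have xe : x - e <= x by rewrite gerBl ltW.
  have := @imass_density_le _ _ measurable_tdens intg_tdens tdens_ge0 _ _ 0 xe.
  by rewrite mul0r; apply => z /H ->.
have [xa|ax] := leP x a.
  exists (r / 2); first by lra.
  apply: vanish => [|z /andP[_ zx]]; first by lra.
  by apply: tdens_out; rewrite negb_and -leNgt (le_trans zx xa).
have [bx|xb] := leP b x.
  pose e := Num.min r n.+1%:R^-1 / 2.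
  have m0 : 0 < Num.min r n.+1%:R^-1 by rewrite lt_min r0.
  have m1 : Num.min r n.+1%:R^-1 <= r by rewrite ge_min lexx.
  have m2 : Num.min r n.+1%:R^-1 <= n.+1%:R^-1 by rewrite ge_min lexx orbT.
  exists e; first by rewrite /e; lra.
  apply: vanish => [|z /andP[zx _]]; first by rewrite /e; lra.
  apply: tdens_out; rewrite negb_and -!leNgt; apply/orP; right.
  by move: m2 m0 zx; rewrite /e; move: (n.+1%:R^-1 : R) => v; move: (Num.min r v) => q; lra.
have xI : a < x < b by rewrite ax.
have dx := (dens_charged x).2 (inC xI).
have /andP[k0 k1] := k01.
have kx : k * dens x < dens x by rewrite gtr_pMl.
pose c1 := (k * dens x + dens x) / 2.
have [s s0 Hs] : exists2 s, 0 < s & forall e, 0 < e < s -> c1 * e <= imass xi (x - e) x.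
  by apply: lower_left_half; apply: dens_gt; rewrite /c1; lra.
have ga : 0 < c1 - k * dens x by rewrite /c1; lra.
have /cvgrPdist_lt/(_ _ ga)/nbhs_ballP[rho /= rho0 Hrho] := dens_interior_continuous xI.
pose e0 := Num.min (Num.min r s) rho.
have e00 : 0 < e0 by rewrite !lt_min r0 s0.
have e0r : e0 <= r by rewrite !ge_min lexx.
have e0s : e0 <= s by rewrite !ge_min lexx orbT.
have e0o : e0 <= rho by rewrite !ge_min lexx orbT.
exists (e0 / 2); first by lra.
apply: le_trans (Hs _ _); last by lra.
have xe : x - e0 / 2 <= x by lra.
have := @imass_density_le _ _ measurable_tdens intg_tdens tdens_ge0 _ _ c1 xe.
rewrite (_ : x - (x - e0 / 2) = e0 / 2); last by ring.
apply => z zI; apply: le_trans (tdens_le z) _.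
have : `|dens x - dens z| < c1 - k * dens x.
  by apply: Hrho; rewrite /ball/= ltr_norml; lra.
rewrite ltr_norml => /andP[h _].
have h' : dens z <= dens x + (c1 - k * dens x) by lra.
apply: le_trans (ler_wpM2l k0 h') _; rewrite mulrDr.
have : k * (c1 - k * dens x) <= c1 - k * dens x by rewrite ler_piMl// ltW.
by lra.
Qed.

End truncated.

Lemma cvg_tdens x : tdens n x @[n --> \oo] --> idens x.
Proof.
have [xI|xI] := boolP (a < x < b); last first.
  rewrite idens_out//; have -> : tdens^~ x = fun=> 0.
    apply/funext => n; rewrite /tdens idens_out// mulr0.
    by rewrite min_l ?mul0r// ler0n.
  exact: cvg_cst.
have [ax xb] := andP xI.
have ev1 : \forall n \near \oo, (n.+1%:R^-1 : R) < b - x.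
  by apply: (cvgr_lt _ (@cvg_harmonic R)); rewrite subr_gt0.
have ev2 : \forall n \near \oo, idens x <= n%:R.
  exists (Num.truncn (idens x)).+1 => // n /= hn; apply: le_trans (ltW (truncnS_gt _)) _.
  by rewrite ler_nat.
have cv : (1 - n.+1%:R^-1) * idens x @[n --> \oo] --> idens x.
  have E : (1 - 0) * idens x = idens x by rewrite subr0 mul1r.
  rewrite -[X in _ --> X]E; apply: cvgMl; apply: cvgB; first exact: cvg_cst.
  exact: cvg_harmonic.
apply: cvg_trans cv; apply: near_eq_cvg; near=> n.
have h1 : n.+1%:R^-1 < b - x by near: n.
have h2 : idens x <= n%:R by near: n.
have v0 : 0 < (n.+1%:R^-1 : R) by rewrite invr_gt0.
rewrite /tdens indicE mem_setE in_itv/= ax (_ : x < b - n.+1%:R^-1); last by move: h1; move: (_^-1) => q; lra.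
rewrite mulr1 min_l//; apply: le_trans h2; rewrite ler_piMl ?idens_ge0//.
Unshelve. all: by end_near.
Qed.

Lemma idens_le_measure c d : c <= d ->
  (\int[mu]_(x in `]c, d]%classic) (idens x)%:E <= (imass xi c d)%:E)%E.
Proof.
move=> cd; have mcd : measurable (`]c, d]%classic : set R) by exact: measurable_itv.
have := @fatou _ _ _ mu _ mcd (fun n x => (tdens n x)%:E).
have mt n : measurable_fun `]c, d]%classic (fun x => (tdens n x)%:E).
  by apply/measurable_funTS/measurable_EFinP; exact: measurable_tdens.
have t0 (n : nat) x : `]c, d]%classic x -> (0 <= (tdens n x)%:E)%E by rewrite lee_fin tdens_ge0.
move=> /(_ mt t0) le.
have E : (\int[mu]_(x in `]c, d]%classic) limn_einf (fun n => (tdens n x)%:E) =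
    \int[mu]_(x in `]c, d]%classic) (idens x)%:E)%E.
  apply: eq_integral => x _; apply: (cvg_limn_einf_sup _).1.
  by apply: cvg_EFin; [exact: nearW|exact: cvg_tdens].
rewrite -E; apply: le_trans le _; rewrite limn_einf_lim.
apply: lime_le; first exact: is_cvg_einfs.
apply: nearW => n; apply: (@le_trans _ _ (\int[mu]_(x in `]c, d]%classic) (tdens n x)%:E)%E).
  by apply: ereal_inf_lbound; exists n => /=.
have := tdens_comparison n cd; rewrite -lee_fin -bmassE; last exact: mcd.
exact.
Qed.

Lemma intg_idens : intg idens.
Proof.
apply/integrableP; split; first by apply/measurable_EFinP; exact: measurable_idens.
have -> : (fun x => `|(EFin \o idens) x|)%E = (fun x => (idens x)%:E).
  by apply/funext => x /=; rewrite ger0_norm ?idens_ge0.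
have -> : (\int[mu]_x (idens x)%:E = \int[mu]_(x in `]a, b]%classic) (idens x)%:E)%E.
  rewrite [RHS]integral_mkcond; congr integral; apply/funext => x; rewrite patchE.
  case: ifPn => // xI; rewrite idens_out//; apply: contra xI.
  by rewrite mem_setE in_itv/= => /andP[-> /ltW].
exact: le_lt_trans (idens_le_measure (ltW ab)) (ltry _).
Qed.

Local Notation nu := (density_measure measurable_idens intg_idens idens_ge0).

(** Without a charged point to the left, x would be an atom and its lower density infinite. *)
Let left_neighbor x : - L < x <= L -> charged xi x -> exists2 y, charged xi y & - L <= y /\ y < x.
Proof.
move=> /andP[Lx xL] px; apply: contrapT => ny.
have r0 : 0 < x + L by lra.
have m0 : 0 < bmass xi [set x].
  apply: (atom_of_left_gap px r0) => z zI pz; apply: ny; exists z => //; lra.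
have [C _ nC] := not_all_lower_left x; apply: nC; exact: atom_lower_left.
Qed.

(** dens x + h is not a lower density at x, so arbitrarily short left intervals have mass below
    (dens x + h) e, while lower semicontinuity keeps the density above dens x - h on them. The slope
    2 h of the discrepancy adds up to eta. *)
Lemma measure_le_idens c d : - L <= c -> c <= d -> d <= L -> imass xi c d <= imass nu c d.
Proof.
move=> Lc cd dL; move: (cd); rewrite le_eqVlt => /predU1P[->|cd'].
  by rewrite {1}/imass set_itv_ge ?bnd_simp ?ltxx// /bmass measure0 bmass_ge0.
have dc : 0 < d - c by rewrite subr_gt0.
apply/ler_addgt0Pr => eta eta0; pose h := eta / (d - c) / 2.
have h0 : 0 < h by rewrite !divr_gt0.
have -> : eta = 2 * h * (d - c) by rewrite /h; field; rewrite gt_eqF.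
have h20 : 0 <= 2 * h by rewrite mulr_ge0// ltW.
have add2 : interval_additive (fun c d => imass nu c d + 2 * h * (d - c)).
  have [A1 P1] := imass_additive nu; have [A2 P2] := linear_additive h20.
  split=> [c' x d' I'|c' d' I']; first by rewrite (A1 _ _ _ I') (A2 _ _ _ I'); ring.
  by rewrite addr_ge0 ?P1 ?P2.
apply: (interval_comparison (imass_additive xi) add2) => //.
  by move=> s W /andP[_ sd]; exact: imass_left_limit.
move=> x r /andP[cx xd] r0.
have [rho rho0 Hrho] : exists2 rho, 0 < rho & forall z, x - rho < z < x -> dens x - h <= idens z.
  have [le|lt] := leP (dens x) h.
    by exists 1 => // z _; apply: le_trans (idens_ge0 z); rewrite subr_le0.
  have px : charged xi x by apply/dens_charged; exact: lt_trans lt.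
  have xL : - L < x <= L by apply/andP; split; lra.
  have [y py [Ly yx]] := left_neighbor xL px.
  have xy : x != y by rewrite gt_eqF.
  have xh : dens x - h < dens x by rewrite gtrBl.
  have [s s0 Hs] := dens_lsc px py xy xh.
  have xy0 : 0 < x - y by rewrite subr_gt0.
  pose rho := Num.min (s * (x - y)) (x - y).
  have rho1 : rho <= s * (x - y) by rewrite ge_min lexx.
  have rho2 : rho <= x - y by rewrite ge_min lexx orbT.
  exists rho; first by rewrite lt_min mulr_gt0.
  move=> z /andP[z1 zx].
  have yI : a <= y <= b by apply: outC => //; apply/andP; split; lra.
  have xI : a <= x <= b by apply: outC => //; apply/andP; split; lra.
  rewrite idens_in; last by lra.
  have -> : z = (1 - (x - z) / (x - y)) * x + (x - z) / (x - y) * y by field; rewrite gt_eqF.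
  apply: ltW; apply: Hs; last by rewrite ltr_pdivrMr// mul1r; lra.
  by rewrite divr_gt0 ?subr_gt0//= ltr_pdivrMr//; lra.
have nG : ~ lower_left xi x (dens x + h) by move=> /dens_ge; lra.
have m0 : 0 < Num.min r rho by rewrite lt_min r0.
have m1 : Num.min r rho <= r by rewrite ge_min lexx.
have m2 : Num.min r rho <= rho by rewrite ge_min lexx orbT.
have [e /andP[e0 er] lt] := not_lower_left nG m0.
exists e; first by lra.
rewrite (_ : x - (x - e) = e); last by ring.
apply: (@le_trans _ _ ((dens x + h) * e)).
  apply: le_trans (ltW lt); rewrite /imass; apply: bmass_mono; [exact: measurable_itv|exact: measurable_itv|].
  by move=> z /=; rewrite !in_itv/= => /andP[/ltW -> ->].
have xe : x - e <= x by lra.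
have [le|hx] := leP (dens x) h.
  have : 0 <= imass nu (x - e) x by exact: bmass_ge0.
  have : (dens x + h) * e <= 2 * h * e by rewrite ler_pM2r//; lra.
  lra.
have dh : 0 <= dens x - h by lra.
have := @imass_density_ge _ _ measurable_idens intg_idens idens_ge0 _ _ _ xe dh.
rewrite (_ : x - (x - e) = e); last by ring.
have -> : (dens x + h) * e = (dens x - h) * e + 2 * h * e by ring.
by rewrite lerD2r; apply => z zI; apply: Hrho; lra.
Qed.

Lemma measure_idens (A : set R) : measurable A -> A `<=` `]- L, L]%classic ->
  xi A = (\int[mu]_(x in A) (idens x)%:E)%E.
Proof.
move=> mA AL; apply: (@finite_measure_window _ xi nu L) => // c d Lc cd dL.
have mcd : measurable (`]c, d]%classic : set R) by exact: measurable_itv.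
have E := bmassE xi mcd; have E' := bmassE nu mcd; rewrite E E'; congr EFin.
apply/eqP; rewrite eq_le; apply/andP; split.
  by apply: measure_le_idens => //; exact: ltW.
have := idens_le_measure (ltW cd); rewrite -lee_fin.
by apply: le_trans; rewrite -E'.
Qed.

End hull.
End density.

(** With at most one charged point in the window, all the mass there sits at a point. Two charged
    points keep the lower densities finite, so that there is no atom and [dens] is the density. The
    window makes the interval bounded even if D is infinite. *)
Theorem MKND_structure {R : realType} (K : R) (N D : \bar R) (xi : finite_borel R) (L : R) :
  dimension_range N -> (0 < delta K N -> K < 0 -> (D < l_delta (delta K N))%E) ->
  MKND K N D xi ->
  (exists x0, forall A : set R, measurable A -> A `<=` `]- L, L[%classic -> ~ A x0 -> xi A = 0%E) \/
  exists J a b, [/\ a < b, ((b - a)%:E <= D)%E, ((b - a)%:E <= l_delta (delta K N))%E &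
    [/\ measurable_fun setT J, (@lebesgue_measure R).-integrable setT (EFin \o J),
       forall x, 0 <= J x, inside a b J & CD K N J] /\
    forall A : set R, measurable A -> A `<=` `]- L, L[%classic ->
      xi A = (\int[@lebesgue_measure R]_(x in A) (J x)%:E)%E].
Proof.
move=> hN hDl hM; pose W : set R := [set x | charged xi x /\ - L <= x <= L].
have [[x1 [y1 [W1 W2 xy1]]]|nW] := pselect (exists x y, [/\ W x, W y & x < y]); last first.
  left; have [x0 Hx0] : exists x0, forall x, - L < x < L -> x != x0 -> ~ charged xi x.
    have [[x0 [p0 x0L]]|nx] := pselect (exists x, W x).
      exists x0 => x /andP[Lx xL]; case: ltgtP => // xx _ px; apply: nW.
        by exists x, x0; split => //; split => //; rewrite !ltW.
      by exists x0, x; split => //; split => //; rewrite !ltW.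
    by exists 0 => x /andP[Lx xL] _ px; apply: nx; exists x; split => //; rewrite !ltW.
  exists x0 => A mA AL nA.
  have mi u v : measurable (`]u, v[%classic : set R) by exact: measurable_itv.
  have null u v : (forall x, u < x < v -> - L < x < L /\ x != x0) -> bmass xi `]u, v[%classic = 0.
    by move=> H; apply: uncharged_null_open => x /H[]; exact: Hx0.
  have n1 : bmass xi (`]- L, Num.min x0 L[%classic : set R) = 0.
    by apply: null => x; rewrite lt_min => /andP[h1 /andP[h2 h3]]; rewrite h1 h3 lt_eqF.
  have n2 : bmass xi (`]Num.max x0 (- L), L[%classic : set R) = 0.
    by apply: null => x; rewrite gt_max => /andP[/andP[h2 h1] h3]; rewrite h1 h3 gt_eqF.
  rewrite (bmassE xi mA); congr EFin; apply/eqP; rewrite eq_le bmass_ge0 andbT.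
  have := bmassU_le xi (mi (- L) (Num.min x0 L)) (mi (Num.max x0 (- L)) L).
  rewrite n1 n2 addr0; apply: le_trans; apply: bmass_mono => //; first exact: measurableU.
  move=> x Ax; have := AL _ Ax; rewrite /= !in_itv/= lt_min gt_max => /andP[-> ->].
  have [xx|xx|E] := ltgtP x x0; [by left|by right|].
  by exfalso; apply: nA; rewrite -E.
right; have [p1 L1] := W1; have [p2 L2] := W2.
have two x : charged xi x -> exists2 y, charged xi y & x != y.
  by move=> px; have [E|n1] := eqVneq x x1; [exists y1; rewrite // E lt_eqF|exists x1].
have iW : is_interval W.
  move=> x y [px xL] [py yL] z xzy; split; first exact: (charged_itv hN hDl hM px py).
  by move: xL yL xzy; lra.
have [|a [b [abW Wab]]] := @interval_hull _ W L iW.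
  by move=> x [_]; rewrite ler_norml.
have ab : a < b.
  by have /andP[h1 _] := Wab _ W1; have /andP[_ h2] := Wab _ W2; lra.
have inC x : a < x < b -> charged xi x by move=> /abW[].
have outC x : - L <= x <= L -> charged xi x -> a <= x <= b by move=> xL px; apply: Wab.
exists (idens xi a b), a, b; split => //.
- apply: interval_length_le => // x y ax xy yb.
  have px : charged xi x by apply: inC; lra.
  have py : charged xi y by apply: inC; lra.
  by have := charged_diam hM py px; rewrite gtr0_norm ?subr_gt0.
- apply: interval_length_le => // x y ax xy yb.
  have px : charged xi x by apply: inC; lra.
  have py : charged xi y by apply: inC; lra.
  exact: (charged_range_weak hN hDl hM).
split; last first.
  move=> A mA AL; apply: (measure_idens hN hDl hM two ab inC outC mA).
  by move=> x /AL; rewrite /= !in_itv/= => /andP[-> /ltW].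
split.
- exact: (measurable_idens hN hDl hM two).
- exact: (intg_idens hN hDl hM two).
- exact: (idens_ge0 hN hDl hM two).
- exact: idens_inside.
- exact: (idens_CD hN hDl hM two).
Qed.

(** * The integrands u, v and h *)

Section pointwise_functionals.
Context {R : realType}.
Implicit Types (f g : R -> R) (x y r e L : R).

Lemma continuous_norm_powR r : 0 < r -> continuous (fun x : R => `|x| `^ r).
Proof.
move=> r0 x; have [->|x0] := eqVneq x 0; last first.
  by apply: cvg_powR; [rewrite normr_gt0|exact: norm_continuous].
apply/cvgrPdist_lt => e e0; rewrite normr0 powR0 ?gt_eqF//.
have n1 : r != 0 by rewrite gt_eqF.
have d0 : 0 < e `^ r^-1 by exact: powR_gt0.
apply/nbhs_ballP; exists (e `^ r^-1) => // y; rewrite /ball/= sub0r normrN => yd.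
rewrite sub0r normrN ger0_norm ?powR_ge0// -(powRKV e0 n1).
by apply: gt0_ltr_powR; rewrite // nnegrE ?normr_ge0 ?powR_ge0.
Qed.

(** From - ln |x| <= 1 / |x|; it gives continuity of the entropy integrand at the zeros of f. *)
Lemma sqr_ln_le x : `|x| <= 1 -> `|x ^+ 2 * ln (x ^+ 2)| <= 2 * `|x|.
Proof.
move=> x1; have [->|x0] := eqVneq x 0; first by rewrite expr0n/= mul0r normr0 mulr0.
have n0 : 0 < `|x| by rewrite normr_gt0.
have l0 : ln `|x| <= 0 by rewrite ln_le0.
have E : ln (x ^+ 2) = 2 * ln `|x|.
  by rewrite -real_normK ?num_real// lnXn// mulr_natl.
have l1 : - ln `|x| <= `|x|^-1.
  rewrite -lnV ?posrE//; have v0 : 0 < `|x|^-1 by rewrite invr_gt0.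
  have h : -1 < `|x|^-1 - 1 by lra.
  by have := le_ln1Dx h; rewrite addrC subrK; lra.
rewrite E !normrM (ler0_norm l0) (ger0_norm (ler0n _ 2)) -expr2.
have h : `|x| * - ln `|x| <= 1 by rewrite -(mulfV (lt0r_neq0 n0)) ler_pM2l.
have -> : `|x| ^+ 2 * (2 * - ln `|x|) = 2 * `|x| * (`|x| * - ln `|x|) by ring.
by rewrite ler_piMr// mulr_ge0.
Qed.

Lemma continuous_sqr_ln : continuous (fun x : R => x ^+ 2 * ln (x ^+ 2)).
Proof.
move=> x; have [->|x0] := eqVneq x 0; last first.
  apply: cvgM; first exact: exprn_continuous.
  apply: cvg_for; last exact: exprn_continuous.
  by apply: continuous_ln; rewrite exprn_even_gt0.
apply/cvgrPdist_lt => e e0; rewrite expr0n/= mul0r.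
have d0 : 0 < Num.min 1 (e / 2) by rewrite lt_min ltr01 divr_gt0.
apply/nbhs_ballP; exists (Num.min 1 (e / 2)) => // y.
rewrite /ball/= sub0r normrN lt_min => /andP[y1 y2].
rewrite sub0r normrN; apply: le_lt_trans (sqr_ln_le (ltW y1)) _; lra.
Qed.

Lemma le_mul_ln y : 0 <= y -> y - 1 <= y * ln y.
Proof.
rewrite le_eqVlt => /predU1P[<-|y0]; first by rewrite mul0r; lra.
have v0 : 0 < y^-1 by rewrite invr_gt0.
have h : -1 < y^-1 - 1 by lra.
have := le_ln1Dx h; rewrite addrC subrK lnV ?posrE// => le.
have : y * - ln y <= y * (y^-1 - 1) by rewrite ler_pM2l.
by rewrite mulrBr divff ?gt_eqF//; lra.
Qed.

Lemma smooth_continuous f : smooth f -> continuous f /\ continuous (derive1 f).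
Proof.
move=> sf; split=> x; apply/differentiable_continuous/derivable1_diffP.
  exact: (sf 0%N x).
exact: (sf 1%N x).
Qed.

Lemma near_constant_derive1 f x : (\forall y \near x, f y = f x) -> derive1 f x = 0.
Proof.
move=> H; have -> : derive1 f x = derive1 (cst (f x)) x.
  by rewrite !derive1E; exact: near_eq_derive.
by rewrite derive1_cst.
Qed.

Variable T : assignment R.

Lemma u_of_ge0 f x : 0 <= u_of T f x.
Proof. by case: T => [p p1|]; rewrite /= ?powR_ge0// mulr_ge0// sqr_ge0. Qed.

Lemma h_of_eq0 f x : h_of T f x = 0 -> v_of T f x = 0.
Proof.
case: T => [p p1|] /= /eqP.
  rewrite mulf_eq0 powR_eq0 normr_eq0 => /orP[|/andP[]] /eqP ->;
  by rewrite normr0 powR0// gt_eqF// (lt_trans ltr01).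
by rewrite subr_eq0 => /eqP ->; rewrite ln1 mulr0.
Qed.

(** In both cases a vanishing h-integral makes the v-integral nonnegative, so the quotient may be
    compared after multiplying by it. *)
Lemma h_of_v_of f : (forall x, 0 <= v_of T f x) \/ (forall x, h_of T f x <= v_of T f x).
Proof.
case: T => [p p1|] /=; first by left => x; exact: powR_ge0.
by right => x; apply: le_mul_ln; exact: sqr_ge0.
Qed.

Lemma continuous_u_of f : smooth f -> continuous (u_of T f).
Proof.
move=> /smooth_continuous[_ cf]; case: T => [p p1|] x /=.
  apply: (cvg_for (g := fun x : R => `|x| `^ p)); last exact: cf.
  by apply: continuous_norm_powR; exact: lt_trans p1.
apply: cvgMr; apply: (cvg_for (g := fun x : R => x ^+ 2)); last exact: cf.
exact: exprn_continuous.
Qed.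

Lemma continuous_v_of f : smooth f -> continuous (v_of T f).
Proof.
move=> /smooth_continuous[cf _]; case: T => [p p1|] x /=.
  apply: (cvg_for (g := fun x : R => `|x| `^ p)); last exact: cf.
  by apply: continuous_norm_powR; exact: lt_trans p1.
by apply: (cvg_for (g := fun x : R => x ^+ 2 * ln (x ^+ 2))); [exact: continuous_sqr_ln|exact: cf].
Qed.

(** Where h vanishes identically f is locally constant: it is 0 in the Poincare case; in the
    log-Sobolev case f ^ 2 = 1 and continuity fixes the sign. *)
Lemma u_of_eq0 f x : smooth f -> (\forall y \near x, h_of T f y = 0) -> u_of T f x = 0.
Proof.
move=> sf H; have [cf _] := smooth_continuous sf.
suff /near_constant_derive1 E : \forall y \near x, f y = f x.
  by case: T => [p p1|] /=; rewrite E ?normr0 ?powR0 ?expr0n ?mulr0// gt_eqF// (lt_trans ltr01).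
move: H; case: T => [p p1|] /= H.
  have f0 : \forall y \near x, f y = 0.
    apply: filterS H => y /eqP; rewrite mulf_eq0 powR_eq0 normr_eq0.
    by move=> /orP[|/andP[]] /eqP.
  have fx : f x = 0 by exact: nbhs_singleton f0.
  by apply: filterS f0 => y ->.
have /cvgrPdist_lt/(_ _ ltr01) ev := cf x.
have hx : f x ^+ 2 - 1 = 0 by exact: nbhs_singleton H.
have sq z : f z ^+ 2 - 1 = 0 -> f z = 1 \/ f z = -1.
  by move/eqP; rewrite subr_eq0 sqrf_eq1 => /orP[]/eqP; [left|right].
near=> y; have hy : f y ^+ 2 - 1 = 0 by near: y.
have : `|f x - f y| < 1 by near: y.
by case: (sq _ hx) => ->; case: (sq _ hy) => ->//; rewrite ltr_norml; lra.
Unshelve. all: by end_near.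
Qed.

Lemma functional_window f : smooth f -> compactly_supported_continuous (h_of T f) ->
  exists2 L, 0 < L & forall x, ~ (- L < x < L) ->
    [/\ h_of T f x = 0, v_of T f x = 0 & u_of T f x = 0].
Proof.
move=> sf [_ cs]; have [L L0 HL] := compact_window cs; exists L => // x xL.
have nx : ~ closure [set x | h_of T f x != 0] x by move=> /HL; rewrite /= in_itv/=.
have nh : \forall y \near x, h_of T f y = 0.
  have oC : open (~` closure [set x | h_of T f x != 0]).
    by rewrite openC; exact: closed_closure.
  have : nbhs x (~` closure [set x | h_of T f x != 0]) by exact: open_nbhs_nbhs.
  by apply: filterS => y ny; apply/eqP; apply: contrapT => /negP hy; apply: ny; exact: subset_closure.
have hx : h_of T f x = 0 by exact: nbhs_singleton nh.
by split => //; [exact: h_of_eq0|exact: u_of_eq0].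
Qed.

End pointwise_functionals.

Lemma window_bounded {R : realType} (g : R -> R) (L : R) : continuous g ->
  (forall x, ~ (- L < x < L) -> g x = 0) -> exists M, forall x, `|g x| <= M.
Proof.
move=> cg g0; have cS : compact (g @` `[- L, L]%classic).
  by apply: continuous_compact; [exact: continuous_subspaceT|exact: segment_compact].
have [M M0 HM] := compact_window cS; exists M => x.
have [xL|xL] := pselect (- L < x < L); last by rewrite g0// normr0 ltW.
have : (g @` `[- L, L]%classic) (g x).
  by exists x => //; rewrite /= in_itv/=; case/andP: xL => *; rewrite !ltW.
by move/HM; rewrite /= in_itv/= ler_norml => /andP[/ltW -> /ltW].
Qed.

(** * Integrals of functions supported in a window *)

Section integrals_on_window.
Context {R : realType} (xi : finite_borel R) (L : R).
Local Notation mu := (@lebesgue_measure R).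
Local Notation W := (`]- L, L[%classic : set R).
Implicit Types g : R -> R.

Lemma integral_window (m : finite_borel R) g : (forall x, ~ (- L < x < L) -> g x = 0) ->
  (\int[m]_x (g x)%:E = \int[m]_(x in W) (g x)%:E)%E.
Proof.
move=> g0; rewrite [RHS]integral_mkcond; congr integral; apply/funext => x; rewrite patchE.
by case: ifPn => //; rewrite mem_setE in_itv/= => /negP/g0 ->.
Qed.

Lemma integral_concentrated (x0 : R) g :
  (forall A : set R, measurable A -> A `<=` W -> ~ A x0 -> xi A = 0%E) ->
  continuous g -> (forall x, ~ (- L < x < L) -> g x = 0) ->
  (\int[xi]_x (g x)%:E = (g x0 * bmass xi (W `&` [set x0]))%:E)%E.
Proof.
move=> null cg g0; have mW : measurable (W : set (measurableTypeR R)) by exact: measurable_itv.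
have m1 : measurable (W `&` [set x0] : set (measurableTypeR R)).
  by apply: measurableI => //; exact: measurable_set1.
have mg : measurable_fun setT (g : measurableTypeR R -> R) by exact: continuous_measurable_fun.
have mD : measurable (W `\` [set x0] : set (measurableTypeR R)).
  by apply: measurableD => //; exact: measurable_set1.
have nD : xi (W `\` [set x0]) = 0%E.
  by apply: null; [exact: mD|move=> x []|move=> [_]; apply].
have -> : (\int[xi]_x (g x)%:E = \int[xi]_(x in W `&` [set x0]) (g x)%:E)%E.
  rewrite [RHS]integral_mkcond; apply: ae_eq_integral => //.
  - exact/measurable_EFinP.
  - apply/(measurable_restrictT _ _).1 => //; apply/measurable_funTS; exact/measurable_EFinP.
  - exists (W `\` [set x0]); split => // x /= nx; apply: contrapT => nW; apply: nx => _.
    rewrite patchE; case: ifPn => // xn; congr EFin; apply: g0 => xL.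
    apply: nW; split; first by rewrite /= in_itv.
    by move=> xx; move/negP: xn; apply; rewrite inE; split => //; rewrite /= in_itv.
transitivity (\int[xi]_(x in W `&` [set x0]) (cst (g x0)%:E x))%E.
  by apply: eq_integral => x; rewrite inE => -[_ /= ->].
by rewrite integral_cst// EFinM -bmassE.
Qed.

Lemma integral_transfer (J g : R -> R) (M : R) :
  measurable_fun setT J -> mu.-integrable setT (EFin \o J) -> (forall x, 0 <= J x) ->
  (forall A : set R, measurable A -> A `<=` W -> xi A = (\int[mu]_(x in A) (J x)%:E)%E) ->
  continuous g -> (forall x, `|g x| <= M) -> (forall x, ~ (- L < x < L) -> g x = 0) ->
  (\int[xi]_x (g x)%:E = (\int[mu]_x (g x * J x))%:E)%E.
Proof.
move=> mJ iJ J0 xiJ cg gM g0; pose nu := density_measure mJ iJ J0.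
rewrite integral_window// (@eq_measure_integral _ _ _ _ nu)//.
rewrite -integral_window//; apply: integral_density => //.
exact: continuous_measurable_fun.
Qed.

End integrals_on_window.

(** * Comparison of an arbitrary measure with the models *)

Section comparison_with_models.
Context {R : realType} (K : R) (N D : \bar R) (T : assignment R).
Hypothesis hN : dimension_range N.
Hypothesis hDl : 0 < delta K N -> K < 0 -> (D < l_delta (delta K N))%E.
Local Notation mu := (@lebesgue_measure R).
Local Notation intg f := (mu.-integrable setT (EFin \o f)).
Implicit Types (f g : R -> R) (xi : finite_borel R).

Lemma Phi_real f xi (U V : R) : (\int[xi]_x (u_of T f x)%:E = U%:E)%E ->
  (\int[xi]_x (v_of T f x)%:E = V%:E)%E ->
  Phi T f xi = if V == 0 then +oo%E else (U / V)%:E.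
Proof.
move=> EU EV; rewrite /Phi EU EV eqe; case: ifPn => // V0.
by rewrite inver (negbTE V0).
Qed.

Lemma model_measure (A B : R) g : A < B -> ((B - A)%:E <= D)%E -> model_piece K N A B g ->
  measurable_fun setT g -> (forall x, A < x < B -> 0 < g x) ->
  intg (fun x => g x * \1_(`]A, B[%classic : set R) x) ->
  exists2 nu, MMKND K N D nu & forall f (M : R), continuous f -> (forall x, `|f x| <= M) ->
    (\int[nu]_x (f x)%:E = (\int[mu]_x (f x * (g x * \1_(`]A, B[%classic : set R) x)))%:E)%E.
Proof.
move=> AB dD [r [c [b [rAB c0 dom gE]]]] mg g0 ig.
set J := fun x => _ in ig.
have IE x : \1_(`]A, B[%classic : set R) x = (A < x < B)%R%:R :> R.
  by rewrite indicE mem_setE in_itv.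
have mJ : measurable_fun setT J.
  by apply: measurable_funM => //; apply: measurable_indic; exact: measurable_itv.
have J0 x : 0 <= J x.
  by rewrite /J IE; case: (boolP (A < x < B)) => xI; rewrite ?mulr0// mulr1 ltW// g0.
exists (density_measure mJ ig J0); last first.
  move=> f M cf fM; apply: (integral_density mJ ig J0) => //.
  exact: continuous_measurable_fun.
exists J, c, r, b, `](A - r), (B - r)[%classic; split => //.
- split.
  + exact: interval_is_interval.
  + move=> x; rewrite /= in_itv/= => xI; apply: subset_closure; exact: dom.
  + have [u [v [uI vI uv]]] : exists u v, [/\ A - r < u < B - r, A - r < v < B - r & u < v].
      by exists ((2 * A + B) / 3 - r), ((A + 2 * B) / 3 - r); split; lra.
    rewrite /diam; apply/andP; split.
      rewrite lt_max; apply/orP; right; apply: (@lt_le_trans _ _ `|u - v|%:E).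
        by rewrite lte_fin normr_gt0 subr_eq0 lt_eqF.
      by apply: ereal_sup_ubound; exists u; [rewrite /= in_itv|exists v; rewrite //= in_itv].
    rewrite ge_max; apply/andP; split; first by apply: le_trans dD; rewrite lee_fin; lra.
    apply: ge_ereal_sup => _ [x xI [y yI <-]]; apply: le_trans dD; rewrite lee_fin.
    by move: xI yI; rewrite /= !in_itv/= => xI yI; rewrite ler_norml; lra.
- move=> x _; have E : (A < x + r < B) = (A - r < x < B - r) by rewrite ltrBlDr ltrBrDr.
  rewrite /J IE indicE mem_setE in_itv/= E; case: (boolP (A - r < x < B - r)) => xI; last by rewrite !mulr0.
  by rewrite !mulr1 gE ?addrK// E.
Qed.

Lemma Phi_ge_models f xi : MKND K N D xi -> F_star T xi f ->
  (ereal_inf [set inf_Phi T nu | nu in MMKND K N D] <= Phi T f xi)%E.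
Proof.
move=> xiM fF; have [sf f0 hc ih] := fF; rewrite leNgt; apply/negP => lt.
have [ch _] := hc; have cu := continuous_u_of (T := T) sf; have cv := continuous_v_of (T := T) sf.
have [L L0 HL] := functional_window sf hc.
have h0 x : ~ (- L < x < L) -> h_of T f x = 0 by move=> /HL[].
have v0 x : ~ (- L < x < L) -> v_of T f x = 0 by move=> /HL[].
have u0 x : ~ (- L < x < L) -> u_of T f x = 0 by move=> /HL[].
have [[x0 null]|[J [a [b [ab dD dl [[mJ iJ J0 insJ cJ] xiJ]]]]]] := MKND_structure L hN hDl xiM.
  (* For a measure concentrated at a point, balance means that h vanishes there or that the mass is
     0; either way the v-integral is 0 and the functional is +oo. *)
  move: lt; rewrite (Phi_real (integral_concentrated null cu u0) (integral_concentrated null cv v0)).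
  move: ih; rewrite (integral_concentrated null ch h0) => -[] /eqP.
  rewrite mulf_eq0 => /orP[/eqP/h_of_eq0 ->|/eqP ->]; rewrite ?mul0r ?mulr0 eqxx;
  by rewrite ltNge leey.
have [Mh hM] := window_bounded ch h0; have [Mu uM] := window_bounded cu u0.
have [Mv vM] := window_bounded cv v0.
have EH := integral_transfer mJ iJ J0 xiJ ch hM h0.
have EU := integral_transfer mJ iJ J0 xiJ cu uM u0.
have EV := integral_transfer mJ iJ J0 xiJ cv vM v0.
have mc g : continuous g -> measurable_fun setT g by move=> cg; exact: continuous_measurable_fun.
have signs J' : measurable_fun setT J' -> intg J' -> (forall x, 0 <= J' x) ->
    \int[mu]_x (h_of T f x * J' x) = 0 ->
    0 <= \int[mu]_x (u_of T f x * J' x) /\ 0 <= \int[mu]_x (v_of T f x * J' x).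
  move=> mJ' iJ' J'0 H; split.
    by apply: Rintegral_ge0 => x _; rewrite mulr_ge0// u_of_ge0.
  have [vp|vh] := h_of_v_of T f.
    by apply: Rintegral_ge0 => x _; rewrite mulr_ge0.
  rewrite -H; apply: le_Rintegral => //.
  - by apply: (intg_mul (M := Mh)) => //; exact: mc.
  - by apply: (intg_mul (M := Mv)) => //; exact: mc.
  - by move=> x _; rewrite ler_wpM2r.
have H0 : \int[mu]_x (h_of T f x * J x) = 0 by move: ih; rewrite EH => -[].
have [U0 V0] := signs _ mJ iJ J0 H0.
have lin J' (la : R) : measurable_fun setT J' -> intg J' -> (forall x, 0 <= J' x) ->
    \int[mu]_x ((u_of T f x - la * v_of T f x) * J' x) =
    \int[mu]_x (u_of T f x * J' x) - la * \int[mu]_x (v_of T f x * J' x).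
  move=> mJ' iJ' J'0.
  have iu : intg (fun x => u_of T f x * J' x) by apply: (intg_mul (M := Mu)) => //; exact: mc.
  have iv : intg (fun x => v_of T f x * J' x) by apply: (intg_mul (M := Mv)) => //; exact: mc.
  have iv' : intg (fun x => la * (v_of T f x * J' x)).
    by have := integrableZl measurableT la iv; apply: eq_integrable => // x _; rewrite /= EFinM.
  rewrite -RintegralZl// -RintegralB//.
  by congr fine; apply: eq_integral => x _; congr EFin; ring.
set U := Rintegral _ _ _ in EU U0; set V := Rintegral _ _ _ in EV V0.
move: lt; rewrite (Phi_real EU EV); case: ifPn => [_|Vn0 lt]; first by rewrite ltNge leey.
have V1 : 0 < V by rewrite lt_neqAle eq_sym Vn0.
(* [la] has to be real, while the infimum over the models may be +oo. *)
have [la [Ula laI]] : exists la : R, U / V < la /\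
    (la%:E <= ereal_inf [set inf_Phi T nu | nu in MMKND K N D])%E.
  case: (ereal_inf _) lt => [i||//] lt.
    by exists i; split; [rewrite -lte_fin|].
  by exists (U / V + 1); rewrite ltrDl ltr01 leey.
pose phi x := u_of T f x - la * v_of T f x.
have cphi : continuous phi by move=> x; apply: cvgB; [exact: cu|apply: cvgMr; exact: cv].
have phi0 x : ~ (- L < x < L) -> phi x = 0 by move=> xL; rewrite /phi u0// v0// mulr0 subrr.
have [Mp pM] := window_bounded cphi phi0.
have bh x : `|h_of T f x| <= Num.max Mh Mp by rewrite le_max hM.
have bp x : `|phi x| <= Num.max Mh Mp by rewrite le_max pM orbT.
have hphi x : h_of T f x = 0 -> 0 <= phi x.
  by move=> /h_of_eq0 E; rewrite /phi E mulr0 subr0 u_of_ge0.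
have neg : \int[mu]_x (phi x * J x) < 0.
  by rewrite lin// -/U -/V subr_lt0 -ltr_pdivrMr.
(* For N <= 0 a positive [delta] means K < 0, so D < l_delta is available and makes the inequality
   strict. *)
have strict : (N <= 0)%E -> ((b - a)%:E < l_delta (delta K N))%E.
  move=> N0; have [d0|d0] := ltP 0 (delta K N); last first.
    have nd : (0 < delta K N) = false by apply/negbTE; rewrite -leNgt.
    by rewrite /l_delta nd ltry.
  apply: le_lt_trans dD (hDl d0 _); move: d0 N0; rewrite /delta.
  case NE : N => [n||]; rewrite ?ltxx// lee_fin => d0 n0.
  have n1 : (n - 1)^-1 < 0 by rewrite invr_lt0; lra.
  by rewrite -(nmulr_lgt0 _ n1).
have [A [B [g [[aA AB Bb] piece [mg g0 ig] Hg Pg]]]] := localization hN ch cphi bh bp hphi ab dl strict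
  mJ iJ J0 insJ cJ H0 neg.
have dAB : ((B - A)%:E <= D)%E by apply: le_trans dD; rewrite lee_fin; lra.
have [nu nuM nuE] := model_measure AB dAB piece mg g0 ig.
pose Jg x := g x * \1_(`]A, B[%classic : set R) x.
have mJg : measurable_fun setT Jg.
  by apply: measurable_funM => //; apply: measurable_indic; exact: measurable_itv.
have Jg0 x : 0 <= Jg x.
  rewrite /Jg indicE mem_setE in_itv/=; case: (boolP (A < x < B)) => xI; rewrite ?mulr0//.
  by rewrite mulr1 ltW// g0.
have [U'0 V'0] := signs _ mJg ig Jg0 Hg.
have EU' := nuE _ _ cu uM; have EV' := nuE _ _ cv vM; have EH' := nuE _ _ ch hM.
rewrite -/Jg in EU' EV' EH'.
move: Pg; rewrite (lin Jg)//; set U' := Rintegral _ _ _ in EU' U'0 *.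
set V' := Rintegral _ _ _ in EV' V'0 *; rewrite subr_lt0 => UV'.
(* V' = 0 would give U' < 0, although u is nonnegative. *)
have V'1 : 0 < V'.
  by rewrite lt_neqAle V'0 andbT; apply/eqP => E; move: UV'; rewrite -E mulr0 ltNge U'0.
have nuF : F_star T nu f by split => //; rewrite EH' Hg.
have : (Phi T f nu < la%:E)%E.
  by rewrite (Phi_real EU' EV') gt_eqF// lte_fin ltr_pdivrMr.
rewrite ltNge => /negP; apply; apply: le_trans laI _.
apply: (@le_trans _ _ (inf_Phi T nu)); first by apply: ereal_inf_lbound; exists nu.
by apply: ereal_inf_lbound; exists f.
Qed.

(** [alpha] ranges over nonzero measures only, whereas [MMKND] states no such restriction; a zero
    measure would contribute +oo and leaves the infimum unchanged. *)
Lemma inf_Phi_null xi : (forall A, measurable A -> xi A = 0%E) -> inf_Phi T xi = +oo%E.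
Proof.
move=> xi0; apply/eqP; rewrite -leye_eq; apply: le_ereal_inf_tmp => _ [f _ <-].
by rewrite /Phi (@eq_measure_integral _ _ _ _ mzero) ?integral_measure_zero ?eqxx// => A mA _; exact: xi0.
Qed.

End comparison_with_models.

Theorem corollary3p5p15 (R : realType) (K : R) (N D : \bar R)
    (hN : (-oo < N <= 0)%E \/ (2%:E <= N)%E)
    (hD : (0 < D)%E)
    (hDl : 0 < delta K N -> K < 0 -> (D < l_delta (delta K N))%E)
    (T : assignment R) :
  alpha T K N D = ereal_inf [set inf_Phi T xi | xi in MMKND K N D].
Proof.
have hN' : dimension_range N := hN.
apply/eqP; rewrite eq_le; apply/andP; split.
  apply: le_ereal_inf_tmp => _ [xi xiM <-].
  have [[A mA An]|nA] := pselect (exists2 A, measurable A & xi A <> 0%E).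
    apply: ereal_inf_lbound; exists xi => //; split; last by exists A.
    exact: MMKND_MKND xiM.
  rewrite inf_Phi_null ?leey// => A mA; apply: contrapT => An; apply: nA.
  by exists A.
apply: le_ereal_inf_tmp => _ [xi [xiM _] <-].
apply: le_ereal_inf_tmp => _ [f fF <-]; exact: Phi_ge_models.
Qed.
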